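(* Let $n\ge 3$ and let $(M,g,u)$ be a static triple with positive cosmological constant, i.e. $M$ is a connected compact $n$-dimensional smooth manifold with non-empty smooth boundary $\partial M$, $g$ is a smooth Riemannian metric on $M$, and $u\in C^\infty(M)$ satisfies $u\,\mathrm{Ric}=\mathrm{D}^2u+n\,u\,g$ and $\Delta u=-n\,u$ in $M$, $u>0$ in the interior of $M$ and $u=0$ on $\partial M$. Then every connected component of $M\setminus\mathrm{MAX}(u)$ has well-defined, and thus nonnegative, virtual mass. Moreover, as soon as the virtual mass of some connected component of $M\setminus \mathrm{MAX}(u)$ vanishes, the entire solution $(M,g,u)$ is isometric to the de Sitter solution, up to a normalization of $u$.
   Context: $\mathrm{Ric}$, $\mathrm{D}$, $\mathrm{D}^2$, $\Delta$ are the Ricci tensor, Levi-Civita connection, Hessian and Laplace-Beltrami operator of $g$. The equations imply that the scalar curvature is $\mathrm{R}\equiv n(n-1)$. It is known that $|\mathrm{D}u|$ is constant and positive on each connected component of $\partial M$. Set $u_{\max}=\max_M u$ and $\mathrm{MAX}(u)=\{p\in M: u(p)=u_{\max}\}$. The surface gravity of a connected component $\Sigma$ of $\partial M$ is $\kappa(\Sigma)=|\mathrm{D}u|_{|\Sigma}/u_{\max}$. For a connected component $N$ of $M\setminus\mathrm{MAX}(u)$ let $\partial N=\partial M\cap N$ (it is non-empty). Surface gravity functions. Let $m_{\max}=\sqrt{(n-2)^{n-2}/n^n}$. For $0<m<m_{\max}$ let $r_-(m)<r_+(m)$ be the two positive solutions of $1-r^2-2mr^{2-n}=0$. Define $k_+:[0,m_{\max})\to[1,\sqrt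 n)$ by $k_+(0)=1$ and $$k_+(m)=\sqrt{\frac{r_+^2(m)\,[1-(n-2)m\,r_+^{-n}(m)]^2}{1-(m/m_{\max})^{2/n}}}\quad\text{for }0<m<m_{\max},$$ and $k_-:(0,m_{\max}]\to[\sqrt n,+\infty)$ by $k_-(m_{\max})=\sqrt n$ and $$k_-(m)=\sqrt{\frac{r_-^2(m)\,[1-(n-2)m\,r_-^{-n}(m)]^2}{1-(m/m_{\max})^{2/n}}}\quad\text{for }0<m<m_{\max}.$$ The function $k_+$ is continuous, strictly increasing, with $k_+(m)\to\sqrt n$ as $m\to m_{\max}^-$; $k_-$ is continuous, strictly decreasing, with $k_-(m)\to+\infty$ as $m\to0^+$. Hence both are bijections onto the stated ranges. Regions. A connected component $N$ of $M\setminus\mathrm{MAX}(u)$ is an outer region if $\max_{\Sigma\in\pi_0(\partial N)}\kappa(\Sigma)<\sqrt n$, an inner region if this maximum is $>\sqrt n$, and a cylindrical region if it equals $\sqrt n$. Virtual mass. The virtual mass $\mu(N,g,u)$ is $k_+^{-1}\big(\max_{\partial N}\frac{|\mathrm{D}u|}{u_{\max}}\big)$ if $N$ is an outer region, and $k_-^{-1}\big(\max_{\partial N}\frac{|\mathrm{D}u|}{u_{\max}}\big)$ if $N$ is an inner or cylindrical region. It is well defined if the argument lies in the domain of the relevant inverse function, namely in $[1,\sqrt n)$ for an outer region, and in $[\sqrt n,+\infty)$ otherwise. The de Sitter solution is the triple $(M_0,g_0,u_0)$ with $M_0=\overline{B(0,1)}\subset\mathbb{R}^n$, $g_0=\frac{d|x|\otimes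 d|x|}{1-|x|^2}+|x|^2g_{\mathbb{S}^{n-1}}$, $u_0=\sqrt{1-|x|^2}$, where $g_{\mathbb{S}^{n-1}}$ is the standard round metric and $g_0,u_0$ are extended smoothly through the origin and up to the boundary (so it is a closed round unit hemisphere with its height function). ''Up to a normalization of $u$, $(M,g,u)$ is isometric to $(M_0,g_0,u_0)$'' means that there are a constant $c>0$ and an isometry $\Phi:(M,g)\to(M_0,g_0)$ with $u=c\,u_0\circ\Phi$. *)

(* Defs.v *)
From HB Require Import structures.
From mathcomp Require Export all_boot all_order all_algebra.
From mathcomp Require Export all_classical all_reals all_analysis.

Set Implicit Arguments.
Unset Strict Implicit.
Unset Printing Implicit Defensive.

Import Order.TTheory GRing.Theory Num.Theory.
Import numFieldNormedType.Exports.

Local Open Scope classical_set_scope.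
Local Open Scope ring_scope.

(* Points of R^n are row vectors.  The norm that 'rV[R]_n carries in the
   library is the sup norm; it is used only through its topology, and the
   Euclidean norm is written out as [sqnorm]. *)

Section euclidean.
Context {R : realType}.

Definition basis n (i : 'I_n) : 'rV[R]_n := delta_mx 0 i.

Definition sqnorm n (x : 'rV[R]_n) : R := \sum_(i < n) x 0 i ^+ 2.

Definition halfspace n : set 'rV[R]_n :=
  [set x | forall i : 'I_n, i = 0%N :> nat -> 0 <= x 0 i].

Fixpoint iter_derive n (s : seq 'I_n) (f : 'rV[R]_n -> R) : 'rV[R]_n -> R :=
  if s is i :: s' then 'D_(basis i) (iter_derive s' f) else f.

Definition smooth_open n (V : set 'rV[R]_n) (f : 'rV[R]_n -> R) : Prop :=
  forall (s : seq 'I_n) x, V x ->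
    {for x, continuous (iter_derive s f)} /\
    forall i, derivable (iter_derive s f) x (basis i).

(* On a set that need not be open in R^n, smooth means: locally the
   restriction of a smooth function on an open set of R^n. *)
Definition smooth_on n (A : set 'rV[R]_n) (f : 'rV[R]_n -> R) : Prop :=
  forall x, A x -> exists (V : set 'rV[R]_n) (F : 'rV[R]_n -> R),
    [/\ open V, V x, smooth_open V F & forall y, A y -> V y -> F y = f y].

Definition smooth_map_on n m (A : set 'rV[R]_n) (f : 'rV[R]_n -> 'rV[R]_m) :=
  forall k : 'I_m, smooth_on A (fun x => f x 0 k).

(* Partial derivative relative to the half-space: the ordinary one inside, the
   one-sided one in the normal direction at the boundary.  On smooth functions
   it agrees with the partial derivative of any smooth local extension. *)
Definition pd n (i : 'I_n) (f : 'rV[R]_n -> R) (x : 'rV[R]_n) : R :=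
  lim ((fun t : R => t^-1 * (f (x + t *: basis i) - f x)) @
       within [set t | halfspace (x + t *: basis i)] (0 : R)^').

(* Row-vector convention, as for the library's [jacobian]. *)
Definition pd_mx n m (f : 'rV[R]_n -> 'rV[R]_m) (x : 'rV[R]_n) : 'M[R]_(n, m) :=
  \matrix_(i, k) pd i (fun y => f y 0 k) x.

End euclidean.

Section local_riemannian_geometry.
Context {R : realType} {n : nat}.
Variables (g : 'rV[R]_n -> 'M[R]_n).

Definition ginv (x : 'rV[R]_n) : 'M[R]_n := invmx (g x).

(* Gamma^k_ij *)
Definition christoffel (k i j : 'I_n) (x : 'rV[R]_n) : R :=
  2^-1 * \sum_(l < n) ginv x k l *
    (pd i (fun y => g y j l) x + pd j (fun y => g y i l) x
     - pd l (fun y => g y i j) x).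

(* Sign convention: the unit sphere S^n has Ric = (n - 1) g. *)
Definition ricci (i j : 'I_n) (x : 'rV[R]_n) : R :=
  \sum_(k < n) (pd k (christoffel k i j) x - pd j (christoffel k i k) x)
  + \sum_(k < n) \sum_(l < n)
      (christoffel k k l x * christoffel l i j x
       - christoffel k j l x * christoffel l i k x).

Definition hessian (f : 'rV[R]_n -> R) (i j : 'I_n) (x : 'rV[R]_n) : R :=
  pd i (pd j f) x - \sum_(k < n) christoffel k i j x * pd k f x.

Definition laplacian (f : 'rV[R]_n -> R) (x : 'rV[R]_n) : R :=
  \sum_(i < n) \sum_(j < n) ginv x i j * hessian f i j x.

Definition grad_norm_loc (f : 'rV[R]_n -> R) (x : 'rV[R]_n) : R :=
  Num.sqrt (\sum_(i < n) \sum_(j < n) ginv x i j * pd i f x * pd j f x).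

End local_riemannian_geometry.

(* A chart is total in both directions; only the values of [cmap] on [cdom]
   and of [cinv] on the image of [cdom] are meaningful. *)
Record chart (R : realType) (n : nat) (T : Type) := Chart {
  cdom : set T;
  cmap : T -> 'rV[R]_n;
  cinv : 'rV[R]_n -> T }.

Definition cimage (R : realType) n T (c : chart R n T) : set 'rV[R]_n :=
  cmap c @` cdom c.

(* Data of an atlas and of the components of a metric in each of its charts,
   as functions of the coordinates; the axioms are [smooth_manifold] and
   [riemannian_metric]. *)
Record riem_data (R : realType) (n : nat) (T : Type) := RiemData {
  chart_index : Type;
  charts : chart_index -> chart R n T;
  metric : chart_index -> 'rV[R]_n -> 'M[R]_n }.

Section manifolds.
Context {R : realType} {n : nat} {T : topologicalType}.

Definition is_chart (c : chart R n T) : Prop :=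
  [/\ open (cdom c),
      exists2 V : set 'rV[R]_n, open V & cimage c = V `&` halfspace (n := n),
      forall p, cdom c p -> cinv c (cmap c p) = p,
      {within cdom c, continuous (cmap c)} &
      {within cimage c, continuous (cinv c)}].

Variable M : riem_data R n T.

Definition transition (a b : chart_index M) (x : 'rV[R]_n) : 'rV[R]_n :=
  cmap (charts b) (cinv (charts a) x).

Definition smooth_manifold : Prop :=
  [/\ hausdorff_space T,
      forall a, is_chart (charts (r := M) a),
      forall p, exists a : chart_index M, cdom (charts a) p &
      forall a b : chart_index M,
        smooth_map_on (cmap (charts a) @` (cdom (charts a) `&` cdom (charts b)))
                      (transition a b)].

Definition riemannian_metric : Prop :=
  [/\ forall (a : chart_index M) i j,
        smooth_on (cimage (charts a)) (fun x => metric a x i j),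
      forall (a : chart_index M) x, cimage (charts a) x ->
        (metric a x)^T = metric a x,
      forall (a : chart_index M) x (v : 'rV[R]_n), cimage (charts a) x -> v != 0 ->
        0 < (v *m metric a x *m v^T) 0 0 &
      forall (a b : chart_index M) p, cdom (charts a) p -> cdom (charts b) p ->
        let x := cmap (charts a) p in let J := pd_mx (transition a b) x in
        metric a x = J *m metric b (cmap (charts b) p) *m J^T].

Definition mboundary : set T :=
  [set p | exists a : chart_index M, cdom (charts a) p /\
     forall i : 'I_n, i = 0%N :> nat -> cmap (charts a) p 0 i = 0].

Definition in_chart (f : T -> R) (a : chart_index M) : 'rV[R]_n -> R :=
  f \o cinv (charts a).

Definition smooth_fun (f : T -> R) : Prop :=
  forall a : chart_index M, smooth_on (cimage (charts a)) (in_chart f a).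

(* |Df|(p), computed in any chart around p. *)
Definition grad_norm (f : T -> R) (p : T) : R :=
  get [set r | exists2 a : chart_index M, cdom (charts a) p &
         r = grad_norm_loc (metric a) (in_chart f a) (cmap (charts a) p)].

Record static_triple (u : T -> R) : Prop := StaticTriple {
  st_manifold : smooth_manifold;
  st_compact : compact [set: T];
  st_connected : connected [set: T];
  st_boundary : mboundary !=set0;
  st_metric : riemannian_metric;
  st_smooth : smooth_fun u;
  st_ricci : forall (a : chart_index M) x i j, cimage (charts a) x ->
    in_chart u a x * ricci (metric a) i j x =
    hessian (metric a) (in_chart u a) i j x
    + n%:R * in_chart u a x * metric a x i j;
  st_laplacian : forall (a : chart_index M) x, cimage (charts a) x ->
    laplacian (metric a) (in_chart u a) x = - n%:R * in_chart u a x;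
  st_interior : forall p, ~ mboundary p -> 0 < u p;
  st_boundary0 : forall p, mboundary p -> u p = 0 }.

End manifolds.

Definition map_in_charts (R : realType) n (T T' : topologicalType)
    (M : riem_data R n T) (M' : riem_data R n T') (Phi : T -> T')
    (a : chart_index M) (b : chart_index M') : 'rV[R]_n -> 'rV[R]_n :=
  cmap (charts b) \o Phi \o cinv (charts a).

Definition smooth_mfd_map (R : realType) n (T T' : topologicalType)
    (M : riem_data R n T) (M' : riem_data R n T') (Phi : T -> T') : Prop :=
  continuous Phi /\
  forall (a : chart_index M) (b : chart_index M'),
    smooth_map_on
      (cmap (charts a) @` (cdom (charts a) `&` Phi @^-1` cdom (charts b)))
      (map_in_charts Phi a b).

Definition isometry (R : realType) n (T T' : topologicalType)
    (M : riem_data R n T) (M' : riem_data R n T') (Phi : T -> T') : Prop :=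
  [/\ smooth_mfd_map M M' Phi,
      exists Psi : T' -> T,
        [/\ cancel Phi Psi, cancel Psi Phi & smooth_mfd_map M' M Psi] &
      forall (a : chart_index M) (b : chart_index M') p,
        cdom (charts a) p -> cdom (charts b) (Phi p) ->
        let x := cmap (charts a) p in let J := pd_mx (map_in_charts Phi a b) x in
        metric a x = J *m metric b (cmap (charts b) (Phi p)) *m J^T].

Section de_Sitter.
Context {R : realType}.
Variable n : nat.

Definition unit_ball : set 'rV[R]_n := [set x | sqnorm x <= 1].

Lemma origin_in_unit_ball : (0 : 'rV[R]_n) \in unit_ball.
Proof.
by rewrite inE /unit_ball /= /sqnorm big1 // => i _; rewrite mxE expr0n.
Qed.

Definition M0 : topologicalType := set_type unit_ball.

Definition origin : M0 := exist _ 0 origin_in_unit_ball.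

Definition u0 (p : M0) : R := Num.sqrt (1 - sqnorm (val p)).

(* Replaces the first coordinate by sqrt(1 - |x|^2); restricted to points of
   the unit ball with nonnegative first coordinate, it is an involution. *)
Definition swap_height (x : 'rV[R]_n) : 'rV[R]_n :=
  \row_j if j == 0%N :> nat then Num.sqrt (1 - sqnorm x) else x 0 j.

(* The open ball, translated so as to lie in the half-space. *)
Definition interior_chart : chart R n M0 :=
  Chart [set p : M0 | sqnorm (val p) < 1]
        (fun p => val p + const_mx 1)
        (fun y => insubd origin (y - const_mx 1)).

(* On the closed ball, g_0 and u_0 are smooth in the differentiable structure
   for which x |-> (x, u_0(x)) is a diffeomorphism onto the closed hemisphere.
   Charts of it around the boundary: rotate x by an orthogonal matrix Q, and,
   where the first coordinate of the result is positive, use u_0(x) in its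
   place. *)
Definition boundary_chart (Q : 'M[R]_n) : chart R n M0 :=
  Chart [set p : M0 | forall i : 'I_n, i = 0%N :> nat -> 0 < (val p *m Q) 0 i]
        (fun p => swap_height (val p *m Q))
        (fun y => insubd origin (swap_height y *m Q^T)).

(* Since d|x| = <x, dx> / |x| and |x|^2 g_S = |dx|^2 - d|x|^2, the metric g_0 is
   |dx|^2 + <x, dx>^2 / (1 - |x|^2): this is the round metric of the hemisphere,
   which has the same expression in the coordinates of each boundary chart, as
   these are again n of the n + 1 coordinates of an orthonormal frame. *)
Definition round_metric (x : 'rV[R]_n) : 'M[R]_n :=
  1%:M + (1 - sqnorm x)^-1 *: (x^T *m x).

Definition de_Sitter : riem_data R n M0 :=
  @RiemData R n M0 (option {Q : 'M[R]_n | Q *m Q^T == 1%:M})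
    (fun a => if a is Some Q then boundary_chart (val Q) else interior_chart)
    (fun a y => if a is Some _ then round_metric y
                else round_metric (y - const_mx 1)).

End de_Sitter.

Arguments u0 {R n}.
Arguments de_Sitter {R n}.

Definition maximum (R : realType) (A : set R) : R :=
  get [set m | A m /\ ubound A m].

Definition minimum (R : realType) (A : set R) : R :=
  get [set m | A m /\ lbound A m].

Definition components (T : topologicalType) (A : set T) : set (set T) :=
  [set connected_component A p | p in A].

Section surface_gravity_functions.
Context {R : realType}.
Variable n : nat.

Definition m_max : R := Num.sqrt ((n - 2)%:R ^+ (n - 2) / n%:R ^+ n).

Definition radii (m : R) : set R :=
  [set r | 0 < r /\ 1 - r ^+ 2 - 2 * m * r ^- (n - 2) = 0].

Definition r_minus (m : R) : R := minimum (radii m).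
Definition r_plus (m : R) : R := maximum (radii m).

Definition k_of (m r : R) : R :=
  Num.sqrt (r ^+ 2 * (1 - (n - 2)%:R * m * r ^- n) ^+ 2 /
            (1 - (m / m_max) `^ (2 / n%:R))).

Definition k_plus (m : R) : R :=
  if m == 0 then 1 else k_of m (r_plus m).

Definition k_minus (m : R) : R :=
  if m == m_max then Num.sqrt n%:R else k_of m (r_minus m).

(* The default value -1 is not a possible mass. *)
Definition k_plus_inv (k : R) : R :=
  xget (-1) [set m | (0 <= m < m_max) /\ k_plus m = k].

Definition k_minus_inv (k : R) : R :=
  xget (-1) [set m | (0 < m <= m_max) /\ k_minus m = k].

End surface_gravity_functions.

Section virtual_mass.
Context {R : realType} {n : nat} {T : topologicalType}.
Variables (M : riem_data R n T) (u : T -> R).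

Definition u_max : R := maximum (range u).

Definition MAX : set T := [set p | u p = u_max].

Definition regions : set (set T) := components (~` MAX).

Definition rboundary (N : set T) : set T := mboundary M `&` N.

(* |Du| is constant on each component of the boundary. *)
Definition surface_gravity (Sigma : set T) : R :=
  get [set k | exists2 p, Sigma p & k = grad_norm M u p / u_max].

Definition max_surface_gravity (N : set T) : R :=
  maximum (surface_gravity @` components (rboundary N)).

Definition outer_region (N : set T) : bool :=
  max_surface_gravity N < Num.sqrt n%:R.

Definition max_grad_norm (N : set T) : R :=
  maximum [set grad_norm M u p / u_max | p in rboundary N].

(* A region that is not outer is inner or cylindrical. *)
Definition virtual_mass (N : set T) : R :=
  if outer_region N then k_plus_inv n (max_grad_norm N)
  else k_minus_inv n (max_grad_norm N).

Definition virtual_mass_well_defined (N : set T) : Prop :=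
  if outer_region N then 1 <= max_grad_norm N < Num.sqrt n%:R
  else Num.sqrt n%:R <= max_grad_norm N.

Definition de_Sitter_up_to_normalization : Prop :=
  exists (c : R) (Phi : T -> M0 (R := R) n),
    [/\ 0 < c, isometry M de_Sitter Phi & forall p, u p = c * u0 (Phi p)].

End virtual_mass.

(* Main.v *)
Require Import Defs.
From HB Require Import structures.
From mathcomp Require Import ring lra zify.
Set Implicit Arguments.
Unset Strict Implicit.
Unset Printing Implicit Defensive.
Import Order.TTheory GRing.Theory Num.Theory.
Import numFieldNormedType.Exports.
Local Open Scope classical_set_scope.
Local Open Scope ring_scope.

(* Write c = max u and w = |Du|^2 + u^2.  By the Bochner formula w satisfies an elliptic inequality, so
 on a region N with |Du| <= c on its boundary it is at most c^2.  Second-order conditions at a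
 maximum point of u in the closure of N then force D^2 u = - u g there; hence N fills a
 neighbourhood of that point up to MAX(u), and the strong maximum principle gives w = c^2 on M.
 So surface gravities cannot all be below 1, and if their maximum is 1 then D^2 u = - u g on M.

 In that case v = u / c satisfies |Dv|^2 + v^2 = 1, and (f, df) is parallel, for each solution of
 D^2 f = - f g, for a connection on R + T^*M.  Its curvature F obeys a transport equation along Dv
 which makes (1 - v^2)^2 |F|^2 constant along the flow of Dv; adding a small multiple of v, a
 maximum would lie in MAX(v), where 1 - v^2 = 0, so F = 0.  An orthonormal parallel frame extending
 (v, dv) yields X with (v, X) a local isometry to the round hemisphere, unique up to O(n).  The
 local inverses of X are continued over the closed unit ball along convex sets, and the resulting
 map from the ball to M is bijective. *)

(** * First-order calculus on R^n *)

Section differentiability.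
Context {R : realType} {n : nat}.
Implicit Types (f g : 'rV[R]_n -> R) (x v h : 'rV[R]_n).

(** The obstacle is MAX(u), about whose size and shape nothing is known. Write T = D^2 u + u g, H =
    D^2 u, h = g^-1. At a point p of MAX(u) in the closure of N the second derivative of w is 2 H h
    T. Suppose it is positive in a direction e; then H(e, e) < 0. Close to p, u is strictly concave
    along segments parallel to e, so such a segment meets MAX(u) at most once, and when it is
    centred at a point of N one of its ends is in N. But w > c^2 at both ends. Hence H h T <= 0 as a
    quadratic form. Since |T|^2 = tr(h H h T) + c tr(h T) and tr(h T) = 0 by Lap u = - n u, T
    vanishes at p; then p is isolated in MAX(u), and a punctured ball is connected for n > 1. The
    boundary is the second obstacle: the drift Du/u of the elliptic operator is singular there. The
    operator is used only where u > 0, and boundary points are reached by continuity or one-sided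
    derivatives. Near the equator the hemisphere is parametrised by its height and n - 1 of the X_i,
    since v is not a smooth function of X there. *)

Definition lin_form (c : 'I_n -> R) (h : 'rV[R]_n) : R := \sum_i h 0 i * c i.

Lemma lin_form_is_linear c : linear (lin_form c).
move=> a h k; rewrite scaler_sumr -big_split; apply: eq_bigr => i _.
by rewrite !mxE mulrDl -mulrA.
Qed.
HB.instance Definition _ c :=
 GRing.isLinear.Build R 'rV[R]_n R _ (lin_form c) (lin_form_is_linear c).

Lemma continuous_sum (T : topologicalType) I (r : seq I) (P : pred I)
  (F : I -> T -> R) (x : T) :
 (forall i, P i -> {for x, continuous (F i)}) ->
 {for x, continuous (fun y => \sum_(i <- r | P i) F i y)}.
move=> h; elim: r => [|i r IH].
 rewrite (_ : (fun y => _) = cst 0); first exact: cst_continuous.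
 by apply/funext => y; rewrite big_nil.
case Pi : (P i); last first.
 by rewrite (_ : (fun y => _) = (fun y => \sum_(j <- r | P j) F j y)) //;
   apply/funext => y; rewrite big_cons Pi.
rewrite (_ : (fun y => _) = (fun y => F i y + \sum_(j <- r | P j) F j y)); last first.
 by apply/funext => y; rewrite big_cons Pi.
by apply: continuousD => //; exact: h.
Qed.

Lemma lin_form_continuous c : continuous (lin_form c).
move=> x; apply: continuous_sum => i _.
apply: continuousM.
 exact: coord_continuous.
exact: cst_continuous.
Qed.

Lemma diff_eps (df : {linear 'rV[R]_n -> R}) f x : continuous df ->
 (forall e, 0 < e -> \forall h \near (0 : 'rV[R]_n),
   `|f (h + x) - f x - df h| <= e * `|h|) ->
 is_diff x f df.
move=> cdf H.
have E : f \o shift x = cst (f x) + df +o_ (0 : 'rV[R]_n) id.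
 apply: eqaddoE; apply/eqaddoP => e e0; near=> h => /=.
 have -> : ((f \o shift x) - (cst (f x) + df)) h = f (h + x) - f x - df h.
  by rewrite -addrA -opprD.
 by near: h; exact: H.
have D := diff_unique cdf E.
by apply: DiffDef => //; apply/diff_locallyP; rewrite D; split.
Unshelve. all: by end_near. Qed.

Lemma basis_sum x : x = \sum_i x 0 i *: basis i.
by rewrite {1}[x]row_sum_delta. Qed.

Lemma mx_norm_coord x i : `|x 0 i| <= `|x|.
have := mx_normrE x; rewrite /Num.Def.normr /= => ->.
by rewrite (bigmax_sup (0, i)).
Qed.

Lemma mx_norm_le x (e : R) : 0 <= e -> (forall i, `|x 0 i| <= e) -> `|x| <= e.
move=> e0 H; have := mx_normrE x; rewrite /Num.Def.normr /= => ->.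
apply/bigmax_leP; split => // -[i j] _; rewrite ord1; exact: H.
Qed.

Lemma mx_norm_lt x (e : R) : 0 < e -> (forall i, `|x 0 i| < e) -> `|x| < e.
move=> e0 H; have := mx_normrE x; rewrite /Num.Def.normr /= => ->.
apply/bigmax_ltP; split => // -[i j] _; rewrite ord1; exact: H.
Qed.

Lemma derive_sumE f x v : differentiable f x ->
 'D_v f x = \sum_i v 0 i * 'D_(basis i) f x.
move=> df; rewrite deriveE // {1}[v]basis_sum raddf_sum /=.
by apply: eq_bigr => i _; rewrite linearZ deriveE.
Qed.

Lemma is_derive_line f x v (t : R) : differentiable f (x + t *: v) ->
 is_derive t 1 (fun s : R => f (x + s *: v)) ('D_v f (x + t *: v)).
move=> df.
have dl : is_diff t (fun s : R => x + s *: v) (fun s => s *: v).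
 have := @is_diffD _ _ _ (cst x) (fun s : R => s *: v) 0 (fun s => s *: v) t _ _.
 rewrite add0r; apply.
have H : differentiable (f \o (fun s : R => x + s *: v)) t.
 exact: differentiable_comp.
apply: DeriveDef; first by apply/derivable1_diffP.
rewrite deriveE // diff_comp //= deriveE // diff_val.
by rewrite scale1r.
Qed.

Lemma near0_ball (P : 'rV[R]_n -> Prop) :
 (\forall h \near (0 : 'rV[R]_n), P h) <->
 exists2 d : R, 0 < d & forall h, `|h| < d -> P h.
split => [/nbhs_ballP [d d0 H]|[d d0 H]].
 exists d => // h hd; apply: H; rewrite -ball_normE /= sub0r normrN //.
apply/nbhs_ballP; exists d => // h; rewrite -ball_normE /= sub0r normrN; exact: H.
Qed.

Lemma nbhs_normP x (P : 'rV[R]_n -> Prop) :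
 (\forall y \near x, P y) <->
 exists2 d : R, 0 < d & forall y, `|y - x| < d -> P y.
split => [/nbhs_ballP [d d0 H]|[d d0 H]].
 exists d => // h hd; apply: H; rewrite -ball_normE /= distrC //.
apply/nbhs_ballP; exists d => // h; rewrite -ball_normE /= distrC; exact: H.
Qed.

End differentiability.

Section C1.
Context {R : realType} {n : nat}.
Implicit Types (f g : 'rV[R]_n -> R) (x v h : 'rV[R]_n).

Lemma MVT_unordered (phi dphi : R -> R) (a b : R) :
 (forall s, Num.min a b <= s <= Num.max a b -> is_derive s 1 phi (dphi s)) ->
 exists2 s, Num.min a b <= s <= Num.max a b & phi b - phi a = dphi s * (b - a).
move=> H.
have key (c d : R) : c <= d -> (forall s, c <= s <= d -> is_derive s 1 phi (dphi s)) ->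
  exists2 s, c <= s <= d & phi d - phi c = dphi s * (d - c).
 move=> cd Hd; have [|||s sI E] := @MVT_segment R phi dphi c d.
 - by [].
 - by move=> s sI; apply: Hd; rewrite ?(itvP sI).
 - apply: derivable_within_continuous => z zI.
  by have [] := Hd z ltac:(by []).
 by exists s => //; rewrite !itvP.
case: leP => ab in H *.
 exact: key.
have [s sI E] := key b a (ltW ab) H.
by exists s => //; rewrite -opprB E -mulrN opprB.
Qed.

Lemma is_derive_dline f x v (t : R) : derivable f (x + t *: v) v ->
 is_derive t 1 (fun s : R => f (x + s *: v)) ('D_v f (x + t *: v)).
have E : (fun h : R => h^-1 *: (((fun s => f (x + s *: v)) \o shift t) (h *: 1) - f (x + t *: v)))
  = (fun h : R => h^-1 *: ((f \o shift (x + t *: v)) (h *: v) - f (x + t *: v))).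
 apply/funext => h /=; congr _.
 by rewrite [h *: 1]mulr1 scalerDl addrCA.
move=> df; split; first by rewrite /derivable E.
by rewrite /derive E.
Qed.

Definition trunc (k : nat) h : 'rV[R]_n := \row_i (if (i < k)%N then h 0 i else 0).

Lemma truncS (k : 'I_n) h : trunc k.+1 h = trunc k h + h 0 k *: basis k.
apply/rowP => i; rewrite !mxE ltnS leq_eqVlt.
case: (eqVneq i k) => [->|ik]; first by rewrite eqxx ltnn add0r mulr1.
have -> /= : (i == k :> nat) = false by apply: contraNF ik => /eqP/val_inj ->.
lra.
Qed.

(** The increment over h telescopes along the truncations of h, which change one coordinate at a
    time; the mean value theorem turns each difference into a partial derivative at a point within
    [|h|] of x in the sup norm. *)
Lemma C1_differentiable f x :
 (\forall y \near x, forall i, derivable f y (basis i)) ->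
 (forall i, {for x, continuous ('D_(basis i) f)}) ->
 differentiable f x.
move=> /nbhs_normP[d0 d0p D] C; pose c i := 'D_(basis i) f x.
suff : is_diff x f (lin_form c) by [].
apply: diff_eps; first exact: lin_form_continuous.
(* Each of the n coordinates contributes e'; [n.+1] keeps the quotient positive when n = 0. *)
move=> e e0; pose e' := e / n.+1%:R.
have e'0 : 0 < e' by rewrite divr_gt0.
have [d dp Hd] : exists2 d : R, 0 < d & forall y, `|y - x| < d ->
  forall i, `|'D_(basis i) f y - c i| <= e'.
 apply/nbhs_normP.
 apply: (@filter_forall _ _ (fun i y => `|'D_(basis i) f y - c i| <= e') (nbhs x)) => i.
 have /cvgrPdist_le/(_ _ e'0) := C i.
 by apply: filterS => y; rewrite distrC.
apply/near0_ball; exists (Num.min d0 d); first by rewrite lt_min d0p.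
move=> h; rewrite lt_min => /andP[hd0 hd].
pose F k := f (x + trunc k h).
have E : f (h + x) - f x = \sum_(k < n) (F k.+1 - F k).
 rewrite -(big_mkord xpredT (fun k => F k.+1 - F k)) telescope_sumr //.
 congr (f _ - f _); rewrite ?[h + x]addrC.
  by congr (_ + _); apply/rowP => i; rewrite mxE ltn_ord.
 by rewrite (_ : trunc 0 h = 0) ?addr0 //; apply/rowP => i; rewrite !mxE.
rewrite E -sumrB.
apply: (le_trans (ler_norm_sum _ _ _)).
apply: (@le_trans _ _ (\sum_(k < n) e' * `|h|)); last first.
 rewrite sumr_const card_ord -mulr_natl mulrA ler_wpM2r //.
 by rewrite mulrCA ger_pMr // ler_pdivrMr // mul1r ler_nat.
apply: ler_sum => k _.
have near_x s : Num.min 0 (h 0 k) <= s <= Num.max 0 (h 0 k) ->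
  `|x + trunc k h + s *: basis k - x| <= `|h|.
 move=> sI; rewrite -(addrA x) [x + _]addrC addrK.
 apply: mx_norm_le => // i; rewrite !mxE.
 case: (eqVneq i k) => [->|ik].
  rewrite ltnn add0r mulr1; apply: (@le_trans _ _ `|h 0 k|); last exact: mx_norm_coord.
  by move: sI; case: (leP 0 (h 0 k)) => hk /andP[s1 s2];
    rewrite ?(ger0_norm s1) ?(ger0_norm hk) ?(ler0_norm s2) ?ltr0_norm ?lerN2.
 rewrite mulr0 addr0; case: ifP => _; first exact: mx_norm_coord.
 by rewrite normr0.
have [s sI Es] := @MVT_unordered (fun s => f (x + trunc k h + s *: basis k))
  (fun s => 'D_(basis k) f (x + trunc k h + s *: basis k)) 0 (h 0 k)
  ltac:(move=> s sI; apply: is_derive_dline; apply: D;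
     exact: le_lt_trans (near_x _ sI) hd0).
rewrite /F truncS addrA.
move: Es; rewrite scale0r addr0 subr0 => ->.
rewrite [_ * h 0 k]mulrC -mulrBr normrM mulrC ler_pM //; last exact: mx_norm_coord.
by apply: Hd; exact: le_lt_trans (near_x _ sI) hd.
Qed.

End C1.

(** * Classes C^k on open sets and their closure properties *)

Section smooth_open_theory.
Context {R : realType}.

(* Differentiability is included at every order, so that the product and chain
  rules apply without further ado. *)
Fixpoint Ck n (k : nat) (V : set 'rV[R]_n) (f : 'rV[R]_n -> R) : Prop :=
 if k is k'.+1 then
  (forall x, V x -> differentiable f x) /\ forall i, Ck k' V ('D_(basis i) f)
 else forall x, V x -> {for x, continuous f}.

Lemma diff_epsE n (f : 'rV[R]_n -> R) x : differentiable f x ->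
 forall e, 0 < e -> \forall h \near (0 : 'rV[R]_n),
   `|f (h + x) - f x - 'd f x h| <= e * `|h|.
move=> df e e0; have /eqaddoP/(_ _ e0) := diff_locally df.
apply: filterS => h.
by rewrite -addrA -opprD.
Qed.

Lemma near_eq_differentiable n (f g : 'rV[R]_n -> R) x :
 (\forall y \near x, f y = g y) -> differentiable f x -> differentiable g x.
move=> fg df; suff : is_diff x g ('d f x) by [].
have fgx : f x = g x := nbhs_singleton fg.
apply: diff_eps; first exact: diff_continuous.
move=> e e0; have := diff_epsE df e0.
have : \forall h \near (0 : 'rV[R]_n), f (h + x) = g (h + x).
 move/nbhs_normP: fg => [d d0 H]; apply/near0_ball; exists d => // h hd.
 by apply: H; rewrite addrK.
by apply: filterS2 => h ->; rewrite fgx.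
Qed.

Definition smooth n (V : set 'rV[R]_n) f := forall k, @Ck n k V f.

Lemma open_near n (V : set 'rV[R]_n) x (P : 'rV[R]_n -> Prop) :
 open V -> V x -> (forall y, V y -> P y) -> \forall y \near x, P y.
by move=> oV Vx H; apply: filterS H _; exact: open_nbhs_nbhs. Qed.

Lemma Ck_ext n k (V : set 'rV[R]_n) f g : open V -> (forall x, V x -> f x = g x) ->
 Ck k V f -> Ck k V g.
move=> oV; elim: k f g => [|k IH] f g E.
 move=> H x Vx; have fg := open_near oV Vx E.
 change (g @ x --> g x); rewrite -(E x Vx).
 exact: cvg_trans (near_eq_cvg fg) (H x Vx).
move=> [H1 H2]; split.
 move=> x Vx; have fg := open_near oV Vx E.
 exact: near_eq_differentiable (H1 x Vx).
move=> i; apply: IH (H2 i) => x Vx.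
by apply: near_eq_derive; exact: open_near oV Vx E.
Qed.

Lemma CkW n k (V : set 'rV[R]_n) f : Ck k.+1 V f -> Ck k V f.
elim: k f => [|k IH] f; first by move=> [H _] x Vx; exact: differentiable_continuous (H x Vx).
by move=> [H1 H2]; split => // i; exact: IH (H2 i).
Qed.

Lemma Ck_sub n k (V W : set 'rV[R]_n) f : W `<=` V -> Ck k V f -> Ck k W f.
move=> WV; elim: k f => [|k IH] f; first by move=> H x /WV; exact: H.
by move=> [H1 H2]; split=> [x /WV|i]; [exact: H1|exact: IH (H2 i)].
Qed.

Lemma Ck_smooth_open n (V : set 'rV[R]_n) f : smooth V f -> smooth_open V f.
move=> H s; elim: s f H => [|i s IH] f H x Vx.
 split; first by have := H 0 x Vx.
 by move=> i; apply: diff_derivable; have [/(_ x Vx)] := H 1.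
suff K : forall s f, smooth V f -> smooth V (iter_derive s f).
 have := K (i :: s) f H; split; first exact: (H0 0%N x Vx).
 by move=> j; apply: diff_derivable; have [/(_ x Vx)] := H0 1%N.
move=> s' f' H'; elim: s' => [|j s' IHs] //= k.
by have [_] := IHs k.+1; exact.
Qed.

(** Continuity of all iterated partial derivatives upgrades to differentiability at every order
    through [C1_differentiable]. *)
Lemma smooth_open_Ck n (V : set 'rV[R]_n) f : open V -> smooth_open V f -> smooth V f.
move=> oV H k.
suff K : forall s, Ck k V (iter_derive s f) by exact: (K [::]).
elim: k => [|k IH] s; first by move=> x Vx; have [] := H s x Vx.
split; last by move=> i; exact: (IH (i :: s)).
move=> x Vx; apply: C1_differentiable.
 by apply: open_near oV Vx _ => y Vy; have [] := H s y Vy.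
by move=> i; have [] := H (i :: s) x Vx.
Qed.

End smooth_open_theory.

Section Ck_algebra.
Context {R : realType}.

Lemma Ck_cst n k (V : set 'rV[R]_n) (c : R) : Ck k V (fun=> c).
elim: k c => [|k IH] c; first by move=> x _; exact: cst_continuous.
split=> [x _|i] //.
rewrite (_ : 'D_(basis i) _ = fun=> 0) //.
by apply/funext => x; rewrite derive_cst.
Qed.

Lemma Ck_coord n k (V : set 'rV[R]_n) j : Ck k V (fun x => x 0 j).
case: k => [|k]; first by move=> x _; exact: coord_continuous.
split=> [x _|i]; first exact: differentiable_coord.
rewrite (_ : 'D_(basis i) _ = fun=> (i == j)%:R :> R); first exact: Ck_cst.
apply/funext => x; rewrite /derive (_ : (fun h => _) = fun h : R => h^-1 * (h * (i == j)%:R)).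
 apply: cvg_lim => //; apply: (@cvg_trans _ ((fun=> (i == j)%:R) @ (0 : R)^')); last exact: cvg_cst.
 apply: near_eq_cvg; near=> h; rewrite mulKf //.
 by near: h; exact: nbhs_dnbhs_neq.
apply/funext => h /=; rewrite !mxE; congr _.
by rewrite addrK eq_sym.
Unshelve. all: by end_near. Qed.

Lemma CkD n k (V : set 'rV[R]_n) f g : open V -> Ck k V f -> Ck k V g ->
 Ck k V (fun x => f x + g x).
move=> oV; elim: k f g => [|k IH] f g.
 by move=> Hf Hg x Vx; apply: continuousD; [exact: Hf|exact: Hg].
move=> [f1 f2] [g1 g2]; split=> [x Vx|i].
 by apply: differentiableD; [exact: f1|exact: g1].
apply: Ck_ext oV _ (IH _ _ (f2 i) (g2 i)) => x Vx.
by rewrite deriveD //; [exact: diff_derivable (f1 _ _)|exact: diff_derivable (g1 _ _)].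
Qed.

Lemma CkM n k (V : set 'rV[R]_n) f g : open V -> Ck k V f -> Ck k V g ->
 Ck k V (fun x => f x * g x).
move=> oV; elim: k f g => [|k IH] f g.
 by move=> Hf Hg x Vx; apply: continuousM; [exact: Hf|exact: Hg].
move=> Hf Hg; have [f1 f2] := Hf; have [g1 g2] := Hg; split=> [x Vx|i].
 by apply: differentiableM; [exact: f1|exact: g1].
apply: Ck_ext oV _ (CkD oV (IH _ _ (CkW Hf) (g2 i)) (IH _ _ (CkW Hg) (f2 i))) => x Vx.
by rewrite deriveM //; [exact: diff_derivable (f1 _ _)|exact: diff_derivable (g1 _ _)].
Qed.

Lemma CkN n k (V : set 'rV[R]_n) f : open V -> Ck k V f -> Ck k V (fun x => - f x).
move=> oV H; apply: Ck_ext oV _ (CkM oV (Ck_cst k V (-1)) H) => x _.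
nra.
Qed.

Lemma CkB n k (V : set 'rV[R]_n) f g : open V -> Ck k V f -> Ck k V g ->
 Ck k V (fun x => f x - g x).
by move=> oV Hf Hg; apply: CkD => //; exact: CkN. Qed.

Lemma Ck_sum n k (V : set 'rV[R]_n) I (r : seq I) (P : pred I) (F : I -> 'rV[R]_n -> R) :
 open V -> (forall i, P i -> Ck k V (F i)) -> Ck k V (fun x => \sum_(i <- r | P i) F i x).
move=> oV H; elim: r => [|i r IH].
 apply: (Ck_ext oV) (Ck_cst k V 0) => x _; by rewrite big_nil.
case Pi : (P i).
 by apply: (Ck_ext oV) (CkD oV (H i Pi) IH) => x _; rewrite big_cons Pi.
by apply: (Ck_ext oV) IH => x _; rewrite big_cons Pi.
Qed.

Lemma Ck_prod n k (V : set 'rV[R]_n) I (r : seq I) (P : pred I) (F : I -> 'rV[R]_n -> R) :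
 open V -> (forall i, P i -> Ck k V (F i)) -> Ck k V (fun x => \prod_(i <- r | P i) F i x).
move=> oV H; elim: r => [|i r IH].
 apply: (Ck_ext oV) (Ck_cst k V 1) => x _; by rewrite big_nil.
case Pi : (P i).
 by apply: (Ck_ext oV) (CkM oV (H i Pi) IH) => x _; rewrite big_cons Pi.
by apply: (Ck_ext oV) IH => x _; rewrite big_cons Pi.
Qed.

Lemma CkV n k (V : set 'rV[R]_n) (f : 'rV[R]_n -> R) : open V -> (forall x, V x -> f x != 0) ->
 Ck k V f -> Ck k V (fun x => (f x)^-1).
move=> oV f0; elim: k f f0 => [|k IH] f f0.
 by move=> Hf x Vx; apply: continuousV; [exact: f0|exact: Hf].
move=> Hf; have [f1 f2] := Hf; split=> [x Vx|i].
 by apply: differentiableV; [exact: f1|exact: f0].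
have Hi := IH _ f0 (CkW Hf).
apply: Ck_ext oV _ (CkN oV (CkM oV (CkM oV Hi Hi) (f2 i))) => x Vx.
rewrite deriveV; [|exact: f0|exact: diff_derivable (f1 _ _)].
by rewrite -exprVn scaleNr.
Qed.

Lemma differentiable_row n m (phi : 'rV[R]_n -> 'rV[R]_m) x :
 (forall j, differentiable (fun y => phi y 0 j) x) -> differentiable phi x.
move=> H; rewrite (_ : phi = \sum_j (fun y => phi y 0 j *: basis j)); last first.
 by apply/funext => y; rewrite {1}[phi y]basis_sum fct_sumE.
by apply: differentiable_sum => j; exact: differentiableZl.
Qed.

Lemma derive_coord n m (phi : 'rV[R]_n -> 'rV[R]_m) x v j : differentiable phi x ->
 ('D_v phi x) 0 j = 'D_v (fun y => phi y 0 j) x.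
by move=> /diff_derivable d; rewrite derive_mx // mxE. Qed.

Lemma derive_comp n m (phi : 'rV[R]_n -> 'rV[R]_m) (f : 'rV[R]_m -> R) x v :
 (forall j, differentiable (fun y => phi y 0 j) x) -> differentiable f (phi x) ->
 'D_v (f \o phi) x = \sum_j 'D_(basis j) f (phi x) * 'D_v (fun y => phi y 0 j) x.
move=> /differentiable_row dphi df.
rewrite (deriveE _ (differentiable_comp dphi df)) (diff_comp dphi df) /=.
rewrite -(deriveE _ dphi) -(deriveE _ df) (derive_sumE _ df); apply: eq_bigr => j _.
by rewrite mulrC derive_coord.
Qed.

Lemma Ck_comp n m k (V : set 'rV[R]_n) (W : set 'rV[R]_m) (phi : 'rV[R]_n -> 'rV[R]_m) f :
 open V -> open W -> (forall x, V x -> W (phi x)) ->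
 (forall j, Ck k V (fun x => phi x 0 j)) -> Ck k W f -> Ck k V (f \o phi).
move=> oV oW VW; elim: k f => [|k IH] f Hp Hf.
 move=> x Vx; apply: continuous_comp; last by apply: Hf; exact: VW.
 move=> A /nbhs_normP[d d0 dA].
 have : \forall y \near x, forall j, `|phi y 0 j - phi x 0 j| < d.
  apply: (@filter_forall _ _ (fun j y => `|phi y 0 j - phi x 0 j| < d) (nbhs x)) => j.
  have /cvgrPdist_lt/(_ _ d0) := Hp j x Vx.
  by apply: filterS => y; rewrite distrC.
 apply: filterS => y H; apply: dA; apply: mx_norm_lt => // j.
 by rewrite !mxE.
have [f1 f2] := Hf.
split=> [x Vx|i].
 apply: differentiable_comp; last exact/f1/VW.
 by apply: differentiable_row => j; have [p1 _] := Hp j; exact: p1.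
apply: Ck_ext oV _ (@Ck_sum _ _ _ _ (index_enum 'I_m) xpredT _ oV (fun j _ => CkM oV
 (IH _ (fun j => CkW (Hp j)) (f2 j)) ((Hp j).2 i))) => x Vx.
rewrite derive_comp //; last exact/f1/VW.
by move=> j; have [p1 _] := Hp j; exact: p1.
Qed.

End Ck_algebra.

(** * Symmetry of second derivatives *)

Section schwarz.
Context {R : realType} {n : nat}.
Implicit Types (f : 'rV[R]_n -> R) (x : 'rV[R]_n).

Lemma norm_basis_le (i : 'I_n) : `|basis i : 'rV[R]_n| <= 1.
apply: mx_norm_le => // j; rewrite !mxE /=; case: eqP => _; rewrite ?normr1 ?normr0 //.
Qed.

Lemma second_difference f x i j (d s : R) : 0 < s -> s + s < d ->
 (forall y, `|y - x| < d -> differentiable f y) ->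
 (forall y, `|y - x| < d -> differentiable ('D_(basis i) f) y) ->
 exists2 y, `|y - x| <= s + s &
  f (x + s *: basis i + s *: basis j) - f (x + s *: basis i)
   - f (x + s *: basis j) + f x
  = s ^+ 2 * 'D_(basis j) ('D_(basis i) f) y.
move=> s0 sd df ddf.
have near_x (a b : R) : 0 <= a <= s -> 0 <= b <= s ->
  `|x + a *: basis i + b *: basis j - x| <= s + s.
 move=> /andP[a0 a1] /andP[b0 b1].
 rewrite -(addrA x) [x + _]addrC addrK; apply: (le_trans (ler_normD _ _)).
 by rewrite !normrZ (ger0_norm a0) (ger0_norm b0) lerD //;
  rewrite -[leRHS]mulr1 ler_pM // norm_basis_le.
have near_x' (a b : R) : 0 <= a <= s -> 0 <= b <= s ->
  `|x + a *: basis i + b *: basis j - x| < d.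
 by move=> Ha Hb; exact: le_lt_trans (near_x a b Ha Hb) sd.
pose phi (t : R) := f (x + s *: basis j + t *: basis i) - f (x + t *: basis i).
pose dphi (t : R) := 'D_(basis i) f (x + s *: basis j + t *: basis i) -
  'D_(basis i) f (x + t *: basis i).
have m0s : Num.min 0 s = 0 by apply: min_l; exact: ltW.
have M0s : Num.max 0 s = s by apply: max_r; exact: ltW.
have s0s : 0 <= s <= s by rewrite lexx ltW.
have z0s : 0 <= (0 : R) <= s by rewrite lexx ltW.
have [t tI Et] : exists2 t, Num.min 0 s <= t <= Num.max 0 s &
  phi s - phi 0 = dphi t * (s - 0).
 apply: MVT_unordered; rewrite m0s M0s => t tI.
 apply: is_deriveB; apply: is_derive_line; apply: df.
  by rewrite (addrAC x); exact: near_x'.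
 by have := near_x' t 0 tI z0s; rewrite scale0r addr0.
rewrite m0s M0s in tI.
pose psi (r : R) := 'D_(basis i) f (x + t *: basis i + r *: basis j).
have [r rI Er] : exists2 r, Num.min 0 s <= r <= Num.max 0 s &
  psi s - psi 0 = 'D_(basis j) ('D_(basis i) f) (x + t *: basis i + r *: basis j) * (s - 0).
 apply: MVT_unordered.
 rewrite m0s M0s => r rI; apply: is_derive_line; apply: ddf; exact: near_x'.
rewrite m0s M0s in rI.
exists (x + t *: basis i + r *: basis j); first exact: near_x.
move: Et Er; rewrite /phi /dphi /psi !scale0r !addr0.
rewrite (addrAC x (s *: basis j) (s *: _)) (addrAC x (s *: basis j) (t *: _)).
nra.
Qed.

Lemma dist_lt_split (a b c e : R) : `|a - c| < e -> `|b - c| < e -> `|a - b| < e + e.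
move=> ac bc; rewrite (_ : a - b = (a - c) - (b - c)); last by nra.
by apply: le_lt_trans (ler_normB _ _) _; exact: ltrD.
Qed.

(** The two forms of the second difference give equal values of the two mixed derivatives at points
    arbitrarily near x; continuity concludes. *)
Lemma schwarz (V : set 'rV[R]_n) f x i j : open V -> V x -> Ck 2 V f ->
 'D_(basis j) ('D_(basis i) f) x = 'D_(basis i) ('D_(basis j) f) x.
move=> oV Vx [f1 f2].
have [d d0 dV] : exists2 d : R, 0 < d & forall y, `|y - x| < d -> V y.
 by apply/nbhs_normP; exact: open_nbhs_nbhs.
pose A y : R := 'D_(basis j) ('D_(basis i) f) y.
pose B y : R := 'D_(basis i) ('D_(basis j) f) y.
have cA e : 0 < e -> exists2 d' : R, 0 < d' & forall y, `|y - x| < d' -> `|A x - A y| < e.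
 by move=> e0; apply/nbhs_normP; have [_ /(_ j) H] := f2 i; have /cvgrPdist_lt := H x Vx; exact.
have cB e : 0 < e -> exists2 d' : R, 0 < d' & forall y, `|y - x| < d' -> `|B x - B y| < e.
 by move=> e0; apply/nbhs_normP; have [_ /(_ i) H] := f2 j; have /cvgrPdist_lt := H x Vx; exact.
have sd (s : R) : 0 < s -> s + s < d -> exists y1 y2, [/\ `|y1 - x| <= s + s,
  `|y2 - x| <= s + s & A y1 = B y2].
 move=> s0 sd.
 have df y : `|y - x| < d -> differentiable f y by move=> /dV; exact: f1.
 have ddf k y : `|y - x| < d -> differentiable ('D_(basis k) f) y.
  by move=> /dV; have [H _] := f2 k; exact: H.
 have [y1 y1x E1] := second_difference j s0 sd df (ddf i).
 have [y2 y2x E2] := second_difference i s0 sd df (ddf j).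
 exists y1, y2; split; [exact: y1x|exact: y2x|].
 have s2 : s ^+ 2 != 0 :> R by rewrite lt0r_neq0 // exprn_gt0.
 apply: (mulfI s2); rewrite -[LHS]E1 -[RHS]E2.
 by rewrite (addrAC x) -!addrA; congr (_ + _); rewrite addrCA.
apply/eqP; rewrite -subr_eq0 -normr_eq0 -[_ == 0]negbK; apply/negP => nab0.
have nab : 0 < `|A x - B x| by rewrite lt_neqAle eq_sym nab0 normr_ge0.
pose e := `|A x - B x| / 2; have e0 : 0 < e by rewrite divr_gt0.
have [d1 d10 H1] := cA e e0; have [d2 d20 H2] := cB e e0.
pose s := Num.min d (Num.min d1 d2) / 3.
have m0 : 0 < Num.min d (Num.min d1 d2) by rewrite !lt_min d0 d10.
have s0 : 0 < s by rewrite divr_gt0.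
have sm : s + s < Num.min d (Num.min d1 d2).
 by rewrite /s; lra.
have [sd0 sd1 sd2] : [/\ s + s < d, s + s < d1 & s + s < d2].
 by move: sm; rewrite !lt_min => /andP[-> /andP[-> ->]].
have [y1 [y2 [y1x y2x E]]] := sd s s0 sd0.
have L1 := H1 y1 (le_lt_trans y1x sd1); have L2 := H2 y2 (le_lt_trans y2x sd2).
rewrite E in L1; have := dist_lt_split L1 L2.
by rewrite -splitr ltxx.
Qed.

End schwarz.

(** * Calculus on relatively open subsets of the half-space *)

Section half_space_calculus.
Context {R : realType} {n : nat}.
Implicit Types (A : set 'rV[R]_n) (x y : 'rV[R]_n) (f g : 'rV[R]_n -> R).

(** The shape of chart images. The rules for [pd] are stated on such sets, so that they hold up to
    the boundary. *)
Definition hopen A := exists2 V, open V & A = V `&` halfspace (n := n).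

Definition local_ext A f x V F :=
 [/\ open V, V x, smooth V F & forall y, A y -> V y -> F y = f y].

Lemma smooth_onP A f : smooth_on A f <->
 forall x, A x -> exists V F, local_ext A f x V F.
split=> H x Ax; have [V [F [oV Vx sF E]]] := H x Ax; exists V, F; split => //.
 exact: smooth_open_Ck.
exact: Ck_smooth_open.
Qed.

Lemma hopenI A B : hopen A -> hopen B -> hopen (A `&` B).
move=> [V oV ->] [W oW ->]; exists (V `&` W); first exact: openI.
by rewrite setIACA setIid.
Qed.

Lemma hopen_open A V : hopen A -> open V -> hopen (A `&` V).
move=> [W oW ->] oV; exists (W `&` V); first exact: openI.
by rewrite setIAC.
Qed.

(** Steps t > 0 stay in the half-space, so the filter in [pd] is proper even at boundary points, and
    the two-sided difference quotient of the extension restricts to it. The rules for [pd] are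
    pulled back from extensions through this. *)
Lemma pdE A f x V F i : hopen A -> A x -> local_ext A f x V F ->
 pd i f x = 'D_(basis i) F x.
move=> [W oW EA] Ax [oV Vx sF E]; have [Wx Hx] : (W `&` halfspace (n := n)) x by rewrite -EA.
pose G := within [set t : R | halfspace (n := n) (x + t *: basis i)] (0 : R)^'.
have right_half t : 0 < t -> halfspace (n := n) (x + t *: basis i).
 move=> t0 j j0; rewrite !mxE addr_ge0 //; first exact: Hx.
 by rewrite mulr_ge0 // ltW.
have PG : ProperFilter G.
 apply: Build_ProperFilter_ex => B; rewrite /G => /nbhs_ballP[d d0 H].
 have d20 : 0 < d / 2 by rewrite divr_gt0.
 exists (d / 2); apply: H.
 - rewrite /ball /= sub0r normrN gtr0_norm //.
  lra.
 - by rewrite gt_eqF.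
 - exact: right_half.
have dF : derivable F x (basis i) by apply: diff_derivable; have [H _] := sF 1%N; exact: H.
apply: cvg_lim => //; have cF : (fun h : R => h^-1 *: ((F \o shift x) (h *: basis i) - F x))
   @ G --> ('D_(basis i) F x : R).
 exact: cvg_within_filter; exact: dF.
apply: cvg_trans cF; apply: near_eq_cvg.
have [d d0 dVW] : exists2 d : R, 0 < d & forall y, `|y - x| < d -> (V `&` W) y.
 by apply/nbhs_normP; apply: open_nbhs_nbhs; split; [exact: openI|].
apply/nbhs_ballP; exists d => //= t; rewrite /ball /= sub0r normrN => td t0 Ht.
have : (V `&` W) (x + t *: basis i).
 apply: dVW; rewrite addrC addKr normrZ; apply: le_lt_trans td.
 by rewrite ler_piMr // norm_basis_le.
move=> [Vt Wt]; rewrite [t *: _ + _]addrC !E //; by rewrite EA.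
Qed.

Lemma local_ext_eq A f g x V F : local_ext A f x V F -> (forall y, A y -> f y = g y) ->
 local_ext A g x V F.
by move=> [oV Vx sF E] fg; split => // y Ay Vy; rewrite -fg // E. Qed.

Lemma local_extS A f x y V F : local_ext A f x V F -> V y -> local_ext A f y V F.
by move=> [oV Vx sF E] Vy; split. Qed.

Lemma local_ext_pd A f x V F i : hopen A -> local_ext A f x V F ->
 local_ext A (pd i f) x V ('D_(basis i) F).
move=> hA H; have [oV Vx sF E] := H; split => //.
 by move=> k; have [_] := sF k.+1; exact.
by move=> y Ay Vy; rewrite (pdE i hA Ay (local_extS H Vy)).
Qed.

Lemma local_extD A f g x V F W G : local_ext A f x V F -> local_ext A g x W G ->
 local_ext A (fun y => f y + g y) x (V `&` W) (fun y => F y + G y).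
move=> [oV Vx sF E] [oW Wx sG E']; split; [exact: openI|by []| |].
 by move=> k; apply: CkD; [exact: openI|apply: Ck_sub (sF k) => y []|apply: Ck_sub (sG k) => y []].
by move=> y Ay [Vy Wy]; rewrite E ?E'.
Qed.

Lemma local_extM A f g x V F W G : local_ext A f x V F -> local_ext A g x W G ->
 local_ext A (fun y => f y * g y) x (V `&` W) (fun y => F y * G y).
move=> [oV Vx sF E] [oW Wx sG E']; split; [exact: openI|by []| |].
 by move=> k; apply: CkM; [exact: openI|apply: Ck_sub (sF k) => y []|apply: Ck_sub (sG k) => y []].
by move=> y Ay [Vy Wy]; rewrite E ?E'.
Qed.

Lemma smooth_on_ext A f g : (forall y, A y -> f y = g y) -> smooth_on A f -> smooth_on A g.
move=> fg /smooth_onP H; apply/smooth_onP => x Ax; have [V [F e]] := H x Ax.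
by exists V, F; exact: local_ext_eq e fg.
Qed.

Lemma smooth_on_sub A B f : A `<=` B -> smooth_on B f -> smooth_on A f.
move=> AB H x /AB Bx; have [V [F [oV Vx sF E]]] := H x Bx; exists V, F; split => //.
by move=> y /AB; exact: E.
Qed.

Lemma smooth_on_cst A c : smooth_on A (fun=> c).
by apply/smooth_onP => x Ax; exists setT, (fun=> c); split => //;
 [exact: openT|move=> k; exact: Ck_cst].
Qed.

Lemma smooth_on_coord A j : smooth_on A (fun x => x 0 j).
by apply/smooth_onP => x Ax; exists setT, (fun x => x 0 j); split => //;
 [exact: openT|move=> k; exact: Ck_coord].
Qed.

Lemma smooth_onD A f g : smooth_on A f -> smooth_on A g -> smooth_on A (fun x => f x + g x).
move=> /smooth_onP Hf /smooth_onP Hg; apply/smooth_onP => x Ax.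
have [V [F e]] := Hf x Ax; have [W [G e']] := Hg x Ax.
by do 2 eexists; exact: local_extD e e'.
Qed.

Lemma smooth_onM A f g : smooth_on A f -> smooth_on A g -> smooth_on A (fun x => f x * g x).
move=> /smooth_onP Hf /smooth_onP Hg; apply/smooth_onP => x Ax.
have [V [F e]] := Hf x Ax; have [W [G e']] := Hg x Ax.
by do 2 eexists; exact: local_extM e e'.
Qed.

Lemma smooth_onN A f : smooth_on A f -> smooth_on A (fun x => - f x).
move=> H; apply: (smooth_on_ext _ (smooth_onM (smooth_on_cst (-1)) H)) => x _.
nra.
Qed.

Lemma smooth_onB A f g : smooth_on A f -> smooth_on A g -> smooth_on A (fun x => f x - g x).
by move=> Hf Hg; apply: smooth_onD => //; exact: smooth_onN. Qed.

Lemma smooth_on_sum A I (r : seq I) (P : pred I) (F : I -> 'rV[R]_n -> R) :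
 (forall i, P i -> smooth_on A (F i)) ->
 smooth_on A (fun x => \sum_(i <- r | P i) F i x).
move=> H; elim: r => [|i r IH].
 by apply: (smooth_on_ext _ (smooth_on_cst 0)) => x _; rewrite big_nil.
case Pi : (P i).
 by apply: (smooth_on_ext _ (smooth_onD (H i Pi) IH)) => x _; rewrite big_cons Pi.
by apply: (smooth_on_ext _ IH) => x _; rewrite big_cons Pi.
Qed.

Lemma smooth_on_prod A I (r : seq I) (P : pred I) (F : I -> 'rV[R]_n -> R) :
 (forall i, P i -> smooth_on A (F i)) ->
 smooth_on A (fun x => \prod_(i <- r | P i) F i x).
move=> H; elim: r => [|i r IH].
 by apply: (smooth_on_ext _ (smooth_on_cst 1)) => x _; rewrite big_nil.
case Pi : (P i).
 by apply: (smooth_on_ext _ (smooth_onM (H i Pi) IH)) => x _; rewrite big_cons Pi.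
by apply: (smooth_on_ext _ IH) => x _; rewrite big_cons Pi.
Qed.

Lemma open_preimage_C0 m (V : set 'rV[R]_m) (F : 'rV[R]_m -> R) (P : set R) :
 open V -> Ck 0 V F -> open P -> open (V `&` F @^-1` P).
move=> oV cF oP; rewrite openE => y [Vy Py].
apply: filterI; first exact: open_nbhs_nbhs.
by apply: (cF y Vy); exact: open_nbhs_nbhs.
Qed.

Lemma smooth_onV A f : (forall x, A x -> f x != 0) -> smooth_on A f ->
 smooth_on A (fun x => (f x)^-1).
move=> f0 /smooth_onP H; apply/smooth_onP => x Ax.
have [V [F [oV Vx sF E]]] := H x Ax.
have oV' : open (V `&` F @^-1` [set r : R | r != 0]).
 exact: open_preimage_C0 => //; exact: sF.
exists (V `&` F @^-1` [set r : R | r != 0]), (fun y => (F y)^-1); split => //.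
- by split => //=; rewrite E // f0.
- move=> k; apply: CkV => //; first by move=> y [].
 exact: Ck_sub (sF k) => y [].
- by move=> y Ay [Vy _]; rewrite E.
Qed.

Lemma smooth_on_pd A f i : hopen A -> smooth_on A f -> smooth_on A (pd i f).
move=> hA /smooth_onP H; apply/smooth_onP => x Ax; have [V [F e]] := H x Ax.
by exists V, ('D_(basis i) F); exact: local_ext_pd.
Qed.

Lemma smooth_on_cont A f x (e : R) : smooth_on A f -> A x -> 0 < e ->
 exists2 d : R, 0 < d & forall y, A y -> `|y - x| < d -> `|f y - f x| < e.
move=> /smooth_onP H Ax e0; have [V [F [oV Vx sF E]]] := H x Ax.
have /cvgrPdist_lt/(_ _ e0) c := sF 0 x Vx.
have [d d0 dP] : exists2 d : R, 0 < d & forall y, `|y - x| < d -> V y /\ `|F x - F y| < e.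
 by apply/nbhs_normP; apply: filterI => //; exact: open_nbhs_nbhs.
exists d => // y Ay /dP [Vy]; by rewrite !E // distrC.
Qed.

Section rules.
Variables (A : set 'rV[R]_n) (x : 'rV[R]_n).
Hypotheses (hA : hopen A) (Ax : A x).

Lemma pd_ext f g i : smooth_on A f -> (forall y, A y -> f y = g y) -> pd i f x = pd i g x.
move=> /smooth_onP /(_ x Ax) [V [F e]] fg.
by rewrite (pdE i hA Ax e) (pdE i hA Ax (local_ext_eq e fg)).
Qed.

Lemma pd_cst c i : pd i (fun=> c) x = 0.
have e : local_ext A (fun=> c) x setT (fun=> c).
 by split => //; [exact: openT|move=> k; exact: Ck_cst].
by rewrite (pdE i hA Ax e) derive_cst.
Qed.

Lemma local_ext_derivable f V F i : local_ext A f x V F -> derivable F x (basis i).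
by move=> [_ Vx sF _]; apply: diff_derivable; have [H _] := sF 1; exact: H. Qed.

Lemma pdD f g i : smooth_on A f -> smooth_on A g ->
 pd i (fun y => f y + g y) x = pd i f x + pd i g x.
move=> /smooth_onP /(_ x Ax) [V [F e]] /smooth_onP /(_ x Ax) [W [G e']].
rewrite (pdE i hA Ax e) (pdE i hA Ax e') (pdE i hA Ax (local_extD e e')).
by apply: deriveD; [exact: local_ext_derivable e|exact: local_ext_derivable e'].
Qed.

Lemma pdM f g i : smooth_on A f -> smooth_on A g ->
 pd i (fun y => f y * g y) x = pd i f x * g x + f x * pd i g x.
move=> /smooth_onP /(_ x Ax) [V [F e]] /smooth_onP /(_ x Ax) [W [G e']].
rewrite (pdE i hA Ax e) (pdE i hA Ax e') (pdE i hA Ax (local_extM e e')).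
have [_ Vx _ E] := e; have [_ Wx _ E'] := e'.
rewrite -E // -E' // [RHS]addrC [X in _ + X]mulrC.
apply: deriveM; [exact: local_ext_derivable e|exact: local_ext_derivable e'].
Qed.

Lemma pd_comm f i j : smooth_on A f -> pd i (pd j f) x = pd j (pd i f) x.
move=> /smooth_onP /(_ x Ax) [V [F e]].
rewrite (pdE i hA Ax (local_ext_pd j hA e)) (pdE j hA Ax (local_ext_pd i hA e)).
by have [oV Vx sF _] := e; exact: schwarz oV Vx (sF 2).
Qed.

Lemma pdZ f c i : smooth_on A f -> pd i (fun y => c * f y) x = c * pd i f x.
by move=> H; rewrite pdM //; [rewrite pd_cst mul0r add0r|exact: smooth_on_cst]. Qed.

Lemma pdN f i : smooth_on A f -> pd i (fun y => - f y) x = - pd i f x.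
move=> H; rewrite -mulN1r -pdZ //; apply: pd_ext; first exact: smooth_onN.
by move=> y _; rewrite mulN1r.
Qed.

Lemma pdB f g i : smooth_on A f -> smooth_on A g ->
 pd i (fun y => f y - g y) x = pd i f x - pd i g x.
by move=> Hf Hg; rewrite pdD //; [rewrite pdN|exact: smooth_onN]. Qed.

Lemma pd_sum I (r : seq I) (P : pred I) (F : I -> 'rV[R]_n -> R) i :
 (forall k, smooth_on A (F k)) ->
 pd i (fun y => \sum_(k <- r | P k) F k y) x = \sum_(k <- r | P k) pd i (F k) x.
move=> H; elim: r => [|k r IH].
 rewrite big_nil -[RHS](pd_cst 0 i); apply/esym/pd_ext; first exact: smooth_on_cst.
 by move=> y _; rewrite big_nil.
have S s : smooth_on A (fun y => \sum_(j <- s | P j) F j y).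
 exact: smooth_on_sum => j _; exact: H.
rewrite big_cons; case Pk : P.
 rewrite -IH -pdD //; apply: pd_ext => // y _; by rewrite big_cons Pk.
by rewrite -IH; apply: pd_ext => // y _; rewrite big_cons Pk.
Qed.

Lemma pd_coord i j : pd i (fun y => y 0 j) x = (i == j)%:R.
have e : local_ext A (fun y => y 0 j) x setT (fun y => y 0 j).
 by split => //; [exact: openT|move=> k; exact: Ck_coord].
rewrite (pdE i hA Ax e) -derive_coord //.
by rewrite derive_id !mxE eq_sym.
Qed.

End rules.
End half_space_calculus.

Section composition.
Context {R : realType} {n m : nat}.
Implicit Types (A : set 'rV[R]_n) (B : set 'rV[R]_m) (phi : 'rV[R]_n -> 'rV[R]_m).

Lemma local_ext_map A phi x : smooth_map_on A phi -> A x ->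
 exists (V : set 'rV[R]_n) (Phi : 'rV[R]_n -> 'rV[R]_m), [/\ open V, V x, forall j, smooth V (fun y => Phi y 0 j) &
  forall y, A y -> V y -> Phi y = phi y].
move=> H Ax; have /choice [VF HVF] : forall j : 'I_m,
  exists VF : set 'rV[R]_n * ('rV[R]_n -> R), local_ext A (fun y => phi y 0 j) x VF.1 VF.2.
 by move=> j; have [V [F e]] := (smooth_onP _ _).1 (H j) x Ax; exists (V, F).
exists [set y | forall j, (VF j).1 y], (fun y => \row_j (VF j).2 y); split.
- rewrite openE => y Hy; apply: (@filter_forall _ _ (fun j z => (VF j).1 z) (nbhs y)) => j.
 by have [oV _ _ _] := HVF j; exact: open_nbhs_nbhs.
- by move=> j; have [] := HVF j.
- move=> j k; have [_ _ sF _] := HVF j.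
 rewrite (_ : (fun y => _) = (VF j).2); first by apply: Ck_sub (sF k) => y /(_ j).
 by apply/funext => y; rewrite mxE.
- by move=> y Ay Hy; apply/rowP => j; rewrite mxE; have [_ _ _ ->] := HVF j.
Qed.

Lemma open_preimage_map (V : set 'rV[R]_n) (W : set 'rV[R]_m) phi :
 open V -> open W -> (forall j, Ck 0 V (fun y => phi y 0 j)) ->
 open (V `&` phi @^-1` W).
move=> oV oW cphi; rewrite openE => y [Vy Wy].
apply: filterI; first exact: open_nbhs_nbhs.
have /nbhs_normP[d d0 dW] : nbhs (phi y) W by exact: open_nbhs_nbhs.
have : \forall z \near y, forall j, `|phi z 0 j - phi y 0 j| < d.
 apply: (@filter_forall _ _ (fun j z => `|phi z 0 j - phi y 0 j| < d) (nbhs y)) => j.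
 have /cvgrPdist_lt/(_ _ d0) := cphi j y Vy.
 by apply: filterS => z; rewrite distrC.
apply: filterS => z H; apply: dW; apply: mx_norm_lt => // j.
by rewrite !mxE.
Qed.

(** The extension of f is composed with an extension of phi, whose domain is shrunk to the preimage
    of W. *)
Lemma local_ext_comp A B phi (f : 'rV[R]_m -> R) x W F :
 smooth_map_on A phi -> (forall y, A y -> B (phi y)) -> A x ->
 local_ext B f (phi x) W F ->
 exists V Phi, [/\ local_ext A (f \o phi) x V (F \o Phi), Phi x = phi x &
  forall j, local_ext A (fun y => phi y 0 j) x V (fun y => Phi y 0 j)].
move=> H AB Ax [oW Wx sF E]; have [V [Phi [oV Vx sP EP]]] := local_ext_map H Ax.
have oV' : open (V `&` Phi @^-1` W) by apply: open_preimage_map => // j; exact: sP.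
have Vx' : (V `&` Phi @^-1` W) x by split => //=; rewrite EP.
exists (V `&` Phi @^-1` W), Phi; split => //; last first.
- move=> j; split => //; first by move=> k; apply: Ck_sub (sP j k) => y [].
 by move=> y Ay [Vy _]; rewrite EP.
- exact: EP.
split => //.
- move=> k; apply: (Ck_comp oV' oW _ _ (sF k)); first by move=> y [].
 by move=> j; apply: Ck_sub (sP j k) => y [].
- by move=> y Ay [Vy Wy] /=; rewrite E ?EP //; [exact: AB|rewrite -EP].
Qed.

Lemma smooth_on_comp A B phi (f : 'rV[R]_m -> R) :
 smooth_map_on A phi -> (forall y, A y -> B (phi y)) -> smooth_on B f ->
 smooth_on A (f \o phi).
move=> H AB /smooth_onP Hf; apply/smooth_onP => x Ax.
have [W [F e]] := Hf _ (AB x Ax).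
by have [V [Phi [e' _ _]]] := local_ext_comp H AB Ax e; exists V, (F \o Phi).
Qed.

Lemma pd_comp A B phi (f : 'rV[R]_m -> R) x i : hopen A -> hopen B ->
 smooth_map_on A phi -> (forall y, A y -> B (phi y)) -> A x -> smooth_on B f ->
 pd i (f \o phi) x = \sum_j pd i (fun y => phi y 0 j) x * pd j f (phi x).
move=> hA hB H AB Ax /smooth_onP Hf.
have [W [F e]] := Hf _ (AB x Ax).
have [V [Phi [e' Ephi ej]]] := local_ext_comp H AB Ax e.
rewrite (pdE i hA Ax e') derive_comp.
- apply: eq_bigr => j _; rewrite mulrC (pdE i hA Ax (ej j)) (pdE j hB (AB x Ax) e).
 by rewrite Ephi.
- by move=> j; have [_ Vx sP _] := ej j; have [d _] := sP 1%N; exact: d.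
- by rewrite Ephi; have [_ Wx sF _] := e; have [d _] := sF 1%N; exact: d.
Qed.

End composition.

(** * Matrix-valued functions and connections on trivial bundles *)

Section matrix_calculus.
Context {R : realType} {n : nat}.
Implicit Types (A : set 'rV[R]_n) (x y : 'rV[R]_n).

Definition pdmx p q (k : 'I_n) (F : 'rV[R]_n -> 'M[R]_(p, q)) (x : 'rV[R]_n) : 'M[R]_(p, q) :=
 \matrix_(a, b) pd k (fun y => F y a b) x.

Lemma pdmxE p q k (F : 'rV[R]_n -> 'M[R]_(p, q)) x a b :
 pdmx k F x a b = pd k (fun y => F y a b) x.
by rewrite mxE. Qed.

Definition smooth_mx p q A (F : 'rV[R]_n -> 'M[R]_(p, q)) :=
 forall a b, smooth_on A (fun y => F y a b).

Lemma smooth_mx_ext p q A (F G : 'rV[R]_n -> 'M[R]_(p, q)) :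
 (forall y, A y -> F y = G y) -> smooth_mx A F -> smooth_mx A G.
by move=> E H a b; apply: (smooth_on_ext _ (H a b)) => y Ay; rewrite E. Qed.

Lemma smooth_mx_cst p q A (C : 'M[R]_(p, q)) : smooth_mx A (fun=> C).
by move=> a b; exact: smooth_on_cst. Qed.

Lemma smooth_mxD p q A (F G : 'rV[R]_n -> 'M[R]_(p, q)) :
 smooth_mx A F -> smooth_mx A G -> smooth_mx A (fun y => F y + G y).
move=> HF HG a b; apply: (smooth_on_ext _ (smooth_onD (HF a b) (HG a b))) => y _.
by rewrite mxE.
Qed.

Lemma smooth_mxN p q A (F : 'rV[R]_n -> 'M[R]_(p, q)) :
 smooth_mx A F -> smooth_mx A (fun y => - F y).
by move=> HF a b; apply: (smooth_on_ext _ (smooth_onN (HF a b))) => y _; rewrite mxE.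
Qed.

Lemma smooth_mxB p q A (F G : 'rV[R]_n -> 'M[R]_(p, q)) :
 smooth_mx A F -> smooth_mx A G -> smooth_mx A (fun y => F y - G y).
by move=> HF HG; apply: smooth_mxD => //; exact: smooth_mxN. Qed.

Lemma smooth_mxM p q r A (F : 'rV[R]_n -> 'M[R]_(p, q)) (G : 'rV[R]_n -> 'M[R]_(q, r)) :
 smooth_mx A F -> smooth_mx A G -> smooth_mx A (fun y => F y *m G y).
move=> HF HG a b.
apply: smooth_on_ext.
 by move=> y _; rewrite mxE.
by apply: smooth_on_sum => j _; exact: smooth_onM.
Qed.

Lemma smooth_mxZ p q A (f : 'rV[R]_n -> R) (F : 'rV[R]_n -> 'M[R]_(p, q)) :
 smooth_on A f -> smooth_mx A F -> smooth_mx A (fun y => f y *: F y).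
by move=> Hf HF a b; apply: (smooth_on_ext _ (smooth_onM Hf (HF a b))) => y _; rewrite mxE.
Qed.

Lemma smooth_mx_tr p q A (F : 'rV[R]_n -> 'M[R]_(p, q)) :
 smooth_mx A F -> smooth_mx A (fun y => (F y)^T).
by move=> HF a b; apply: (smooth_on_ext _ (HF b a)) => y _; rewrite mxE.
Qed.

Lemma smooth_mx_pd p q A k (F : 'rV[R]_n -> 'M[R]_(p, q)) : hopen A ->
 smooth_mx A F -> smooth_mx A (pdmx k F).
move=> hA HF a b; apply: (smooth_on_ext _ (smooth_on_pd k hA (HF a b))) => y _.
by rewrite mxE.
Qed.

Lemma smooth_on_det p A (F : 'rV[R]_n -> 'M[R]_p) : smooth_mx A F ->
 smooth_on A (fun y => \det (F y)).
move=> HF; apply: smooth_on_sum => s _; apply: smooth_onM; first exact: smooth_on_cst.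
exact: smooth_on_prod => i _; exact: HF.
Qed.

Lemma smooth_mx_inv p A (F : 'rV[R]_n -> 'M[R]_p) :
 (forall y, A y -> F y \in unitmx) -> smooth_mx A F -> smooth_mx A (fun y => invmx (F y)).
move=> uF HF a b.
apply: smooth_on_ext.
 by move=> y Ay; rewrite /invmx (uF _ Ay) !mxE.
apply: smooth_onM.
 apply: smooth_onV; last exact: smooth_on_det.
 by move=> y /uF; rewrite unitmxE unitfE.
apply: smooth_onM; first exact: smooth_on_cst.
apply: smooth_on_det => c d; apply: (smooth_on_ext _ (HF (lift b c) (lift a d))) => y _.
by rewrite !mxE.
Qed.

Section rules.
Variables (A : set 'rV[R]_n) (x : 'rV[R]_n).
Hypotheses (hA : hopen A) (Ax : A x).

Lemma pdmx_ext p q (F G : 'rV[R]_n -> 'M[R]_(p, q)) k : smooth_mx A F ->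
 (forall y, A y -> F y = G y) -> pdmx k F x = pdmx k G x.
move=> HF E; apply/matrixP => a b; rewrite !mxE; apply: (pd_ext hA Ax) => // y Ay.
by rewrite E.
Qed.

Lemma pdmx_cst p q (C : 'M[R]_(p, q)) k : pdmx k (fun=> C) x = 0.
by apply/matrixP => a b; rewrite !mxE (pd_cst hA Ax). Qed.

Lemma pdmxD p q (F G : 'rV[R]_n -> 'M[R]_(p, q)) k : smooth_mx A F -> smooth_mx A G ->
 pdmx k (fun y => F y + G y) x = pdmx k F x + pdmx k G x.
move=> HF HG; apply/matrixP => a b; rewrite !mxE -(pdD hA Ax) //.
apply: (pd_ext hA Ax); first exact: smooth_mxD.
by move=> y _; rewrite mxE.
Qed.

Lemma pdmxN p q (F : 'rV[R]_n -> 'M[R]_(p, q)) k : smooth_mx A F ->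
 pdmx k (fun y => - F y) x = - pdmx k F x.
move=> HF; apply/matrixP => a b; rewrite !mxE -(pdN hA Ax) //.
apply: (pd_ext hA Ax); first exact: smooth_mxN.
by move=> y _; rewrite mxE.
Qed.

Lemma pdmxB p q (F G : 'rV[R]_n -> 'M[R]_(p, q)) k : smooth_mx A F -> smooth_mx A G ->
 pdmx k (fun y => F y - G y) x = pdmx k F x - pdmx k G x.
by move=> HF HG; rewrite pdmxD ?pdmxN //; exact: smooth_mxN. Qed.

Lemma pdmxM p q r (F : 'rV[R]_n -> 'M[R]_(p, q)) (G : 'rV[R]_n -> 'M[R]_(q, r)) k :
 smooth_mx A F -> smooth_mx A G ->
 pdmx k (fun y => F y *m G y) x = pdmx k F x *m G x + F x *m pdmx k G x.
move=> HF HG; apply/matrixP => a b; rewrite !mxE.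
transitivity (pd k (fun y => \sum_j F y a j * G y j b) x).
 apply: (pd_ext hA Ax); first exact: smooth_mxM.
 by move=> y _; rewrite mxE.
rewrite (pd_sum hA Ax); last by move=> j; exact: smooth_onM.
by rewrite -big_split; apply: eq_bigr => j _; rewrite (pdM hA Ax) // !mxE.
Qed.

Lemma pdmxZ p q (f : 'rV[R]_n -> R) (F : 'rV[R]_n -> 'M[R]_(p, q)) k :
 smooth_on A f -> smooth_mx A F ->
 pdmx k (fun y => f y *: F y) x = pd k f x *: F x + f x *: pdmx k F x.
move=> Hf HF; apply/matrixP => a b; rewrite !mxE -(pdM hA Ax) //.
apply: (pd_ext hA Ax); first exact: smooth_mxZ.
by move=> y _; rewrite mxE.
Qed.

Lemma pdmx_tr p q (F : 'rV[R]_n -> 'M[R]_(p, q)) k : smooth_mx A F ->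
 pdmx k (fun y => (F y)^T) x = (pdmx k F x)^T.
move=> HF; apply/matrixP => a b; rewrite !mxE.
by apply: (pd_ext hA Ax); [exact: smooth_mx_tr|move=> y _; rewrite mxE].
Qed.

Lemma pdmx_comm p q (F : 'rV[R]_n -> 'M[R]_(p, q)) j k : smooth_mx A F ->
 pdmx j (pdmx k F) x = pdmx k (pdmx j F) x.
move=> HF; apply/matrixP => a b; rewrite [LHS]pdmxE [RHS]pdmxE.
transitivity (pd j (pd k (fun y => F y a b)) x).
 by apply: (pd_ext hA Ax); [exact: smooth_mx_pd|move=> y _; rewrite mxE].
rewrite (pd_comm hA Ax) //.
by apply/esym/(pd_ext hA Ax); [exact: smooth_mx_pd|move=> y _; rewrite mxE].
Qed.

Lemma pdmx_inv p (F : 'rV[R]_n -> 'M[R]_p) k :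
 (forall y, A y -> F y \in unitmx) -> smooth_mx A F ->
 pdmx k (fun y => invmx (F y)) x = - (invmx (F x) *m pdmx k F x *m invmx (F x)).
move=> uF HF; have HI := smooth_mx_inv uF HF.
have E : pdmx k (fun y => F y *m invmx (F y)) x = 0.
 rewrite -(pdmx_cst (1%:M : 'M[R]_p) k); apply: pdmx_ext; first exact: smooth_mxM.
 by move=> y Ay; rewrite mulmxV // uF.
rewrite pdmxM // in E; move/(congr1 (mulmx (invmx (F x)))): E.
rewrite mulmxDr mulmx0 !mulmxA mulVmx ?uF // mul1mx => /eqP; rewrite addrC addr_eq0 => /eqP ->.
by [].
Qed.

End rules.

(* Curvature of the connection [d + A] on a trivial bundle whose sections are
  row vectors, the parallel sections being those with [d_k s = s *m A_k]. *)
Definition curv p (A : 'I_n -> 'rV[R]_n -> 'M[R]_p) (j k : 'I_n) (x : 'rV[R]_n) : 'M[R]_p :=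
 pdmx j (A k) x - pdmx k (A j) x + A j x *m A k x - A k x *m A j x.

End matrix_calculus.

Lemma addmxE (R : realType) p q (F G : 'M[R]_(p, q)) a b : (F + G) a b = F a b + G a b.
by rewrite mxE. Qed.
Lemma oppmxE (R : realType) p q (F : 'M[R]_(p, q)) a b : (- F) a b = - F a b.
by rewrite mxE. Qed.
Lemma scalemxE (R : realType) p q c (F : 'M[R]_(p, q)) a b : (c *: F) a b = c * F a b.
by rewrite mxE. Qed.
Lemma zeromxE (R : realType) p q a b : (0 : 'M[R]_(p, q)) a b = 0.
by rewrite mxE. Qed.

Lemma trmx_addE (R : realType) p q (F G : 'M[R]_(p, q)) : (F + G)^T = F^T + G^T.
exact: linearD. Qed.
Lemma trmx_oppE (R : realType) p q (F : 'M[R]_(p, q)) : (- F)^T = - F^T.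
exact: linearN. Qed.

Lemma mxtrace_addE (R : realType) p (F G : 'M[R]_p) : \tr (F + G) = \tr F + \tr G.
exact: mxtraceD. Qed.
Lemma mxtrace_oppE (R : realType) p (F : 'M[R]_p) : \tr (- F) = - \tr F.
exact: linearN. Qed.

Ltac mx_entries := let a := fresh "a" in let b := fresh "b" in
 apply/matrixP => a b; rewrite ?(addmxE, oppmxE, scalemxE, zeromxE).

Definition mulmx_rules (R : realType) :=
 (@mulmxDl R, @mulmxDr R, @mulmxBl R, @mulmxBr R, @mulmxN R, @mulNmx R, @mulmxA R).

Section connections.
Context {R : realType} {n p : nat}.
Variables (U : set 'rV[R]_n) (A : 'I_n -> 'rV[R]_n -> 'M[R]_p).
Hypotheses (hU : hopen U) (sA : forall k, smooth_mx U (A k)).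

Lemma smooth_mx_curv j k : smooth_mx U (curv A j k).
apply: smooth_mxB; last exact: smooth_mxM.
apply: smooth_mxD; last exact: smooth_mxM.
by apply: smooth_mxB; exact: smooth_mx_pd.
Qed.

Lemma curv_anti j k x : curv A k j x = - curv A j k x.
by mx_entries; ring. Qed.

(** Mixed second derivatives of a form P preserved by the connection commute. The terms [A^T P A]
    cancel, and what remains says that the curvature is skew for P. *)
Lemma curv_skew (P : 'rV[R]_n -> 'M[R]_p) j k x : U x -> smooth_mx U P ->
 (forall l y, U y -> pdmx l P y = (A l y)^T *m P y + P y *m A l y) ->
 P x *m curv A j k x + (curv A j k x)^T *m P x = 0.
move=> Ux sP dP.
have dd a b : pdmx a (pdmx b P) x =
  (pdmx a (A b) x)^T *m P x + (A b x)^T *m ((A a x)^T *m P x + P x *m A a x)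
  + (((A a x)^T *m P x + P x *m A a x) *m A b x + P x *m pdmx a (A b) x).
 have sAT := smooth_mx_tr (sA b).
 rewrite (pdmx_ext hU Ux (G := fun y => (A b y)^T *m P y + P y *m A b y)).
 - by rewrite (pdmxD hU Ux) ?(pdmxM hU Ux) ?(pdmx_tr hU Ux) ?dP //; exact: smooth_mxM.
 - exact: smooth_mx_pd.
 - by move=> y Uy; rewrite dP.
have := pdmx_comm hU Ux j k sP; rewrite !dd /curv.
move: (P x) (A j x) (A k x) (pdmx j (A k) x) pdmx => p0 a1 a2 c1 c2.
rewrite !(trmx_addE, trmx_oppE) !trmx_mul !mulmx_rules.
move: (a2^T *m a1^T *m p0) (a1^T *m a2^T *m p0) (a2^T *m p0 *m a1) (a1^T *m p0 *m a2)
 (p0 *m a1 *m a2) (p0 *m a2 *m a1) => r1 r2 r3 r4 r5 r6 E.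
mx_entries; have := congr1 (fun M : matrix _ _ _ => M a b) E; rewrite ?(addmxE, oppmxE).
lra.
Qed.

(** Integrability condition: equality of the mixed second derivatives of s. *)
Lemma parallel_curv q (s : 'rV[R]_n -> 'M[R]_(q, p)) j k x : U x -> smooth_mx U s ->
 (forall l y, U y -> pdmx l s y = s y *m A l y) -> s x *m curv A j k x = 0.
move=> Ux ss ds.
have dd a b : pdmx a (pdmx b s) x = s x *m A a x *m A b x + s x *m pdmx a (A b) x.
 rewrite (pdmx_ext hU Ux (G := fun y => s y *m A b y)).
 - by rewrite (pdmxM hU Ux) ?ds.
 - exact: smooth_mx_pd.
 - by move=> y Uy; rewrite ds.
have := pdmx_comm hU Ux j k ss; rewrite !dd !mulmx_rules.
move: (s x *m _) (s x *m _) (s x *m _ *m A k x) (s x *m _ *m A j x) => q1 q2 q3 q4 E.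
mx_entries; have := congr1 (fun M : matrix _ _ _ => M a b) E; rewrite ?(addmxE, oppmxE).
lra.
Qed.

(** Covariant derivative of the curvature as a field of endomorphisms acting on rows from the right,
    whence the order of the two products. *)
Definition dcurv i j k x := pdmx i (curv A j k) x + A i x *m curv A j k x - curv A j k x *m A i x.

Lemma bianchi i j k x : U x -> dcurv i j k x + dcurv j k i x + dcurv k i j x = 0.
move=> Ux; have spd a b : smooth_mx U (pdmx a (A b)) by exact: smooth_mx_pd.
have sM a b : smooth_mx U (fun y => A a y *m A b y) by exact: smooth_mxM.
have dc a b c : pdmx a (curv A b c) x = pdmx a (pdmx b (A c)) x - pdmx a (pdmx c (A b)) x
  + (pdmx a (A b) x *m A c x + A b x *m pdmx a (A c) x)
  - (pdmx a (A c) x *m A b x + A c x *m pdmx a (A b) x).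
 rewrite /curv (pdmxB hU Ux) //; last by apply: smooth_mxD => //; exact: smooth_mxB.
 by rewrite (pdmxD hU Ux) ?(pdmxB hU Ux) ?(pdmxM hU Ux) //; exact: smooth_mxB.
rewrite /dcurv !dc (pdmx_comm hU Ux j i) // (pdmx_comm hU Ux k i) // (pdmx_comm hU Ux k j) //.
rewrite /curv.
move: (pdmx i (A j) x) pdmx (pdmx j (A i) x) (pdmx j (A k) x)
 (pdmx k (A i) x) (pdmx k (A j) x) A A A => p1 p2 p3 p4 p5 p6 a1 a2 a3.
rewrite !mulmx_rules.
mx_entries; ring.
Qed.

End connections.

Lemma dot_mxC (R : realType) p (a b : 'rV[R]_p) : (a *m b^T) 0 0 = (b *m a^T) 0 0.
by rewrite -{1}[a *m b^T]trmxK trmx_mul trmxK mxE. Qed.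

Definition posdef (R : realType) p (P : 'M[R]_p) := forall v : 'rV[R]_p, v != 0 -> 0 < (v *m P *m v^T) 0 0.

Lemma posdef_unit (R : realType) p (P : 'M[R]_p) : posdef P -> P \in unitmx.
move=> H; rewrite unitmxE unitfE; apply/negP => /det0P[v v0 vP].
by have := H v v0; rewrite vP mul0mx mxE ltxx.
Qed.

Record local_metric (R : realType) n (A : set 'rV[R]_n) (g : 'rV[R]_n -> 'M[R]_n) : Prop :=
 LocalMetric {
  lm_open : hopen A;
  lm_smooth : smooth_mx A g;
  lm_sym : forall x, A x -> (g x)^T = g x;
  lm_pos : forall x, A x -> posdef (g x) }.

(** * Riemannian metrics in a chart and the Bochner formula for static potentials *)

Section riemannian.
Context {R : realType} {n : nat}.
Variables (A : set 'rV[R]_n) (g : 'rV[R]_n -> 'M[R]_n).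
Hypothesis lm : local_metric A g.
Let hA : hopen A := lm_open lm.
Let sg : smooth_mx A g := lm_smooth lm.
Let symg : forall x, A x -> (g x)^T = g x := lm_sym lm.
Let posg : forall x, A x -> posdef (g x) := lm_pos lm.

Lemma g_unit x : A x -> g x \in unitmx. Proof. by move=> /posg/posdef_unit. Qed.

Lemma g_ginv x : A x -> g x *m ginv g x = 1%:M.
by move=> /g_unit /mulmxV. Qed.

Lemma ginv_g x : A x -> ginv g x *m g x = 1%:M.
by move=> /g_unit /mulVmx. Qed.

Lemma ginv_sym x : A x -> (ginv g x)^T = ginv g x.
by move=> Ax; rewrite trmx_inv symg. Qed.

Lemma smooth_ginv : smooth_mx A (ginv g).
by apply: smooth_mx_inv => // y /g_unit. Qed.

(** Connection matrices on covectors written as rows: the covariant derivative along k of a row a is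
    [d_k a - a *m gam k]. *)
Definition gam (k : 'I_n) (x : 'rV[R]_n) : 'M[R]_n := \matrix_(l, i) christoffel g l k i x.

(** Christoffel symbols of the first kind. *)
Definition koszul (k : 'I_n) (x : 'rV[R]_n) : 'M[R]_n := \matrix_(m, i)
 (2^-1 * (pd k (fun y => g y i m) x + pd i (fun y => g y k m) x - pd m (fun y => g y k i) x)).

Lemma gamE k x : gam k x = ginv g x *m koszul k x.
apply/matrixP => l i; rewrite !mxE /christoffel mulr_sumr; apply: eq_bigr => m _.
by rewrite mxE mulrCA.
Qed.

Lemma smooth_gam k : smooth_mx A (gam k).
apply: (smooth_mx_ext (fun y _ => esym (gamE k y))).
apply: smooth_mxM; first exact: smooth_ginv.
move=> m i; apply: smooth_on_ext.
 by move=> y _; rewrite mxE.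
apply: smooth_onM; first exact: smooth_on_cst.
by apply: smooth_onB; [apply: smooth_onD|]; exact: smooth_on_pd.
Qed.

Lemma pd_gsym k i j x : A x -> pd k (fun y => g y i j) x = pd k (fun y => g y j i) x.
by move=> Ax; apply: (pd_ext hA Ax) => // y Ay; rewrite -{1}symg // mxE. Qed.

Lemma gam_sym k i l x : A x -> gam k x l i = gam i x l k.
move=> Ax; rewrite !gamE !mxE; apply: eq_bigr => m _; rewrite !mxE.
by rewrite (pd_gsym m k i Ax) (addrC (pd k _ x)).
Qed.

Lemma metric_compat k x : A x -> pdmx k g x = (gam k x)^T *m g x + g x *m gam k x.
move=> Ax; have -> : (gam k x)^T *m g x = (g x *m gam k x)^T by rewrite trmx_mul symg.
rewrite gamE mulmxA g_ginv // mul1mx; apply/matrixP => i j; rewrite !mxE.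
rewrite (pd_gsym k j i Ax); set a := pd k _ x; set b := pd i _ x; set c := pd j _ x.
lra.
Qed.

Lemma pd_ginv k x : A x ->
 pdmx k (ginv g) x = - (ginv g x *m (gam k x)^T) - gam k x *m ginv g x.
move=> Ax; rewrite (pdmx_inv hA Ax) // => [|y /g_unit] //.
rewrite metric_compat // mulmxDr mulmxDl !mulmxA ginv_g // mul1mx.
by rewrite -mulmxA g_ginv // mulmx1 opprD.
Qed.

Lemma ricciE i j x : A x -> ricci g i j x = \sum_k curv gam k j x k i.
move=> Ax; rewrite /ricci -big_split /=; apply: eq_bigr => k _.
rewrite /curv !addmxE !oppmxE !pdmxE.
have E a b c d : pd a (christoffel g b c d) x = pd a (fun y => gam c y b d) x.
 apply: (@pd_ext _ _ A _ hA Ax); last by move=> y _; rewrite mxE.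
 by apply: (smooth_on_ext _ (smooth_gam c b d)) => y _; rewrite mxE.
have E' a b c d : pd a (christoffel g b c d) x = pd a (fun y => gam d y b c) x.
 rewrite E; apply: (pd_ext hA Ax); first exact: smooth_gam.
 by move=> y Ay; exact: gam_sym.
rewrite E' E' -[RHS]addrA; congr (_ + _).
rewrite !mxE -sumrB; apply: eq_bigr => l _.
by rewrite (gam_sym j i l Ax) (gam_sym k i l Ax) !mxE.
Qed.

Definition drow (f : 'rV[R]_n -> R) (x : 'rV[R]_n) : 'rV[R]_n := \row_i pd i f x.

Definition hessmx (f : 'rV[R]_n -> R) (x : 'rV[R]_n) : 'M[R]_n :=
 \matrix_(k, i) hessian g f k i x.

Definition gradup (f : 'rV[R]_n -> R) (x : 'rV[R]_n) : 'rV[R]_n := drow f x *m ginv g x.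

Definition gradsq (f : 'rV[R]_n -> R) (x : 'rV[R]_n) : R := (gradup f x *m (drow f x)^T) 0 0.

Lemma smooth_drow f : smooth_on A f -> smooth_mx A (drow f).
move=> sf a b; apply: (smooth_on_ext _ (smooth_on_pd b hA sf)) => y _; by rewrite mxE.
Qed.

Lemma smooth_gradup f : smooth_on A f -> smooth_mx A (gradup f).
by move=> sf; apply: smooth_mxM; [exact: smooth_drow|exact: smooth_ginv]. Qed.

Lemma smooth_gradsq f : smooth_on A f -> smooth_on A (gradsq f).
move=> sf; apply: smooth_mxM; first exact: smooth_gradup.
by apply: smooth_mx_tr; exact: smooth_drow.
Qed.

Lemma hess_row f k x : smooth_on A f -> A x ->
 row k (hessmx f x) = pdmx k (drow f) x - drow f x *m gam k x.
move=> sf Ax; apply/rowP => i; rewrite !mxE.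
congr (_ - _).
 by apply: (pd_ext hA Ax); [exact: smooth_on_pd|move=> y _; rewrite mxE].
by apply: eq_bigr => l _; rewrite !mxE mulrC.
Qed.

Lemma hess_sym f x : smooth_on A f -> A x -> (hessmx f x)^T = hessmx f x.
move=> sf Ax; apply/matrixP => i k; rewrite !mxE /hessian (pd_comm hA Ax) //.
by congr (_ - _); apply: eq_bigr => l _; have := gam_sym k i l Ax; rewrite !mxE => ->.
Qed.

Lemma smooth_hess f : smooth_on A f -> smooth_mx A (hessmx f).
move=> sf k i.
apply: (smooth_on_ext (f := fun y => (pdmx k (drow f) y - drow f y *m gam k y) 0 i)).
 by move=> y Ay; rewrite -hess_row // mxE.
apply: smooth_mxB; first by apply: smooth_mx_pd => //; exact: smooth_drow.
by apply: smooth_mxM; [exact: smooth_drow|exact: smooth_gam].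
Qed.

Lemma pd_gradup f k x : smooth_on A f -> A x ->
 pdmx k (gradup f) x = row k (hessmx f x) *m ginv g x - gradup f x *m (gam k x)^T.
move=> sf Ax; rewrite (pdmxM hA Ax); [|exact: smooth_drow|exact: smooth_ginv].
rewrite hess_row // pd_ginv // /gradup.
move: pdmx (drow f x) (ginv g x) (gam k x) => a b c d.
rewrite !mulmx_rules; move: a b (b *m d *m c) => q1 q2 q3.
by mx_entries; ring.
Qed.

Lemma gradup_g f x : A x -> gradup f x *m g x = drow f x.
by move=> Ax; rewrite -mulmxA ginv_g // mulmx1. Qed.

Lemma pd_gradsq f k x : smooth_on A f -> A x ->
 pd k (gradsq f) x = 2 * (row k (hessmx f x) *m (gradup f x)^T) 0 0.
move=> sf Ax; have sd := smooth_drow sf; have su := smooth_gradup sf.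
have := pdmxE k (fun y => gradup f y *m (drow f y)^T) x 0 0; rewrite /gradsq => <-.
rewrite (pdmxM hA Ax) //; last exact: smooth_mx_tr.
rewrite (pdmx_tr hA Ax) // pd_gradup //.
have -> : pdmx k (drow f) x = row k (hessmx f x) + drow f x *m gam k x.
 by rewrite hess_row // subrK.
rewrite trmx_addE trmx_mul.
have E : (gradup f x *m (row k (hessmx f x))^T) 0 0 = (row k (hessmx f x) *m (gradup f x)^T) 0 0.
 exact: dot_mxC.
rewrite !mulmx_rules !addmxE oppmxE.
have -> : row k (hessmx f x) *m ginv g x *m (drow f x)^T = row k (hessmx f x) *m (gradup f x)^T.
 by rewrite trmx_mul ginv_sym // mulmxA.
nra.
Qed.

Lemma ginv_symE x j k : A x -> ginv g x j k = ginv g x k j.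
by move=> Ax; rewrite -{1}(ginv_sym Ax) mxE. Qed.

(** Covariant derivative of a covariant 2-tensor. *)
Definition covd (T : 'rV[R]_n -> 'M[R]_n) (j : 'I_n) (x : 'rV[R]_n) : 'M[R]_n :=
 pdmx j T x - (gam j x)^T *m T x - T x *m gam j x.

Lemma row_pdmx p q (F : 'rV[R]_n -> 'M[R]_(p, q)) i j x :
 row i (pdmx j F x) = pdmx j (fun y => row i (F y)) x.
apply/rowP => k; rewrite !mxE; congr pd; apply/funext => y; by rewrite mxE.
Qed.

Lemma smooth_row p q (F : 'rV[R]_n -> 'M[R]_(p, q)) i : smooth_mx A F ->
 smooth_mx A (fun y => row i (F y)).
by move=> sF a b; apply: (smooth_on_ext _ (sF i b)) => y _; rewrite mxE. Qed.

(** Ricci identity: in D_j D_i df - D_i D_j df the third partial derivatives cancel, and so do the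
    terms in which [gam] acts on the outer index, by symmetry of [gam]. *)
Lemma hess_codazzi f i j x : smooth_on A f -> A x ->
 row i (covd (hessmx f) j x) - row j (covd (hessmx f) i x) = - (drow f x *m curv gam j i x).
move=> sf Ax; have sd := smooth_drow sf.
have dd a b : row a (pdmx b (hessmx f) x) = pdmx b (pdmx a (drow f)) x
  - (row b (hessmx f x) + drow f x *m gam b x) *m gam a x - drow f x *m pdmx b (gam a) x.
 rewrite row_pdmx.
 have sh := smooth_hess sf.
 rewrite (pdmx_ext hA Ax (G := fun y => pdmx a (drow f) y - drow f y *m gam a y)); first last.
 - by move=> y Ay; rewrite hess_row.
 - exact: smooth_row.
 have sg' := smooth_gam a.
 rewrite (pdmxB hA Ax) ?(pdmxM hA Ax) //; first last.
 - exact: smooth_mxM.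
 - exact: smooth_mx_pd.
 by rewrite hess_row // subrK opprD addrA.
have rs a b : row a (pdmx b (hessmx f) x - (gam b x)^T *m hessmx f x - hessmx f x *m gam b x)
  = row a (pdmx b (hessmx f) x) - row a (gam b x)^T *m hessmx f x - row a (hessmx f x) *m gam b x.
 by rewrite !linearB /= !row_mul.
rewrite !rs !dd (pdmx_comm hA Ax i j) // /curv.
have -> : row i (gam j x)^T = row j (gam i x)^T.
 by apply/rowP => l; have := gam_sym j i l Ax; rewrite !mxE.
move: pdmx (pdmx j _ x) (pdmx i _ x) (gam j x) (gam i x) drow => q1 q2 q3 gj gi d.
rewrite !mulmx_rules.
by mx_entries; ring.
Qed.

Lemma pd_trace p (F : 'rV[R]_n -> 'M[R]_p) i x : A x -> smooth_mx A F ->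
 pd i (fun y => \tr (F y)) x = \tr (pdmx i F x).
move=> Ax sF; rewrite (pd_sum hA Ax) => [|k] //.
by apply: eq_bigr => k _; rewrite mxE.
Qed.

Lemma laplacianE f x : smooth_on A f -> A x -> laplacian g f x = \tr (ginv g x *m hessmx f x).
move=> sf Ax; rewrite -{1}(hess_sym sf Ax); apply: eq_bigr => i _.
by rewrite mxE; apply: eq_bigr => j _; rewrite !mxE.
Qed.

(** The metric is parallel, so tracing commutes with covariant differentiation. *)
Lemma trace_covd T i x : smooth_mx A T -> A x ->
 pd i (fun y => \tr (ginv g y *m T y)) x = \tr (ginv g x *m covd T i x).
move=> sT Ax; have si := smooth_ginv.
rewrite pd_trace //; last exact: smooth_mxM.
rewrite (pdmxM hA Ax) // pd_ginv // !mulmx_rules.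
rewrite !(mxtrace_addE, mxtrace_oppE).
have -> : \tr (ginv g x *m T x *m gam i x) = \tr (gam i x *m ginv g x *m T x).
 by rewrite mxtrace_mulC mulmxA.
move: (\tr _) (\tr _) (\tr _) => a b c; ring.
Qed.

Lemma ginv_curv j i x : A x ->
 curv gam j i x *m ginv g x = - (ginv g x *m (curv gam j i x)^T).
move=> Ax; have := curv_skew hA smooth_gam j i Ax sg (fun l y Ay => metric_compat l Ay).
move/(congr1 (fun M => ginv g x *m M *m ginv g x)).
rewrite mulmxDr mulmxDl !mulmxA ginv_g // mul1mx mulmx0 mul0mx -(mulmxA _ (g x)) g_ginv //.
by rewrite mulmx1 => /eqP; rewrite addr_eq0 => /eqP.
Qed.

(** Trace of the Ricci identity: div D^2 f = d(Lap f) + Ric(Df). Skewness of the curvature moves the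
    inverse metric past it, so that the contraction becomes the one of [ricciE]. *)
Lemma div_hess f i x : smooth_on A f -> A x ->
 \sum_j \sum_k ginv g x j k * covd (hessmx f) j x i k
 = pd i (laplacian g f) x + \sum_k gradup f x 0 k * ricci g k i x.
move=> sf Ax.
have cod j k : covd (hessmx f) j x i k = covd (hessmx f) i x j k - (drow f x *m curv gam j i x) 0 k.
 have := congr1 (fun M : matrix _ _ _ => M 0 k) (hess_codazzi i j sf Ax).
 rewrite addmxE => E; apply/eqP; apply/eqP.
 by move: E; rewrite !mxE => E; lra.
under eq_bigr do under eq_bigr do rewrite cod mulrBr.
under eq_bigr do rewrite sumrB.
rewrite sumrB; congr (_ + _).
 transitivity (\tr (ginv g x *m covd (hessmx f) i x)).
  rewrite exchange_big; apply: eq_bigr => k _; rewrite mxE; apply: eq_bigr => j _.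
  by rewrite -[in LHS](ginv_sym Ax) mxE.
 rewrite -trace_covd //; last exact: smooth_hess.
 apply: (pd_ext hA Ax); last by move=> y Ay; rewrite laplacianE.
 apply: smooth_on_sum => k _; apply: smooth_mxM; first exact: smooth_ginv.
 exact: smooth_hess.
transitivity (- \sum_j (drow f x *m curv gam j i x *m ginv g x) 0 j).
 congr (- _); apply: eq_bigr => j _; rewrite [RHS]mxE; apply: eq_bigr => k _.
 by rewrite mulrC ginv_symE.
transitivity (\sum_j \sum_k gradup f x 0 k * curv gam j i x j k).
 rewrite -sumrN; apply: eq_bigr => j _; rewrite -mulmxA ginv_curv // mulmxN oppmxE opprK.
 by rewrite mulmxA mxE; apply: eq_bigr => k _; rewrite [_^T _ _]mxE.
rewrite exchange_big; apply: eq_bigr => k _.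
by rewrite -mulr_sumr ricciE.
Qed.

(** For a static potential this is the trace-free part of the Hessian, because Lap u = - n u. It
    vanishes for the height functions of the unit sphere. *)
Definition trfree (u : 'rV[R]_n -> R) (x : 'rV[R]_n) : 'M[R]_n := hessmx u x + u x *: g x.

Definition energy (u : 'rV[R]_n -> R) (x : 'rV[R]_n) : R := gradsq u x + u x ^+ 2.

Lemma smooth_trfree u : smooth_on A u -> smooth_mx A (trfree u).
by move=> su; apply: smooth_mxD; [exact: smooth_hess|exact: smooth_mxZ]. Qed.

Lemma smooth_energy u : smooth_on A u -> smooth_on A (energy u).
by move=> su; apply: smooth_onD; [exact: smooth_gradsq|exact: smooth_onM]. Qed.

Lemma trfree_sym u x : smooth_on A u -> A x -> (trfree u x)^T = trfree u x.
by move=> su Ax; rewrite trmx_addE linearZ /= hess_sym // symg. Qed.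

Lemma drow_energy u x : smooth_on A u -> A x ->
 drow (energy u) x = 2 *: (gradup u x *m trfree u x).
move=> su Ax; apply/rowP => k; rewrite scalemxE mxE.
rewrite (pdD hA Ax); [|exact: smooth_gradsq|exact: smooth_onM].
rewrite pd_gradsq // (pdM hA Ax) //.
have -> : (row k (hessmx u x) *m (gradup u x)^T) 0 0 = (gradup u x *m hessmx u x) 0 k.
 rewrite dot_mxC !mxE; apply: eq_bigr => j _; congr _.
 by rewrite -[in RHS](hess_sym su Ax) !mxE.
rewrite mulmxDr -scalemxAr gradup_g // addmxE scalemxE.
by rewrite [drow u x 0 k]mxE; ring.
Qed.

Lemma covd_trfree u j x : smooth_on A u -> A x ->
 covd (trfree u) j x = covd (hessmx u) j x + pd j u x *: g x.
move=> su Ax; rewrite /covd.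
rewrite (pdmxD hA Ax); [|exact: smooth_hess|exact: smooth_mxZ].
rewrite (pdmxZ hA Ax) // metric_compat // mulmxDr mulmxDl -scalemxAr -scalemxAl.
move: g g ((gam _ _)^T *m g x) hessmx ((gam _ _)^T *m hessmx _ _) pdmx.
by move=> a b c d e h; mx_entries; ring.
Qed.

Section static.
Variable u : 'rV[R]_n -> R.
Hypotheses (su : smooth_on A u)
 (Eric : forall x i j, A x -> u x * ricci g i j x = hessian g u i j x + n%:R * u x * g x i j)
 (Elap : forall x, A x -> laplacian g u x = - n%:R * u x).

Lemma trace_trfree x : A x -> \tr (ginv g x *m trfree u x) = 0.
move=> Ax; rewrite mulmxDr -scalemxAr ginv_g // linearD linearZ /=.
by rewrite -laplacianE // Elap // mxtrace1; ring.
Qed.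

(** In [div_hess] the Laplacian contributes - n du and the summand u g contributes du. After
    multiplication by u the static equation replaces u Ric, the multiples of n u du cancel, and the
    remaining u du completes D^2 u(Du) to T(Du), with T = [trfree]. *)
Lemma div_trfree i x : A x -> u x * (\sum_j \sum_k ginv g x j k * covd (trfree u) j x i k)
  = (gradup u x *m trfree u x) 0 i.
move=> Ax.
have -> : \sum_j \sum_k ginv g x j k * covd (trfree u) j x i k =
  \sum_j \sum_k ginv g x j k * covd (hessmx u) j x i k + pd i u x.
 have -> : pd i u x = \sum_j \sum_k ginv g x j k * (pd j u x * g x i k).
  transitivity ((gradup u x *m g x) 0 i); first by rewrite gradup_g // mxE.
  rewrite mxE exchange_big; apply: eq_bigr => k _; rewrite mxE mulr_suml.
  apply: eq_bigr => j _; rewrite mxE -[in LHS](symg Ax) mxE.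
  lra.
 rewrite -big_split; apply: eq_bigr => j _; rewrite -big_split; apply: eq_bigr => k _.
 by rewrite covd_trfree // addmxE scalemxE mulrDr.
rewrite div_hess //.
have -> : pd i (laplacian g u) x = - n%:R * pd i u x.
 rewrite -(pdZ hA Ax) //; apply/esym/(pd_ext hA Ax); first by apply: smooth_onM => //; exact: smooth_on_cst.
 by move=> y Ay; rewrite Elap.
have E : u x * (\sum_k gradup u x 0 k * ricci g k i x) =
  (gradup u x *m hessmx u x) 0 i + n%:R * u x * pd i u x.
 have -> : pd i u x = (gradup u x *m g x) 0 i by rewrite gradup_g // mxE.
 rewrite !mxE !mulr_sumr -big_split; apply: eq_bigr => k _ /=.
 rewrite mulrCA Eric // [hessmx _ _ _ _]mxE; ring.
rewrite !mulrDr E mulmxDr -scalemxAr gradup_g // addmxE scalemxE [drow _ _ _ _]mxE.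
ring.
Qed.

Lemma hess_energy x j : A x -> row j (hessmx (energy u) x) =
 2 *: (row j (hessmx u x) *m ginv g x *m trfree u x + gradup u x *m covd (trfree u) j x).
move=> Ax; have sT := smooth_trfree su; have sE := smooth_gradup su.
rewrite hess_row //; last exact: smooth_energy.
rewrite (pdmx_ext hA Ax (G := fun y => 2 *: (gradup u y *m trfree u y))); first last.
- by move=> y Ay; rewrite drow_energy.
- by apply: smooth_drow; exact: smooth_energy.
rewrite (pdmxZ hA Ax); [|exact: smooth_on_cst|exact: smooth_mxM].
rewrite (pd_cst hA Ax) (pdmxM hA Ax) // pd_gradup // drow_energy //.
rewrite -scalemxAl; congr _; rewrite /covd.
rewrite !mulmx_rules.
by mx_entries; ring.
Qed.

(** Since dw = 2 T(Du), Lap w = 2 <D^2 u, T> + 2 (div T)(Du). The first pairing is |T|^2 because T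
    is trace-free, and the second term is <Du, dw> / u by [div_trfree]. *)
Lemma bochner x : A x -> u x != 0 ->
 laplacian g (energy u) x = (u x)^-1 * (gradup u x *m (drow (energy u) x)^T) 0 0
  + 2 * \tr (ginv g x *m trfree u x *m (ginv g x *m trfree u x)).
move=> Ax ux0.
rewrite laplacianE //; last exact: smooth_energy.
have E1 : \tr (ginv g x *m hessmx (energy u) x) =
  \sum_j (ginv g x *m (row j (hessmx (energy u) x))^T) j 0.
 rewrite mxtrace_mulC; apply: eq_bigr => j _; rewrite mxE [RHS]mxE.
 by apply: eq_bigr => k _; rewrite -[in LHS](ginv_sym Ax) !mxE mulrC.
have E2 j : (ginv g x *m (row j (hessmx (energy u) x))^T) j 0 =
  2 * (hessmx u x *m ginv g x *m trfree u x *m ginv g x) j j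
  + 2 * \sum_k ginv g x j k * (gradup u x *m covd (trfree u) j x) 0 k.
 rewrite hess_energy //.
 have -> b : (ginv g x *m (2 *: b)^T) j 0 = 2 * \sum_k ginv g x j k * b 0 k.
  by rewrite mxE mulr_sumr; apply: eq_bigr => k _; rewrite !mxE; ring.
 rewrite -mulrDr; congr (_ * _); rewrite [in RHS]mxE -big_split; apply: eq_bigr => k _.
 rewrite addmxE mulrDr; congr (_ + _); rewrite mulrC (ginv_symE j k Ax).
 by congr (_ * _); rewrite -!row_mul [LHS]mxE.
rewrite E1; under eq_bigr do rewrite E2.
rewrite big_split /= -!mulr_sumr.
have -> : \sum_j \sum_k ginv g x j k * (gradup u x *m covd (trfree u) j x) 0 k =
  (u x)^-1 * (gradup u x *m trfree u x *m (gradup u x)^T) 0 0.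
 transitivity (\sum_i gradup u x 0 i * (\sum_j \sum_k ginv g x j k * covd (trfree u) j x i k)).
  under eq_bigr do under eq_bigr do rewrite mxE mulr_sumr.
  under [RHS]eq_bigr do rewrite mulr_sumr.
  under [RHS]eq_bigr do under eq_bigr do rewrite mulr_sumr.
  rewrite [RHS]exchange_big; apply: eq_bigr => j _; rewrite [RHS]exchange_big.
  by apply: eq_bigr => k _; apply: eq_bigr => i _; rewrite mulrCA.
 rewrite [X in _ = _ * X]mxE mulr_sumr; apply: eq_bigr => i _.
 by rewrite -div_trfree // [_^T _ _]mxE; field.
rewrite drow_energy // linearZ -scalemxAr scalemxE.
rewrite [X in _ = _ * (_ * X) + _]dot_mxC.
have -> : \sum_i (hessmx u x *m ginv g x *m trfree u x *m ginv g x) i i =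
  \tr (ginv g x *m trfree u x *m (ginv g x *m trfree u x)).
 have -> : hessmx u x = trfree u x - u x *: g x by rewrite addrK.
 rewrite -[LHS]/(\tr _) !mulmxBl -!scalemxAl g_ginv // mul1mx linearB linearZ /=.
 rewrite [\tr (trfree u x *m ginv g x)]mxtrace_mulC trace_trfree // mulr0 subr0.
 by rewrite mxtrace_mulC !mulmxA.
nra.
Qed.

End static.
End riemannian.

(** * Quadratic forms *)

Section quadratic_forms.
Context {R : realType}.

Definition qf n (M : 'M[R]_n) (v : 'rV[R]_n) : R := (v *m M *m v^T) 0 0.

Lemma mulmx_block_row m n (a : 'M[R]_m) (b : 'M[R]_(m, n)) c d (x : 'rV[R]_m) (y : 'rV[R]_n) :
 qf (block_mx a b c d) (row_mx x y) = qf a x + (x *m b *m y^T) 0 0 + (y *m c *m x^T) 0 0 + qf d y.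
rewrite /qf mul_row_block tr_row_mx mul_row_col !mulmxDl !addmxE; lra.
Qed.

(** Induction on n through the Schur complement [D - a^-1 *: (b^T *m b)]. *)
Lemma cholesky n (P : 'M[R]_n) : P^T = P -> posdef P ->
 exists S : 'M[R]_n, S \in unitmx /\ P = S^T *m S.
elim: n P => [|n IH] P sP pP.
 by exists 1%:M; rewrite unitmx1; split => //; apply/matrixP => -[].
rewrite -[n.+1]/(1 + n)%N in P sP pP *.
pose a := P 0 0.
have EP := submxK P.
set b := ursubmx P in EP; set D := drsubmx P in EP.
have aE : ulsubmx P = a%:M by rewrite [LHS]mx11_scalar; congr (_ %:M); rewrite !mxE; congr (P _ _); apply/val_inj.
have cE : dlsubmx P = b^T by rewrite -{1}sP trmx_ursub.
have sD : D^T = D by rewrite trmx_drsub sP.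
rewrite aE cE in EP.
have a0 : 0 < a.
 have /pP : row_mx 1%:M (0 : 'rV[R]_n) != 0.
  apply/negP => /eqP/(congr1 lsubmx); rewrite row_mxKl => /matrixP/(_ 0 0).
  by rewrite !mxE => /eqP; rewrite oner_eq0.
 change (0 < qf P (row_mx 1%:M 0) -> 0 < a).
 rewrite -EP mulmx_block_row /qf !(mul0mx, trmx0, mulmx0, trmx1, mulmx1, mul1mx).
 by rewrite !(zeromxE, addr0) mxE.
have [] := IH (D - a^-1 *: (b^T *m b)).
- by rewrite trmx_addE trmx_oppE linearZ /= trmx_mul trmxK sD.
(* This x minimises the form on the vectors (x, y), and the minimum is the Schur complement at y. *)
- move=> y y0; pose x : 'rV[R]_1 := - (a^-1 *: (y *m b^T)).
 have /pP : row_mx x y != 0.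
  by apply: contraNN y0 => /eqP/(congr1 rsubmx); rewrite row_mxKr linear0 => ->.
 change (0 < qf P (row_mx x y) -> 0 < qf (D - a^-1 *: (b^T *m b)) y).
 rewrite -EP mulmx_block_row; congr (0 < _).
 pose c := (y *m b^T) 0 0.
 have Ec : y *m b^T = c%:M by rewrite [LHS]mx11_scalar.
 have Ec' : b *m y^T = c%:M by rewrite -[LHS]trmxK trmx_mul trmxK Ec tr_scalar_mx.
 have xE : x = (- (a^-1 * c))%:M by rewrite /x Ec scale_scalar_mx -raddfN.
 rewrite /qf mulmxBr mulmxBl -scalemxAr -scalemxAl -!mulmxA Ec' !mulmxA Ec xE.
 rewrite !(tr_scalar_mx, mul_scalar_mx, scale_scalar_mx).
 rewrite !mxE; field; exact: lt0r_neq0.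
move=> S [uS ES].
pose sa := Num.sqrt a; have sa0 : sa != 0 by rewrite gt_eqF // sqrtr_gt0.
have sasa : sa * sa = a by rewrite -expr2 sqr_sqrtr // ltW.
exists (block_mx sa%:M (sa^-1 *: b) 0 S); split.
 by rewrite unitmxE det_ublock unitrM -!unitmxE uS andbT unitmxE det_scalar1 unitfE.
have bT : (sa^-1 *: b)^T = sa^-1 *: b^T by rewrite linearZ.
rewrite -EP tr_block_mx mulmx_block tr_scalar_mx bT trmx0 !mul0mx !mulmx0 !addr0.
rewrite -ES -!scalemxAl -!scalemxAr; congr block_mx.
- by rewrite -scalar_mxM sasa.
- by rewrite mul_scalar_mx scalerA mulVf // scale1r.
- by rewrite mul_mx_scalar scalerA mulVf // scale1r.
- by rewrite scalerA -invfM sasa addrC subrK.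
Qed.

Lemma qf_sum n (K M : 'M[R]_n) : \tr (K^T *m K *m M) = \sum_a qf M (row a K).
rewrite -mulmxA mxtrace_mulC; apply: eq_bigr => a _.
rewrite /qf -row_mul !mxE; apply: eq_bigr => j _.
by rewrite !mxE.
Qed.

Lemma trace_sqr n (N : 'M[R]_n) : N^T = N -> \tr (N *m N) = \sum_i \sum_j N i j ^+ 2.
move=> sN; apply: eq_bigr => i _; rewrite mxE; apply: eq_bigr => j _.
by rewrite -{2}sN mxE.
Qed.

Lemma trace_sqr_ge0 n (N : 'M[R]_n) : N^T = N -> 0 <= \tr (N *m N).
by move=> sN; rewrite trace_sqr //; do 2![apply: sumr_ge0 => ? _]; exact: sqr_ge0. Qed.

Lemma trace_sqr_eq0 n (N : 'M[R]_n) : N^T = N -> \tr (N *m N) <= 0 -> N = 0.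
move=> sN; rewrite trace_sqr // => H; apply/matrixP => i j; rewrite mxE.
have /eqP : \sum_i \sum_j N i j ^+ 2 = 0.
 by apply/eqP; rewrite eq_le H; do 2![apply: sumr_ge0 => ? _]; exact: sqr_ge0.
rewrite psumr_eq0 => [/allP /(_ i (mem_index_enum _)) |k _]; last by apply: sumr_ge0 => ? _; exact: sqr_ge0.
rewrite psumr_eq0 => [/allP /(_ j (mem_index_enum _)) |k _]; last exact: sqr_ge0.
nra.
Qed.

(** The rows of K form an orthonormal basis of the tangent space, as K g K^T = 1. *)
Lemma ginv_frame n (A : set 'rV[R]_n) g x : local_metric A g -> A x ->
 exists K : 'M[R]_n, K \in unitmx /\ ginv g x = K^T *m K.
move=> lm Ax; have [S [uS ES]] := cholesky (lm_sym lm Ax) (lm_pos lm Ax).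
exists (invmx S)^T; split; first by rewrite unitmx_tr unitmx_inv.
have uST : S^T \in unitmx by rewrite unitmx_tr.
rewrite trmxK trmx_inv /ginv ES.
apply: (can_inj (mulmxK (_ : S^T *m S \in unitmx))); first by rewrite unitmx_mul uST.
by rewrite mulVmx ?unitmx_mul ?uST // -mulmxA mulKmx // mulVmx.
Qed.

Lemma trace_le0 n (A : set 'rV[R]_n) g x M : local_metric A g -> A x ->
 (forall v, qf M v <= 0) -> \tr (ginv g x *m M) <= 0.
move=> lm Ax H; have [K [_ ->]] := ginv_frame lm Ax.
by rewrite qf_sum; apply: sumr_le0 => a _; exact: H.
Qed.

Lemma trace_normsq n (A : set 'rV[R]_n) g x T : local_metric A g -> A x -> T^T = T ->
 0 <= \tr (ginv g x *m T *m (ginv g x *m T)) /\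
 (\tr (ginv g x *m T *m (ginv g x *m T)) <= 0 -> T = 0).
move=> lm Ax sT; have [K [uK ->]] := ginv_frame lm Ax.
have E : \tr (K^T *m K *m T *m (K^T *m K *m T)) = \tr (K *m T *m K^T *m (K *m T *m K^T)).
 by rewrite -!mulmxA mxtrace_mulC !mulmxA.
have sN : (K *m T *m K^T)^T = K *m T *m K^T by rewrite !trmx_mul trmxK sT mulmxA.
rewrite E; split; first exact: trace_sqr_ge0.
move=> /(trace_sqr_eq0 sN) E0; have uKT : K^T \in unitmx by rewrite unitmx_tr.
by rewrite -[T](mulKmx uK) -[K *m T](mulmxK uKT) E0 mul0mx mulmx0.
Qed.

Lemma gradsq_ge0 n (A : set 'rV[R]_n) g x f : local_metric A g -> A x -> 0 <= gradsq g f x.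
move=> lm Ax; rewrite /gradsq /gradup; have [K [_ ->]] := ginv_frame lm Ax.
rewrite mulmxA -mulmxA -{2}[K]trmxK -trmx_mul mxE; apply: sumr_ge0 => i _.
by rewrite [_^T _ _]mxE sqr_ge0.
Qed.

Lemma gradsq_eq0 n (A : set 'rV[R]_n) g x f : local_metric A g -> A x -> gradsq g f x <= 0 ->
 drow f x = 0.
move=> lm Ax; rewrite /gradsq /gradup; have [K [uK ->]] := ginv_frame lm Ax.
rewrite mulmxA -mulmxA -{2}[K]trmxK -trmx_mul mxE => H.
have uKT : K^T \in unitmx by rewrite unitmx_tr.
rewrite -[drow f x](mulmxK uKT); move: (drow f x *m K^T) H => v H.
suff -> : v = 0 by rewrite mul0mx.
apply/rowP => i; rewrite [RHS]mxE.
have /eqP : \sum_j v 0 j * v^T j 0 = 0.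
 by apply/eqP; rewrite eq_le H; apply: sumr_ge0 => j _; rewrite [_^T _ _]mxE sqr_ge0.
rewrite psumr_eq0 => [/allP /(_ i (mem_index_enum _)) |k _]; rewrite [_^T _ _]mxE ?sqr_ge0 //.
nra.
Qed.

(** For w = v M the form at v + t w is 2 t |w|^2 + t^2 q(w), positive for small t > 0 unless w =
    0. *)
Lemma qf_le0_kernel n (M : 'M[R]_n) v : M^T = M -> (forall v, qf M v <= 0) -> qf M v = 0 ->
 v *m M = 0.
move=> sM H qv; apply/eqP; apply: contraT => nz.
pose w := v *m M; pose c := (w *m w^T) 0 0.
have c0 : 0 < c.
 have : 0 <= c by rewrite /c mxE; apply: sumr_ge0 => i _; rewrite [_^T _ _]mxE sqr_ge0.
 rewrite le_eqVlt => /orP[/eqP c0|//]; move: nz => /eqP[]; apply/rowP => i; rewrite [RHS]mxE.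
 move/esym/eqP: c0; rewrite /c mxE psumr_eq0 => [/allP /(_ i (mem_index_enum _)) |k _]; rewrite [_^T _ _]mxE ?sqr_ge0 //.
 nra.
have q t : qf M (v + t *: w) = 2 * t * c + t ^+ 2 * qf M w.
 rewrite /qf linearD linearZ !mulmx_rules -!scalemxAr -!scalemxAl.
 rewrite !addmxE !scalemxE -[(v *m M *m v^T) 0 0]/(qf M v) -/c.
 have -> : (w *m M *m v^T) 0 0 = c by rewrite -mulmxA -[M]sM -trmx_mul.
 nra.
(* As q(w) <= 0, the denominator d = 1 - q(w) is at least 1, and for t = c/d the value is t^2 (1 +
   d) > 0. *)
have := H (v + (c / (1 - qf M w)) *: w); rewrite q => Hle.
have d0 : 0 < 1 - qf M w by have := H w; lra.
exfalso; move: Hle; apply/negP; rewrite -ltNge.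
set d := 1 - qf M w in d0 *; have -> : qf M w = 1 - d by rewrite /d; ring.
have -> : 2 * (c / d) * c + (c / d) ^+ 2 * (1 - d) = (c / d) ^+ 2 * (1 + d).
 by field; exact: lt0r_neq0.
by rewrite mulr_gt0 ?exprn_gt0 ?divr_gt0 // addr_gt0.
Qed.

End quadratic_forms.

(** * Necessary conditions at interior extrema *)

Section interior_points.
Context {R : realType} {n : nat}.
Implicit Types (A : set 'rV[R]_n) (f : 'rV[R]_n -> R) (x v : 'rV[R]_n).

Lemma interior_ext A f x : nbhs x A -> smooth_on A f ->
 exists V, [/\ V `<=` A & local_ext A f x V f].
move=> nA /smooth_onP H; have [V [F [oV Vx sF E]]] := H x (nbhs_singleton nA).
have oV' : open (V `&` A^°) by apply: openI => //; exact: open_interior.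
exists (V `&` A^°); split; first by move=> y [_ /interior_subset].
split => //.
move=> k; apply: (Ck_ext (f := F) oV').
 by move=> y [Vy /interior_subset Ay]; exact: E.
exact: Ck_sub (sF k) => y [].
Qed.

Definition dd v f (y : 'rV[R]_n) : R := \sum_i v 0 i * pd i f y.

Lemma smooth_dd A v f : hopen A -> smooth_on A f -> smooth_on A (dd v f).
move=> hA sf; apply: smooth_on_sum => i _; apply: smooth_onM; first exact: smooth_on_cst.
exact: smooth_on_pd.
Qed.

Lemma is_derive_pd A f x v (t : R) : hopen A -> nbhs (x + t *: v) A -> smooth_on A f ->
 is_derive t 1 (fun s : R => f (x + s *: v)) (dd v f (x + t *: v)).
move=> hA nA sf; have [V [VA e]] := interior_ext nA sf; have [oV Vx sV _] := e.
have df : differentiable f (x + t *: v) by have [H _] := sV 1%N; exact: H.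
have := is_derive_line df; rewrite derive_sumE //.
rewrite (_ : \sum_i _ = dd v f (x + t *: v)) //; apply: eq_bigr => i _.
by rewrite (pdE i hA (VA _ Vx) e).
Qed.

Definition d2 f x : 'M[R]_n := \matrix_(i, j) pd i (pd j f) x.

Lemma dd_dd A v f x : hopen A -> A x -> smooth_on A f -> dd v (dd v f) x = qf (d2 f x) v.
move=> hA Ax sf; rewrite /qf -mulmxA mxE; apply: eq_bigr => i _; congr (_ * _).
rewrite mxE (pd_sum hA Ax) => [|j]; last first.
 by apply: smooth_onM; [exact: smooth_on_cst|exact: smooth_on_pd].
apply: eq_bigr => j _; rewrite (pdZ hA Ax); last exact: smooth_on_pd.
by rewrite !mxE mulrC.
Qed.

Lemma line_near x v (P : 'rV[R]_n -> Prop) : (\forall y \near x, P y) ->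
 exists2 d : R, 0 < d & forall t : R, `|t| < d -> P (x + t *: v).
move=> /nbhs_normP[d d0 H]; exists (d / (`|v| + 1)).
 by rewrite divr_gt0.
move=> t td; apply: H; rewrite addrC addKr normrZ.
apply: (@le_lt_trans _ _ (`|t| * (`|v| + 1))); first by rewrite ler_wpM2l // lerDl.
by rewrite -ltr_pdivlMr.
Qed.

(** Near 0 the quotient phi'(t)/t is positive, so phi decreases before 0 and increases after it. *)
Lemma second_derivative_pos (phi dphi : R -> R) (d c : R) : 0 < d ->
 (forall t : R, `|t| < d -> is_derive t 1 phi (dphi t)) ->
 dphi 0 = 0 -> is_derive (0 : R) 1 dphi c -> 0 < c ->
 exists2 e : R, 0 < e & forall t : R, 0 < `|t| < e -> phi 0 < phi t.
move=> d0 D dphi0 [dd0 dE] c0.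
have H : (fun h : R => h^-1 *: (dphi (h + 0) - dphi 0)) @ (0 : R)^' --> c.
 move: dd0; rewrite /derivable => dd0; rewrite -dE.
 rewrite (_ : (fun h : R => _) = (fun h : R => h^-1 *: ((dphi \o shift 0) (h *: 1) - dphi 0))) //.
 by apply/funext => h; rewrite [h *: 1]mulr1.
have /nbhs_ballP[e e0 He] : \forall h \near (0 : R)^', 0 < h^-1 *: (dphi (h + 0) - dphi 0).
 exact: (cvgr_gt c) => //; exact: H.
have pos h : 0 < `|h| < e -> 0 < h^-1 * dphi h.
 move=> /andP[h0 he]; have := He h; rewrite /ball /= sub0r normrN => /(_ he).
 by rewrite -normr_gt0 addr0 dphi0 subr0; exact.
exists (Num.min d e); first by rewrite lt_min d0.
move=> t; rewrite lt_min => /andP[t0 /andP[td te]].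
have cts a b : `|a| < d -> `|b| < d -> {within `[a, b], continuous phi}.
 move=> ad bd; apply: derivable_within_continuous => z zI.
 have zd : `|z| < d.
  move: zI ad bd; rewrite in_itv /= !ltr_norml => /andP[az zb] /andP[a1 a2] /andP[b1 b2].
  lra.
 by have [] := D z zd.
have d0' : `|0 : R| < d by rewrite normr0.
have := t0; rewrite normr_gt0 => tn0.
move: tn0; rewrite neq_lt => /orP[tn|tp].
- have tdl : - d < t by move: td; rewrite ltr_norml => /andP[].
 have tel : - e < t by move: te; rewrite ltr_norml => /andP[].
 have [|s] := @MVT R phi dphi t 0 tn _ (cts _ _ td d0').
  move=> z; rewrite in_itv /= => /andP[z1 z2]; apply: D.
  by rewrite ltr_norml; apply/andP; split; lra.
 rewrite in_itv /= => /andP[s1 s2] E.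
 have : 0 < s^-1 * dphi s.
  by apply: pos; rewrite ltr0_norm //; apply/andP; split; lra.
 rewrite nmulr_rgt0 ?invr_lt0 // => ds.
 nra.
- have tdr : t < d by move: td; rewrite ltr_norml => /andP[].
 have ter : t < e by move: te; rewrite ltr_norml => /andP[].
 have [|s] := @MVT R phi dphi 0 t tp _ (cts _ _ d0' td).
  move=> z; rewrite in_itv /= => /andP[z1 z2]; apply: D.
  by rewrite ltr_norml; apply/andP; split; lra.
 rewrite in_itv /= => /andP[s1 s2] E.
 have : 0 < s^-1 * dphi s.
  by apply: pos; rewrite gtr0_norm //; apply/andP; split; lra.
 rewrite pmulr_rgt0 ?invr_gt0 // => ds.
 nra.
Qed.

Section local_max.
Variables (A : set 'rV[R]_n) (f : 'rV[R]_n -> R) (x : 'rV[R]_n).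
Hypotheses (hA : hopen A) (nA : nbhs x A) (sf : smooth_on A f).

Let Ax : A x := nbhs_singleton nA.

Lemma line_data v : exists2 d : R, 0 < d & forall t : R, `|t| < d -> nbhs (x + t *: v) A.
by have := @line_near x v _ (nbhs_interior nA).
Qed.

Lemma local_max_dd v : (\forall y \near x, f y <= f x) -> dd v f x = 0.
move=> mx; have [d1 d10 H1] := line_data v; have [d2 d20 H2] := line_near v mx.
pose d := Num.min d1 d2; have d0 : 0 < d by rewrite lt_min d10.
have near_d t : t \in `]-d, d[ -> `|t| < d1 /\ `|t| < d2.
 move=> tI; have : `|t| < d by rewrite ltr_norml.
 by rewrite lt_min => /andP[].
have D0 := is_derive_pd (t := 0) (v := v) hA ltac:(rewrite scale0r addr0; exact: nA) sf.
have : is_derive (0 : R) 1 (fun s : R => f (x + s *: v)) 0.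
 apply: (@derive1_at_max _ _ (- d) d).
 - by nra.
 - by move=> t /near_d[t1 _]; have [] := is_derive_pd hA (H1 t t1) sf.
 - by rewrite in_itv /= oppr_lt0 d0.
 - by move=> t /near_d[_ t2]; rewrite scale0r addr0; exact: H2.
by move=> [_ E]; move: D0 => [_]; rewrite scale0r addr0 => <-.
Qed.

Lemma local_max_drow : (\forall y \near x, f y <= f x) -> drow f x = 0.
move=> mx; apply/rowP => i; rewrite !mxE -[RHS](local_max_dd (basis i) mx) /dd.
rewrite (bigD1 i) //= big1 ?addr0 => [|j ji]; rewrite !mxE /=; first by rewrite eqxx mul1r.
by rewrite (negbTE ji) mul0r.
Qed.

Lemma d2_pos_increase v : dd v f x = 0 -> 0 < qf (d2 f x) v ->
 exists2 e : R, 0 < e & forall t : R, 0 < `|t| < e -> f x < f (x + t *: v).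
move=> d0 q0; have [d d0' H] := line_data v.
have nA0 : nbhs (x + 0 *: v) A by rewrite scale0r addr0.
have := @second_derivative_pos (fun t => f (x + t *: v)) (fun t => dd v f (x + t *: v)) d (qf (d2 f x) v) d0'.
rewrite scale0r addr0; apply => //.
 by move=> t td; apply: is_derive_pd (H t td) sf.
have := is_derive_pd (v := v) hA nA0 (smooth_dd v hA sf).
by rewrite scale0r addr0 (dd_dd v hA Ax sf).
Qed.

Lemma local_max_d2 v : (\forall y \near x, f y <= f x) -> qf (d2 f x) v <= 0.
move=> mx; rewrite leNgt; apply/negP => /(d2_pos_increase (local_max_dd v mx))[e e0 H].
have [d d0 Hd] := line_near v mx.
pose t := Num.min e d / 2; have m0 : 0 < Num.min e d by rewrite lt_min e0.
have t0 : 0 < t by rewrite divr_gt0.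
have : `|t| < Num.min e d by rewrite gtr0_norm // ltr_pdivrMr // ltr_pMr // ltr1n.
rewrite lt_min => /andP[te td].
have := H t; rewrite te gtr0_norm // t0 => /(_ isT).
by rewrite ltNge Hd.
Qed.

Lemma hess_crit g : drow f x = 0 -> hessmx g f x = d2 f x.
move=> d0; apply/matrixP => i j; rewrite !mxE /hessian big1 ?subr0 // => k _.
by move/rowP/(_ k): d0; rewrite !mxE => ->; rewrite mulr0.
Qed.

End local_max.

End interior_points.

(** * Elliptic operators and the strong maximum principle *)

Section maximum_principle.
Context {R : realType} {n : nat}.
Variables (A : set 'rV[R]_n) (g : 'rV[R]_n -> 'M[R]_n) (b : 'rV[R]_n -> 'rV[R]_n).
Hypotheses (lm : local_metric A g) (sb : smooth_mx A b).
Let hA := lm_open lm.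

Definition ellop (f : 'rV[R]_n -> R) (x : 'rV[R]_n) : R :=
 \tr (ginv g x *m hessmx g f x) - (b x *m (drow f x)^T) 0 0.

Lemma smooth_ellop f : smooth_on A f -> smooth_on A (ellop f).
move=> sf; apply: smooth_onB.
 apply: smooth_on_sum => k _; apply: smooth_mxM; first exact: smooth_ginv.
 exact: smooth_hess.
by apply: smooth_mxM => //; apply: smooth_mx_tr; exact: (smooth_drow lm).
Qed.

Lemma drowD f h x : A x -> smooth_on A f -> smooth_on A h ->
 drow (fun y => f y + h y) x = drow f x + drow h x.
by move=> Ax sf sh; apply/rowP => i; rewrite !mxE (pdD hA Ax). Qed.

Lemma drowM f h x : A x -> smooth_on A f -> smooth_on A h ->
 drow (fun y => f y * h y) x = h x *: drow f x + f x *: drow h x.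
by move=> Ax sf sh; apply/rowP => i; rewrite !mxE (pdM hA Ax) // mulrC. Qed.

Lemma drow_cst c x : A x -> drow (fun=> c : R) x = 0.
by move=> Ax; apply/rowP => i; rewrite !mxE (pd_cst hA Ax). Qed.

Lemma hessD f h x : A x -> smooth_on A f -> smooth_on A h ->
 hessmx g (fun y => f y + h y) x = hessmx g f x + hessmx g h x.
move=> Ax sf sh; apply/matrixP => i j; rewrite !mxE /hessian.
rewrite (pd_ext hA Ax (g := fun y => pd j f y + pd j h y)); first last.
- by move=> y Ay; rewrite (pdD hA Ay).
- by apply: smooth_on_pd => //; exact: smooth_onD.
rewrite (pdD hA Ax); [|exact: smooth_on_pd|exact: smooth_on_pd].
under eq_bigr do rewrite (pdD hA Ax) // mulrDr.
by rewrite big_split opprD addrACA.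
Qed.

Lemma hessM f h x : A x -> smooth_on A f -> smooth_on A h ->
 hessmx g (fun y => f y * h y) x = h x *: hessmx g f x + f x *: hessmx g h x
  + (drow f x)^T *m drow h x + (drow h x)^T *m drow f x.
move=> Ax sf sh; apply/matrixP => i j; rewrite !mxE /hessian !big_ord1 !mxE.
rewrite (pd_ext hA Ax (g := fun y => pd j f y * h y + f y * pd j h y)); first last.
- by move=> y Ay; rewrite (pdM hA Ay).
- by apply: smooth_on_pd => //; exact: smooth_onM.
have sfj := smooth_on_pd j hA sf; have shj := smooth_on_pd j hA sh.
rewrite (pdD hA Ax) ?(pdM hA Ax) //; [|exact: smooth_onM|exact: smooth_onM].
have -> : \sum_(k < n) christoffel g k i j x * pd k (fun y => f y * h y) x =
  h x * (\sum_(k < n) christoffel g k i j x * pd k f x) +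
  f x * (\sum_k christoffel g k i j x * pd k h x).
 rewrite !mulr_sumr -big_split; apply: eq_bigr => k _ /=; rewrite (pdM hA Ax) //; ring.
ring.
Qed.

Lemma ellopD f h x : A x -> smooth_on A f -> smooth_on A h ->
 ellop (fun y => f y + h y) x = ellop f x + ellop h x.
move=> Ax sf sh; rewrite /ellop hessD // drowD // mulmxDr trmx_addE mulmxDr addmxE; ring.
Qed.

Lemma ellopM f h x : A x -> smooth_on A f -> smooth_on A h ->
 ellop (fun y => f y * h y) x = h x * ellop f x + f x * ellop h x
  + 2 * (gradup g f x *m (drow h x)^T) 0 0.
move=> Ax sf sh; rewrite /ellop hessM // drowM // !mulmxDr !mxtrace_addE trmx_addE !linearZ /=.
rewrite !mulmxDr -!scalemxAr !addmxE !scalemxE.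
have E (p q : 'rV[R]_n) : \tr (ginv g x *m (p^T *m q)) = (q *m ginv g x *m p^T) 0 0.
 by rewrite mulmxA mxtrace_mulC /mxtrace big_ord1 mulmxA.
rewrite !E.
have -> : (drow h x *m ginv g x *m (drow f x)^T) 0 0 = (gradup g f x *m (drow h x)^T) 0 0.
 rewrite dot_mxC trmx_mul (ginv_sym lm) // mulmxA //.
move: (\tr _) (\tr _) b b => q1 q2 q3 q4; ring.
Qed.

Lemma ellop_cst c x : A x -> ellop (fun=> c) x = 0.
move=> Ax; rewrite /ellop drow_cst // trmx0 mulmx0 mxE subr0.
rewrite (_ : hessmx g (fun=> c) x = 0) ?mulmx0 ?mxtrace0 //.
apply/matrixP => i j; rewrite !mxE /hessian big1 => [|k _]; last by rewrite (pd_cst hA Ax) mulr0.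
rewrite subr0 (pd_ext hA Ax (g := fun=> 0)) ?(pd_cst hA Ax) //; last by move=> y Ay; rewrite (pd_cst hA Ay).
by apply: smooth_on_pd => //; exact: smooth_on_cst.
Qed.

Lemma ellopZ c f x : A x -> smooth_on A f -> ellop (fun y => c * f y) x = c * ellop f x.
move=> Ax sf; rewrite ellopM ?ellop_cst //; last exact: smooth_on_cst.
by rewrite /gradup drow_cst // !mul0mx mxE; ring.
Qed.

Lemma ellop_local_max f x : nbhs x A -> smooth_on A f ->
 (\forall y \near x, f y <= f x) -> ellop f x <= 0.
move=> nA sf mx; have Ax := nbhs_singleton nA.
have d0 := local_max_drow hA nA sf mx.
rewrite /ellop d0 trmx0 mulmx0 mxE subr0 (hess_crit g d0).
by apply: trace_le0 lm Ax _ => v; exact: (local_max_d2 hA nA sf).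
Qed.

End maximum_principle.

Section rV_topology.
Context {R : realType} {n : nat}.
Implicit Types (x z : 'rV[R]_n) (d : R).

Lemma continuous_normB z : continuous (fun x => `|x - z|).
suff H x : {for x, continuous (fun y : 'rV[R]_n => `|y - z|)} by [].
apply: continuous_comp; last exact: norm_continuous.
apply: continuousB; [exact: cvg_id|exact: cst_continuous].
Qed.

Lemma closed_le_fun (T : topologicalType) (f : T -> R) d : continuous f -> closed [set x | f x <= d].
by move=> cf; apply: (@preimage_closed _ _ f [set r | r <= d]) => [x _|]. Qed.

Lemma closed_ge_fun (T : topologicalType) (f : T -> R) d : continuous f -> closed [set x | d <= f x].
by move=> cf; apply: (@preimage_closed _ _ f [set r | d <= r]) => [x _|]. Qed.

Lemma compact_normball z d : compact [set x | `|x - z| <= d].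
apply: bounded_closed_compact; last by apply: closed_le_fun; exact: continuous_normB.
exists (d + `|z|); split; first exact: num_real.
move=> r rd x xB; apply: le_trans (ltW rd); rewrite -[x](subrK z).
by apply: (le_trans (ler_normD _ _)); rewrite lerD2r.
Qed.

Definition sqdist (c x : 'rV[R]_n) : R := \sum_i (x 0 i - c 0 i) ^+ 2.

Lemma continuous_sqdist c : continuous (sqdist c).
move=> x; apply: continuous_sum => i _.
have ci : {for x, continuous (fun y : 'rV[R]_n => y 0 i - c 0 i)}.
 by apply: continuousB; [exact: coord_continuous|exact: cst_continuous].
exact: continuousM.
Qed.

Lemma sqdist_eq0 c x : sqdist c x = 0 -> x = c.
move=> /eqP; rewrite psumr_eq0 => [/allP H|i _]; last exact: sqr_ge0.
apply/rowP => i; apply/eqP; rewrite -subr_eq0 -sqrf_eq0.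
by have := H i (mem_index_enum _).
Qed.

Lemma sqdist_ge0 c x : 0 <= sqdist c x.
by apply: sumr_ge0 => i _; exact: sqr_ge0. Qed.

Lemma open_norm_ball (c : 'rV[R]_n) (d : R) : open [set x : 'rV[R]_n | `|x - c| < d].
have -> : [set x : 'rV[R]_n | `|x - c| < d] = ball c d; last exact: ball_open.
by apply/seteqP; split => x; rewrite -ball_normE /= distrC.
Qed.

End rV_topology.

Section hopf.
Context {R : realType} {n : nat}.
Variables (A : set 'rV[R]_n) (g : 'rV[R]_n -> 'M[R]_n) (b : 'rV[R]_n -> 'rV[R]_n).
Hypotheses (lm : local_metric A g) (sb : smooth_mx A b).
Let hA := lm_open lm.

Lemma smooth_sqdist c : smooth_on A (sqdist c).
apply: smooth_on_sum => i _.
have s1 : smooth_on A (fun x => x 0 i - c 0 i).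
 by apply: smooth_onB; [exact: smooth_on_coord|exact: smooth_on_cst].
exact: smooth_onM.
Qed.

Lemma drow_sqdist c x : A x -> drow (sqdist c) x = 2 *: (x - c).
move=> Ax; have s1 i : smooth_on A (fun x => x 0 i - c 0 i).
 by apply: smooth_onB; [exact: smooth_on_coord|exact: smooth_on_cst].
apply/rowP => j; rewrite !mxE (pd_sum hA Ax) => [|i]; last exact: smooth_onM.
rewrite (bigD1 j) //= big1 ?addr0 => [|i ij]; rewrite (pdM hA Ax) // (pdB hA Ax) ?(pd_cst hA Ax) ?(pd_coord hA Ax);
 try exact: smooth_on_coord; try exact: smooth_on_cst.
 by rewrite eqxx subr0 mul1r mulr1 mulr_natl.
by rewrite eq_sym (negbTE ij) subr0 mul0r mulr0 addr0.
Qed.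

(* The barrier [- psi + K psi^2], with [psi] the squared distance to the centre
  minus its value at [z], replaces the usual exponential one. *)
Lemma hopf_touch (w : 'rV[R]_n -> R) (m : R) (c z : 'rV[R]_n) (e : R) :
 nbhs z A -> smooth_on A w -> (forall x, A x -> 0 <= ellop g b w x) ->
 (forall x, A x -> w x <= m) -> w z = m -> 0 < e -> 0 < sqdist c z ->
 (forall x, `|x - z| < e -> sqdist c x <= sqdist c z -> x <> z -> w x < m) -> False.
move=> nA sw Lw wm wz e0 cz H; have Az := nbhs_singleton nA.
pose rho := sqdist c z; pose psi x := sqdist c x - rho.
have spsi : smooth_on A psi by apply: smooth_onB; [exact: smooth_sqdist|exact: smooth_on_cst].
have dpsi : drow psi z = 2 *: (z - c).
 rewrite -drow_sqdist //; apply/rowP => i; rewrite !mxE (pdB hA Az) ?(pd_cst hA Az) ?subr0 //.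
  exact: smooth_sqdist.
 exact: smooth_on_cst.
have G0 : 0 < gradsq g psi z.
 rewrite lt_neqAle (gradsq_ge0 _ lm Az) andbT eq_sym; apply/negP => /eqP G0.
 have /eqP := gradsq_eq0 lm Az (eq_rect _ (fun r => r <= 0) (lexx 0) _ (esym G0)); rewrite dpsi; rewrite scaler_eq0 pnatr_eq0 /=.
 rewrite subr_eq0 => /eqP zc; move: cz; rewrite zc /sqdist big1 ?ltxx // => i _.
 by rewrite subrr expr0n.
(* At z, where psi = 0, L(psi^2) = 2 |D psi|^2, so L h = - L psi + 2 (|L psi| + 1) > 0. *)
pose K := (`|ellop g b psi z| + 1) / gradsq g psi z.
have K0 : 0 < K by rewrite divr_gt0 // ltr_wpDl.
pose h x := - psi x + K * (psi x * psi x).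
have spp : smooth_on A (fun x => psi x * psi x) by exact: smooth_onM.
have sN : smooth_on A (fun x => - psi x) by exact: smooth_onN.
have sK : smooth_on A (fun x => K * (psi x * psi x)) by apply: smooth_onM => //; exact: smooth_on_cst.
have sh : smooth_on A h by exact: smooth_onD.
have psiz : psi z = 0 by rewrite /psi subrr.
have Lh : 0 < ellop g b h z.
 rewrite /h (ellopD _ lm Az sN sK) (ellopZ _ lm K Az spp) (ellopM _ lm Az spsi spsi) psiz.
 have -> : ellop g b (fun x => - psi x) z = - ellop g b psi z.
  rewrite -[RHS]mulN1r -(ellopZ _ lm (-1) Az spsi) (_ : (fun x => - psi x) = (fun x => -1 * psi x)) //.
  by apply/funext => x; rewrite mulN1r.
 rewrite !mul0r !add0r -/(gradsq g psi z) mulrCA /K divfK ?lt0r_neq0 //.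
 by have := ler_norm (ellop g b psi z); have := normr_ge0 (ellop g b psi z); lra.
have [V [VA [oV Vz _ _]]] := interior_ext nA sh.
have [d1 d10 H1] : exists2 d : R, 0 < d & forall x, `|x - z| < d -> V x.
 by apply/nbhs_normP; exact: open_nbhs_nbhs.
have [d2 d20 H2] := smooth_on_cont (smooth_ellop lm sb sh) Az Lh.
have Ki0 : 0 < K^-1 by rewrite invr_gt0.
have [d3 d30 H3] := smooth_on_cont spsi Az Ki0.
(* Within distance d of z, L h stays positive and |psi| < 1/K, so that h = - psi (1 - K psi) is
   negative where psi > 0. *)
pose d := Num.min (Num.min d1 d2) (Num.min d3 e) / 2.
have m0 : 0 < Num.min (Num.min d1 d2) (Num.min d3 e) by rewrite !lt_min d10 d20 d30.
have d0 : 0 < d by rewrite divr_gt0.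
have dlt x : `|x - z| <= d -> [/\ `|x - z| < d1, `|x - z| < d2, `|x - z| < d3 & `|x - z| < e].
 move=> xd; have : `|x - z| < Num.min (Num.min d1 d2) (Num.min d3 e).
  by apply: le_lt_trans xd _; rewrite /d ltr_pdivrMr // ltr_pMr // ltr1n.
 by rewrite !lt_min => /andP[/andP[-> ->] /andP[-> ->]].
have cont (f : 'rV[R]_n -> R) (B : set 'rV[R]_n) : smooth_on A f -> B `<=` V -> {within B, continuous f}.
 move=> sf BV; apply: continuous_in_subspaceT => x; rewrite inE => Bx.
 have nx : nbhs x A by apply: filterS VA _; apply: open_nbhs_nbhs; split => //; exact: BV.
 by have [V' [_ [_ Vx sV' _]]] := interior_ext nx sf; exact: (sV' 0%N x Vx).
pose Bd := [set x : 'rV[R]_n | `|x - z| <= d].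
have kBd : compact Bd by exact: compact_normball.
have BV x : Bd x -> V x by move=> /dlt[? _ _ _]; exact: H1.
(* The part of the small sphere that lies in the closed Euclidean ball touching at z: a compact set
   on which w < m. *)
pose S := Bd `&` [set x | `|x - z| = d /\ psi x <= 0].
have kS : compact S.
 apply: (subclosed_compact _ kBd) => //; last by move=> x [].
 rewrite (_ : S = [set x | `|x - z| <= d] `&` [set x | d <= `|x - z|] `&` [set x | sqdist c x <= rho]).
  apply: closedI; last by apply: closed_le_fun; exact: continuous_sqdist.
  by apply: closedI; [apply: closed_le_fun|apply: closed_ge_fun]; exact: continuous_normB.
 apply/seteqP; split => x /=.
  by move=> [Bx [xd]]; rewrite subr_le0 => p0; rewrite xd lexx.
 move=> [[Bx dx] p0]; split; first exact: Bx.
 by split; [apply/eqP; rewrite eq_le Bx dx|rewrite /psi subr_le0].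
have wS x : S x -> w x < m.
 move=> [Bx [xd px]]; have [_ _ _ xe] := dlt x Bx; apply: H => //; first by rewrite -subr_le0.
 by move=> E; move: xd; rewrite E subrr normr0 => dz; move: d0; rewrite -dz ltxx.
have [eta eta0 Heta] : exists2 eta : R, 0 < eta & forall x, S x -> w x <= m - eta.
 case: (pselect (S !=set0)) => [S0|nS]; last first.
  by exists 1 => // x Sx; exfalso; apply: nS; exists x.
 have [x xS Hx] := compact_EVT_max S0 kS (cont w S sw (fun y Sy => BV y Sy.1)).
 rewrite inE in xS; exists (m - w x); first by rewrite subr_gt0; exact: wS.
 by move=> y Sy; rewrite opprB addrC subrK; apply: Hx; rewrite inE.
have Bd0 : Bd !=set0 by exists z; rewrite /Bd /= subrr normr0 ltW.
have [xh xhB Hh] := compact_EVT_max Bd0 kBd (cont h Bd sh BV).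
pose C := `|h xh| + 1; have C0 : 0 < C by rewrite ltr_wpDl.
pose ep := eta / C; have ep0 : 0 < ep by rewrite divr_gt0.
(* F takes the value m at z. Its maximum over the small ball is not where psi > 0, since h < 0
   there, nor on S, where [ep * h] is below eta; so it is an interior maximum, against L F > 0. *)
pose F x := w x + ep * h x.
have seh : smooth_on A (fun x => ep * h x) by apply: smooth_onM => //; exact: smooth_on_cst.
have sF : smooth_on A F by exact: smooth_onD.
have [y yB Hy] := compact_EVT_max Bd0 kBd (cont F Bd sF BV).
rewrite inE in yB; have zB : Bd z by rewrite /Bd /= subrr normr0 ltW.
have hz : h z = 0 by rewrite /h psiz; ring.
have Fy : m <= F y by have := Hy z; rewrite inE => /(_ zB); rewrite /F wz hz mulr0 addr0.
have Ay : A y by apply: VA; exact: BV.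
have [yd1 yd2 yd3 ye] := dlt y yB.
have [py|py] := ltP 0 (psi y).
 have Kpsi : K * psi y < 1.
  have := H3 y Ay yd3; rewrite psiz subr0 => pK.
  rewrite mulrC -ltr_pdivlMr // div1r; exact: le_lt_trans (ler_norm _) pK.
 have hy : h y < 0.
  rewrite /h (_ : _ + _ = - (psi y * (1 - K * psi y))); last by ring.
  by rewrite oppr_lt0 mulr_gt0 // subr_gt0.
 move: Fy; rewrite /F; have := wm y Ay; have : ep * h y < 0 by rewrite nmulr_llt0.
 by lra.
have [yd|yd] := eqVneq `|y - z| d.
 have := Heta y (conj yB (conj yd py)) => wy.
 have : ep * h y < eta.
  apply: (@le_lt_trans _ _ (ep * `|h xh|)).
   rewrite ler_wpM2l //; first exact: ltW.
   by apply: le_trans (ler_norm _); apply: Hh; rewrite inE.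
  by rewrite mulrAC ltr_pdivrMr // ltr_pM2l // /C ltrDl.
 by move: Fy; rewrite /F; lra.
have yd' : `|y - z| < d by rewrite lt_neqAle yd.
have nyA : nbhs y A by apply: filterS VA _; apply: open_nbhs_nbhs; split => //; exact: BV.
have mx : \forall x \near y, F x <= F y.
 apply/nbhs_normP; exists (d - `|y - z|); first by nra.
 move=> x xy; apply: Hy; rewrite inE /Bd /= -[x](subrK y) -addrA.
 by apply: (le_trans (ler_normD _ _)); lra.
have := ellop_local_max b lm nyA sF mx.
rewrite (ellopD _ lm Ay sw seh) (ellopZ _ lm ep Ay sh).
have L1 := Lw y Ay.
have L2 : 0 < ellop g b h y.
 have := H2 y Ay yd2; rewrite ltr_distl => /andP[+ _]; lra.
nra.
Qed.

Lemma sqdist_le_norm (c x : 'rV[R]_n) : sqdist c x <= n%:R * `|x - c| ^+ 2.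
apply: (@le_trans _ _ (\sum_(i < n) `|x - c| ^+ 2)); last by rewrite sumr_const card_ord mulr_natl.
apply: ler_sum => i _; rewrite -real_normK ?num_real // ler_pXn2r ?nnegrE //.
by have := mx_norm_coord (x - c) i; rewrite !mxE.
Qed.

Lemma norm_le_sqdist (c x : 'rV[R]_n) (r : R) : 0 < r -> sqdist c x < r ^+ 2 -> `|x - c| < r.
move=> r0 H; apply: mx_norm_lt => // i; rewrite !mxE.
rewrite -(@ltr_pXn2r _ 2) ?nnegrE ?(ltW r0) // real_normK ?num_real //.
apply: le_lt_trans H; rewrite /sqdist (bigD1 i) //= lerDl.
by apply: sumr_ge0 => j _; exact: sqr_ge0.
Qed.

(** Parallelogram identity around the midpoint c. The ball with diameter yz thus lies in the ball
    about y through z and meets its sphere only at z. *)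
Lemma sqdist_midpoint (y z x : 'rV[R]_n) : let c := 2^-1 *: (y + z) in
 sqdist c x <= sqdist c z -> sqdist y x <= sqdist y z - sqdist z x.
move=> c H; rewrite lerBrDr; have : 2 * sqdist c x + 2 * sqdist c z <= 4 * sqdist c z by lra.
have -> : 2 * sqdist c x + 2 * sqdist c z = sqdist y x + sqdist z x.
 by rewrite !mulr_sumr -!big_split /=; apply: eq_bigr => i _; rewrite !mxE; field.
have -> // : 4 * sqdist c z = sqdist y z.
by rewrite mulr_sumr; apply: eq_bigr => i _; rewrite !mxE; field.
Qed.

(** If w(y) < m for some y near z0, let z be a point of {w = m} nearest to y. On the ball with
    diameter yz one has w < m except at z, the situation excluded by [hopf_touch]. *)
Lemma strong_max_local (w : 'rV[R]_n -> R) (m : R) (z0 : 'rV[R]_n) :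
 nbhs z0 A -> smooth_on A w -> (forall x, A x -> 0 <= ellop g b w x) ->
 (forall x, A x -> w x <= m) -> w z0 = m -> \forall y \near z0, w y = m.
move=> nA sw Lw wm wz0.
have [d d0 Hd] : exists2 d : R, 0 < d & forall y, `|y - z0| < d -> nbhs y A.
 by apply/nbhs_normP; exact: nbhs_interior.
(* Sup-norm distance below r gives Euclidean distance below d/2, because n r^2 < (n + 1)^2 r^2 =
   (d/2)^2. *)
pose r := d / (2 * n.+1%:R); have r0 : 0 < r by rewrite divr_gt0 // mulr_gt0.
apply/nbhs_normP; exists r => // y yr; apply/eqP; apply/negPn/negP => wy.
have n1 : (0 : R) < n.+1%:R by [].
have rd2 : r <= d / 2.
 by rewrite /r invfM mulrA ler_pdivrMr // ler_pMr ?divr_gt0 // ler1n.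
have nyz : sqdist y z0 < (d / 2) ^+ 2.
 apply: (le_lt_trans (sqdist_le_norm _ _)); rewrite distrC.
 have -> : d / 2 = n.+1%:R * r by rewrite /r; field; rewrite nat1r pnatr_eq0.
 rewrite exprMn; apply: (@le_lt_trans _ _ (n%:R * r ^+ 2)).
  by rewrite ler_wpM2l // ler_pXn2r ?nnegrE // ltW.
 rewrite ltr_pM2r ?exprn_gt0 // expr2 (@lt_le_trans _ _ n.+1%:R) ?ltr_nat //.
 by rewrite ler_pMr // ler1n.
have d20 : 0 < d / 2 by rewrite divr_gt0.
have inA x : sqdist y x <= sqdist y z0 -> nbhs x A /\ `|x - y| <= d / 2.
 move=> H; have xy : `|x - y| < d / 2 by apply: norm_le_sqdist => //; exact: le_lt_trans H nyz.
 split; last exact: ltW; apply: Hd; rewrite -[x](subrK y) -addrA.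
 by apply: (le_lt_trans (ler_normD _ _)); rewrite [ltRHS](splitr d) ltrD // (lt_le_trans yr).
pose K : set 'rV[R]_n := [set x | `|x - y| <= d / 2] `&` [set x | sqdist y x <= sqdist y z0].
have cK : closed K.
 apply: closedI; first by apply: closed_le_fun; exact: continuous_normB.
 by apply: closed_le_fun; exact: continuous_sqdist.
pose Z : set 'rV[R]_n := K `&` [set x | w x = m].
have cZ : closed Z.
 rewrite -openC openE => x nZ; case: (pselect (K x)) => Kx; last first.
  have : nbhs x (~` K) by apply: open_nbhs_nbhs; split => //; rewrite openC.
  by apply: filterS => t nKt [].
 have [nxA _] := inA x Kx.2.
 have [V' [_ [_ Vx sV' _]]] := interior_ext nxA sw.
 have wx : w x < m.
  rewrite lt_neqAle wm ?andbT; last exact: nbhs_singleton.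
  by apply/eqP => E; apply: nZ.
 have mw : 0 < m - w x by rewrite subr_gt0.
 have [e e0 He] := smooth_on_cont sw (nbhs_singleton nxA) mw.
 have [e' e'0 He'] := (nbhs_normP _ _).1 nxA.
 suff : nbhs x (~` Z) by [].
 apply/nbhs_normP; exists (Num.min e e'); first by rewrite lt_min e0.
 move=> t; rewrite lt_min => /andP[te te'] [_ /= E].
 have := He t (He' t te') te; rewrite E ltr_distl => /andP[_].
 by rewrite addrC subrK ltxx.
have kZ : compact Z by apply: (subclosed_compact cZ (@compact_normball R n y (d / 2))) => x [[]].
have Zz0 : Z z0 by split => //; split; [exact: (inA z0 (lexx _)).2|exact: lexx].
have [z zZ Hz] := compact_EVT_min (ex_intro _ z0 Zz0) kZ (continuous_subspaceT (@continuous_sqdist R n y)).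
rewrite inE in zZ; have [Kz wz] := zZ; have [nzA _] := inA z Kz.2.
have yz0 : 0 < sqdist y z.
 rewrite lt_neqAle sqdist_ge0 andbT eq_sym; apply/eqP => /sqdist_eq0 E.
 by move: wy; rewrite -E wz eqxx.
apply: (@hopf_touch w m (2^-1 *: (y + z)) z 1 nzA sw Lw wm wz) => //.
 have -> : sqdist (2^-1 *: (y + z)) z = 4^-1 * sqdist y z.
  by rewrite /sqdist mulr_sumr; apply: eq_bigr => i _; rewrite !mxE; field.
 by rewrite mulr_gt0 // invr_gt0.
move=> x _ cx xz; have H := sqdist_midpoint cx.
have zx0 : 0 < sqdist z x.
 rewrite lt_neqAle sqdist_ge0 andbT eq_sym; apply/eqP => /sqdist_eq0 E; exact: xz.
have yx : sqdist y x < sqdist y z by lra.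
have Kx2 : sqdist y x <= sqdist y z0 by apply: (le_trans (ltW yx)); exact: Kz.2.
have [nxA xy] := inA x Kx2.
rewrite lt_neqAle wm ?andbT; last exact: nbhs_singleton.
apply/eqP => wx; have := Hz x; rewrite inE => /(_ (conj (conj xy Kx2) wx)).
by rewrite leNgt yx.
Qed.

End hopf.

(** * Charts of a manifold with boundary *)

Local Notation dom a := (cdom (charts a)).
Local Notation "a @@ p" := (cmap (charts a) p) (at level 30).
Local Notation img a := (cimage (charts a)).
Local Notation inv a := (cinv (charts a)).

Section charts.
Context {R : realType} {n : nat} {T : topologicalType}.
Variable M : riem_data R n T.
Hypotheses (n0 : (0 < n)%N) (mM : smooth_manifold M) (rM : riemannian_metric M).
Implicit Types (a b : chart_index M) (p q : T) (x y : 'rV[R]_n).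

Definition ord00 : 'I_n := Ordinal n0.

Lemma halfspaceE x : halfspace (n := n) x <-> 0 <= x 0 ord00.
split=> [H|H i i0]; first exact: H.
by rewrite (_ : i = ord00) //; apply/val_inj.
Qed.

Lemma chart_hopen a : hopen (img a).
by have [_ /(_ a) [_ [V oV E] _ _ _] _ _] := mM; exists V. Qed.

Lemma chart_local_metric a : local_metric (img a) (metric a).
have [sm sy po _] := rM; split; first exact: chart_hopen.
- by [].
- by move=> x; exact: sy.
- by move=> x Ax v; exact: po.
Qed.

Lemma chart_img a p : dom a p -> img a (a @@ p).
by move=> Dp; exists p. Qed.

Lemma chart_inv a p : dom a p -> inv a (a @@ p) = p.
by have [_ /(_ a) [_ _ H _ _] _ _] := mM; exact: H. Qed.

Lemma chart_dom_inv a x : img a x -> dom a (inv a x).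
by move=> [p Dp <-]; rewrite chart_inv. Qed.

Lemma chart_mapK a x : img a x -> a @@ (inv a x) = x.
by move=> [p Dp <-]; rewrite chart_inv. Qed.

Lemma chart_open a : open (dom a).
by have [_ /(_ a) [] ] := mM. Qed.

Lemma chart_halfspace a p : dom a p -> 0 <= (a @@ p) 0 ord00.
move=> Dp; have [_ /(_ a) [_ [V oV E] _ _ _] _ _] := mM.
by have := chart_img Dp; rewrite E => -[_ /halfspaceE].
Qed.

Lemma chart_exists p : exists a, dom a p.
by have [_ _ H _] := mM; exact: H. Qed.

Lemma within_nbhs (X Y : topologicalType) (f : X -> Y) (D : set X) (x : X) (W : set Y) :
 {within D, continuous f} -> D x -> nbhs (f x) W ->
 \forall y \near x, D y -> W (f y).
move=> cf Dx nW.
by have := (subspace_continuousP _ _).1 cf x Dx W nW.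
Qed.

Lemma chart_near a p (W : set 'rV[R]_n) : dom a p -> nbhs (a @@ p) W ->
 \forall q \near p, dom a q /\ W (a @@ q).
move=> Dp nW; have [_ /(_ a) [oD _ _ cm _] _ _] := mM.
have nD : nbhs p (dom a) by exact: open_nbhs_nbhs.
have := within_nbhs cm Dp nW; move: nD; by apply: filterS2 => q Dq H; split => //; exact: H.
Qed.

Lemma chart_inv_near a x (U : set T) : img a x -> nbhs (inv a x) U ->
 exists2 d : R, 0 < d & forall y, img a y -> `|y - x| < d -> U (inv a y).
move=> Ax nU; have [_ /(_ a) [_ _ _ _ ci] _ _] := mM.
have /nbhs_normP[d d0 H] := within_nbhs ci Ax nU.
by exists d => // y Ay /H; apply.
Qed.

Lemma chart_nbhs a p : dom a p -> forall e : R, 0 < e ->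
 \forall q \near p, dom a q /\ `|a @@ q - a @@ p| < e.
move=> Dp e e0; apply: (@chart_near a p [set y | `|y - a @@ p| < e]) => //.
by apply/nbhs_normP; exists e.
Qed.

Lemma interior_img a p : dom a p -> 0 < (a @@ p) 0 ord00 -> nbhs (a @@ p) (img a).
move=> Dp H; have [V oV E] := chart_hopen a.
have Vx : V (a @@ p) by have := chart_img Dp; rewrite E => -[].
rewrite E; apply: filterI; first exact: open_nbhs_nbhs.
apply/nbhs_normP; exists ((a @@ p) 0 ord00) => // y yd; apply/halfspaceE.
have := le_lt_trans (mx_norm_coord _ ord00) yd; rewrite !mxE ltr_distl => /andP[]; lra.
Qed.

Lemma interior_img0 a x : img a x -> 0 < x 0 ord00 -> nbhs x (img a).
by move=> [p Dp <-] H; exact: interior_img. Qed.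

Definition overlap a b : set 'rV[R]_n := cmap (charts a) @` (dom a `&` dom b).

Lemma overlapP a b x : overlap a b x <-> img a x /\ dom b (inv a x).
split=> [[p [Dp Dp'] <-]|[Ax Db]]; first by rewrite chart_inv //; split => //; exact: chart_img.
exists (inv a x); last by rewrite chart_mapK.
by split => //; exact: chart_dom_inv.
Qed.

Lemma hopen_preimage a (U : set T) : open U -> hopen (img a `&` inv a @^-1` U).
move=> oU; have [V oV E] := chart_hopen a.
pose W := [set x | exists2 d, 0 < d & forall y, img a y -> `|y - x| < d -> U (inv a y)].
have oW : open W.
 rewrite openE => x [d d0 H]; apply/nbhs_normP; exists (d / 2); first by lra.
 move=> y yx; exists (d / 2); first by lra.
 move=> z Az zy; apply: H => //; rewrite -(subrK y z) -addrA [ltRHS]splitr.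
 by apply: (le_lt_trans (ler_normD _ _)); exact: ltrD.
exists (V `&` W); first exact: openI.
rewrite setIAC -E; apply/seteqP; split => x [Ax]; last first.
 by move=> [d d0 H]; split => //; apply: H => //; rewrite subrr normr0.
move=> Ux; split => //; apply: chart_inv_near => //; exact: open_nbhs_nbhs.
Qed.

Lemma overlap_hopen a b : hopen (overlap a b).
rewrite (_ : overlap a b = img a `&` inv a @^-1` dom b).
 by apply: hopen_preimage; exact: chart_open.
by apply/seteqP; split => x /overlapP.
Qed.

Lemma overlap_img a b : overlap a b `<=` img a.
by move=> x /overlapP[]. Qed.

Lemma transition_img a b x : overlap a b x -> img b (transition a b x).
by move=> /overlapP[_ D]; exact: chart_img. Qed.

Lemma transition_smooth a b : smooth_map_on (overlap a b) (transition a b).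
by have [_ _ _ H] := mM; exact: H. Qed.

Lemma in_chart_transition (f : T -> R) a b x : overlap a b x ->
 in_chart f a x = (in_chart f b \o transition a b) x.
by move=> /overlapP[_ D]; rewrite /in_chart /= chart_inv. Qed.

Definition jac a b x := pd_mx (transition a b) x.

Lemma metric_change a b x : overlap a b x ->
 metric a x = jac a b x *m metric b (transition a b x) *m (jac a b x)^T.
move=> /overlapP[Ax Db]; have [_ _ _ H] := rM.
have := H a b (inv a x) (chart_dom_inv Ax) Db.
by rewrite chart_mapK.
Qed.

(** The Jacobian is a left factor of the invertible matrix [metric a x]. *)
Lemma jac_unit a b x : overlap a b x -> jac a b x \in unitmx.
move=> Ox; have := g_unit (chart_local_metric a) (overlap_img Ox).
by rewrite (metric_change Ox) -mulmxA unitmx_mul => /andP[].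
Qed.

(** Stated on subdomains so as to cover functions that are smooth only over an open part of M. *)
Lemma drow_change_dom (f : T -> R) a b (D : set 'rV[R]_n) (E : set 'rV[R]_n) x :
 hopen D -> hopen E -> D `<=` overlap a b -> (forall y, D y -> E (transition a b y)) ->
 smooth_on E (in_chart f b) -> D x ->
 drow (in_chart f a) x = drow (in_chart f b) (transition a b x) *m (jac a b x)^T.
move=> hD hE DO DE sf Dx; apply/rowP => i; rewrite mxE.
have sT : smooth_map_on D (transition a b).
 by move=> k; apply: smooth_on_sub DO (transition_smooth (b := b) k).
have sc : smooth_on D (in_chart f b \o transition a b) by exact: smooth_on_comp sT DE sf.
rewrite -(pd_ext hD Dx i sc (g := in_chart f a)); last first.
 by move=> y Dy; rewrite -in_chart_transition //; exact: DO.
rewrite (pd_comp i hD hE sT DE Dx sf) mxE; apply: eq_bigr => k _.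
by rewrite !mxE mulrC.
Qed.

Lemma drow_change (f : T -> R) a b x : smooth_fun M f -> overlap a b x ->
 drow (in_chart f a) x = drow (in_chart f b) (transition a b x) *m (jac a b x)^T.
move=> sf; apply: drow_change_dom (sf b) => //; [exact: overlap_hopen|exact: chart_hopen|].
exact: transition_img.
Qed.

Lemma gradsq_change (f : T -> R) a b x : smooth_fun M f -> overlap a b x ->
 gradsq (metric a) (in_chart f a) x = gradsq (metric b) (in_chart f b) (transition a b x).
move=> sf Ox; rewrite /gradsq /gradup (drow_change sf Ox) /ginv (metric_change Ox).
have uJ := jac_unit Ox; have uJT : (jac a b x)^T \in unitmx by rewrite unitmx_tr.
have ug := g_unit (chart_local_metric b) (transition_img Ox).
set J := jac a b x in uJ uJT *; set g := metric b _ in ug *; set d := drow _ _.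
have -> : invmx (J *m g *m J^T) = invmx J^T *m invmx g *m invmx J.
 have uU : J *m g *m J^T \in unitmx by rewrite !unitmx_mul uJ ug.
 apply: (can_inj (mulmxK uU)); rewrite mulVmx // !mulmxA mulmxKV // -(mulmxA _ (invmx g)).
 by rewrite mulVmx // mulmx1 mulVmx.
by rewrite !mulmxA mulmxK // trmx_mul trmxK mulmxA mulmxKV.
Qed.

(** Otherwise the first coordinate of the transition map, which is nonnegative, would have an
    interior minimum 0; its differential, a column of the Jacobian, would vanish. *)
Lemma boundary_chart_invariance a b p : dom a p -> dom b p ->
 0 < (a @@ p) 0 ord00 -> 0 < (b @@ p) 0 ord00.
move=> Da Db H; rewrite lt_neqAle chart_halfspace // andbT eq_sym; apply/eqP => b0.
pose x := a @@ p; have Ox : overlap a b x by exists p.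
have nO : nbhs x (overlap a b).
 have [V oV E] := overlap_hopen a b.
 have Vx : V x by move: Ox; rewrite E => -[].
 rewrite E; have : nbhs x V by exact: open_nbhs_nbhs.
 have : nbhs x (img a) by exact: interior_img.
 apply: filterS2 => y [q Dq <-] Vq; split => //; apply/halfspaceE.
 exact: chart_halfspace.
pose f y := - transition a b y 0 ord00.
have sf : smooth_on (overlap a b) f by apply: smooth_onN; exact: transition_smooth.
have f0 : f x = 0 by rewrite /f /transition chart_inv // b0 oppr0.
have d0 : drow f x = 0.
 apply: (local_max_drow (overlap_hopen a b) nO sf); move: nO; apply: filterS => y Oy.
 by rewrite f0 oppr_le0; apply: chart_halfspace; move/overlapP: Oy => [].
have := jac_unit Ox; rewrite unitmxE unitfE => /negP[]; apply/eqP.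
rewrite -det_tr; apply/eqP/det0P; exists (delta_mx 0 ord00).
 by apply/negP => /eqP/matrixP/(_ 0 ord00)/eqP; rewrite !mxE oner_eq0.
apply/rowP => i; rewrite -rowE.
move/rowP: d0 => /(_ i); rewrite !mxE (pdN (overlap_hopen a b) Ox); last exact: transition_smooth.
nra.
Qed.

Lemma mboundaryP a p : dom a p -> mboundary M p <-> (a @@ p) 0 ord00 = 0.
move=> Da; split=> [[b [Db H]]|H]; last first.
 by exists a; split => // i i0; rewrite (_ : i = ord00) //; exact/val_inj.
apply/eqP; apply: contraT => a0.
have : 0 < (a @@ p) 0 ord00 by rewrite lt_neqAle eq_sym a0 chart_halfspace.
by move=> /(boundary_chart_invariance Da Db); rewrite H // ltxx.
Qed.

Lemma nmboundaryP a p : dom a p -> ~ mboundary M p <-> 0 < (a @@ p) 0 ord00.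
move=> Da; rewrite (mboundaryP Da) lt_neqAle chart_halfspace //.
nra.
Qed.

(** By [gradsq_change] the set inside [get] is a singleton. *)
Lemma grad_normE (f : T -> R) a p : smooth_fun M f -> dom a p ->
 grad_norm M f p = Num.sqrt (gradsq (metric a) (in_chart f a) (a @@ p)).
move=> sf Da.
have loc b q : grad_norm_loc (metric b) (in_chart f b) (b @@ q) =
  Num.sqrt (gradsq (metric b) (in_chart f b) (b @@ q)).
 congr (Num.sqrt _); rewrite /gradsq mxE exchange_big; apply: eq_bigr => j _.
 rewrite mxE mulr_suml; apply: eq_bigr => i _; rewrite !mxE; ring.
rewrite /grad_norm; set S := (X in get X).
have [b Db E] : S (get S).
 by apply: getPex; exists (Num.sqrt (gradsq (metric a) (in_chart f a) (a @@ p))); exists a; rewrite ?loc.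
rewrite E loc; congr (Num.sqrt _).
have O : overlap b a (b @@ p) by exists p.
by rewrite (gradsq_change sf O) /transition chart_inv.
Qed.

Lemma grad_norm_sqr (f : T -> R) a p : smooth_fun M f -> dom a p ->
 grad_norm M f p ^+ 2 = gradsq (metric a) (in_chart f a) (a @@ p).
move=> sf Da; rewrite (grad_normE sf Da) sqr_sqrtr //.
exact: gradsq_ge0 (chart_local_metric a) (chart_img Da).
Qed.

Lemma grad_norm_ge0 (f : T -> R) p : smooth_fun M f -> 0 <= grad_norm M f p.
by move=> sf; have [a Da] := chart_exists p; rewrite (grad_normE sf Da). Qed.

Lemma chart_continuous (f : T -> R) a (F : 'rV[R]_n -> R) p : dom a p ->
 smooth_on (img a) F -> (forall q, dom a q -> f q = F (a @@ q)) -> {for p, continuous f}.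
move=> Da sF fF; apply/cvgrPdist_lt => e e0.
have [d d0 H] := smooth_on_cont sF (chart_img Da) e0.
have := chart_nbhs Da d0; apply: filterS => q [Dq qd].
by rewrite !fF // distrC; apply: H => //; exact: chart_img.
Qed.

Lemma smooth_fun_continuous (f : T -> R) : smooth_fun M f -> continuous f.
move=> sf p; have [a Da] := chart_exists p; apply: (chart_continuous Da (sf a)) => q Dq.
by rewrite /in_chart /= chart_inv.
Qed.

Lemma grad_norm_continuous (f : T -> R) : smooth_fun M f -> continuous (grad_norm M f).
move=> sf; have c2 : continuous (fun p => grad_norm M f p ^+ 2).
 move=> p; have [a Da] := chart_exists p.
 apply: (chart_continuous Da (smooth_gradsq (chart_local_metric a) (sf a))) => q Dq.
 exact: grad_norm_sqr.
rewrite (_ : grad_norm M f = Num.sqrt \o (fun p => grad_norm M f p ^+ 2)).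
 by move=> p; apply: continuous_comp; [exact: c2|exact: sqrt_continuous].
by apply/funext => p /=; rewrite sqrtr_sqr ger0_norm // grad_norm_ge0.
Qed.

End charts.

(** * Connectedness along segments, and maxima of sets of reals *)

Section connectedness.
Context {R : realType}.

Lemma segment_clopen (P : R -> Prop) :
 (forall t : R, 0 <= t <= 1 -> P t -> \forall s \near t, 0 <= s <= 1 -> P s) ->
 (forall t : R, 0 <= t <= 1 -> ~ P t -> \forall s \near t, 0 <= s <= 1 -> ~ P s) ->
 P 0 -> forall t : R, 0 <= t <= 1 -> P t.
move=> Po Pc P0.
have C := @segment_connected R 0 1.
pose B := [set t | 0 <= t <= 1 /\ P t].
have zI : 0 <= (0 : R) <= 1 by lra.
have EB : B = `[0%R, 1%R]%classic.
 apply: C; first by exists 0.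
 - exists (interior [set s | 0 <= s <= 1 -> P s]); first exact: open_interior.
  apply/seteqP; split=> t; first by move=> [tI Pt]; split => //; exact: Po.
  by rewrite /= => -[tI /nbhs_singleton H]; split => //; exact: H.
 - exists (~` interior [set s | 0 <= s <= 1 -> ~ P s]).
   by rewrite closedC; exact: open_interior.
  apply/seteqP; split=> t.
   by move=> [tI Pt]; split => // /nbhs_singleton H; exact: H.
  rewrite /= => -[tI nP]; split => //; apply: contrapT => nPt; apply: nP.
  exact: Pc.
move=> t tI; have : B t by rewrite EB.
by case.
Qed.

Lemma connected_component_path (T : topologicalType) (D : set T) p (gamma : R -> T) :
 {within `[0%R, 1%R]%classic, continuous gamma} ->
 (forall t : R, 0 <= t <= 1 -> D (gamma t)) ->
 connected_component D p (gamma 0) -> connected_component D p (gamma 1).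
move=> cg gD N0.
have Cg : connected (gamma @` `[0%R, 1%R]%classic).
 by apply: connected_continuous_connected => //; exact: segment_connected.
have z0 : (gamma @` `[0%R, 1%R]%classic) (gamma 0) by exists 0; rewrite //= in_itv /= lexx ler01.
have z1 : (gamma @` `[0%R, 1%R]%classic) (gamma 1) by exists 1; rewrite //= in_itv /= lexx ler01.
have sub : gamma @` `[0%R, 1%R]%classic `<=` D.
 by move=> q [t]; rewrite /= => tI <-; exact: gD.
case: N0 => B [Bp BD CB] B0.
exists (B `|` gamma @` `[0%R, 1%R]%classic); last by right.
split; [by left|by move=> q [/BD|/sub]|].
by apply: connectedU => //; exists (gamma 0).
Qed.

End connectedness.

Section maximum.
Context {R : realType}.

Lemma maximumE (A : set R) m : A m -> ubound A m -> maximum A = m.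
move=> Am um; rewrite /maximum; set P := (X in get X).
have [Ag ug] : P (get P) by apply: getPex; exists m.
by apply/eqP; rewrite eq_le um //=; apply: ug.
Qed.

End maximum.

(** * Regions of a static triple and the function w *)

Section regions.
Context {R : realType} {n : nat} {T : topologicalType}.
Variables (M : riem_data R n T) (u : T -> R).
Hypotheses (n0 : (0 < n)%N) (hM : static_triple M u).
Let mM := st_manifold hM.
Let rM := st_metric hM.
Let su := st_smooth hM.
Implicit Types (a b : chart_index M) (p q : T) (x y : 'rV[R]_n) (N : set T).

Local Notation f a := (in_chart u a).
Local Notation c := (u_max u).
Local Notation o := (ord00 n0).

Lemma chart_ball a p : dom a p ->
 exists2 d : R, 0 < d & forall y, `|y - a @@ p| < d -> 0 <= y 0 o -> img a y.
move=> Da; have [V oV E] := chart_hopen mM a.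
have : nbhs (a @@ p) V.
 by apply: open_nbhs_nbhs; split => //; have := chart_img Da; rewrite E => -[].
move=> /nbhs_normP[d d0 H]; exists d => // y yd y0; rewrite E; split; first exact: H.
exact/halfspaceE.
Qed.

Lemma segment_ball (z x y : 'rV[R]_n) (d t : R) : `|x - z| < d -> `|y - z| < d -> 0 <= t <= 1 ->
 `|x + t *: (y - x) - z| < d.
move=> xd yd /andP[t0 t1].
have -> : x + t *: (y - x) - z = (1 - t) *: (x - z) + t *: (y - z).
 by apply/rowP => i; rewrite !mxE; ring.
apply: (le_lt_trans (ler_normD _ _)); rewrite !normrZ (ger0_norm t0) ger0_norm ?subr_ge0 //.
have [->|tn] := eqVneq t 0; first by nra.
nra.
Qed.

Lemma segment_coord (x y : 'rV[R]_n) (t : R) i : 0 <= x 0 i -> 0 <= y 0 i -> 0 <= t <= 1 ->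
 0 <= (x + t *: (y - x)) 0 i.
move=> x0 y0 /andP[t0 t1]; rewrite !mxE.
nra.
Qed.

Lemma segment_dist (x y : 'rV[R]_n) (s t : R) :
 `|(x + s *: (y - x)) - (x + t *: (y - x))| = `|s - t| * `|y - x|.
by rewrite opprD addrACA subrr add0r -scalerBl normrZ. Qed.

Lemma chart_segment a x y (D : set T) p :
 (forall t : R, 0 <= t <= 1 -> img a (x + t *: (y - x)) /\ D (inv a (x + t *: (y - x)))) ->
 connected_component D p (inv a x) -> connected_component D p (inv a y).
move=> H Nx; pose gamma t := inv a (x + t *: (y - x)).
have E0 : gamma 0 = inv a x by rewrite /gamma scale0r addr0.
have E1 : gamma 1 = inv a y by rewrite /gamma scale1r addrC subrK.
rewrite -E1; apply: connected_component_path; last by rewrite E0.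
- apply/subspace_continuousP => t; rewrite /= => tI U nU.
 have [d d0 Hd] := chart_inv_near mM (H t tI).1 nU.
 apply/nbhs_ballP; exists (d / (`|y - x| + 1)) => /=.
  by rewrite divr_gt0.
 move=> s; rewrite /ball /= distrC => st; rewrite /= => sI.
 apply: Hd; first by have [] := H s sI.
 rewrite segment_dist; apply: (@le_lt_trans _ _ (`|s - t| * (`|y - x| + 1))).
  by rewrite ler_wpM2l // lerDl.
 by rewrite -ltr_pdivlMr.
- by move=> t tI; have [] := H t tI.
Qed.

Lemma u_continuous : continuous u. Proof. exact: smooth_fun_continuous su. Qed.

Lemma u_max_spec : (exists p, u p = c) /\ forall q, u q <= c.
have [p0 _] := st_boundary hM.
have [p _ H] := @compact_EVT_max T R u setT (ex_intro _ p0 I) (st_compact hM)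
 (continuous_subspaceT u_continuous).
have -> : c = u p.
 by apply: maximumE; [exists p|move=> r [q _ <-]; apply: H; rewrite inE].
by split; [exists p|move=> q; apply: H; rewrite inE].
Qed.

Lemma u_le_max q : u q <= c. Proof. by case: u_max_spec. Qed.

Lemma boundary_u0 p : mboundary M p <-> u p = 0.
split; first exact: st_boundary0.
move=> u0; apply: contrapT => nb; have := st_interior hM nb.
nra.
Qed.

Lemma u_ge0 p : 0 <= u p.
case: (pselect (mboundary M p)) => [/boundary_u0 ->//|nb].
exact: ltW (st_interior hM nb).
Qed.

Lemma u_pos_coord a p : dom a p -> 0 < u p <-> 0 < (a @@ p) 0 o.
move=> Da; rewrite -(nmboundaryP n0 mM rM Da) boundary_u0 lt_neqAle u_ge0.
nra.
Qed.

(** A small step along the first basis vector leaves the boundary. *)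
Lemma near_boundary_interior p (U : set T) : nbhs p U -> exists2 q, U q & 0 < u q.
move=> nU; have [a Da] := chart_exists mM p.
have [d d0 Hd] := chart_ball Da.
have nU' : nbhs (inv a (a @@ p)) U by rewrite chart_inv.
have [d' d'0 Hd'] := chart_inv_near mM (chart_img Da) nU'.
pose e := Num.min d d' / 2; have m0 : 0 < Num.min d d' by rewrite lt_min d0.
have e0 : 0 < e by rewrite divr_gt0.
pose y := a @@ p + e *: basis o.
have ye : `|y - a @@ p| < Num.min d d'.
 rewrite addrC addKr normrZ gtr0_norm //; apply: (@le_lt_trans _ _ e).
  by rewrite ler_piMr ?norm_basis_le // ltW.
 by rewrite ltr_pdivrMr // ltr_pMr // ltr1n.
move: ye; rewrite lt_min => /andP[yd yd'].
have y0 : 0 < y 0 o.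
 by rewrite !mxE mulr1 ltr_wpDl //; exact: chart_halfspace.
have Ay : img a y by apply: Hd => //; exact: ltW.
exists (inv a y); first exact: Hd'.
by apply/(u_pos_coord (chart_dom_inv mM Ay)); rewrite chart_mapK.
Qed.

Lemma u_max_gt0 : 0 < c.
have [p0 _] := st_boundary hM.
have [q _ q0] := @near_boundary_interior p0 setT filterT.
exact: lt_le_trans q0 (u_le_max q).
Qed.

Local Notation MAXu := (MAX u).

Lemma open_notMAX : open (~` MAXu).
rewrite (_ : ~` MAXu = u @^-1` [set r | r != c]).
 by apply: open_comp => [p _|]; [exact: u_continuous|exact: open_neq].
by apply/seteqP; split => p H; apply/eqP.
Qed.

Lemma region_sub N : regions u N -> N `<=` ~` MAXu.
by move=> [p Dp <-]; exact: connected_component_sub. Qed.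

Lemma region_nonempty N : regions u N -> N !=set0.
by move=> [p Dp <-]; exists p; exact: connected_component_refl. Qed.

Lemma region_segment N a x y : regions u N ->
 (forall t : R, 0 <= t <= 1 -> img a (x + t *: (y - x)) /\ u (inv a (x + t *: (y - x))) <> c) ->
 N (inv a x) -> N (inv a y).
by move=> [p Dp <-] H; exact: chart_segment. Qed.

(** A small half-ball in a chart around a point off MAX(u) is convex and misses MAX(u), so a region
    that meets it contains it. Both [region_open] and [region_closure] follow. *)
Lemma region_near N q : regions u N -> ~ MAXu q ->
 \forall q' \near q, N q' -> \forall q'' \near q, N q''.
move=> rN nM; have [a Da] := chart_exists mM q.
have [d d0 Hd] := chart_ball Da.
have nU : nbhs (inv a (a @@ q)) (~` MAXu).
 by rewrite chart_inv //; apply: open_nbhs_nbhs; split => //; exact: open_notMAX.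
have [d' d'0 Hd'] := chart_inv_near mM (chart_img Da) nU.
have m0 : 0 < Num.min d d' by rewrite lt_min d0.
have C := chart_nbhs mM Da m0.
apply: filterS C => q' [Dq' q'd] Nq'.
apply: filterS (chart_nbhs mM Da m0) => q'' [Dq'' q''d].
rewrite -(chart_inv mM Dq''); apply: (region_segment rN) (_ : N (inv a (a @@ q'))); last by rewrite chart_inv.
move=> t tI; have := segment_ball q'd q''d tI; rewrite lt_min => /andP[td td'].
have At : img a (a @@ q' + t *: (a @@ q'' - a @@ q')).
 by apply: Hd => //; apply: segment_coord => //; exact: chart_halfspace.
by split => //; exact: Hd'.
Qed.

Lemma region_open N : regions u N -> open N.
move=> rN; rewrite openE => q Nq.
have := region_near rN (region_sub rN Nq).
by move=> /nbhs_singleton /(_ Nq).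
Qed.

Lemma region_closure N q : regions u N -> closure N q -> ~ MAXu q -> N q.
move=> rN cN nM; have [q' [Nq' H]] := cN _ (region_near rN nM).
exact: nbhs_singleton (H Nq').
Qed.

Lemma closure_region_compact N : compact (closure N).
by apply: (subclosed_compact _ (st_compact hM)) => //; exact: closed_closure. Qed.

Lemma chart_inv_nbhs a p (U : set T) : dom a p -> 0 < u p -> nbhs p U ->
 \forall y \near (a @@ p), img a y /\ U (inv a y).
move=> Da up nU.
have nI := interior_img mM Da ((u_pos_coord Da).1 up).
have nU' : nbhs (inv a (a @@ p)) U by rewrite chart_inv.
have [d d0 H] := chart_inv_near mM (chart_img Da) nU'.
have nd : \forall y \near (a @@ p), `|y - a @@ p| < d by apply/nbhs_normP; exists d.
move: nI nd; apply: filterS2 => y Ay yd; split => //; exact: H.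
Qed.

Lemma local_metric_sub (A D : set 'rV[R]_n) g : local_metric A g -> hopen D -> D `<=` A ->
 local_metric D g.
move=> lm hD DA; split => //.
- by move=> i j; apply: smooth_on_sub DA (lm_smooth lm i j).
- by move=> x /DA; exact: lm_sym.
- by move=> x /DA; exact: lm_pos.
Qed.

Definition intr a : set 'rV[R]_n := img a `&` [set x : 'rV[R]_n | 0 < x 0 o].

Lemma intr_hopen a : hopen (intr a).
apply: hopen_open; first exact: chart_hopen.
apply: (@open_comp _ _ (fun x => x 0 o) [set r | 0 < r]) => //.
by move=> x _; exact: coord_continuous.
Qed.

Lemma intr_lm a : local_metric (intr a) (metric a).
apply: local_metric_sub (chart_local_metric mM rM a) (intr_hopen a) _.
by move=> x [].
Qed.

Lemma lm_img a : local_metric (img a) (metric a). Proof. exact: chart_local_metric. Qed.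

Lemma intr_pos a x : intr a x -> 0 < f a x.
move=> [Ax x0]; apply/(u_pos_coord (chart_dom_inv mM Ax)).
by rewrite chart_mapK.
Qed.

Lemma intr_img a p : dom a p -> 0 < u p -> intr a (a @@ p).
by move=> Da up; split; [exact: chart_img|exact/u_pos_coord]. Qed.

Lemma intr_nbhs a x : intr a x -> nbhs x (intr a).
move=> Ix; have [V oV E] := intr_hopen a.
have nA := interior_img0 mM Ix.1 Ix.2.
have : nbhs x [set y | 0 < y 0 o].
 apply: open_nbhs_nbhs; split; last exact: Ix.2.
 apply: (@open_comp _ _ (fun x => x 0 o) [set r | 0 < r]) => //.
 by move=> y _; exact: coord_continuous.
by move: nA; apply: filterS2 => y; split.
Qed.

Lemma sf_img a : smooth_on (img a) (f a). Proof. exact: su. Qed.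

Lemma sf_intr a : smooth_on (intr a) (f a).
by apply: (smooth_on_sub _ (@sf_img a)) => x []. Qed.

(** Chosen to absorb the first-order term of [bochner]. It is singular where u = 0, hence the
    restriction to [intr]. *)
Definition drift a (x : 'rV[R]_n) := (f a x)^-1 *: gradup (metric a) (f a) x.

Lemma smooth_drift a : smooth_mx (intr a) (drift a).
apply: smooth_mxZ; last exact (smooth_gradup (intr_lm a) (@sf_intr a)).
by apply: smooth_onV (@sf_intr a) => x /intr_pos/lt0r_neq0.
Qed.

Lemma chart_ricci a x i j : img a x ->
 f a x * ricci (metric a) i j x = hessian (metric a) (f a) i j x + n%:R * f a x * metric a x i j.
exact: st_ricci. Qed.

Lemma chart_laplacian a x : img a x -> laplacian (metric a) (f a) x = - n%:R * f a x.
exact: st_laplacian. Qed.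

Local Notation w a := (energy (metric a) (f a)).

Lemma ellop_energy a x : intr a x -> ellop (metric a) (drift a) (w a) x =
 2 * \tr (ginv (metric a) x *m trfree (metric a) (f a) x *m (ginv (metric a) x *m trfree (metric a) (f a) x)).
move=> Ix; have Ax := Ix.1; have f0 := lt0r_neq0 (intr_pos Ix).
have B := bochner (lm_img a) (@sf_img a) (fun x i j => @chart_ricci a x i j) (@chart_laplacian a) Ax f0.
rewrite /ellop -(laplacianE (lm_img a)) //; last exact (smooth_energy (lm_img a) (@sf_img a)).
by rewrite B -scalemxAl scalemxE addrC addKr.
Qed.

Lemma ellop_energy_ge0 a x : intr a x -> 0 <= ellop (metric a) (drift a) (w a) x.
move=> Ix; rewrite ellop_energy // mulr_ge0 //.
exact: (trace_normsq (lm_img a) Ix.1 (trfree_sym (lm_img a) (@sf_img a) Ix.1)).1.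
Qed.

(** The drift Du/u cancels the term 2 |Du|^2 of Lap(u^2). The strict sign that remains makes u^2 the
    right perturbation in [weak_max]. *)
Lemma ellop_square a x : intr a x ->
 ellop (metric a) (drift a) (fun y => f a y * f a y) x = - 2 * n%:R * f a x ^+ 2.
move=> Ix; have Ax := Ix.1; have f0 := lt0r_neq0 (intr_pos Ix).
rewrite (ellopM _ (lm_img a) Ax (@sf_img a) (@sf_img a)) /ellop.
rewrite -(laplacianE (lm_img a) (@sf_img a) Ax) chart_laplacian // -scalemxAl scalemxE.
by move: ((gradup _ _ _ *m _) 0 0) => q; field.
Qed.

Definition wfun p := grad_norm M u p ^+ 2 + u p ^+ 2.

Lemma wfunE a p : dom a p -> wfun p = w a (a @@ p).
move=> Da; rewrite /wfun /energy (grad_norm_sqr mM rM su Da); congr _.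
by rewrite /in_chart /= chart_inv.
Qed.

Lemma wfun_inv a x : img a x -> wfun (inv a x) = w a x.
by move=> Ax; rewrite (wfunE (chart_dom_inv mM Ax)) chart_mapK. Qed.

Lemma wfun_continuous : continuous wfun.
move=> p; have [a Da] := chart_exists mM p.
apply: (chart_continuous mM Da (smooth_energy (lm_img a) (@sf_img a))) => q Dq.
exact: wfunE.
Qed.

(** Lap u = - n u is negative where u > 0. *)
Lemma local_min_boundary q : (\forall p \near q, u q <= u p) -> mboundary M q.
move=> mn; apply: contrapT => nb; have uq := st_interior hM nb.
have [a Da] := chart_exists mM q; have Ix := intr_img Da uq; have Ax := Ix.1.
have sN : smooth_on (img a) (fun y => -1 * f a y).
 by apply: smooth_onM; [exact: smooth_on_cst|exact: sf_img].
have nA := interior_img mM Da Ix.2.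
have := ellop_local_max (fun=> 0) (lm_img a) nA sN.
rewrite (ellopZ _ (lm_img a) (-1) Ax (@sf_img a)) /ellop mul0mx mxE subr0.
rewrite -(laplacianE (lm_img a) (@sf_img a) Ax) chart_laplacian // => H.
have fq : f a (a @@ q) = u q by rewrite /in_chart /= chart_inv.
have : -1 * (- n%:R * f a (a @@ q)) <= 0.
 apply: H; have := chart_inv_nbhs Da uq mn; apply: filterS => y [Ay uy].
 by rewrite fq !mulN1r lerN2.
by rewrite fq mulN1r mulNr opprK leNgt mulr_gt0 // ltr0n.
Qed.

(** The minimum of u over the closure of N is below the maximum of u, so it is attained in N, which
    is open. *)
Lemma rboundary_nonempty N : regions u N -> rboundary M N !=set0.
move=> rN; have [p0 Np0] := region_nonempty rN.
have cN : closure N !=set0 by exists p0; exact: subset_closure.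
have [q cq H] := @compact_EVT_min T R u _ cN (@closure_region_compact N) (continuous_subspaceT u_continuous).
rewrite inE in cq; exists q.
have qM : ~ MAXu q.
 move=> qM; have p0M := region_sub rN Np0; apply: p0M; apply/eqP; rewrite eq_le u_le_max.
 by rewrite -[X in X <= _]qM; apply: H; rewrite inE; exact: subset_closure.
have Nq := region_closure rN cq qM; split => //.
apply: local_min_boundary; have : nbhs q N by apply: open_nbhs_nbhs; split => //; exact: region_open.
by apply: filterS => p Np; apply: H; rewrite inE; exact: subset_closure.
Qed.

Lemma MAX_drow a p : dom a p -> MAXu p -> drow (f a) (a @@ p) = 0.
move=> Da Mp; have up : 0 < u p by rewrite Mp u_max_gt0.
have Ix := intr_img Da up.
apply: (local_max_drow (chart_hopen mM a) (interior_img mM Da Ix.2) (@sf_img a)).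
have nA := interior_img mM Da Ix.2; move: nA; apply: filterS => y Ay.
by rewrite /in_chart /= (chart_inv mM Da) Mp u_le_max.
Qed.

Lemma MAX_wfun p : MAXu p -> wfun p = c ^+ 2.
move=> Mp; have [a Da] := chart_exists mM p; rewrite (wfunE Da) /energy /gradsq.
by rewrite MAX_drow // trmx0 mulmx0 mxE add0r /in_chart /= (chart_inv mM Da) Mp.
Qed.

(** For e > 0 the elliptic operator takes at least the value 2 n e u^2 > 0 on w - e u^2 where u > 0.
    So the maximum of this function over the closure of N lies on the boundary of M or on MAX(u),
    where w = c^2; then e tends to 0. *)
Lemma weak_max N : regions u N -> (forall p, rboundary M N p -> wfun p <= c ^+ 2) ->
 forall p, closure N p -> wfun p <= c ^+ 2.
move=> rN Hb.
have key e : 0 < e -> forall p, closure N p -> wfun p - e * (u p * u p) <= c ^+ 2.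
 move=> e0; pose F p := wfun p - e * (u p * u p).
 have cF : continuous F.
  move=> p; apply: continuousB; first exact: wfun_continuous.
  apply: continuousM; first exact: cst_continuous.
  by apply: continuousM; exact: u_continuous.
 have [p0 Np0] := region_nonempty rN.
 have cN : closure N !=set0 by exists p0; exact: subset_closure.
 have [q cq H] := @compact_EVT_max T R F _ cN (@closure_region_compact N) (continuous_subspaceT cF).
 rewrite inE in cq.
 suff Fq : F q <= c ^+ 2 by move=> p cp; apply: le_trans (H p _) Fq; rewrite inE.
 have e2 : 0 <= e * (u q * u q) by nra.
 case: (pselect (MAXu q)) => [Mq|nMq]; first by rewrite /F (MAX_wfun Mq); lra.
 have Nq := region_closure rN cq nMq.
 case: (pselect (mboundary M q)) => [bq|nbq].
  by have := Hb q (conj bq Nq); rewrite /F; lra.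
 exfalso; have uq := st_interior hM nbq.
 have [a Da] := chart_exists mM q; have Ix := intr_img Da uq; have Ax := Ix.1.
 have sw : smooth_on (intr a) (w a) by exact (smooth_energy (intr_lm a) (@sf_intr a)).
 have sff : smooth_on (intr a) (fun y => f a y * f a y) by apply: smooth_onM; exact: sf_intr.
 have se : smooth_on (intr a) (fun y => - e * (f a y * f a y)).
  by apply: smooth_onM => //; exact: smooth_on_cst.
 have sFa : smooth_on (intr a) (fun y => w a y + - e * (f a y * f a y)) by exact: smooth_onD.
 have := ellop_local_max (drift a) (intr_lm a) (intr_nbhs Ix) sFa.
 rewrite (ellopD _ (intr_lm a) Ix sw se) (ellopZ _ (intr_lm a) (- e) Ix sff) ellop_square //.
 have L := ellop_energy_ge0 Ix; have f0 := intr_pos Ix.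
 have P : 0 < e * (n%:R * f a (a @@ q) ^+ 2) by rewrite !mulr_gt0 ?ltr0n.
 move=> K; have : ellop (metric a) (drift a) (w a) (a @@ q)
   + - e * (- 2 * n%:R * f a (a @@ q) ^+ 2) <= 0.
  apply: K; have nN : nbhs q N by apply: open_nbhs_nbhs; split => //; exact: region_open.
  have := chart_inv_nbhs Da uq nN; apply: filterS => y [Ay Ny].
  have cNy : inv a y \in closure N by rewrite inE; exact: subset_closure.
  have := H _ cNy; rewrite /F wfun_inv // (wfunE Da).
  rewrite /in_chart /= (chart_inv mM Da) => H'.
  lra.
 nra.
move=> p cp; rewrite leNgt; apply/negP => wp.
pose d := wfun p - c ^+ 2; have d0 : 0 < d by rewrite subr_gt0.
have U0 : 0 <= u p * u p by nra.
(* Small enough for e u(p)^2 to be at most half of the excess d. *)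
pose e := d / (2 * (u p * u p + 1)).
have den : 0 < 2 * (u p * u p + 1) by nra.
have e0 : 0 < e by rewrite divr_gt0.
have := key e e0 p cp.
have : e * (u p * u p) <= d / 2.
 have -> : d / 2 = e * (u p * u p + 1) by rewrite /e; field; rewrite gt_eqF // ltr_wpDl.
 lra.
by rewrite /d; lra.
Qed.

(** A point of the segment where u is maximal is critical along it, and two such points contradict
    strict concavity. So one half of the segment avoids MAX(u) and remains in N. *)
Lemma line_in_region N a (x e : 'rV[R]_n) (d : R) : regions u N ->
 (forall t : R, `|t| <= d -> intr a (x + t *: e)) ->
 (forall t : R, `|t| <= d -> dd e (dd e (f a)) (x + t *: e) < 0) ->
 N (inv a x) -> 0 < d ->
 N (inv a (x + d *: e)) \/ N (inv a (x + (- d) *: e)).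
move=> rN Hi Hc Nx d0.
have sd : smooth_on (intr a) (dd e (f a)) by apply: smooth_dd (intr_hopen a) _; exact: sf_intr.
have crit (t : R) : `|t| <= d -> f a (x + t *: e) = c -> dd e (f a) (x + t *: e) = 0.
 move=> td E; apply: (local_max_dd (intr_hopen a) (intr_nbhs (Hi t td)) (@sf_intr a)).
 by apply: filterE => y; rewrite E u_le_max.
have half (s : R) : `|s| = d ->
  N (inv a (x + s *: e)) \/ exists t : R, [/\ 0 <= t <= 1, 0 < t * `|s| & f a (x + (t * s) *: e) = c].
 move=> sd'; case: (pselect (exists t : R, 0 <= t <= 1 /\ f a (x + (t * s) *: e) = c)); last first.
  move=> H; left; apply: (region_segment rN (a := a) (x := x)) => // t tI.
  have -> : x + t *: (x + s *: e - x) = x + (t * s) *: e by rewrite [X in t *: X]addrC addKr scalerA.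
  have [Ay _] : intr a (x + (t * s) *: e).
   apply: Hi; rewrite normrM sd' ger0_norm; last by case/andP: tI.
   by rewrite ler_piMl ?(ltW d0) //; case/andP: tI.
  by split => // E; apply: H; exists t.
 move=> [t [/andP[t0 t1] E]]; right; exists t; split; rewrite ?t0 //.
 rewrite sd' mulr_gt0 // lt_neqAle t0 andbT; apply/eqP => z; move: E.
 rewrite -z mul0r scale0r addr0 => E; exact: region_sub rN _ Nx E.
have [Hp|[t1 [/andP[t10 t11] p1 E1]]] := half d (gtr0_norm d0); first by left.
have [Hm|[t2 [/andP[t20 t21] p2 E2]]] := half (- d) (etrans (normrN d) (gtr0_norm d0)); first by right.
rewrite normrN (gtr0_norm d0) in p2; rewrite (gtr0_norm d0) in p1.
have b1 : `|t1 * d| <= d by rewrite gtr0_norm // ler_piMl // ltW.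
have b2 : `|t2 * - d| <= d by rewrite mulrN normrN gtr0_norm // ler_piMl // ltW.
have lo : Num.min (t2 * - d) (t1 * d) = t2 * - d by rewrite min_l; lra.
have hi : Num.max (t2 * - d) (t1 * d) = t1 * d by rewrite max_r; lra.
have sd2 s : Num.min (t2 * - d) (t1 * d) <= s <= Num.max (t2 * - d) (t1 * d) -> `|s| <= d.
 by move: b1 b2; rewrite !ler_norml; lra.
have [s /sd2/Hc sI] := @MVT_unordered R (fun t => dd e (f a) (x + t *: e)) (fun t => dd e (dd e (f a)) (x + t *: e))
  _ _ (fun s sI => is_derive_pd (intr_hopen a) (intr_nbhs (Hi s (sd2 s sI))) sd).
rewrite crit // crit // subrr => /esym/eqP; rewrite mulf_eq0 => /orP[/eqP E|/eqP E]; last by lra.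
nra.
Qed.

Lemma qf_scale (M' : 'M[R]_n) (k : R) v : qf (k *: M') v = k * qf M' v.
by rewrite /qf -scalemxAr -scalemxAl scalemxE. Qed.

Lemma MAX_hess_neg a p : dom a p -> MAXu p -> forall e, qf (hessmx (metric a) (f a) (a @@ p)) e <= 0.
move=> Da Mp e; have up : 0 < u p by rewrite Mp u_max_gt0.
have Ix := intr_img Da up; rewrite (hess_crit _ (MAX_drow Da Mp)).
apply: (local_max_d2 (intr_hopen a) (intr_nbhs Ix) (@sf_intr a)); apply: filterE => y.
by rewrite /in_chart /= (chart_inv mM Da) Mp u_le_max.
Qed.

(** As Du = 0, only the first term of [hess_energy] survives, and at a critical point of w the
    Hessian is the matrix of second partial derivatives. *)
Lemma MAX_energy_d2 a p : dom a p -> MAXu p ->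
 drow (w a) (a @@ p) = 0 /\
 d2 (w a) (a @@ p) = 2 *: (hessmx (metric a) (f a) (a @@ p) *m ginv (metric a) (a @@ p) *m trfree (metric a) (f a) (a @@ p)).
move=> Da Mp; have up : 0 < u p by rewrite Mp u_max_gt0.
have Ix := intr_img Da up; have Ax := Ix.1; have d0 := MAX_drow Da Mp.
have E0 : gradup (metric a) (f a) (a @@ p) = 0 by rewrite /gradup d0 mul0mx.
have dw : drow (w a) (a @@ p) = 0 by rewrite (drow_energy (lm_img a) (@sf_img a) Ax) E0 mul0mx scaler0.
split => //; rewrite -(hess_crit (metric a) dw); apply/row_matrixP => j.
have HE := hess_energy (lm_img a) (@sf_img a) j Ax.
by rewrite HE E0 mul0mx addr0 linearZ /= !row_mul.
Qed.

Lemma MAX_trfree N a p : regions u N -> (forall q, closure N q -> wfun q <= c ^+ 2) ->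
 closure N p -> MAXu p -> dom a p -> trfree (metric a) (f a) (a @@ p) = 0.
move=> rN wN cp Mp Da; have up : 0 < u p by rewrite Mp u_max_gt0.
have Ix := intr_img Da up; have Ax := Ix.1; have d0 := MAX_drow Da Mp.
have [dw Dw] := MAX_energy_d2 Da Mp.
set x := a @@ p in Ix Ax d0 dw Dw *.
have fx : f a x = c by rewrite /in_chart /= (chart_inv mM).
have sw : smooth_on (intr a) (w a) by exact (smooth_energy (intr_lm a) (@sf_intr a)).
have wx : w a x = c ^+ 2 by rewrite -(wfunE Da) (MAX_wfun Mp).
pose H := hessmx (metric a) (f a) x; pose h := ginv (metric a) x; pose g := metric a x.
have Hle := MAX_hess_neg Da Mp : forall e, qf H e <= 0.
have sH : H^T = H by exact: (hess_sym (lm_img a) (@sf_img a) Ax).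
have TE : trfree (metric a) (f a) x = H + c *: g by rewrite /trfree fx.
have hg : h *m g = 1%:M by exact: ginv_g (lm_img a) _ Ax.
have Qle e : qf (H *m h *m (H + c *: g)) e <= 0.
 (* H is nonpositive, so a null direction of H lies in its kernel and the form vanishes on it. *)
 have [q0|q0] := eqVneq (qf H e) 0.
  by rewrite /qf 2!mulmxA (qf_le0_kernel sH Hle q0) !mul0mx mxE.
 have qn : qf H e < 0 by rewrite lt_neqAle q0 Hle.
 rewrite leNgt; apply/negP => Qp.
 have Q2 : 0 < qf (d2 (w a) x) e by rewrite Dw qf_scale -/h -/H TE mulr_gt0.
 have dde : dd e (w a) x = 0.
  by apply: big1 => i _; move/rowP/(_ i): dw; rewrite !mxE => ->; rewrite mulr0.
 have [e1 e10 He1] := d2_pos_increase (intr_hopen a) (intr_nbhs Ix) sw dde Q2.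
 have sdd : smooth_on (intr a) (dd e (dd e (f a))).
  by do 2![apply: smooth_dd (intr_hopen a) _]; exact: sf_intr.
 have ddn : dd e (dd e (f a)) x < 0.
  by rewrite (dd_dd e (intr_hopen a) Ix (@sf_intr a)) -(hess_crit (metric a) d0).
 have ddn' : 0 < - dd e (dd e (f a)) x by rewrite oppr_gt0.
 have [d1 d10 Hd1] := smooth_on_cont sdd Ix ddn'.
 have /nbhs_normP[d2' d20 Hd2] := intr_nbhs Ix.
 pose D := Num.min d1 d2'; have D0 : 0 < D by rewrite lt_min d10.
 pose k := `|e| + 1; have k0 : 0 < k by rewrite ltr_wpDl.
 (* Half-length of the segments: w exceeds c^2 at x + d e and x - d e, and segments centred within
    D/2 of x stay where u is strictly concave along e. *)
 pose d := Num.min e1 (D / (2 * k)) / 2.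
 have m0 : 0 < Num.min e1 (D / (2 * k)) by rewrite lt_min e10 divr_gt0 // mulr_gt0.
 have dp : 0 < d by rewrite divr_gt0.
 have dm : d < Num.min e1 (D / (2 * k)) by rewrite ltr_pdivrMr // ltr_pMr // ltr1n.
 move: dm; rewrite lt_min => /andP[de1 dk].
 have dk' : d * k <= D / 2.
  by rewrite -ler_pdivlMr //; apply: le_trans (ltW dk) _; rewrite invfM mulrA.
 have near (y : 'rV[R]_n) (t : R) : `|y - x| < D / 2 -> `|t| <= d -> `|y + t *: e - x| < D.
  move=> yx td; rewrite addrAC; apply: (le_lt_trans (ler_normD _ _)).
  rewrite [ltRHS](splitr D); apply: ltr_leD => //; rewrite normrZ; apply: le_trans dk'.
  by apply: ler_pM => //; rewrite lerDl.
 have inI (y : 'rV[R]_n) (t : R) : `|y - x| < D / 2 -> `|t| <= d -> intr a (y + t *: e).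
  by move=> yx td; apply: Hd2; have := near y t yx td; rewrite lt_min => /andP[].
 have big (t : R) : `|t| = d -> c ^+ 2 < w a (x + t *: e).
  by move=> td; rewrite -wx; apply: He1; rewrite td dp.
 have xx : `|x - x| < D / 2 by rewrite subrr normr0 divr_gt0.
 have far t : `|t| = d -> exists2 r, 0 < r & forall y, `|y - x| < D / 2 ->
   `|y - x| < r -> c ^+ 2 < w a (y + t *: e).
  move=> td; have wp : 0 < w a (x + t *: e) - c ^+ 2 by rewrite subr_gt0 big.
  have It : intr a (x + t *: e) by apply: inI => //; rewrite td.
  have [r r0 Hr] := smooth_on_cont sw It wp; exists r => // y yx yr.
  have : `|w a (y + t *: e) - w a (x + t *: e)| < w a (x + t *: e) - c ^+ 2.
   apply: Hr; first by apply: inI => //; rewrite td.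
   by rewrite opprD addrACA subrr addr0.
  by rewrite ltr_distl => /andP[]; lra.
 have [r1 r10 H1] := far d (gtr0_norm dp).
 have [r2 r20 H2] := far (- d) (etrans (normrN d) (gtr0_norm dp)).
 pose r := Num.min (D / 2) (Num.min r1 r2).
 have r0 : 0 < r by rewrite !lt_min divr_gt0 //= r10.
 (* A point of N so close to x that w still exceeds c^2 at both ends of the segment centred at it;
    yet one of these ends lies in N. *)
 have [q [Nq [Dq]]] := cp _ (chart_nbhs mM Da r0).
 rewrite !lt_min => /and3P[qD q1 q2].
 have := @line_in_region N a (a @@ q) e d rN (inI _ ^~ qD) _ _ dp.
 rewrite (chart_inv mM Dq) => /(_ _ Nq) L.
 have concl t : `|t| = d -> N (inv a (a @@ q + t *: e)) -> w a (a @@ q + t *: e) <= c ^+ 2.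
  move=> td Nt; rewrite -wfun_inv; last by apply: (inI _ _ qD _).1; rewrite td.
  by apply: wN; exact: subset_closure.
 case: L => [t td|/concl|/concl].
 - have := Hd1 (a @@ q + t *: e) (inI _ _ qD td).
  have := near _ _ qD td; rewrite lt_min => /andP[nd _] /(_ nd).
  by rewrite ltr_distl => /andP[_]; rewrite addrN.
 - by rewrite (gtr0_norm dp) => /(_ erefl); rewrite leNgt H1.
 - by rewrite normrN (gtr0_norm dp) => /(_ erefl); rewrite leNgt H2.
apply: (trace_normsq (lm_img a) Ax _).2; first exact: (trfree_sym (lm_img a) (@sf_img a) Ax).
have := trace_le0 (lm_img a) Ax Qle; rewrite TE.
have trT : \tr (h *m (H + c *: g)) = 0.
 by rewrite -TE; apply: (trace_trfree (lm_img a) (@sf_img a) (@chart_laplacian a) Ax).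
(* As H + c g = T and h g = 1, h T h T = h H h T + c h T. *)
have -> : \tr (h *m (H + c *: g) *m (h *m (H + c *: g))) = \tr (h *m (H *m h *m (H + c *: g))) + c * \tr (h *m (H + c *: g)).
 rewrite {1}mulmxDr -scalemxAr hg mulmxDl -scalemxAl mul1mx mxtrace_addE linearZ.
 by rewrite !mulmxA.
nra.
Qed.

(** From P = S^T S: v is recovered from v S^T by a fixed matrix, whose entries bound |v| by C times
    the square root of the form. *)
Lemma posdef_lower (P : 'M[R]_n) : P^T = P -> posdef P ->
 exists2 k : R, 0 < k & forall v, k * `|v| ^+ 2 <= qf P v.
move=> sP pP; have [S [uS ES]] := cholesky sP pP.
pose W := invmx S^T; pose C := 1 + \sum_i \sum_j `|W i j|.
have C1 : 1 <= C by rewrite lerDl; do 2![apply: sumr_ge0 => ? _].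
have C0 : 0 < C by lra.
exists (C ^- 2); first by rewrite invr_gt0 exprn_gt0.
move=> v; rewrite mulrC ler_pdivrMr ?exprn_gt0 //.
pose z := v *m S^T; have vz : v = z *m W by rewrite mulmxK // unitmx_tr.
have qz : qf P v = \sum_j z 0 j ^+ 2.
 rewrite /qf ES mulmxA -mulmxA -[X in _ *m X]trmxK trmx_mul trmxK mxE.
 by apply: eq_bigr => j _; rewrite [_^T _ _]mxE.
have q0 : 0 <= qf P v by rewrite qz; apply: sumr_ge0 => j _; exact: sqr_ge0.
have zj j : `|z 0 j| <= Num.sqrt (qf P v).
 rewrite -sqrtr_sqr ler_sqrt // qz (bigD1 j) //= lerDl.
 by apply: sumr_ge0 => i _; exact: sqr_ge0.
have : `|v| <= C * Num.sqrt (qf P v).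
 apply: mx_norm_le => [|i]; first by rewrite mulr_ge0 // ltW.
 rewrite {1}vz mxE; apply: (le_trans (ler_norm_sum _ _ _)).
 apply: (@le_trans _ _ (\sum_j `|W j i| * Num.sqrt (qf P v))).
  by apply: ler_sum => j _; rewrite normrM mulrC ler_wpM2l.
 rewrite -mulr_suml ler_wpM2r // /C addrC ler_wpDr //.
 by apply: ler_sum => j _; rewrite (bigD1 i) //= lerDl; apply: sumr_ge0.
move=> H; apply: (@le_trans _ _ ((C * Num.sqrt (qf P v)) ^+ 2)).
 by rewrite ler_pXn2r // nnegrE // mulr_ge0 // ltW.
by rewrite exprMn sqr_sqrtr // mulrC.
Qed.

Lemma qf_bound (E : 'M[R]_n) (e : R) v : (forall i j, `|E i j| <= e) ->
 `|qf E v| <= n%:R * n%:R * e * `|v| ^+ 2.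
move=> H; rewrite /qf mxE; apply: (le_trans (ler_norm_sum _ _ _)).
apply: (@le_trans _ _ (\sum_(j < n) n%:R * e * `|v| ^+ 2)); last first.
 by rewrite sumr_const card_ord -[X in X <= _]mulr_natl !mulrA.
apply: ler_sum => j _; rewrite normrM [v^T _ _]mxE mulrA.
apply: ler_pM => //; last exact: mx_norm_coord.
rewrite mxE; apply: (le_trans (ler_norm_sum _ _ _)).
apply: (@le_trans _ _ (\sum_(k < n) e * `|v|)); last by rewrite sumr_const card_ord -[X in X <= _]mulr_natl !mulrA.
by apply: ler_sum => k _; rewrite normrM mulrC; apply: ler_pM => //; exact: mx_norm_coord.
Qed.

Lemma negdef_near A (F : 'rV[R]_n -> 'M[R]_n) x : smooth_mx A F -> nbhs x A -> (F x)^T = F x ->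
 (forall v, v != 0 -> qf (F x) v < 0) ->
 exists2 d : R, 0 < d & forall y, `|y - x| < d -> A y /\ forall v, v != 0 -> qf (F y) v < 0.
move=> sF nA sx nx; have Ax := nbhs_singleton nA.
have [k k0 Hk] : exists2 k, 0 < k & forall v, k * `|v| ^+ 2 <= qf (- F x) v.
 apply: posdef_lower; first by rewrite linearN /= sx.
 by move=> v v0; have := nx v v0; rewrite mulmxN mulNmx oppmxE oppr_gt0.
(* Then n^2 e = k/2, so perturbing the entries costs half of the coercivity constant. *)
pose e := k / (2 * (n%:R * n%:R)); have nn : (0 : R) < n%:R * n%:R by rewrite mulr_gt0 // ltr0n.
have e0 : 0 < e by rewrite divr_gt0 // mulr_gt0.
have near i j : \forall y \near x, `|F y i j - F x i j| < e.
 have [d d0 H] := smooth_on_cont (sF i j) Ax e0.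
 have : \forall y \near x, `|y - x| < d by apply/nbhs_normP; exists d.
 by move: nA; apply: filterS2 => y Ay; exact: H.
have /nbhs_normP[d d0 H] : \forall y \near x, A y /\ forall i j, `|F y i j - F x i j| < e.
 have near1 i : \forall y \near x, forall j, `|F y i j - F x i j| < e by exact (filter_forall _ (near i)).
 have : \forall y \near x, forall i j, `|F y i j - F x i j| < e by exact (filter_forall _ near1).
  by move: nA; apply: filterS2 => y.
exists d => // y /H[Ay Hy]; split => // v v0.
have E : qf (F y) v = qf (F y - F x) v - qf (- F x) v.
 by rewrite /qf mulmxBr mulmxBl mulmxN mulNmx !(addmxE, oppmxE); ring.
have B : `|qf (F y - F x) v| <= n%:R * n%:R * e * `|v| ^+ 2.
 by apply: qf_bound => i j; rewrite addmxE oppmxE ltW.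
have v1 : 0 < `|v| ^+ 2 by rewrite exprn_gt0 // normr_gt0.
have := Hk v; move: B; rewrite (_ : n%:R * n%:R * e = k / 2); last first.
 by rewrite /e; field; rewrite pnatr_eq0 -lt0n.
have kp : 0 < k * `|v| ^+ 2 by nra.
rewrite ler_norml => /andP[_]; lra.
Qed.

(** At p the Hessian is - c g, so u is strictly concave along segments in a small ball; its
    derivative along a segment cannot vanish both at p and at another maximum point. *)
Lemma MAX_isolated a p : dom a p -> MAXu p -> trfree (metric a) (f a) (a @@ p) = 0 ->
 exists2 d : R, 0 < d & forall y, `|y - a @@ p| < d -> intr a y /\ (y <> a @@ p -> f a y <> c).
move=> Da Mp T0; have up : 0 < u p by rewrite Mp u_max_gt0.
have Ix := intr_img Da up; have Ax := Ix.1; have d0 := MAX_drow Da Mp.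
set x := a @@ p in T0 Ix Ax d0 *.
have fx : f a x = c by rewrite /in_chart /= (chart_inv mM).
have E : d2 (f a) x = - (c *: metric a x).
 by rewrite -(hess_crit (metric a) d0); apply/eqP; rewrite -addr_eq0 -fx; apply/eqP.
have sD : smooth_mx (intr a) (d2 (f a)).
 move=> i j; apply: (smooth_on_ext (f := pd i (pd j (f a)))) => [y _|]; first by rewrite mxE.
 by apply: smooth_on_pd (intr_hopen a) _; apply: smooth_on_pd (intr_hopen a) _; exact: sf_intr.
have [|v v0|d dp H] := negdef_near sD (intr_nbhs Ix).
- by rewrite E linearN /= linearZ /= (lm_sym (lm_img a) Ax).
- rewrite E -scaleNr qf_scale mulNr oppr_lt0 mulr_gt0 ?u_max_gt0 //.
 exact: lm_pos (lm_img a) _ Ax _ v0.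
exists d => // y yd; split; first by have [] := H y yd.
move=> yx fy; pose e := y - x.
have e0 : e != 0 by rewrite subr_eq0; apply/eqP.
have inI (t : R) : 0 <= t <= 1 -> `|x + t *: e - x| < d.
 by move=> tI; apply: segment_ball => //; rewrite subrr normr0.
have sd : smooth_on (intr a) (dd e (f a)) by apply: smooth_dd (intr_hopen a) _; exact: sf_intr.
have crit z : intr a z -> f a z = c -> dd e (f a) z = 0.
 move=> Iz fz; apply: (local_max_dd (intr_hopen a) (intr_nbhs Iz) (@sf_intr a)).
 by apply: filterE => q; rewrite fz u_le_max.
have [s sI] := @MVT_unordered R (fun t => dd e (f a) (x + t *: e)) (fun t => dd e (dd e (f a)) (x + t *: e))
  0 1 (fun s sI => is_derive_pd (intr_hopen a) (intr_nbhs (H _ (inI s ltac:(by move: sI; rewrite min_l ?max_r ?ler01))).1) sd).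
have sI' : 0 <= s <= 1 by move: sI; rewrite min_l ?max_r ?ler01.
rewrite scale0r addr0 scale1r {1}/e (addrC x) subrK.
rewrite (crit y (H y yd).1 fy) (crit x Ix fx) subrr subr0 mulr1 => Z.
have [Is Hs] := H _ (inI s sI').
by have := Hs e e0; rewrite -(dd_dd e (intr_hopen a) Is (@sf_intr a)) -Z ltxx.
Qed.

(** A point of the ball is joined to a point q0 of N by a segment, which contains p only if the
    point lies on the ray opposite to q0. The points of that ray are limits of points off it,
    because n > 1. *)
Lemma closure_nbhs_MAX N a p : (1 < n)%N -> regions u N -> closure N p -> MAXu p -> dom a p ->
 trfree (metric a) (f a) (a @@ p) = 0 -> \forall q \near p, closure N q.
move=> n1 rN cp Mp Da T0; have [d d0 H] := MAX_isolated Da Mp T0.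
pose x := a @@ p.
have C := chart_nbhs mM Da d0; have [q0 [Nq0 [D0 q0d]]] := cp _ C.
pose y0 := a @@ q0; pose e := y0 - x.
have inv0 : inv a y0 = q0 by exact: chart_inv.
have ne : e != 0.
 rewrite subr_eq0; apply/eqP => E; apply: (region_sub rN Nq0).
 by rewrite -inv0 E /x (chart_inv mM Da).
(* With e_i nonzero, a shift along a basis vector j different from i leaves the line spanned by
   e. *)
have [i ei] : exists i, e 0 i != 0.
 apply: contrapT => K; move/eqP: ne; apply; apply/rowP => i; rewrite [RHS]mxE.
 by apply/eqP; apply: contrapT => /negP z; apply: K; exists i.
have [j ji] : exists j : 'I_n, j != i.
 case: (eqVneq i o) => [->|io]; last by exists o; rewrite eq_sym.
 by exists (Ordinal n1).
have good y : `|y - x| < d -> (forall s : R, y - x <> - s *: e) -> N (inv a y).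
 move=> yd Hy; apply: (region_segment rN (a := a) (x := y0)); last by rewrite inv0.
 move=> t tI; have It := H _ (segment_ball q0d yd tI); split; first exact: It.1.1.
 apply: It.2 => E.
 have t0 : t != 0.
  apply/eqP => tz; move: E; rewrite tz scale0r addr0 => E; move/eqP: ne; apply.
  by rewrite /e /y0 E subrr.
 apply: (Hy ((1 - t) / t)); apply/rowP => k; move/rowP/(_ k): E; rewrite !mxE -/x => E.
 apply: (mulfI t0); rewrite -/x.
 have -> : t * (- ((1 - t) / t) * (y0 0 k - x 0 k)) = - (1 - t) * (y0 0 k - x 0 k) by field.
 lra.
apply: filterS C => q [Dq qd] U nU.
have nU' : nbhs (inv a (a @@ q)) U by rewrite chart_inv.
pose y := a @@ q.
case: (pselect (exists s, y - x = - s *: e)) => [[s Es]|K]; last first.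
 exists q; split; last exact: nbhs_singleton.
 by rewrite -(chart_inv mM Dq); apply: good => // s Es; apply: K; exists s.
have [r r0 Hr] := chart_inv_near mM (chart_img Dq) nU'.
pose tau := Num.min r (d - `|y - x|) / 2.
have m0 : 0 < Num.min r (d - `|y - x|) by rewrite lt_min r0 subr_gt0.
have tp : 0 < tau by rewrite divr_gt0.
have : tau < Num.min r (d - `|y - x|) by rewrite ltr_pdivrMr // ltr_pMr // ltr1n.
rewrite lt_min => /andP[tr td].
pose y' := y + tau *: basis j.
have nt : `|tau *: basis j : 'rV[R]_n| <= tau.
 by rewrite normrZ gtr0_norm // ler_piMr ?norm_basis_le // ltW.
have y'd : `|y' - x| < d.
 by rewrite addrAC; apply: (le_lt_trans (ler_normD _ _)); lra.
exists (inv a y'); split.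
 apply: good => // s' Es'; move: Es'; rewrite addrAC Es => /rowP Es'.
 have bj : (basis j : 'rV[R]_n) 0 j = 1 by rewrite mxE !eqxx.
 have bi : (basis j : 'rV[R]_n) 0 i = 0 by rewrite mxE eq_sym (negbTE ji).
 have := Es' i; have := Es' j; rewrite !(addmxE, scalemxE) bj bi => Ej Ei.
 have /eqP : (s' - s) * e 0 i = 0 by rewrite addmxE; move: Ei; move: (y0 0 i + _) => z; lra.
 rewrite mulf_eq0 (negbTE ei) orbF subr_eq0 => /eqP ss; move: Ej; rewrite ss.
 lra.
apply: Hr; first by have [[]] := H _ y'd.
by rewrite addrAC subrr add0r; exact: le_lt_trans tr.
Qed.

Lemma connected_clopen (D : set T) : open D -> closed D -> D !=set0 -> forall p, D p.
move=> oD cD [p0 D0].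
have -> : D = setT.
 apply: (st_connected hM); first by exists p0.
 - by exists D => //; rewrite setTI.
 - by exists D => //; rewrite setTI.
by [].
Qed.

Lemma energy_const N : (1 < n)%N -> regions u N -> (forall p, rboundary M N p -> wfun p <= c ^+ 2) ->
 forall p, wfun p = c ^+ 2.
move=> n1 rN Hb; have wN := weak_max rN Hb.
have cT : forall p, closure N p.
 (* The closure of N is open: around its points off MAX(u) by [region_open], around the others by
    [closure_nbhs_MAX]. So N is dense and w <= c^2 on M. *)
 apply: connected_clopen; [|exact: closed_closure|]; last first.
  by have [p Np] := region_nonempty rN; exists p; exact: subset_closure.
 rewrite openE => p cp; case: (pselect (MAXu p)) => [Mp|nM]; last first.
  have Np := region_closure rN cp nM.
  have : nbhs p N by apply: open_nbhs_nbhs; split => //; exact: region_open rN.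
  by apply: filterS => q; exact: subset_closure.
 have [a Da] := chart_exists mM p.
 exact: (closure_nbhs_MAX n1 rN cp Mp Da (MAX_trfree rN wN cp Mp Da)).
have wle q : wfun q <= c ^+ 2 by apply: wN; exact: cT.
have smax a x : intr a x -> w a x = c ^+ 2 -> \forall y \near x, intr a y /\ w a y = c ^+ 2.
 move=> Ix wx; have nI := intr_nbhs Ix.
 have sw : smooth_on (intr a) (w a) by exact (smooth_energy (intr_lm a) (@sf_intr a)).
 have L := strong_max_local (intr_lm a) (@smooth_drift a) nI sw (fun y Iy => ellop_energy_ge0 Iy) _ wx.
 have : \forall y \near x, w a y = c ^+ 2.
  by apply: L => y [Ay _]; rewrite -wfun_inv.
 by move: nI; apply: filterS2 => y.
(* S is also closed: near a limit point, possibly on the boundary, the equality w = c^2 spreads from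
   a point of S with u > 0 along segments on which u > 0, and then to u = 0 by continuity. *)
pose S := interior [set q | wfun q = c ^+ 2].
have [[p Mp] _] := u_max_spec.
have pull a q : dom a q -> 0 < u q -> wfun q = c ^+ 2 -> S q.
 move=> Da uq wq; have wx : w a (a @@ q) = c ^+ 2 by rewrite -wfunE.
 have := chart_near mM Da (smax a _ (intr_img Da uq) wx).
 by apply: filterS => q' [Dq' [_ E]]; rewrite /= (wfunE Dq').
suff HS q : S q by move=> q; have := nbhs_singleton (HS q).
move: q; apply: connected_clopen; first exact: open_interior; last first.
 have [a Da] := chart_exists mM p; exists p; apply: (pull a) => //; last exact: MAX_wfun.
 by rewrite Mp u_max_gt0.
move=> q cq; have [a Da] := chart_exists mM q.
have [d d0 Hd] := chart_ball Da.
have [q1 [Sq1 [D1 q1d]]] := cq _ (chart_nbhs mM Da d0).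
have nS : nbhs q1 (S `&` [set q' | dom a q' /\ `|a @@ q' - a @@ q| < d]).
 apply: filterI; first by apply: open_nbhs_nbhs; split => //; exact: open_interior.
 apply: (@chart_near _ _ _ M mM a q1 [set y | `|y - a @@ q| < d]) => //.
 apply/nbhs_normP; exists (d - `|a @@ q1 - a @@ q|); first by lra.
 move=> y /= yd; rewrite -(subrK (a @@ q1) y) -addrA.
 by apply: (le_lt_trans (ler_normD _ _)); lra.
have [q2 [Sq2 [D2 q2d]] u2] := near_boundary_interior nS.
have z2 : 0 < (a @@ q2) 0 o by apply/u_pos_coord.
have all y : `|y - a @@ q| < d -> 0 < y 0 o -> w a y = c ^+ 2.
 move=> yd y0; pose gam t := a @@ q2 + t *: (y - a @@ q2).
 have inI t : 0 <= t <= 1 -> intr a (gam t).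
  move=> tI; have /andP[t0 t1] := tI.
  have g0 : 0 < gam t 0 o.
   have -> : gam t 0 o = (1 - t) * (a @@ q2) 0 o + t * y 0 o by rewrite !mxE; ring.
   nra.
  by split => //; apply: Hd; [exact: segment_ball|exact: ltW].
 have sw : smooth_on (intr a) (w a) by exact (smooth_energy (intr_lm a) (@sf_intr a)).
 have near_t t Q : (\forall z \near gam t, Q z) -> \forall s \near t, Q (gam s).
  move=> nQ; have [r r0 Hr] := line_near (y - a @@ q2) nQ.
  apply/nbhs_ballP; exists r => //= s; rewrite /ball /= distrC => st.
  by have := Hr _ st; rewrite -addrA -scalerDl (addrC t) subrK.
 have E1 : gam 1 = y by rewrite /gam scale1r addrC subrK.
 have E0 : gam 0 = a @@ q2 by rewrite /gam scale0r addr0.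
 rewrite -E1; apply: (@segment_clopen R (fun t => w a (gam t) = c ^+ 2)); last by lra.
 - move=> t tI wt; have := near_t t _ (smax a _ (inI t tI) wt).
  by apply: filterS => s [_ E].
 - move=> t tI wt; have e0 : 0 < `|w a (gam t) - c ^+ 2| by rewrite normr_gt0 subr_eq0; apply/eqP.
  have [r r0 Hr] := smooth_on_cont sw (inI t tI) e0.
  have nb : \forall z \near gam t, `|z - gam t| < r by apply/nbhs_normP; exists r.
  have := near_t t _ nb; apply: filterS => s sr sI E.
  by have := Hr _ (inI s sI) sr; rewrite E distrC ltxx.
 - rewrite E0 -(wfunE D2); exact: nbhs_singleton Sq2.
have := chart_nbhs mM Da d0; apply: filterS => q' [Dq' q'd] /=.
rewrite (wfunE Dq'); set y := a @@ q' in q'd *.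
apply: contrapT => wy; have e0 : 0 < `|w a y - c ^+ 2| by rewrite normr_gt0 subr_eq0; apply/eqP.
have sw : smooth_on (img a) (w a) by exact (smooth_energy (lm_img a) (@sf_img a)).
have [r r0 Hr] := smooth_on_cont sw (chart_img Dq') e0.
pose t := Num.min r (d - `|y - a @@ q|) / 2.
have m0 : 0 < Num.min r (d - `|y - a @@ q|) by rewrite lt_min r0 subr_gt0.
have tp : 0 < t by rewrite divr_gt0.
have : t < Num.min r (d - `|y - a @@ q|) by rewrite ltr_pdivrMr // ltr_pMr // ltr1n.
rewrite lt_min => /andP[tr td].
have nt : `|t *: basis o : 'rV[R]_n| <= t by rewrite normrZ gtr0_norm // ler_piMr ?norm_basis_le // ltW.
have y'0 : 0 < (y + t *: basis o) 0 o.
 by rewrite !mxE mulr1 ltr_wpDl //; exact: chart_halfspace.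
have y'd : `|y + t *: basis o - a @@ q| < d.
 by rewrite addrAC; apply: (le_lt_trans (ler_normD _ _)); lra.
have Ay' : img a (y + t *: basis o) by apply: Hd => //; exact: ltW.
have y'y : `|y + t *: basis o - y| < r by rewrite addrAC subrr add0r; exact: le_lt_trans tr.
by have := Hr _ Ay' y'y; rewrite all // distrC ltxx.
Qed.

(** For constant w the square |T|^2 in [ellop_energy] vanishes where u > 0; the boundary follows by
    continuity. *)
Lemma trfree_eq0 : (forall p, wfun p = c ^+ 2) -> forall a x, img a x -> trfree (metric a) (f a) x = 0.
move=> wE a; have I0 x : intr a x -> trfree (metric a) (f a) x = 0.
 move=> Ix; have Ax := Ix.1.
 apply: (trace_normsq (lm_img a) Ax (trfree_sym (lm_img a) (@sf_img a) Ax)).2.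
 have sw : smooth_on (intr a) (w a) by exact (smooth_energy (intr_lm a) (@sf_intr a)).
 have := ellop_local_max (drift a) (intr_lm a) (intr_nbhs Ix) sw.
 rewrite ellop_energy // => H; rewrite -(ler_pM2l (ltr0Sn R 1)) mulr0; apply: H.
 by have := intr_nbhs Ix; apply: filterS => y [Ay _]; rewrite -!wfun_inv // !wE.
move=> x Ax; apply/matrixP => i j; rewrite [RHS]mxE; apply: contrapT => /eqP T0.
have e0 : 0 < `|trfree (metric a) (f a) x i j| by rewrite normr_gt0.
have [r r0 Hr] := smooth_on_cont (smooth_trfree (lm_img a) (@sf_img a) i j) Ax e0.
have Da := chart_dom_inv mM Ax; have xE := chart_mapK mM Ax.
have [d d0 Hd] := chart_ball Da; rewrite xE in Hd.
pose t := Num.min r d / 2; have m0 : 0 < Num.min r d by rewrite lt_min r0.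
have tp : 0 < t by rewrite divr_gt0.
have : t < Num.min r d by rewrite ltr_pdivrMr // ltr_pMr // ltr1n.
rewrite lt_min => /andP[tr td].
have nt : `|t *: basis o : 'rV[R]_n| <= t by rewrite normrZ gtr0_norm // ler_piMr ?norm_basis_le // ltW.
have xo : 0 <= x 0 o by have := chart_halfspace n0 mM Da; rewrite xE.
have y0 : 0 < (x + t *: basis o) 0 o by rewrite !mxE mulr1 ltr_wpDl.
have yx : `|x + t *: basis o - x| = `|t *: basis o : 'rV[R]_n| by rewrite addrAC subrr add0r.
have Ay : img a (x + t *: basis o) by apply: Hd; [rewrite yx; exact: le_lt_trans td|exact: ltW].
have yr : `|x + t *: basis o - x| < r by nra.
by have := Hr _ Ay yr; rewrite I0 // mxE sub0r normrN ltxx.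
Qed.

Lemma sqr_ge0_inj (r s : R) : 0 <= r -> 0 <= s -> r ^+ 2 = s ^+ 2 -> r = s.
nra. Qed.

Lemma sqr_ge0_le (r s : R) : 0 <= r -> r <= s -> r ^+ 2 <= s ^+ 2.
nra. Qed.

(** Mean value theorem up to the boundary: half-balls are convex, and the extension of F is smooth
    along the whole segment. *)
Lemma mvt_near (A : set 'rV[R]_n) (F : 'rV[R]_n -> R) x : hopen A -> smooth_on A F -> A x ->
 exists2 d : R, 0 < d & forall y z, A y -> A z -> `|y - x| < d -> `|z - x| < d ->
  exists s : R, [/\ 0 <= s <= 1, A (y + s *: (z - y)), `|y + s *: (z - y) - x| < d &
   F z - F y = dd (z - y) F (y + s *: (z - y))].
move=> hA sF Ax; have [V [G e]] := (smooth_onP _ _).1 sF x Ax; have [oV Vx sG E] := e.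
have [U oU AU] := hA; have Ux : U x by move: Ax; rewrite AU => -[].
have /nbhs_normP[d d0 H] : \forall y \near x, V y /\ U y.
 by apply: filterI; apply: open_nbhs_nbhs.
have inA y : `|y - x| < d -> 0 <= y 0 o -> A y.
 by move=> /H[_ Uy] y0; rewrite AU; split => //; exact/halfspaceE.
have A0 y : A y -> 0 <= y 0 o by rewrite AU => -[_] /halfspaceE.
exists d => // y z Ay Az yd zd.
have seg s : 0 <= s <= 1 -> `|y + s *: (z - y) - x| < d /\ A (y + s *: (z - y)).
 move=> sI; have sd := segment_ball yd zd sI; split => //.
 by apply: inA => //; apply: segment_coord => //; exact: A0.
have der (s : R) : 0 <= s <= 1 -> is_derive s 1 (fun t => G (y + t *: (z - y))) (dd (z - y) F (y + s *: (z - y))).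
 move=> sI; have [sd As] := seg s sI; have [Vs _] := H _ sd.
 have dG : differentiable G (y + s *: (z - y)) by have [K _] := sG 1%N; exact: K.
 have := is_derive_line dG; rewrite (derive_sumE _ dG).
 rewrite (eq_bigr (fun i => (z - y) 0 i * pd i F (y + s *: (z - y)))) // => i _.
 by rewrite (pdE i hA As (local_extS e Vs)).
have [s sI] := @MVT_unordered R (fun t => G (y + t *: (z - y))) (fun s => dd (z - y) F (y + s *: (z - y)))
 0 1 (fun s sI => der s ltac:(by move: sI; rewrite min_l ?max_r)).
rewrite min_l ?max_r // in sI; have [sd As] := seg s sI.
rewrite scale0r addr0 scale1r (addrC y) subrK subr0 mulr1 => Q.
by exists s; split => //; rewrite -Q !E //; [have [] := H _ yd|have [] := H _ zd].
Qed.

(** The static equation at u = 0 reads D^2 u = 0. *)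
Lemma boundary_trfree a x : img a x -> u (inv a x) = 0 -> trfree (metric a) (f a) x = 0.
move=> Ax u0; have f0 : f a x = 0 by [].
apply/matrixP => i j; rewrite addmxE scalemxE f0 mul0r addr0 [RHS]mxE.
by have := chart_ricci i j Ax; rewrite f0 mul0r mulr0 mul0r addr0 [hessmx _ _ _ _ _]mxE => <-.
Qed.

(** The differential dw = 2 T(Du) vanishes on the boundary by [boundary_trfree], and the chart
    segment between two boundary points stays in the boundary. *)
Lemma energy_boundary_const q : \forall q' \near q, u q = 0 -> u q' = 0 -> wfun q' = wfun q.
case: (pselect (u q = 0)) => [uq|nq]; last by near=> q' => /nq.
have [a Da] := chart_exists mM q.
have sw : smooth_on (img a) (w a) by exact (smooth_energy (lm_img a) (@sf_img a)).
have [d d0 H] := mvt_near (chart_hopen mM a) sw (chart_img Da).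
have := chart_nbhs mM Da d0; apply: filterS => q' [Dq' q'd] _ uq'.
have bq : (a @@ q) 0 o = 0 by apply/mboundaryP/boundary_u0.
have bq' : (a @@ q') 0 o = 0 by apply/mboundaryP/boundary_u0.
have dx : `|a @@ q - a @@ q| < d by rewrite subrr normr0.
have [s [sI As sd E]] := H _ _ (chart_img Da) (chart_img Dq') dx q'd.
apply/eqP; rewrite (wfunE Da) (wfunE Dq') -subr_eq0 E; apply/eqP; apply: big1 => i _.
set y := _ + s *: _ in As *.
have y0 : y 0 o = 0 by rewrite !mxE bq bq'; ring.
have uy : u (inv a y) = 0.
 by apply/boundary_u0/(mboundaryP n0 mM rM (chart_dom_inv mM As)); rewrite chart_mapK.
have := drow_energy (lm_img a) (@sf_img a) As; rewrite (boundary_trfree As uy) mulmx0 scaler0.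
by move=> /rowP/(_ i); rewrite !mxE => ->; rewrite mulr0.
Unshelve. all: by end_near. Qed.

Lemma energy_component_const D p q : D `<=` mboundary M -> connected_component D p q ->
 wfun q = wfun p.
move=> DM [C [Cp CD cC] Cq].
pose B := C `&` [set q' | wfun q' = wfun p].
suff EB : B = C by move: Cq; rewrite -EB => -[].
have u0 q' : C q' -> u q' = 0 by move=> /CD/DM/boundary_u0.
apply: cC; first by exists p.
- exists (interior [set q' | u q' = 0 -> wfun q' = wfun p]); first exact: open_interior.
 apply/seteqP; split=> q' [Cq' E]; split => //; last by have := nbhs_singleton E; apply; exact: u0.
 have := energy_boundary_const q'; apply: filterS => z H uz; rewrite -E; apply: H => //; exact: u0.
- exists [set q' | wfun q' = wfun p] => //.
 by apply: (@preimage_closed _ _ wfun [set r | r = wfun p]) => [z _|]; [exact: wfun_continuous|exact: closed_eq].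
Qed.

Lemma rboundary_energy N p : rboundary M N p -> wfun p = grad_norm M u p ^+ 2.
by move=> [/boundary_u0 up _]; rewrite /wfun up expr0n addr0. Qed.

(** The boundary of N is compact, being the zero set of u in the closure of N. *)
Lemma rboundary_max N : regions u N -> exists2 p, rboundary M N p &
 forall q, rboundary M N q -> grad_norm M u q <= grad_norm M u p.
move=> rN; have ne := rboundary_nonempty rN.
have E : rboundary M N = closure N `&` [set p | u p = 0].
 apply/seteqP; split => p [].
  by move=> /boundary_u0 up Np; split => //; exact: subset_closure.
 move=> cp up; have nM : ~ MAXu p by rewrite /MAX /= up => c0; have := u_max_gt0; rewrite -c0 ltxx.
 by split; [exact/boundary_u0|exact: region_closure].
have kB : compact (rboundary M N).
 rewrite E; apply: (subclosed_compact _ (st_compact hM)) => //; apply: closedI; first exact: closed_closure.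
 by apply: (@preimage_closed _ _ u [set r | r = 0]) => [z _|]; [exact: u_continuous|exact: closed_eq].
have [p Bp H] := compact_EVT_max ne kB (continuous_subspaceT (grad_norm_continuous mM rM su)).
by exists p; [rewrite inE in Bp|move=> q Bq; apply: H; rewrite inE].
Qed.

(** |Du| is constant on each component of the boundary, so the maximum over components equals the
    maximum over points. *)
Lemma max_grad_normE N p : regions u N -> rboundary M N p ->
 (forall q, rboundary M N q -> grad_norm M u q <= grad_norm M u p) ->
 max_grad_norm M u N = grad_norm M u p / c /\ max_surface_gravity M u N = grad_norm M u p / c.
move=> rN Bp H; have c0 := u_max_gt0.
have le q : rboundary M N q -> grad_norm M u q / c <= grad_norm M u p / c.
 by move=> Bq; rewrite ler_pM2r ?invr_gt0 //; exact: H.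
have sg S : S `<=` rboundary M N -> S !=set0 -> exists2 q, S q & surface_gravity M u S = grad_norm M u q / c.
 move=> SB [q Sq]; rewrite /surface_gravity; set K := (X in get X).
 by apply: (@getPex _ K); exists (grad_norm M u q / c); exists q.
split; apply: maximumE.
- by exists p.
- by move=> r [q Bq <-]; exact: le.
- exists (connected_component (rboundary M N) p); first by exists p.
 have [||q Cq ->] := sg (connected_component (rboundary M N) p).
 + exact: connected_component_sub.
 + by exists p; exact: connected_component_refl.
 have Bq : rboundary M N q by exact: connected_component_sub Cq.
 have := energy_component_const (fun z (Bz : rboundary M N z) => Bz.1) Cq.
 rewrite (rboundary_energy Bq) (rboundary_energy Bp) => E.
 by rewrite (sqr_ge0_inj (grad_norm_ge0 mM rM q su) (grad_norm_ge0 mM rM p su) E).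
- move=> r [S [q Bq <-] <-].
 have [||q' Cq ->] := sg (connected_component (rboundary M N) q).
 + exact: connected_component_sub.
 + by exists q; exact: connected_component_refl.
 by apply: le; exact: connected_component_sub Cq.
Qed.

(** If |Du| <= c on the boundary of N, then w <= c^2 there, hence w = c^2 everywhere and |Du| = c on
    that boundary. A maximum below 1 would contradict the last equality. *)
Lemma max_grad_norm_ge1 N : (1 < n)%N -> regions u N ->
 [/\ 1 <= max_grad_norm M u N, max_surface_gravity M u N = max_grad_norm M u N &
  max_grad_norm M u N = 1 -> forall p, wfun p = c ^+ 2].
move=> n1 rN; have [p Bp H] := rboundary_max rN; have [E1 E2] := max_grad_normE rN Bp H.
have c0 := u_max_gt0.
have ge0 q : 0 <= grad_norm M u q by exact: (grad_norm_ge0 mM rM q su).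
have key : grad_norm M u p <= c -> forall q, wfun q = c ^+ 2.
 move=> le; apply: (energy_const n1 rN) => q Bq.
 rewrite (rboundary_energy Bq); apply: sqr_ge0_le (ge0 q) _.
 by apply: le_trans le; exact: H.
split; last first.
- rewrite E1 => /eqP; rewrite -(inj_eq (mulIf (lt0r_neq0 c0))) divfK ?lt0r_neq0 // mul1r => /eqP pc.
 by apply: key; rewrite pc.
- by rewrite E1 E2.
rewrite E1 ler_pdivlMr // mul1r leNgt; apply/negP => lt.
have := key (ltW lt) p; rewrite (rboundary_energy Bp) => /(sqr_ge0_inj (ge0 p) (ltW c0)) E.
by move: lt; rewrite E ltxx.
Qed.

End regions.

(** * Derivatives of real functions *)

Section real_derivatives.
Context {R : realType}.
Implicit Types (f g : R -> R) (x a b c : R).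

Lemma der_eq f x a b : is_derive x 1 f a -> a = b -> is_derive x 1 f b.
by move=> H <-. Qed.

Lemma derC c x : is_derive x 1 (fun=> c) 0.
exact: is_derive_cst. Qed.

Lemma derI x : is_derive x 1 (fun y : R => y) 1.
exact: is_derive_id. Qed.

Lemma derD f g x a b : is_derive x 1 f a -> is_derive x 1 g b ->
 is_derive x 1 (fun y => f y + g y) (a + b).
by move=> Hf Hg; exact: is_deriveD. Qed.

Lemma derN f x a : is_derive x 1 f a -> is_derive x 1 (fun y => - f y) (- a).
by move=> Hf; exact: is_deriveN. Qed.

Lemma derB f g x a b : is_derive x 1 f a -> is_derive x 1 g b ->
 is_derive x 1 (fun y => f y - g y) (a - b).
by move=> Hf Hg; exact: is_deriveB. Qed.

Lemma derM f g x a b : is_derive x 1 f a -> is_derive x 1 g b ->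
 is_derive x 1 (fun y => f y * g y) (a * g x + f x * b).
move=> Hf Hg; have H := is_deriveM Hf Hg; apply: der_eq.
by rewrite addrC mulrC.
Qed.

Lemma derZ c f x a : is_derive x 1 f a -> is_derive x 1 (fun y => c * f y) (c * a).
by move=> Hf; apply: (der_eq (derM (derC c x) Hf)); rewrite mul0r add0r. Qed.

Lemma derV f x a : f x != 0 -> is_derive x 1 f a -> is_derive x 1 (fun y => (f y)^-1) (- (f x) ^- 2 * a).
by move=> f0 Hf; exact: is_deriveV. Qed.

Lemma derX f k x a : is_derive x 1 f a -> is_derive x 1 (fun y => f y ^+ k) (k%:R * f x ^+ k.-1 * a).
move=> Hf; have H := is_deriveX k Hf; apply: der_eq => //.
rewrite (_ : (fun y => f y ^+ k) = f ^+ k) //.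
apply/funext => y; elim: k {H} => [|k IH] //.
by rewrite [LHS]exprS IH exprS.
Qed.

Lemma der_ln f x a : 0 < f x -> is_derive x 1 f a -> is_derive x 1 (fun y => ln (f y)) ((f x)^-1 * a).
by move=> f0 Hf; exact: is_derive1_comp (is_derive1_ln f0) Hf. Qed.

Lemma der_expR f x a : is_derive x 1 f a -> is_derive x 1 (fun y => expR (f y)) (expR (f x) * a).
by move=> Hf; exact: is_derive1_comp. Qed.

Lemma der_continuous f x a : is_derive x 1 f a -> {for x, continuous f}.
by move=> [df _]; apply: differentiable_continuous; exact/derivable1_diffP. Qed.

End real_derivatives.

(** * Preimages under the surface gravity functions *)

Section surface_gravity_inverse.
Context {R : realType}.
Variable n : nat.
Hypothesis n3 : (3 <= n)%N.
Local Notation N := (n - 2)%N.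
Local Notation nR := (n%:R : R).
Local Notation NR := (N%:R : R).

Let N0 : 0 < NR. Proof. by rewrite ltr0n subn_gt0. Qed.
Let n0 : 0 < nR. Proof. by rewrite ltr0n (leq_trans _ n3). Qed.
Let nN : nR = NR + 2. Proof. by rewrite -natrD subnK // ltnW. Qed.

(** The equation for the radii is linear in m. Solved for m, it makes the radius the parameter: r_+
    and r_- are the branches on the two sides of the critical radius, where the mass is maximal. *)
Definition mass_of (r : R) : R := (1 - r ^+ 2) * r ^+ N / 2.

Definition critical_radius : R := Num.sqrt (NR / nR).
Local Notation r0 := critical_radius.

Lemma critical_radius_sqr : r0 ^+ 2 = NR / nR.
by rewrite sqr_sqrtr. Qed.

Lemma critical_radius_gt0 : 0 < r0.
by rewrite sqrtr_gt0 divr_gt0. Qed.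

Lemma critical_radius_lt1 : r0 < 1.
rewrite -(@ltr_pXn2r _ 2) ?nnegrE ?(ltW critical_radius_gt0) // critical_radius_sqr expr1n.
by rewrite ltr_pdivrMr // mul1r nN ltrDl.
Qed.

Lemma mass_of_critical : mass_of r0 = m_max n.
have r00 := critical_radius_gt0; have := critical_radius_sqr => r2.
have M0 : 0 <= mass_of r0.
 rewrite !mulr_ge0 ?exprn_ge0 ?(ltW r00) // subr_ge0.
 by rewrite r2 ler_pdivrMr // mul1r nN lerDl.
rewrite -[LHS](ger0_norm M0) -sqrtr_sqr; congr (Num.sqrt _).
rewrite !exprMn exprAC r2 expr_div_n.
have -> : nR ^+ n = nR ^+ N * nR ^+ 2 by rewrite -exprD subnK // ltnW.
have : NR + 2 != 0 by [].
have : nR ^+ N != 0 by rewrite expf_neq0 // lt0r_neq0.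
move: (nR ^+ N) (NR ^+ N) => X Y X0; rewrite nN => n0'.
by field; rewrite n0'.
Qed.

Let der_mass (z : R) : is_derive z 1 mass_of (z ^+ N.-1 * (NR - nR * z ^+ 2) / 2).
have D := derM (derM (derB (derC 1 z) (derX 2 (derI z))) (derX N (derI z))) (derC 2^-1 z).
apply: der_eq; rewrite nN.
have -> : z ^+ N = z * z ^+ N.-1 by rewrite -exprS prednK // subn_gt0.
lra.
Qed.

Let mass_of_mvt (r s : R) : 0 < r -> r < s -> exists z, [/\ r < z, z < s &
 mass_of s - mass_of r = z ^+ N.-1 * (nR * (s - r) / 2) * (r0 ^+ 2 - z ^+ 2)].
move=> rp rs; have [||z] := MVT rs (f := mass_of) (df := fun z => z ^+ N.-1 * (NR - nR * z ^+ 2) / 2).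
- by [].
- by apply: continuous_subspaceT => z; exact: der_continuous (der_mass z).
rewrite /= => /andP[rz zs] ->; exists z; split => //; rewrite critical_radius_sqr.
by field; exact: lt0r_neq0.
Qed.

Let mass_of_coef (z r s : R) : 0 < z -> r < s -> 0 < z ^+ N.-1 * (nR * (s - r) / 2).
by move=> z0 rs; rewrite !mulr_gt0 ?exprn_gt0 // subr_gt0. Qed.

Lemma mass_of_decr (r s : R) : r0 <= r -> r < s -> mass_of s < mass_of r.
move=> rr rs; have rp := lt_le_trans critical_radius_gt0 rr.
have [z [rz zs E]] := mass_of_mvt rp rs; have z0 := lt_trans rp rz.
rewrite -subr_lt0 E pmulr_rlt0 ?mass_of_coef // subr_lt0 ltr_pXn2r ?nnegrE ?(ltW z0) ?(ltW critical_radius_gt0) //.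
exact: le_lt_trans rz.
Qed.

Lemma mass_of_incr (r s : R) : 0 < r -> r < s -> s <= r0 -> mass_of r < mass_of s.
move=> rp rs sr; have [z [rz zs E]] := mass_of_mvt rp rs; have z0 := lt_trans rp rz.
rewrite -subr_gt0 E pmulr_rgt0 ?mass_of_coef // subr_gt0 ltr_pXn2r ?nnegrE ?(ltW z0) ?(ltW critical_radius_gt0) //.
exact: lt_le_trans sr.
Qed.

Lemma radiiE (m r : R) : radii n m r <-> 0 < r /\ m = mass_of r.
split=> -[rp E]; split => //; have rN : r ^+ N != 0 by rewrite expf_neq0 // lt0r_neq0.
 rewrite /mass_of; have -> : 1 - r ^+ 2 = 2 * m * r ^- N by lra.
 by field.
by rewrite E /mass_of; field.
Qed.

Lemma r_plus_mass (r : R) : r0 <= r -> r_plus n (mass_of r) = r.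
move=> rr; have rp := lt_le_trans critical_radius_gt0 rr.
apply: maximumE; first exact/radiiE.
move=> s /radiiE[sp E]; rewrite leNgt; apply/negP => /mass_of_decr.
lra.
Qed.

Lemma r_minus_mass (r : R) : 0 < r -> r <= r0 -> r_minus n (mass_of r) = r.
move=> rp rr; rewrite /r_minus /minimum; set P := (X in get X).
have [Ag lg] : P (get P).
 apply: getPex; exists r; split; first exact/radiiE.
 move=> s /radiiE[sp E]; rewrite leNgt; apply/negP => sr.
 by have := mass_of_incr sp sr rr; rewrite E ltxx.
move/radiiE: Ag => [gp E]; apply/eqP; rewrite eq_le; apply/andP; split.
 by apply: lg; exact/radiiE.
rewrite leNgt; apply/negP => sr.
by have := mass_of_incr gp sr rr; rewrite E ltxx.
Qed.

Lemma mass_of_gt0 (r : R) : 0 < r -> r < 1 -> 0 < mass_of r.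
move=> rp r1; rewrite !mulr_gt0 ?exprn_gt0 //.
nra.
Qed.

Definition mass_ratio (r : R) : R := (mass_of r / m_max n) `^ (2 / nR).

(** Twice the factor r [1 - (n - 2) m r^-n] once m is expressed by r. Thus k^2 = h^2 / (4 (1 - q))
    with q = [mass_ratio]. *)
Let h (r : R) : R := nR * r - NR / r.

Lemma k_of_mass (r k : R) : 0 < r -> 0 < k -> mass_ratio r < 1 ->
 h r ^+ 2 = 4 * k ^+ 2 * (1 - mass_ratio r) -> k_of n (mass_of r) r = k.
move=> rp kp q1 E; rewrite /k_of.
have qn : 1 - mass_ratio r != 0 by nra.
rewrite -[RHS](ger0_norm (ltW kp)) -sqrtr_sqr; congr (Num.sqrt _).
have r2 : r != 0 by lra.
have rn : NR * mass_of r * r ^- n = NR * (1 - r ^+ 2) / (2 * r ^+ 2).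
 have -> : r ^+ n = r ^+ N * r ^+ 2 by rewrite -exprD subnK // ltnW.
 have : r ^+ N != 0 by rewrite expf_neq0.
 by rewrite /mass_of; move: (r ^+ N) => X X0; field; rewrite r2.
rewrite rn; apply: (mulIf qn); rewrite divfK //.
have e4 : 4 != 0 :> R by [].
by apply: (mulfI e4); rewrite [RHS]mulrA -E /h nN; field.
Qed.

Lemma powR_expR (x y : R) : 0 < x -> x `^ y = expR (y * ln x).
by move=> x0; rewrite /powR gt_eqF. Qed.

Lemma mass_lt_max (r : R) : 0 < r -> r <> r0 -> mass_of r < m_max n.
move=> rp rr; rewrite -mass_of_critical; case: (ltgtP r r0) => // H.
- exact: mass_of_incr.
- exact: mass_of_decr.
Qed.

Lemma m_max_gt0 : 0 < m_max n :> R.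
rewrite -mass_of_critical; apply: mass_of_gt0; [exact: critical_radius_gt0|exact: critical_radius_lt1].
Qed.

Lemma mass_ratio_lt1 (r : R) : 0 < r -> r < 1 -> r <> r0 -> mass_ratio r < 1.
move=> rp r1 rr; have m0 := mass_of_gt0 rp r1; have M0 := m_max_gt0.
have q0 : 0 < mass_of r / m_max n by rewrite divr_gt0.
rewrite /mass_ratio /powR gt_eqF // -[X in _ < X]expR0 ltr_expR.
rewrite pmulr_rlt0 ?divr_gt0 // -[X in _ < X]ln1 ltr_ln ?posrE //.
by rewrite ltr_pdivrMr // mul1r mass_lt_max.
Qed.

(** L is the logarithm of [mass_ratio] on (0, 1), and l its derivative. *)
Let L (r : R) : R := 2 / nR * (ln (1 - r ^+ 2) + NR * ln r + (- ln 2 - ln (m_max n))).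
Let l (r : R) : R := 2 / nR * (- 2 * r / (1 - r ^+ 2) + NR / r).

Let LE (r : R) : 0 < r -> r < 1 -> mass_ratio r = expR (L r).
move=> rp r1; have m0 := mass_of_gt0 rp r1; have M0 := m_max_gt0.
have s0 : 0 < 1 - r ^+ 2 by nra.
have rN : 0 < r ^+ N by rewrite exprn_gt0.
have q0 : 0 < mass_of r / m_max n by rewrite divr_gt0.
rewrite /mass_ratio (powR_expR _ q0); suff -> : ln (mass_of r / m_max n) = ln (1 - r ^+ 2) + NR * ln r + (- ln 2 - ln (m_max n)) by [].
rewrite lnM ?posrE ?invr_gt0 // lnV // lnM ?posrE ?mulr_gt0 // lnV ?posrE //.
rewrite lnM // lnXn //; ring.
Qed.

Let der_L (t : R) : 0 < r0 + t -> r0 + t < 1 -> is_derive t 1 (fun s => L (r0 + s)) (l (r0 + t)).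
move=> rp r1.
have s0 : 0 < 1 - (r0 + t) ^+ 2 by nra.
have Dr := derD (derC r0 t) (derI t).
have D1 := der_ln (f := fun s => 1 - (r0 + s) ^+ 2) s0 (derB (derC 1 t) (derX 2 Dr)).
have D := derZ (2 / nR) (derD (derD D1 (derZ NR (der_ln (f := fun s => r0 + s) rp Dr))) (derC (- ln 2 - ln (m_max n)) t)).
apply: der_eq; congr (_ * _); rewrite /=.
lra.
Qed.

Let r0n1 : 1 - r0 ^+ 2 = 2 / nR.
by rewrite critical_radius_sqr nN; field; rewrite lt0r_neq0. Qed.

Let l0 : l r0 = 0.
have r00 := lt0r_neq0 critical_radius_gt0; have nn := lt0r_neq0 n0.
have -> : l r0 = 2 / nR * ((NR * (1 - r0 ^+ 2) - 2 * r0 ^+ 2) / (r0 * (1 - r0 ^+ 2))).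
 by rewrite /l; field; rewrite r00 r0n1 mulf_neq0 ?invr_eq0.
rewrite r0n1 critical_radius_sqr; ring.
Qed.

Let der_l : is_derive (0 : R) 1 (fun s => l (r0 + s)) (- 2 * nR).
have r00 := critical_radius_gt0; have r0z := lt0r_neq0 r00; have nn := lt0r_neq0 n0.
have Dr := derD (derC r0 0) (derI 0).
have s0 : 1 - (r0 + 0) ^+ 2 != 0 by rewrite addr0 r0n1 mulf_neq0 ?invr_eq0.
have rz : r0 + 0 != 0 by lra.
have D1 := derV (f := fun s => 1 - (r0 + s) ^+ 2) s0 (derB (derC 1 0) (derX 2 Dr)).
have D2 := derV (f := fun s => r0 + s) rz Dr.
have D := derZ (2 / nR) (derD (derM (derZ (- 2) Dr) D1) (derZ NR D2)).
apply: der_eq; rewrite !addr0 r0n1.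
have -> : r0 ^- 2 = nR / NR by rewrite critical_radius_sqr invf_div.
have Nz := lt0r_neq0 N0.
transitivity (2 / nR * (- nR - nR ^+ 2 * r0 ^+ 2 - nR)).
 by field; rewrite nn.
by rewrite critical_radius_sqr nN; field; rewrite -nN.
Qed.

Let h0 : h r0 = 0.
have r00 := lt0r_neq0 critical_radius_gt0; have nn := lt0r_neq0 n0.
have -> : h r0 = (nR * r0 ^+ 2 - NR) / r0 by rewrite /h; field.
by rewrite critical_radius_sqr (mulrC nR) divfK // subrr mul0r.
Qed.

Let der_h (t : R) : 0 < r0 + t -> is_derive t 1 (fun s => h (r0 + s)) (nR + NR / (r0 + t) ^+ 2).
move=> rp; have Dr := derD (derC r0 t) (derI t).
have D := derB (derZ nR Dr) (derZ NR (derV (f := fun s => r0 + s) (lt0r_neq0 rp) Dr)).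
by apply: der_eq; ring.
Qed.

Let L0 : L r0 = 0.
have := LE critical_radius_gt0 critical_radius_lt1.
rewrite /mass_ratio mass_of_critical mulfV ?lt0r_neq0 ?m_max_gt0 // powR1 -[LHS]expR0.
by move=> /expR_inj.
Qed.

Let near_critical (phi dphi : R -> R) (e : R) : phi r0 = 0 -> dphi r0 = 0 -> 0 < e ->
 (forall t, 0 < r0 + t -> r0 + t < 1 -> is_derive t 1 (fun s => phi (r0 + s)) (dphi (r0 + t))) ->
 is_derive (0 : R) 1 (fun s => dphi (r0 + s)) e ->
 exists2 d : R, 0 < d & forall t : R, 0 < `|t| < d -> [/\ 0 < r0 + t, r0 + t < 1 & 0 < phi (r0 + t)].
move=> p0 dp0 e0 D1 D2; have r00 := critical_radius_gt0; have r01 := critical_radius_lt1.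
pose d := Num.min r0 (1 - r0); have d0 : 0 < d by rewrite lt_min r00 subr_gt0.
have rng t : `|t| < d -> 0 < r0 + t /\ r0 + t < 1.
 by rewrite lt_min !ltr_norml => /andP[/andP[h1 h2] /andP[h3 h4]]; split; lra.
have [||d' d'0 H] := @second_derivative_pos R (fun t => phi (r0 + t)) (fun t => dphi (r0 + t)) d e d0 _ _ D2 e0.
- by move=> t /rng[]; exact: D1.
- by rewrite addr0.
exists (Num.min d d'); first by rewrite lt_min d0.
move=> t; rewrite lt_min => /and3P[t0 td td']; have [h1 h2] := rng t td; split => //.
by have := H t; rewrite t0 addr0 p0; apply.
Qed.

(** At the critical radius L and h^2 vanish to second order, with second derivatives - 2 n and 8
    n^2. So L + h^2 / (4 k^2) has second derivative 2 n (n - k^2) / k^2, whose sign tells on which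
    side of sqrt n the number k lies. The term t L^2 is of higher order. *)
Let near_k (k s t : R) : 0 < k -> 0 < s * (nR - k ^+ 2) -> exists2 d : R, 0 < d & forall e : R, 0 < `|e| < d ->
 [/\ 0 < r0 + e, r0 + e < 1 & 0 < s * (L (r0 + e) + h (r0 + e) ^+ 2 / (4 * k ^+ 2)) - t * L (r0 + e) ^+ 2].
move=> k0 sk; have r00 := critical_radius_gt0; have nn := lt0r_neq0 n0; have kk := lt0r_neq0 k0.
have dh0 := @der_h 0; rewrite addr0 in dh0.
have hE : nR + NR / (NR / nR) = 2 * nR by field; rewrite nn lt0r_neq0.
apply: (near_critical (phi := fun r => s * (L r + h r ^+ 2 / (4 * k ^+ 2)) - t * L r ^+ 2)
  (dphi := fun r => s * (l r + 2 * h r * (nR + NR / r ^+ 2) / (4 * k ^+ 2)) - t * (2 * L r * l r))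
  (e := s * (- 2 * nR + 2 * nR ^+ 2 / k ^+ 2))).
- by rewrite L0 h0; ring.
- by rewrite l0 h0; ring.
- have -> : s * (- 2 * nR + 2 * nR ^+ 2 / k ^+ 2) = 2 * nR * (s * (nR - k ^+ 2)) / k ^+ 2 by field.
 by apply: divr_gt0; rewrite mulr_gt0 // mulr_gt0.
- move=> e rp r1; have DL := der_L rp r1.
 have D := derB (derZ s (derD DL (derM (derX 2 (der_h rp)) (derC (4 * k ^+ 2)^-1 e)))) (derZ t (derX 2 DL)).
 by apply: der_eq; ring.
have Dr := derD (derC r0 0) (derI 0).
have rz : (r0 + 0) ^+ 2 != 0 by nra.
have Dq := derD (derC nR 0) (derZ NR (derV (f := fun s => (r0 + s) ^+ 2) rz (derX 2 Dr))).
have rp : 0 < r0 + 0 by lra. have r1 : r0 + 0 < 1 by rewrite addr0 critical_radius_lt1.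
have D := derB (derZ s (derD der_l (derM (derM (derZ 2 (dh0 r00)) Dq) (derC (4 * k ^+ 2)^-1 0))))
 (derZ t (derM (derZ 2 (der_L rp r1)) der_l)).
apply: der_eq; rewrite addr0 h0 L0 l0 critical_radius_sqr hE !(mulr0, mul0r); field; exact: kk.
Qed.

(** The bound 1 - exp L <= - L converts [near_k] with s = 1 and t = 0. *)
Lemma k_plus_near (k : R) : 0 < k -> k ^+ 2 < nR ->
 exists r : R, [/\ r0 < r, r < 1 & 4 * k ^+ 2 * (1 - mass_ratio r) < h r ^+ 2].
move=> k0 kn; have k2 : 0 < k ^+ 2 by rewrite exprn_gt0.
have [|d d0 H] := @near_k k 1 0 k0; first by rewrite mul1r subr_gt0.
have dp : 0 < d / 2 by rewrite divr_gt0.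
exists (r0 + d / 2); have [|rp r1 Hp] := H (d / 2); first by rewrite gtr0_norm // dp /=; lra.
split => //; first by rewrite ltrDl.
rewrite mulrC -ltr_pdivlMr ?mulr_gt0 //.
have := expR_ge1Dx (L (r0 + d / 2)); rewrite -LE // => E; lra.
Qed.

(** Here the opposite bound 1 - exp L >= - L - L^2 for L < 0 is used; it is the origin of the term t
    L^2 in [near_k]. *)
Lemma k_minus_near (k : R) : 0 < k -> nR < k ^+ 2 ->
 exists r : R, [/\ 0 < r, r < r0 & h r ^+ 2 < 4 * k ^+ 2 * (1 - mass_ratio r)].
move=> k0 kn; have k2 : 0 < k ^+ 2 by rewrite exprn_gt0.
have [|d d0 H] := @near_k k (- 1) 1 k0; first by rewrite mulN1r opprB subr_gt0.
have dp : 0 < d / 2 by rewrite divr_gt0.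
exists (r0 + - (d / 2)); have [|rp r1 Hp] := H (- (d / 2)); first by rewrite normrN gtr0_norm /=; lra.
have rlt : r0 + - (d / 2) <> r0 by lra.
split => //; first by nra.
set r := r0 + - (d / 2) in rp r1 Hp rlt *.
rewrite [4 * _ * _]mulrC -ltr_pdivrMr ?mulr_gt0 //.
have q1 := mass_ratio_lt1 rp r1 rlt; rewrite LE // in q1 *.
have E1 := expR_ge1Dx (- L r); rewrite expRN in E1.
have e0 : 0 < expR (L r) by exact: expR_gt0.
have E2 : expR (L r) * (1 - L r) <= 1 by rewrite -ler_pdivlMl // mulr1.
have E3 : expR (L r) <= 1 + L r + L r ^+ 2.
 nra.
lra.
Qed.

(* Polynomial form of the equation k(m) = k, continuous up to r = 1. *)
Let gap (k r : R) : R := (1 - h r ^+ 2 / (4 * k ^+ 2)) ^+ n - (mass_of r / m_max n) ^+ 2.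

Let gapE (k r : R) : 0 < r -> r <= 1 ->
 gap k r = (1 - h r ^+ 2 / (4 * k ^+ 2)) ^+ n - mass_ratio r ^+ n.
move=> rp r1; congr (_ - _); have M0 := m_max_gt0.
have z0 : 0 <= mass_of r / m_max n.
 by rewrite !mulr_ge0 ?invr_ge0 ?exprn_ge0 ?(ltW rp) ?(ltW M0) // subr_ge0 mulr_ile1 // ltW.
by rewrite -[in RHS]powR_mulrn ?powR_ge0 // -powRrM divfK ?lt0r_neq0 // powR_mulrn.
Qed.

(** Intermediate value theorem for [gap]. The bound on h makes 1 - h^2 / (4 k^2) nonnegative, so
    that n-th roots may be taken. *)
Lemma mass_root (k a b : R) : 0 < k -> 0 < a -> a <= b -> b <= 1 ->
 (forall r, a <= r <= b -> h r ^+ 2 <= 4 * k ^+ 2) ->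
 Num.min (gap k a) (gap k b) <= 0 <= Num.max (gap k a) (gap k b) ->
 exists r : R, [/\ a <= r, r <= b & h r ^+ 2 = 4 * k ^+ 2 * (1 - mass_ratio r)].
move=> k0 a0 ab b1 hk Gs; have k4 : 0 < 4 * k ^+ 2 by nra.
have cG : {within `[a, b], continuous (gap k)}.
 apply: continuous_in_subspaceT => r; rewrite inE => /andP[ar _]; have rp := lt_le_trans a0 ar.
 have Dh := derB (derZ nR (derI r)) (derZ NR (derV (f := fun r => r) (lt0r_neq0 rp) (derI r))).
 have D1 := derX n (derB (derC 1 r) (derM (derX 2 Dh) (derC (4 * k ^+ 2)^-1 r))).
 exact: der_continuous (derB D1 (derX 2 (derM (der_mass r) (derC (m_max n)^-1 r)))).
have [r] := IVT ab cG Gs; rewrite in_itv /= => /andP[ar rb].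
have rp := lt_le_trans a0 ar; have r1 := le_trans rb b1.
rewrite gapE // => /eqP; rewrite subr_eq0 eqrXn2 ?powR_ge0 //; last 2 first.
- by rewrite (leq_trans _ n3).
- by rewrite subr_ge0 ler_pdivrMr // mul1r hk // ar.
move=> /eqP qE; exists r; split => //; rewrite -qE; field; exact: lt0r_neq0.
Qed.

Let h_le (r s : R) : 0 < r -> r <= s -> h r <= h s.
move=> rp rs; apply: lerB; first by rewrite ler_pM2l.
by rewrite ler_pM2l // lef_pV2 ?posrE // (lt_le_trans rp).
Qed.

Lemma k_plus_onto (k : R) : 1 <= k -> k < Num.sqrt nR -> exists m, 0 <= m < m_max n /\ k_plus n m = k.
rewrite le_eqVlt => /orP[/eqP <- _|k1 kn].
 by exists 0; rewrite lexx m_max_gt0; split => //; rewrite /k_plus eqxx.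
have k0 : 0 < k by lra. have k2 : 1 < k ^+ 2 by rewrite exprn_egt1.
have kn2 : k ^+ 2 < nR by rewrite -(@sqr_sqrtr _ nR) ?ltW // ltr_pXn2r // nnegrE ?sqrtr_ge0 // ltW.
(* The gap is nonpositive at a because k^2 < n. At r = 1 the mass is 0 and h = 2, so the gap is (1 -
   k^-2)^n >= 0. *)
have [a [ra a1 Ga]] := k_plus_near k0 kn2; have ap := lt_trans critical_radius_gt0 ra.
have k4 : 0 < 4 * k ^+ 2 by rewrite mulr_gt0 // exprn_gt0.
have h1 : h 1 = 2 by rewrite /h nN; field.
have hk r : a <= r <= 1 -> h r ^+ 2 <= 4 * k ^+ 2.
 move=> /andP[ar r1]; have rp := lt_le_trans ap ar.
 have : 0 <= h r by rewrite -h0; apply: h_le critical_radius_gt0 _; exact: le_trans (ltW ra) ar.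
 by have := h_le rp r1; rewrite h1; move: (h r) => z; nra.
have [|r [ar rb E]] := @mass_root k a 1 k0 ap (ltW a1) (lexx _) hk.
 have Ga' : gap k a <= 0.
  rewrite gapE ?(ltW a1) // subr_le0 lerXn2r ?nnegrE ?powR_ge0 ?subr_ge0 ?ler_pdivrMr ?mul1r ?hk ?lexx ?(ltW a1) //.
  by move: Ga; rewrite mulrC -ltr_pdivlMr //; lra.
 have G1 : 0 <= gap k 1.
  rewrite /gap /mass_of expr1n subrr !mul0r expr0n subr0 exprn_ge0 // subr_ge0 ler_pdivrMr // mul1r.
  by rewrite hk // (ltW a1) lexx.
 by rewrite ge_min le_max Ga' G1 orbT.
have rr : r0 < r by exact: lt_le_trans ar. have rp : 0 < r by exact: lt_le_trans ar.
have r1 : r < 1.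
 rewrite lt_neqAle rb andbT; apply/eqP => r1; move: E.
 have p0 : 2 / nR != 0 by rewrite lt0r_neq0 // divr_gt0.
 by rewrite r1 h1 /mass_ratio /mass_of expr1n subrr !mul0r powR0 //; lra.
have rn : r <> r0 by move=> Er; move: rr; rewrite Er ltxx.
exists (mass_of r); split; first by rewrite mass_lt_max // andbT ltW // mass_of_gt0.
rewrite /k_plus gt_eqF ?mass_of_gt0 // (r_plus_mass (ltW rr)); apply: k_of_mass => //.
exact: mass_ratio_lt1.
Qed.

Lemma k_minus_onto (k : R) : Num.sqrt nR <= k -> exists m, 0 < m <= m_max n /\ k_minus n m = k.
have M0 := m_max_gt0; have s0 : 0 < Num.sqrt nR by rewrite sqrtr_gt0.
rewrite le_eqVlt => /orP[/eqP <-|kn].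
 by exists (m_max n); rewrite M0 lexx; split => //; rewrite /k_minus eqxx.
have k0 : 0 < k by exact: lt_trans kn.
have kn2 : nR < k ^+ 2 by rewrite -(@sqr_sqrtr _ nR) ?ltW // ltr_pXn2r // nnegrE ?sqrtr_ge0 // ltW.
have [b [bp br Gb]] := k_minus_near k0 kn2; have b1 := lt_trans br critical_radius_lt1.
have k4 : 0 < 4 * k ^+ 2 by rewrite mulr_gt0 // exprn_gt0.
(* a is the positive root of h(a) = - 2 k, where 1 - h^2 / (4 k^2) vanishes and the gap is
   nonpositive. *)
pose s := Num.sqrt (k ^+ 2 + nR * NR); pose a := (s - k) / nR.
have s2 : s ^+ 2 = k ^+ 2 + nR * NR by rewrite sqr_sqrtr // addr_ge0 ?sqr_ge0 // mulr_ge0 // ltW.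
have sk : k < s.
 rewrite -(@ltr_pXn2r _ 2) ?nnegrE ?sqrtr_ge0 ?(ltW k0) // s2 ltrDl; exact: mulr_gt0.
have ap : 0 < a by rewrite divr_gt0 // subr_gt0.
have ha : h a = - 2 * k.
 have -> : h a = (s - k) - (s ^+ 2 - k ^+ 2) / (s - k).
  rewrite s2 [k ^+ 2 + _]addrC addrK /h /a; field; rewrite (lt0r_neq0 n0) /=; lra.
 by field; lra.
have q0 : 0 <= mass_ratio b by exact: powR_ge0.
have ab : a <= b.
 rewrite leNgt; apply/negP => /ltW /(h_le bp); rewrite ha; move: Gb q0 k0.
 by move: (h b) (mass_ratio b) => z q; nra.
have hk r : a <= r <= b -> h r ^+ 2 <= 4 * k ^+ 2.
 move=> /andP[ar rb]; have rp := lt_le_trans ap ar; have := h_le ap ar; rewrite ha.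
 by have := h_le rp (le_trans rb (ltW br)); rewrite h0; move: (h r) => z; nra.
have [|r [ar rb E]] := @mass_root k a b k0 ap ab (ltW b1) hk.
 have Ga : gap k a <= 0.
  rewrite /gap ha (_ : 1 - _ = 0); last by field; exact: lt0r_neq0.
  by rewrite expr0n gtn_eqF ?(leq_trans _ n3) // sub0r oppr_le0 sqr_ge0.
 have G1 : 0 <= gap k b.
  rewrite gapE ?(ltW b1) // subr_ge0 lerXn2r ?nnegrE ?subr_ge0 ?ler_pdivrMr ?mul1r ?hk ?ab ?lexx //.
  by move: Gb; rewrite [4 * _ * _]mulrC -ltr_pdivrMr //; lra.
 by rewrite ge_min le_max Ga G1 orbT.
have rp : 0 < r by exact: lt_le_trans ar.
have rr : r < r0 by exact: le_lt_trans br.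
have r1 : r < 1 by exact: le_lt_trans b1.
have rn : r <> r0 by move=> Er; move: rr; rewrite Er ltxx.
exists (mass_of r); split; first by rewrite mass_of_gt0 // ltW // mass_lt_max.
rewrite /k_minus lt_eqF ?mass_lt_max // (r_minus_mass rp (ltW rr)); apply: k_of_mass => //.
exact: mass_ratio_lt1.
Qed.

(** By [k_plus_onto] the set inside [xget] is nonempty, so the default -1 is never returned. *)
Lemma k_plus_inv_spec (k : R) : 1 <= k -> k < Num.sqrt nR ->
 0 <= k_plus_inv n k < m_max n /\ k_plus n (k_plus_inv n k) = k.
move=> k1 kn; rewrite /k_plus_inv; have [m Hm] := k_plus_onto k1 kn.
by case: xgetP => [x _ //|H]; have := H m Hm.
Qed.

Lemma k_minus_inv_spec (k : R) : Num.sqrt nR <= k ->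
 0 < k_minus_inv n k <= m_max n /\ k_minus n (k_minus_inv n k) = k.
move=> k1; rewrite /k_minus_inv; have [m Hm] := k_minus_onto k1.
by case: xgetP => [x _ //|H]; have := H m Hm.
Qed.

Lemma k_plus_inv_eq0 (k : R) : 1 <= k -> k < Num.sqrt nR -> k_plus_inv n k = 0 -> k = 1.
by move=> k1 kn E; have [_] := k_plus_inv_spec k1 kn; rewrite E /k_plus eqxx.
Qed.

End surface_gravity_inverse.

(** * The spherical connection and the deviation from constant curvature *)

Section sphere_connection.
Context {R : realType} {n : nat}.
Variables (A : set 'rV[R]_n) (g : 'rV[R]_n -> 'M[R]_n).
Hypothesis lm : local_metric A g.
Let hA : hopen A := lm_open lm.
Let sg : smooth_mx A g := lm_smooth lm.
Let symg : forall x, A x -> (g x)^T = g x := lm_sym lm.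

Lemma pdmx_block (a : 'rV[R]_n -> 'M[R]_1) (b : 'rV[R]_n -> 'M[R]_(1, n))
  (c : 'rV[R]_n -> 'M[R]_(n, 1)) (d : 'rV[R]_n -> 'M[R]_n) k x :
 pdmx k (fun y => block_mx (a y) (b y) (c y) (d y)) x =
 block_mx (pdmx k a x) (pdmx k b x) (pdmx k c x) (pdmx k d x).
apply/matrixP => i j; case: (split_ordP i) => i' ->; case: (split_ordP j) => j' ->;
 rewrite ?(block_mxEul, block_mxEur, block_mxEdl, block_mxEdr) !pdmxE; congr pd;
 by apply/funext => y; rewrite ?(block_mxEul, block_mxEur, block_mxEdl, block_mxEdr).
Qed.

Lemma smooth_mx_block (a : 'rV[R]_n -> 'M[R]_1) (b : 'rV[R]_n -> 'M[R]_(1, n))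
  (c : 'rV[R]_n -> 'M[R]_(n, 1)) (d : 'rV[R]_n -> 'M[R]_n) :
 smooth_mx A a -> smooth_mx A b -> smooth_mx A c -> smooth_mx A d ->
 smooth_mx A (fun y => block_mx (a y) (b y) (c y) (d y)).
move=> sa sb sc sd i j; case: (split_ordP i) => i' ->; case: (split_ordP j) => j' ->.
- by apply: (smooth_on_ext _ (sa i' j')) => y _; rewrite block_mxEul.
- by apply: (smooth_on_ext _ (sb i' j')) => y _; rewrite block_mxEur.
- by apply: (smooth_on_ext _ (sc i' j')) => y _; rewrite block_mxEdl.
- by apply: (smooth_on_ext _ (sd i' j')) => y _; rewrite block_mxEdr.
Qed.

Let e (k : 'I_n) : 'cV[R]_n := delta_mx k 0.

Lemma mulmx_delta p (B : 'M[R]_(p, n)) k : B *m e k = col k B.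
by rewrite colE. Qed.

(* A row section (X | dX) is parallel for this connection exactly when
  D^2 X = - X g: on the unit sphere, for the linear functions. *)
Definition sph (k : 'I_n) (x : 'rV[R]_n) : 'M[R]_(1 + n) :=
 block_mx 0 (- row k (g x)) (e k) (gam g k x).

(** Its inverse is the fibre metric on the rows (f, df), preserved by [sph]. *)
Definition sph_metric (x : 'rV[R]_n) : 'M[R]_(1 + n) := block_mx 1%:M 0 0 (g x).

Lemma smooth_sph k : smooth_mx A (sph k).
apply: smooth_mx_block; [exact: smooth_mx_cst| |exact: smooth_mx_cst|exact: smooth_gam].
by apply: smooth_mxN; exact: smooth_row.
Qed.

Lemma smooth_sph_metric : smooth_mx A sph_metric.
by apply: smooth_mx_block => //; exact: smooth_mx_cst. Qed.

Lemma col_gam_sym j k x : A x -> col k (gam g j x) = col j (gam g k x).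
by move=> Ax; apply/colP => l; rewrite mxE [RHS]mxE (gam_sym lm). Qed.

Lemma sph_metric_compat k x : A x ->
 pdmx k sph_metric x = (sph k x)^T *m sph_metric x + sph_metric x *m sph k x.
move=> Ax; rewrite pdmx_block !(pdmx_cst hA Ax) (metric_compat lm) // tr_block_mx !mulmx_block.
rewrite add_block_mx !(trmx0, mulmx0, mul0mx, addr0, add0r, mulmx1, mul1mx) mulmx_delta.
have -> : (e k)^T *m g x = row k (g x) by rewrite trmx_delta rowE.
rewrite [(- row k (g x))^T]linearN /= tr_row symg // addNr subrr.
by [].
Qed.

(** Curvature minus that of the unit sphere. It is the Weyl tensor when Ric = (n - 1) g. *)
Definition weyl (j k : 'I_n) (x : 'rV[R]_n) : 'M[R]_n :=
 curv (gam g) j k x - e j *m row k (g x) + e k *m row j (g x).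

Lemma row_pd_g j k x : A x -> row k (pdmx j g x) = (col k (gam g j x))^T *m g x + row k (g x) *m gam g j x.
by move=> Ax; rewrite (metric_compat lm) // linearD /= !row_mul tr_col. Qed.

(** The off-diagonal blocks vanish because [gam] is symmetric and g is parallel. *)
Lemma curv_sph j k x : A x -> curv sph j k x = block_mx 0 0 0 (weyl j k x).
move=> Ax; rewrite /curv.
have dS a b : pdmx a (sph b) x = block_mx 0 (- row b (pdmx a g x)) 0 (pdmx a (gam g b) x).
 rewrite /sph pdmx_block !(pdmx_cst hA Ax) (pdmxN hA Ax); last exact: smooth_row.
 by rewrite row_pdmx.
rewrite !dS /sph !mulmx_block !(mulmx0, mul0mx, addr0, add0r) !mulmx_delta !opp_block_mx !add_block_mx.
have E00 : col k (- row j (g x)) - col j (- row k (g x)) = 0.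
 by apply/matrixP => a b; rewrite !mxE -{1}(symg Ax) mxE subrr.
rewrite !(oppr0, addr0, add0r) E00 (col_gam_sym j k Ax) subrr.
congr block_mx.
 rewrite !row_pd_g // (col_gam_sym j k Ax) !mulNmx.
 by mx_entries; ring.
rewrite /weyl /curv !mulmxN.
move: e e gam (gam g k x *m _) pdmx (pdmx k _ x) => a b c d p q.
by mx_entries; ring.
Qed.

Lemma weyl_anti j k x : weyl k j x = - weyl j k x.
rewrite /weyl curv_anti; move: e e curv => a b c.
by mx_entries; ring.
Qed.

Lemma weyl_skew j k x : A x -> g x *m weyl j k x + (weyl j k x)^T *m g x = 0.
move=> Ax; have := curv_skew hA smooth_sph j k Ax smooth_sph_metric (fun l y => @sph_metric_compat l y).
rewrite curv_sph // tr_block_mx !mulmx_block add_block_mx.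
rewrite !(trmx0, mulmx0, mul0mx, addr0, add0r) => /eqP.
by rewrite block_mx_eq0 => /and4P[_ _ _ /eqP].
Qed.

Lemma smooth_weyl j k : smooth_mx A (weyl j k).
have sr l : smooth_mx A (fun y => row l (g y)) by exact: smooth_row.
apply: smooth_mxD; last by apply: smooth_mxM => //; exact: smooth_mx_cst.
apply: smooth_mxB; last by apply: smooth_mxM => //; exact: smooth_mx_cst.
exact: (smooth_mx_curv hA (smooth_gam lm)).
Qed.

Definition dweyl i j k x := pdmx i (weyl j k) x + gam g i x *m weyl j k x - weyl j k x *m gam g i x.

Lemma dcurv_sph i j k x : A x ->
 dcurv sph i j k x = block_mx 0 (- row i (g x) *m weyl j k x) (- (weyl j k x *m e i)) (dweyl i j k x).
move=> Ax; rewrite /dcurv (pdmx_ext hA Ax (G := fun y => block_mx 0 0 0 (weyl j k y))); first last.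
- by move=> y Ay; exact: curv_sph.
- exact: (smooth_mx_curv hA smooth_sph).
rewrite pdmx_block !(pdmx_cst hA Ax) curv_sph // !mulmx_block opp_block_mx !add_block_mx.
by rewrite !(mulmx0, mul0mx, addr0, add0r, oppr0).
Qed.

(** The algebraic and the differential Bianchi identity are two blocks of the single differential
    identity for [sph]. *)
Lemma weyl_bianchi i j k x : A x ->
 weyl j k x *m e i + weyl k i x *m e j + weyl i j x *m e k = 0 /\
 dweyl i j k x + dweyl j k i x + dweyl k i j x = 0.
move=> Ax; have := bianchi hA smooth_sph i j k Ax; rewrite !dcurv_sph // !add_block_mx => /eqP.
rewrite block_mx_eq0 => /and4P[_ _ E /eqP ?]; split => //.
by move: E; rewrite -!opprD oppr_eq0 => /eqP.
Qed.

(** The classical octahedron argument: four cyclic sums, reduced by the two skew symmetries. *)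
Lemma pair_symmetry (I : Type) (Q : I -> I -> I -> I -> R) :
 (forall l i j k, Q i l j k = - Q l i j k) -> (forall l i j k, Q l i k j = - Q l i j k) ->
 (forall l i j k, Q l i j k + Q l j k i + Q l k i j = 0) ->
 forall l i j k, Q l i j k = Q j k l i.
move=> s1 s2 B l i j k.
have B1 := B l i j k; have B2 := B i j k l; have B3 := B j k l i; have B4 := B k l i j.
have a1 := s1 l i j k; have a2 := s1 j k l i; have a3 := s2 l i j k; have a4 := s2 j k l i.
have := s1 i j k l; have := s1 l j k i; have := s1 k j l i; have := s1 l k i j; have := s1 k i j l.
have := s2 i k l j; have := s2 i l j k; have := s2 j l i k; have := s2 k l i j; have := s2 k j l i; have := s2 i l k j.
lra.
Qed.

Variable f : 'rV[R]_n -> R.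
Hypotheses (sf : smooth_on A f) (f_hess : forall x, A x -> trfree g f x = 0).
Local Notation E := (gradup g f).

Lemma hess_rigid x : A x -> hessmx g f x = - (f x *: g x).
by move=> Ax; apply/eqP; rewrite -addr_eq0; apply/eqP; exact: f_hess. Qed.

Definition sph_section (x : 'rV[R]_n) : 'rV[R]_(1 + n) := row_mx (f x)%:M (drow f x).

Lemma smooth_sph_section : smooth_mx A sph_section.
move=> i j; rewrite ord1; case: (split_ordP j) => j' ->.
- by apply: (smooth_on_ext _ sf) => y _; rewrite row_mxEl ord1 mxE.
- by apply: (smooth_on_ext _ (smooth_drow lm sf 0 j')) => y _; rewrite row_mxEr.
Qed.

Lemma sph_section_parallel k x : A x -> pdmx k sph_section x = sph_section x *m sph k x.
move=> Ax; rewrite /sph mul_row_block mulmx0 add0r mulmx_delta mulmxN mul_scalar_mx.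
have -> : - (f x *: row k (g x)) + drow f x *m gam g k x = pdmx k (drow f) x.
 by rewrite -linearZ /= -linearN /= -hess_rigid // (hess_row lm) // subrK.
apply/rowP => j; case: (split_ordP j) => j' ->.
- rewrite row_mxEl (ord1 j') !mxE; congr pd.
 by apply/funext => y; rewrite row_mxEl mxE.
- rewrite row_mxEr !pdmxE; congr pd.
 by apply/funext => y; rewrite row_mxEr.
Qed.

Lemma drow_weyl j k x : A x -> drow f x *m weyl j k x = 0.
move=> Ax; have := parallel_curv hA smooth_sph j k Ax smooth_sph_section (fun l y => @sph_section_parallel l y).
rewrite curv_sph // mul_row_block !mulmx0 !add0r => /eqP.
by rewrite row_mx_eq0 => /andP[_ /eqP].
Qed.

(** The parallel section (f, df) is annihilated by the curvature; pair symmetry moves this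
    contraction from the endomorphism slot to a form slot. *)
Lemma grad_weyl k x : A x -> \sum_j E x 0 j *: weyl j k x = 0.
move=> Ax; have ug := g_unit lm Ax; apply: (can_inj (mulKmx ug)); rewrite mulmx0.
pose Q l i j k := (g x *m weyl j k x) l i.
have s1 a b c d : Q b a c d = - Q a b c d.
 have := weyl_skew c d Ax; rewrite /Q => /matrixP/(_ a b).
 rewrite [in LHS]mxE [RHS]mxE => /eqP; rewrite addrC addr_eq0 => /eqP H; rewrite -H.
 by rewrite -[in RHS](symg Ax) -trmx_mul [RHS]mxE.
have s2 a b c d : Q a b d c = - Q a b c d by rewrite /Q weyl_anti mulmxN oppmxE.
have B a b c d : Q a b c d + Q a c d b + Q a d b c = 0.
 have [/(congr1 (mulmx (g x)))] := weyl_bianchi b c d Ax.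
 rewrite mulmx0 !mulmxDr !mulmxA !mulmx_delta => /matrixP/(_ a 0) H _.
 by move: H; rewrite !(addmxE, zeromxE) ![col _ _ _ _]mxE.
have ps := pair_symmetry s1 s2 B.
apply/matrixP => l i; rewrite mulmx_sumr summxE.
rewrite (eq_bigr (fun j => E x 0 j * Q j k l i)); last first.
 by move=> j _; rewrite -scalemxAr scalemxE -ps.
have := drow_weyl l i Ax; rewrite -(gradup_g lm f Ax) -mulmxA => /rowP/(_ k).
by rewrite !mxE => H; rewrite -[RHS]H; apply: eq_bigr => j _; rewrite /Q.
Qed.

(** Connection matrix in the direction Df. It collects the non-tensorial terms of the transport
    equation, which cancel in the norm. *)
Definition grad_gam x : 'M[R]_n := \sum_l E x 0 l *: gam g l x.

Lemma pd_grad j i x : A x -> pd j (fun y => E y 0 i) x = - f x * (i == j)%:R - grad_gam x i j.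
move=> Ax; rewrite -[LHS]pdmxE (pd_gradup lm) // hess_rigid // linearN linearZ.
rewrite mulNmx -scalemxAl -row_mul (g_ginv lm) // addmxE oppmxE scalemxE.
rewrite [row j _ _ _]mxE [1%:M _ _]mxE eq_sym mulNr oppmxE; congr (_ - _).
rewrite mxE summxE; apply: eq_bigr => l _; rewrite scalemxE [_^T _ _]mxE.
by rewrite (gam_sym lm).
Qed.

(** In invariant terms D_E W = 2 f W for E = Df and W = [weyl]: contract the differential Bianchi
    identity with E, and use the derivative of [grad_weyl] together with DE = - f Id. *)
Lemma weyl_transport j k x : A x ->
 \sum_i E x 0 i *: pdmx i (weyl j k) x =
 weyl j k x *m grad_gam x - grad_gam x *m weyl j k x + (2 * f x) *: weyl j k x
 + \sum_i grad_gam x i j *: weyl i k x + \sum_i grad_gam x i k *: weyl j i x.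
move=> Ax.
have key a b : \sum_i E x 0 i *: pdmx a (weyl i b) x = f x *: weyl a b x + \sum_i grad_gam x i a *: weyl i b x.
 have sE i : smooth_on A (fun y => E y 0 i) by exact: (smooth_gradup lm sf).
 have H : pdmx a (fun y => \sum_i E y 0 i *: weyl i b y) x = 0.
  transitivity (pdmx a (fun=> 0 : 'M[R]_n) x); last by rewrite (pdmx_cst hA Ax).
  apply/esym; apply: (pdmx_ext hA Ax); first exact: smooth_mx_cst.
  by move=> y Ay; rewrite grad_weyl.
 have D : pdmx a (fun y => \sum_i E y 0 i *: weyl i b y) x =
   \sum_i (pd a (fun y => E y 0 i) x *: weyl i b x + E x 0 i *: pdmx a (weyl i b) x).
  apply/matrixP => p q; rewrite pdmxE summxE.
  rewrite (_ : (fun y => _) = fun y => \sum_i (E y 0 i *: weyl i b y) p q); last first.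
   by apply/funext => y; rewrite summxE.
  rewrite (pd_sum hA Ax) => [|i]; last exact: (smooth_mxZ (sE i) (smooth_weyl i b)).
  by apply: eq_bigr => i _; rewrite -(pdmxE a (fun y => E y 0 i *: weyl i b y)) (pdmxZ hA Ax) //; exact: smooth_weyl.
 move: H; rewrite D big_split /= => /eqP; rewrite addrC addr_eq0 => /eqP ->.
 rewrite -sumrN.
 have -> : f x *: weyl a b x = \sum_i (f x * (i == a)%:R) *: weyl i b x.
  rewrite (bigD1 a) //= big1 => [|i ia]; last by rewrite (negbTE ia) mulr0 scale0r.
  by rewrite eqxx mulr1 addr0.
 rewrite -big_split /=; apply: eq_bigr => i _.
 by rewrite (pd_grad a i Ax) -scaleNr opprD mulNr !opprK scalerDl.
have sumB : \sum_i E x 0 i *: (dweyl i j k x + dweyl j k i x + dweyl k i j x) = 0.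
 by rewrite big1 // => i _; have [_ ->] := weyl_bianchi i j k Ax; rewrite scaler0.
have D1 : \sum_i E x 0 i *: dweyl i j k x = \sum_i E x 0 i *: pdmx i (weyl j k) x
  + grad_gam x *m weyl j k x - weyl j k x *m grad_gam x.
 rewrite /grad_gam mulmx_suml mulmx_sumr -big_split /= -sumrB; apply: eq_bigr => i _.
 by rewrite -scalemxAl -scalemxAr /dweyl scalerBr scalerDr.
have D2 a b : \sum_i E x 0 i *: dweyl a i b x = f x *: weyl a b x + \sum_i grad_gam x i a *: weyl i b x.
 rewrite -key (eq_bigr (fun i => E x 0 i *: pdmx a (weyl i b) x + (gam g a x *m (E x 0 i *: weyl i b x)
   - (E x 0 i *: weyl i b x) *m gam g a x))).
  by rewrite big_split /= sumrB -mulmx_sumr -mulmx_suml grad_weyl // mulmx0 mul0mx subrr addr0.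
 by move=> i _; rewrite -scalemxAr -scalemxAl -scalerBr -scalerDr /dweyl addrA.
have D3 : \sum_i E x 0 i *: dweyl j k i x = - (f x *: weyl j k x + \sum_i grad_gam x i j *: weyl i k x).
 rewrite -D2 -sumrN; apply: eq_bigr => i _; rewrite /dweyl weyl_anti.
 have -> : pdmx j (weyl k i) x = - pdmx j (weyl i k) x.
  rewrite -(pdmxN hA Ax); last exact: smooth_weyl.
  by congr (pdmx j _ x); apply/funext => y; rewrite weyl_anti.
 by rewrite mulmxN mulNmx -scalerN; congr (_ *: _); rewrite opprB addrC opprD opprK addrA.
move: sumB; rewrite (eq_bigr (fun i => E x 0 i *: dweyl i j k x + E x 0 i *: dweyl j k i x + E x 0 i *: dweyl k i j x)); last first.
 by move=> i _; rewrite !scalerDr.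
rewrite !big_split /= D1 D3 D2.
have -> : \sum_i grad_gam x i k *: weyl i j x = - \sum_i grad_gam x i k *: weyl j i x.
 by rewrite -sumrN; apply: eq_bigr => i _; rewrite weyl_anti scalerN.
rewrite (weyl_anti j k).
set s1 := \sum_i E x 0 i *: pdmx i _ x; set s2 := \sum_i grad_gam x i j *: _.
set s3 := \sum_i grad_gam x i k *: weyl j i x; set p := grad_gam x *m _; set q := _ *m grad_gam x.
set W := weyl j k x; move: W p q s1 s2 s3 => W p q s1 s2 s3 H.
mx_entries; have := congr1 (fun M : matrix _ _ _ => M a b) H; rewrite ?(addmxE, oppmxE, scalemxE, zeromxE).
lra.
Qed.

End sphere_connection.

(** * The squared norm of the curvature deviation and its transport *)

Section curvature_norm.
Context {R : realType} {n : nat}.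

(** [N a b] gathers, over the two form indices, the (a, b) entries of the endomorphisms. Pairing
    [N a b] with [N b a] forms traces of products of endomorphisms, nonpositive on squares of skew
    maps, whence the sign; the metric enters only on form indices. *)
Definition comp_norm (h : 'M[R]_n) (N : 'I_n -> 'I_n -> 'M[R]_n) : R :=
 - \sum_a \sum_b \tr (h *m N a b *m h *m (N b a)^T).

(** The terms in G are an infinitesimal change of basis, under which the norm is invariant. They
    cancel separately on the form indices, together with dh, and on the endomorphism indices; only
    the scaling t survives. *)
Lemma comp_norm_deriv (h G : 'M[R]_n) (N dN : 'I_n -> 'I_n -> 'M[R]_n) (dh : 'M[R]_n) (t : R) :
 dh = - (h *m G^T) - G *m h ->
 (forall a b, dN a b = \sum_c (G c b *: N a c - G a c *: N c b) + t *: N a b + G^T *m N a b + N a b *m G) ->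
 - \sum_a \sum_b \tr (dh *m N a b *m h *m (N b a)^T + h *m dN a b *m h *m (N b a)^T
   + h *m N a b *m dh *m (N b a)^T + h *m N a b *m h *m (dN b a)^T) = 2 * t * comp_norm h N.
move=> Eh EN; rewrite mulrN; congr (- _).
pose be P Q := \tr (h *m P *m h *m Q^T).
pose C a b := \sum_c (G c b *: N a c - G a c *: N c b).
have beD P P' Q : be (P + P') Q = be P Q + be P' Q.
 by rewrite /be mulmxDr !mulmxDl mxtrace_addE.
have beD' P Q Q' : be P (Q + Q') = be P Q + be P Q'.
 nra.
have beZ c P Q : be (c *: P) Q = c * be P Q.
 by rewrite /be -scalemxAr -!scalemxAl mxtraceZ.
have beZ' c P Q : be P (c *: Q) = c * be P Q.
 by rewrite /be linearZ -scalemxAr mxtraceZ.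
have be0 Q : be 0 Q = 0 by rewrite /be mulmx0 !mul0mx mxtrace0.
have be0' P : be P 0 = 0 by nra.
have beS F Q : be (\sum_c F c) Q = \sum_c be (F c) Q.
 exact: (big_morph (be ^~ Q)).
have beS' P F : be P (\sum_c F c) = \sum_c be P (F c).
 exact: big_morph.
have step a b : \tr (dh *m N a b *m h *m (N b a)^T + h *m dN a b *m h *m (N b a)^T
   + h *m N a b *m dh *m (N b a)^T + h *m N a b *m h *m (dN b a)^T)
  = be (C a b) (N b a) + be (N a b) (C b a) + 2 * t * be (N a b) (N b a).
 (* Cancellation on the form indices. *)
 have lie P Q : \tr (dh *m P *m h *m Q^T) + be (G^T *m P + P *m G) Q + \tr (h *m P *m dh *m Q^T)
   + be P (G^T *m Q + Q *m G) = 0.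
  rewrite /be Eh trmx_addE !trmx_mul trmxK !mulmx_rules !mxtrace_addE.
  rewrite !mxtrace_oppE.
  have -> : \tr (G *m h *m P *m h *m Q^T) = \tr (h *m P *m h *m Q^T *m G).
   by rewrite -!mulmxA [LHS]mxtrace_mulC -!mulmxA.
  move: (\tr _) (\tr _) (\tr _) (\tr _) => q1 q2 q3 q4; ring.
 rewrite !mxtrace_addE !EN.
 have := lie (N a b) (N b a).
 rewrite -[\tr (h *m _ *m h *m _)]/(be (C a b + t *: N a b + G^T *m N a b + N a b *m G) (N b a)).
 rewrite -[\tr (h *m N a b *m h *m _^T)]/(be (N a b) (C b a + t *: N b a + G^T *m N b a + N b a *m G)).
 rewrite !beD !beD' !beZ !beZ'.
 move: (\tr _) (\tr _) => q1 q2; lra.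
under eq_bigr => a _ do under eq_bigr => b _ do rewrite step.
under eq_bigr => a _ do rewrite big_split.
rewrite big_split /= [X in X + _](_ : _ = 0) ?add0r.
 by rewrite mulr_sumr; apply: eq_bigr => a _; rewrite mulr_sumr; apply: eq_bigr => b _.
pose X a b := \sum_c G c b * be (N a c) (N b a); pose Y a b := \sum_c G a c * be (N c b) (N b a).
pose Z a b := \sum_c G c a * be (N a b) (N b c); pose V a b := \sum_c G b c * be (N a b) (N c a).
have E a b : be (C a b) (N b a) + be (N a b) (C b a) = X a b - Y a b + (Z a b - V a b).
 rewrite beS beS' -!sumrB -!big_split; apply: eq_bigr => c _.
 have beN P Q : be (- P) Q = - be P Q by rewrite -scaleN1r beZ mulN1r.
 have beN' P Q : be P (- Q) = - be P Q by lra.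
 by rewrite beD beD' beN beN' !beZ !beZ'.
under eq_bigr => a _ do under eq_bigr => b _ do rewrite E.
have s1 : \sum_a \sum_b X a b = \sum_a \sum_b V a b.
 apply: eq_bigr => a _; rewrite /V exchange_big; apply: eq_bigr => b _.
 lra.
have s2 : \sum_a \sum_b Y a b = \sum_a \sum_b Z a b.
 rewrite exchange_big [RHS]exchange_big; apply: eq_bigr => b _.
 by rewrite exchange_big; apply: eq_bigr => a _; apply: eq_bigr => c _.
under eq_bigr => a _ do rewrite big_split !sumrB.
rewrite big_split /= !sumrB s1 s2; ring.
Qed.

Lemma comp_transport_entry (w N : 'I_n -> 'I_n -> 'M[R]_n) (G : 'M[R]_n) (t : R) a b j k :
 (forall p q r s, N p q r s = w r s p q) ->
 (w j k *m G - G *m w j k + t *: w j k + \sum_i G i j *: w i k + \sum_i G i k *: w j i) a b =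
 (\sum_c (G c b *: N a c - G a c *: N c b) + t *: N a b + G^T *m N a b + N a b *m G) j k.
move=> NE; rewrite !(addmxE, oppmxE, scalemxE) !summxE NE; congr (_ + _ + _ + _).
- rewrite !mxE -sumrB; apply: eq_bigr => c _.
 by rewrite !(addmxE, oppmxE, scalemxE) !NE mulrC.
- by rewrite [RHS]mxE; apply: eq_bigr => c _; rewrite scalemxE NE [_^T _ _]mxE.
- by rewrite [RHS]mxE; apply: eq_bigr => c _; rewrite scalemxE NE mulrC.
Qed.

Lemma comp_normE (h : 'M[R]_n) (W : 'I_n -> 'I_n -> 'M[R]_n) :
 comp_norm h (fun a b => \matrix_(j, k) W j k a b) =
 - \sum_j \sum_k \sum_l \sum_m h l j * h k m * \tr (W j k *m W l m).
congr (- _).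
transitivity (\sum_a \sum_b \sum_j \sum_k \sum_l \sum_m h l j * h k m * (W j k a b * W l m b a)).
 apply: eq_bigr => a _; apply: eq_bigr => b _.
 transitivity (\sum_l \sum_m \sum_k \sum_j h l j * h k m * (W j k a b * W l m b a)).
  apply: eq_bigr => l _; rewrite mxE; apply: eq_bigr => m _.
  rewrite !mxE mulr_suml; apply: eq_bigr => k _; rewrite !mxE !mulr_suml; apply: eq_bigr => j _.
  by rewrite !mxE; ring.
 under eq_bigr => l _ do (rewrite exchange_big; under eq_bigr => k _ do rewrite exchange_big; rewrite exchange_big).
 rewrite exchange_big; apply: eq_bigr => j _; rewrite exchange_big; apply: eq_bigr => k _.
 lra.
under eq_bigr => a _ do (rewrite exchange_big; under eq_bigr => j _ do (rewrite exchange_big;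
 under eq_bigr => k _ do (rewrite exchange_big; under eq_bigr => l _ do rewrite exchange_big))).
rewrite exchange_big; apply: eq_bigr => j _; rewrite exchange_big; apply: eq_bigr => k _.
rewrite exchange_big; apply: eq_bigr => l _; rewrite exchange_big; apply: eq_bigr => m _.
rewrite mulr_sumr; apply: eq_bigr => a _; rewrite mxE mulr_sumr.
nra.
Qed.

Lemma comp_norm_frame (h K : 'M[R]_n) (N : 'I_n -> 'I_n -> 'M[R]_n) : h = K^T *m K ->
 comp_norm h N = - \sum_p \sum_q \sum_a \sum_b (K *m N a b *m K^T) p q * (K *m N b a *m K^T) p q.
move=> ->; congr (- _).
transitivity (\sum_a \sum_b \sum_p \sum_q (K *m N a b *m K^T) p q * (K *m N b a *m K^T) p q).
 apply: eq_bigr => a _; apply: eq_bigr => b _.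
 have -> : \tr (K^T *m K *m N a b *m (K^T *m K) *m (N b a)^T) = \tr ((K *m N a b *m K^T) *m (K *m N b a *m K^T)^T).
  by rewrite !trmx_mul trmxK -!mulmxA [LHS]mxtrace_mulC -!mulmxA.
 by apply: eq_bigr => p _; rewrite mxE; apply: eq_bigr => q _; rewrite [X in _ * X]mxE.
under eq_bigr => a _ do (rewrite exchange_big; under eq_bigr => p _ do rewrite exchange_big).
by rewrite exchange_big; apply: eq_bigr => p _; rewrite exchange_big.
Qed.

(** In an orthonormal basis U becomes a skew matrix V, and tr(V^2) is minus the sum of the squares
    of its entries. *)
Lemma skew_trace (g K U : 'M[R]_n) : K \in unitmx -> invmx g = K^T *m K -> g \in unitmx ->
 g *m U + U^T *m g = 0 ->
 \tr (U *m U) <= 0 /\ (\tr (U *m U) = 0 -> U = 0).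
move=> uK hK ug skew; have uKT : K^T \in unitmx by rewrite unitmx_tr.
pose V := invmx K^T *m U *m K^T.
have KU : U = K^T *m V *m invmx K^T by rewrite !mulmxA mulmxV // mul1mx mulmxK.
have KgK : K *m g *m K^T = 1%:M.
 apply: (can_inj (mulKmx uKT)); rewrite !mulmxA -hK mulVmx // mul1mx mulmx1 //.
have VT : V^T = - V.
 have := congr1 (fun X => K *m X *m K^T) skew; rewrite mulmxDr mulmxDl mulmx0 mul0mx.
 have -> : K *m (g *m U) *m K^T = V.
  by rewrite KU !mulmxA KgK mul1mx mulmxKV.
 have -> : K *m (U^T *m g) *m K^T = V^T.
  have gKT : g *m K^T = invmx K by apply: (can_inj (mulKmx uK)); rewrite mulmxA mulmxV.
  by rewrite !trmx_mul trmx_inv trmxK -!mulmxA gKT.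
 by move/eqP; rewrite addrC addr_eq0 => /eqP.
have tr : \tr (U *m U) = - \sum_i \sum_j V i j ^+ 2.
 have -> : \tr (U *m U) = \tr (V *m V).
  by rewrite {1 2}KU !mulmxA mulmxKV // mxtrace_mulC !mulmxA mulVmx // mul1mx.
 rewrite -sumrN; apply: eq_bigr => i _; rewrite mxE -sumrN; apply: eq_bigr => j _.
 have -> : V j i = - V i j by have /matrixP/(_ i j) := VT; rewrite !mxE.
 nra.
have s0 : 0 <= \sum_i \sum_j V i j ^+ 2 by do 2![apply: sumr_ge0 => ? _]; exact: sqr_ge0.
split; first by nra.
rewrite tr => /eqP; rewrite oppr_eq0 psumr_eq0 => [/allP H|i _]; last by apply: sumr_ge0 => ? _; exact: sqr_ge0.
rewrite KU (_ : V = 0) ?mulmx0 ?mul0mx //; apply/matrixP => i j; rewrite [RHS]mxE.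
have := H i (mem_index_enum _); rewrite psumr_eq0 => [/allP/(_ j (mem_index_enum _))|k _]; last exact: sqr_ge0.
nra.
Qed.

(** An orthonormal frame in the form indices splits the norm into terms - tr(U_pq^2), each of them
    nonnegative by [skew_trace]. *)
Lemma comp_norm_skew (g : 'M[R]_n) (K : 'M[R]_n) (W : 'I_n -> 'I_n -> 'M[R]_n) :
 K \in unitmx -> invmx g = K^T *m K -> g \in unitmx ->
 (forall j k, g *m W j k + (W j k)^T *m g = 0) ->
 0 <= comp_norm (invmx g) (fun a b => \matrix_(j, k) W j k a b) /\
 (comp_norm (invmx g) (fun a b => \matrix_(j, k) W j k a b) = 0 -> forall j k, W j k = 0).
move=> uK hK ug skew; rewrite (comp_norm_frame _ hK).
pose U p q := \sum_j \sum_k (K p j * K q k) *: W j k.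
have UE a b p q : (K *m (\matrix_(j, k) W j k a b) *m K^T) p q = U p q a b.
 transitivity (\sum_k \sum_j K p j * K q k * W j k a b).
  rewrite mxE; apply: eq_bigr => k _; rewrite !mxE mulr_suml; apply: eq_bigr => j _.
  by rewrite !mxE; ring.
 rewrite exchange_big summxE; apply: eq_bigr => j _; rewrite summxE.
 by apply: eq_bigr => k _; rewrite mxE.
have sU p q : g *m U p q + (U p q)^T *m g = 0.
 have UT : (U p q)^T = \sum_j \sum_k (K p j * K q k) *: (W j k)^T.
  rewrite raddf_sum; apply: eq_bigr => j _; rewrite raddf_sum /=; apply: eq_bigr => k _.
  by rewrite linearZ.
 rewrite UT mulmx_sumr mulmx_suml -big_split big1 //= => j _.
 rewrite mulmx_sumr mulmx_suml -big_split big1 //= => k _.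
 by rewrite -scalemxAr -scalemxAl -scalerDr skew scaler0.
have E : \sum_p \sum_q \sum_a \sum_b (K *m (\matrix_(j, k) W j k a b) *m K^T) p q * (K *m (\matrix_(j, k) W j k b a) *m K^T) p q
  = \sum_p \sum_q \tr (U p q *m U p q).
 apply: eq_bigr => p _; apply: eq_bigr => q _; apply: eq_bigr => a _; rewrite mxE.
 by apply: eq_bigr => b _; rewrite !UE.
rewrite E; have T p q := skew_trace uK hK ug (sU p q).
split; first by rewrite oppr_ge0; do 2![apply: sumr_le0 => ? _]; exact: (T _ _).1.
rewrite -sumrN => /eqP; rewrite psumr_eq0 => [/allP H|p _]; last first.
 by rewrite oppr_ge0; apply: sumr_le0 => q _; exact: (T _ _).1.
have U0 p q : U p q = 0.
 apply: (T p q).2; have := H p (mem_index_enum _); rewrite -sumrN psumr_eq0 => [/allP/(_ q (mem_index_enum _))|r _].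
  lra.
 by rewrite oppr_ge0; exact: (T _ _).1.
move=> j k; apply/matrixP => a b; rewrite [RHS]mxE.
have Z : K *m (\matrix_(j, k) W j k a b) *m K^T = 0 by apply/matrixP => p q; rewrite UE U0 !mxE.
have uKT : K^T \in unitmx by rewrite unitmx_tr.
have : \matrix_(j, k) W j k a b = 0 :> 'M[R]_n.
 by apply: (can_inj (mulKmx uK)); apply: (can_inj (mulmxK uKT)); rewrite mulmx0 mul0mx.
by move/matrixP/(_ j k); rewrite !mxE.
Qed.

End curvature_norm.

Section weyl_norm.
Context {R : realType} {n : nat}.
Variables (A : set 'rV[R]_n) (g : 'rV[R]_n -> 'M[R]_n).
Hypothesis lm : local_metric A g.
Let hA : hopen A := lm_open lm.

Definition weyl_comp (a b : 'I_n) (x : 'rV[R]_n) : 'M[R]_n := \matrix_(j, k) weyl g j k x a b.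

Definition weyl_norm (x : 'rV[R]_n) : R := comp_norm (ginv g x) (fun a b => weyl_comp a b x).

Lemma smooth_weyl_comp a b : smooth_mx A (weyl_comp a b).
move=> j k; apply: (smooth_on_ext _ (smooth_weyl lm j k a b)) => y _.
by rewrite [RHS]mxE.
Qed.

Let term a b y := ginv g y *m weyl_comp a b y *m ginv g y *m (weyl_comp b a y)^T.

Let smooth_term a b : smooth_mx A (term a b).
apply: smooth_mxM; last by apply: smooth_mx_tr; exact: smooth_weyl_comp.
apply: smooth_mxM; last exact: smooth_ginv.
by apply: smooth_mxM; [exact: smooth_ginv|exact: smooth_weyl_comp].
Qed.

Let smooth_trterm a b : smooth_on A (fun y => \tr (term a b y)).
by apply: smooth_on_sum => i _; exact: smooth_term. Qed.

Lemma smooth_weyl_norm : smooth_on A weyl_norm.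
by apply: smooth_onN; apply: smooth_on_sum => a _; apply: smooth_on_sum => b _; exact: smooth_trterm.
Qed.

Lemma weyl_norm_ge0 x : A x -> 0 <= weyl_norm x /\ (weyl_norm x = 0 -> forall j k, weyl g j k x = 0).
move=> Ax; have [K [uK hK]] := ginv_frame lm Ax.
exact: (comp_norm_skew uK hK (g_unit lm Ax) (fun j k => weyl_skew lm j k Ax)).
Qed.

Definition dirmx p q (v : 'rV[R]_n) (F : 'rV[R]_n -> 'M[R]_(p, q)) x := \sum_i v 0 i *: pdmx i F x.

Lemma dirmxM p q r v (F : 'rV[R]_n -> 'M[R]_(p, q)) (G : 'rV[R]_n -> 'M[R]_(q, r)) x : A x ->
 smooth_mx A F -> smooth_mx A G ->
 dirmx v (fun y => F y *m G y) x = dirmx v F x *m G x + F x *m dirmx v G x.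
move=> Ax sF sG; rewrite mulmx_suml mulmx_sumr -big_split; apply: eq_bigr => i _.
by rewrite (pdmxM hA Ax) // scalerDr scalemxAl scalemxAr.
Qed.

Lemma dirmx_tr p q v (F : 'rV[R]_n -> 'M[R]_(p, q)) x : A x -> smooth_mx A F ->
 dirmx v (fun y => (F y)^T) x = (dirmx v F x)^T.
move=> Ax sF; rewrite raddf_sum /=; apply: eq_bigr => i _.
by rewrite (pdmx_tr hA Ax) // linearZ.
Qed.

Lemma dd_trace v p (F : 'rV[R]_n -> 'M[R]_p) x : A x -> smooth_mx A F ->
 dd v (fun y => \tr (F y)) x = \tr (dirmx v F x).
move=> Ax sF; rewrite raddf_sum; apply: eq_bigr => i _ /=.
by rewrite (pd_trace lm) // linearZ.
Qed.

Variable f : 'rV[R]_n -> R.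
Hypotheses (sf : smooth_on A f) (f_hess : forall x, A x -> trfree g f x = 0).
Local Notation E := (gradup g f).

(** The scaling is t = 2 f in [comp_norm_deriv], doubled because the norm is quadratic. *)
Lemma weyl_norm_transport x : A x -> dd (E x) weyl_norm x = 4 * f x * weyl_norm x.
move=> Ax; pose v := E x; pose h := ginv g x.
pose dN a b := dirmx v (weyl_comp a b) x.
have sh := smooth_ginv lm; have sN := smooth_weyl_comp.
have D : dd v weyl_norm x = - \sum_a \sum_b \tr (dirmx v (ginv g) x *m weyl_comp a b x *m h *m (weyl_comp b a x)^T
  + h *m dN a b *m h *m (weyl_comp b a x)^T + h *m weyl_comp a b x *m dirmx v (ginv g) x *m (weyl_comp b a x)^T
  + h *m weyl_comp a b x *m h *m (dN b a)^T).
 have key i : pd i weyl_norm x = - \sum_a \sum_b pd i (fun y => \tr (term a b y)) x.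
  rewrite (pdN hA Ax); last first.
   by apply: smooth_on_sum => a _; apply: smooth_on_sum => b _; exact: smooth_trterm.
  congr (- _); rewrite (pd_sum hA Ax) => [|a]; last by apply: smooth_on_sum => b _; exact: smooth_trterm.
  by apply: eq_bigr => a _; rewrite (pd_sum hA Ax) // => b; exact: smooth_trterm.
 rewrite /dd; under eq_bigr => i _ do rewrite key mulrN mulr_sumr.
 rewrite sumrN; congr (- _); rewrite exchange_big; apply: eq_bigr => a _.
 under eq_bigr => i _ do rewrite mulr_sumr.
 rewrite exchange_big; apply: eq_bigr => b _.
 rewrite -[LHS]/(dd v (fun y => \tr (term a b y)) x) dd_trace //; congr (\tr _).
 have s1 : smooth_mx A (fun y => ginv g y *m weyl_comp a b y) by exact: smooth_mxM.
 have s2 : smooth_mx A (fun y => ginv g y *m weyl_comp a b y *m ginv g y) by exact: smooth_mxM.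
 have s3 : smooth_mx A (fun y => (weyl_comp b a y)^T) by exact: smooth_mx_tr.
 rewrite (dirmxM v Ax s2 s3) (dirmxM v Ax s1 sh) (dirmxM v Ax sh (sN a b)) (dirmx_tr v Ax (sN b a)).
 by rewrite !mulmxDl.
rewrite D (comp_norm_deriv (G := grad_gam g f x) (t := 2 * f x)).
- by lra.
- rewrite /dirmx; under eq_bigr => i _ do rewrite (pd_ginv lm) // scalerBr scalerN scalemxAr scalemxAl.
 rewrite sumrB sumrN -mulmx_sumr -mulmx_suml; congr (- (_ *m _) - _).
 by rewrite raddf_sum /=; apply: eq_bigr => i _; rewrite linearZ.
- move=> a b; apply/matrixP => j k; rewrite summxE.
 have := weyl_transport lm sf f_hess j k Ax => /matrixP/(_ a b); rewrite summxE => W.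
 transitivity (\sum_i (v 0 i *: pdmx i (weyl g j k) x) a b).
  apply: eq_bigr => i _; rewrite !scalemxE !pdmxE; congr (_ * pd i _ x).
  by apply/funext => y; rewrite mxE.
 have wc p q r s : weyl_comp p q x r s = weyl g r s x p q by rewrite mxE.
 rewrite W.
 by rewrite (@comp_transport_entry R n (fun j k => weyl g j k x) (fun a b => weyl_comp a b x) (grad_gam g f x) (2 * f x) a b j k wc).
Qed.

End weyl_norm.

(** * Behaviour under change of chart *)

Lemma tr_sub_add_entry (R : realType) n (P Q W : 'M[R]_n) i j :
 (P^T - Q + W) i j = P j i - Q i j + W i j.
by rewrite !mxE. Qed.

Lemma pd_mx_sym (R : realType) n m (A : set 'rV[R]_n) (phi : 'rV[R]_n -> 'rV[R]_m) i j k y :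
 hopen A -> A y -> smooth_map_on A phi -> pdmx k (pd_mx phi) y i j = pdmx i (pd_mx phi) y k j.
move=> hA Ay sphi.
have E p q : pdmx p (pd_mx phi) y q j = pd p (pd q (fun z => phi z 0 j)) y.
 by rewrite pdmxE; congr pd; apply/funext => z; rewrite mxE.
exact: etrans (E k i) (etrans (pd_comm hA Ay k i (sphi j)) (esym (E i k))).
Qed.

(** Algebraic core of [gam_change]: equating the two expressions for the derivative of the metric
    says that the difference of the connections is skew after an index is lowered. *)
Lemma gauge_skew (R : realType) n (p q r j H : 'M[R]_n) : H^T = H ->
 p *m H *m j^T + j *m (q^T *m H + H *m q) *m j^T + j *m H *m p^T
  = r^T *m (j *m H *m j^T) + j *m H *m j^T *m r ->
 j *m H *m (p^T - j^T *m r + q *m j^T) + (j *m H *m (p^T - j^T *m r + q *m j^T))^T = 0.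
move=> symH.
rewrite !(trmx_mul, trmx_addE, trmx_oppE, trmxK, symH).
rewrite !mulmx_rules.
set t1 := p *m H *m j^T; set t2 := j *m q^T *m H *m j^T; set t3 := j *m H *m q *m j^T.
set t4 := j *m H *m p^T; set t5 := r^T *m j *m H *m j^T; set t6 := j *m H *m j^T *m r.
move: t1 t2 t3 t4 t5 t6 => t1 t2 t3 t4 t5 t6 Q.
mx_entries; have := congr1 (fun Z : matrix _ _ _ => Z a b) Q; rewrite ?(addmxE, oppmxE); lra.
Qed.

Section chart_change.
Context {R : realType} {n : nat} {T : topologicalType}.
Variable M : riem_data R n T.
Hypotheses (n0 : (0 < n)%N) (mM : smooth_manifold M) (rM : riemannian_metric M).
Variables (a b : chart_index M) (x : 'rV[R]_n).
Hypothesis Ox : overlap a b x.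
Let D := overlap a b.
Let tau := transition a b.
Let hD : hopen D := overlap_hopen mM a b.
Let lmA := chart_local_metric mM rM a.
Let lmB := chart_local_metric mM rM b.
Let Ax : cimage (charts a) x := overlap_img mM Ox.
Let J := jac a b.
Let S y := (J y)^T.
Let G := metric b (tau x).

Lemma pdmx_transition p q (F : 'rV[R]_n -> 'M[R]_(p, q)) k y : D y -> smooth_mx (cimage (charts b)) F ->
 pdmx k (fun y => F (tau y)) y = \sum_l J y k l *: pdmx l F (tau y).
move=> Dy sF; apply/matrixP => i j; rewrite pdmxE summxE.
have := pd_comp k hD (chart_hopen mM b) (transition_smooth mM (b := b)) (@transition_img _ _ _ _ mM a b) Dy (sF i j).
by rewrite /comp => ->; apply: eq_bigr => l _; rewrite scalemxE; congr (_ * _); rewrite mxE.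
Qed.

Lemma smooth_mx_transition p q (F : 'rV[R]_n -> 'M[R]_(p, q)) : smooth_mx (cimage (charts b)) F ->
 smooth_mx D (fun y => F (tau y)).
move=> sF i j; exact: (smooth_on_comp (transition_smooth mM (b := b)) (@transition_img _ _ _ _ mM a b) (sF i j)).
Qed.

Lemma smooth_jac : smooth_mx D J.
move=> i k; apply: smooth_on_ext => [y _|]; first by rewrite mxE.
by apply: smooth_on_pd hD _; exact: transition_smooth.
Qed.

Lemma pd_jac_sym k i m y : D y -> pdmx k J y i m = pdmx i J y k m.
move=> Dy; exact: pd_mx_sym hD Dy (transition_smooth mM (b := b)).
Qed.

Let smA p q (F : 'rV[R]_n -> 'M[R]_(p, q)) : smooth_mx (cimage (charts a)) F -> smooth_mx D F.
by move=> sF i j; apply: smooth_on_sub (sF i j); exact: overlap_img. Qed.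

Definition pulled_gam k y : 'M[R]_n := \sum_l J y k l *: gam (metric b) l (tau y).

Lemma smooth_pulled_gam k : smooth_mx D (pulled_gam k).
move=> i j; apply: smooth_on_ext => [y _|].
 by rewrite summxE.
apply: smooth_on_sum => l _; apply: smooth_mxZ; first exact: smooth_jac.
by apply: smooth_mx_transition; exact: smooth_gam.
Qed.

(** Uniqueness of the Levi-Civita connection: the difference [Dk] of the two sides is symmetric in
    its lower indices and, once lowered, skew by metric compatibility in both charts; such a tensor
    vanishes. *)
Lemma gam_change k y : D y -> pdmx k S y = S y *m gam (metric a) k y - pulled_gam k y *m S y.
move=> Dy; have Ay := overlap_img mM Dy; have By := transition_img mM Dy.
pose H := metric b (tau y).
have sJ := smooth_jac; have sS : smooth_mx D S by exact: smooth_mx_tr.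
have sH : smooth_mx D (fun z => metric b (tau z)) by apply: smooth_mx_transition; exact: lm_smooth.
have SE : pdmx k S y = (pdmx k J y)^T by rewrite (pdmx_tr hD Dy).
have sA : smooth_mx D (metric a) by apply: smA; exact: lm_smooth.
have symH : H^T = H by exact: (lm_sym lmB).
pose Dk i := (pdmx i J y)^T - S y *m gam (metric a) i y + pulled_gam i y *m S y.
pose Tk i := J y *m H *m Dk i.
have Dsym i j m : Dk i m j = Dk j m i.
 apply: (etrans (tr_sub_add_entry _ _ _ m j)); apply: (etrans _ (esym (tr_sub_add_entry _ _ _ m i))).
 congr (_ - _ + _); first exact: pd_jac_sym.
  rewrite mxE [RHS]mxE; apply: eq_bigr => l _; by rewrite (gam_sym lmA).
 rewrite !mulmx_suml !summxE.
 transitivity (\sum_l \sum_p J y i l * gam (metric b) l (tau y) m p * J y j p).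
  apply: eq_bigr => l _; rewrite mxE; apply: eq_bigr => p _; by rewrite scalemxE [_^T _ _]mxE.
 rewrite exchange_big; apply: eq_bigr => l _; rewrite [RHS]mxE; apply: eq_bigr => p _.
 by rewrite scalemxE [_^T _ _]mxE (gam_sym lmB p l m By); ring.
have Tsym i j m : Tk i m j = Tk j m i.
 by rewrite !mxE; apply: eq_bigr => l _; rewrite Dsym.
have Tskew i : Tk i + (Tk i)^T = 0.
 have gE z : D z -> metric a z = J z *m metric b (tau z) *m S z by exact: metric_change.
 have E := metric_compat lmA i Ay.
 have E2 : pdmx i (metric a) y = pdmx i J y *m H *m S y
   + J y *m ((pulled_gam i y)^T *m H + H *m pulled_gam i y) *m S y + J y *m H *m (pdmx i J y)^T.
  rewrite (pdmx_ext hD Dy i sA gE).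
  have s1 : smooth_mx D (fun z => J z *m metric b (tau z)) by exact: smooth_mxM.
  rewrite (pdmxM hD Dy i s1 sS) (pdmxM hD Dy i sJ sH) mulmxDl; congr (_ + _ *m _ + _); last first.
   by rewrite (pdmx_tr hD Dy).
  rewrite pdmx_transition //; last exact: lm_smooth.
  congr (_ *m _); rewrite raddf_sum /= mulmx_suml mulmx_sumr -big_split.
  apply: eq_bigr => l _; rewrite (metric_compat lmB) // scalerDr linearZ -scalemxAl -scalemxAr.
  by [].
 have := E; rewrite E2 (gE y Dy).
 exact: gauge_skew.
have T0 : Tk k = 0.
 have sk i p q : Tk i p q = - Tk i q p.
  have /matrixP/(_ p q) := Tskew i; rewrite !mxE => /eqP; rewrite addr_eq0 => /eqP ->.
  nra.
 apply/matrixP => p q; rewrite [RHS]mxE.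
 have e1 := sk k p q; have e2 := Tsym k p q; have e3 := sk p q k.
 have e4 := Tsym p q k; have e5 := sk q k p; have e6 := Tsym q p k; have e7 := Tsym k q p.
 lra.
have uJ := jac_unit mM rM Dy; have uH := g_unit lmB By.
have : Dk k = 0.
 apply: (can_inj (mulKmx uH)); apply: (can_inj (mulKmx uJ)).
 by rewrite !mulmx0 mulmxA.
by rewrite /Dk SE => /eqP; rewrite -addrA addr_eq0 => /eqP ->; rewrite opprD opprK.
Qed.

Definition pulled_weyl j k y : 'M[R]_n := \sum_m \sum_l (J y j m * J y k l) *: weyl (metric b) m l (tau y).

(** S intertwines the connection matrices by [gam_change]; equality of its mixed second derivatives
    then intertwines the curvatures. *)
Lemma weyl_change j k : S x *m weyl (metric a) j k x = pulled_weyl j k x *m S x.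
have sJ := smooth_jac; have sS : smooth_mx D S by exact: smooth_mx_tr.
have sgA i : smooth_mx D (gam (metric a) i) by apply: smA; exact: smooth_gam.
have sP := smooth_pulled_gam.
have dd2 p q : pdmx p (pdmx q S) x = (S x *m gam (metric a) p x - pulled_gam p x *m S x) *m gam (metric a) q x
  + S x *m pdmx p (gam (metric a) q) x - (pdmx p (pulled_gam q) x *m S x
  + pulled_gam q x *m (S x *m gam (metric a) p x - pulled_gam p x *m S x)).
 rewrite (pdmx_ext hD Ox (G := fun y => S y *m gam (metric a) q y - pulled_gam q y *m S y)); first last.
 - by move=> y Dy; exact: gam_change.
 - by apply: smooth_mx_pd.
 have s1 : smooth_mx D (fun y => S y *m gam (metric a) q y) by exact: smooth_mxM.
 have s2 : smooth_mx D (fun y => pulled_gam q y *m S y) by exact: smooth_mxM.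
 by rewrite (pdmxB hD Ox p s1 s2) (pdmxM hD Ox p sS (sgA q)) (pdmxM hD Ox p (sP q) sS) !gam_change.
have dP p q : pdmx p (pulled_gam q) x = \sum_l (pdmx p J x q l *: gam (metric b) l (tau x)
  + J x q l *: \sum_m J x p m *: pdmx m (gam (metric b) l) (tau x)).
 have sl l : smooth_mx D (fun y => gam (metric b) l (tau y)) by apply: smooth_mx_transition; exact: smooth_gam.
 apply/matrixP => r s; rewrite pdmxE summxE.
 rewrite (_ : (fun y => pulled_gam q y r s) = fun y => \sum_l (J y q l *: gam (metric b) l (tau y)) r s); last first.
  by apply/funext => y; rewrite summxE.
 rewrite (pd_sum hD Ox) => [|l]; last exact: smooth_mxZ.
 apply: eq_bigr => l _; rewrite -pdmxE.
 rewrite (pdmxZ hD Ox p (sJ q l) (sl l)) pdmx_transition //; last exact: smooth_gam.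
 by rewrite -pdmxE.
(* The curvature of the pulled-back connection is the pulled-back curvature: the terms with
   derivatives of J cancel by [pd_jac_sym]. *)
have cP : pdmx j (pulled_gam k) x - pdmx k (pulled_gam j) x + pulled_gam j x *m pulled_gam k x
  - pulled_gam k x *m pulled_gam j x = \sum_m \sum_l (J x j m * J x k l) *: curv (gam (metric b)) m l (tau x).
 pose g' := gam (metric b); pose y := tau x.
 have e1 : pdmx j (pulled_gam k) x - pdmx k (pulled_gam j) x =
   \sum_m \sum_l (J x j m * J x k l) *: (pdmx m (g' l) y - pdmx l (g' m) y).
  rewrite !dP !big_split opprD addrACA.
  have -> : \sum_l pdmx j J x k l *: gam (metric b) l (tau x) = \sum_l pdmx k J x j l *: gam (metric b) l (tau x).
   apply: eq_bigr => l _; exact: (congr1 (fun c => c *: gam (metric b) l (tau x)) (pd_jac_sym j k l Ox)).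
  rewrite subrr add0r.
  transitivity (\sum_m \sum_l (J x j m * J x k l) *: pdmx m (g' l) y - \sum_m \sum_l (J x j m * J x k l) *: pdmx l (g' m) y).
   congr (_ - _).
    rewrite exchange_big; apply: eq_bigr => l _; rewrite scaler_sumr; apply: eq_bigr => m _.
    by rewrite scalerA mulrC.
   by apply: eq_bigr => m _; rewrite scaler_sumr; apply: eq_bigr => l _; rewrite scalerA.
  rewrite -sumrB; apply: eq_bigr => m _; rewrite -sumrB; apply: eq_bigr => l _.
  by rewrite scalerBr.
 have e2 p q : pulled_gam p x *m pulled_gam q x = \sum_m \sum_l (J x p m * J x q l) *: (g' m y *m g' l y).
  rewrite mulmx_suml; apply: eq_bigr => m _; rewrite mulmx_sumr; apply: eq_bigr => l _.
  by rewrite -scalemxAl -scalemxAr scalerA.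
 rewrite e1 e2 e2 [X in _ - X]exchange_big -big_split -sumrB; apply: eq_bigr => m _.
 rewrite -big_split -sumrB; apply: eq_bigr => l _ /=.
 by rewrite [J x k l * _]mulrC -scalerDr -scalerBr.
have flat : S x *m curv (gam (metric a)) j k x = (pdmx j (pulled_gam k) x - pdmx k (pulled_gam j) x
  + pulled_gam j x *m pulled_gam k x - pulled_gam k x *m pulled_gam j x) *m S x.
 have := pdmx_comm hD Ox j k sS; rewrite !dd2 /curv.
 move: (pdmx j (pulled_gam k) x) pdmx (pdmx j (gam _ k) x) (pdmx k (gam _ j) x)
  (pulled_gam j x) (pulled_gam k x) (gam _ j x) (gam _ k x) (S x) => p1 p2 p3 p4 q1 q2 q3 q4 s.
 rewrite !mulmx_rules.
 move: p1 p2 s (s *m p4) (s *m q3 *m q4) (s *m q4 *m q3) q1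
  q2 (q1 *m q2 *m s) (q2 *m q1 *m s) => r1 r2 r3 r4 r5 r6 r7 r8 r9 r10 Q.
 mx_entries; have := congr1 (fun Z : matrix _ _ _ => Z a0 b0) Q; rewrite ?(addmxE, oppmxE); lra.
(* The part of constant curvature transforms in the same way, by [metric_change]. *)
have ext p q : S x *m (delta_mx p 0 *m row q (metric a x)) =
  (\sum_m \sum_l (J x p m * J x q l) *: ((delta_mx m 0 : 'cV[R]_n) *m row l (metric b (tau x)))) *m S x.
 rewrite mulmxA (metric_change mM rM Ox) !row_mul mulmxA mulmxA; congr (_ *m _).
 rewrite -mulmxA.
 have -> : S x *m delta_mx p 0 = \sum_m J x p m *: (delta_mx m 0 : 'cV[R]_n).
  apply/colP => r; rewrite -colE summxE (bigD1 r) //= big1 => [|m mr].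
   by rewrite !mxE !eqxx mulr1 addr0.
  by rewrite !mxE eq_sym (negbTE mr) mulr0.
 have -> : row q (J x) *m metric b (transition a b x) = \sum_l J x q l *: row l (metric b (tau x)).
  apply/rowP => r; rewrite mxE summxE; apply: eq_bigr => l _; by rewrite !mxE.
 rewrite mulmx_suml; apply: eq_bigr => m _; rewrite mulmx_sumr; apply: eq_bigr => l _.
 by rewrite -scalemxAl -scalemxAr scalerA.
rewrite mulmxDr mulmxBr flat cP !ext -mulNmx -!mulmxDl; congr (_ *m _).
rewrite [X in _ + X]exchange_big -sumrB -big_split; apply: eq_bigr => m _.
rewrite -sumrB -big_split; apply: eq_bigr => l _ /=.
by rewrite [J x k l * _]mulrC -scalerBr -scalerDr.
Qed.

Lemma weyl_norm_change : weyl_norm (metric a) x = weyl_norm (metric b) (tau x).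
have Bx := transition_img mM Ox.
have uJ := jac_unit mM rM Ox; have uS : S x \in unitmx by rewrite unitmx_tr.
have E j k : weyl (metric a) j k x = invmx (S x) *m pulled_weyl j k x *m S x.
 by apply: (can_inj (mulKmx uS)); rewrite !mulmxA mulmxV // mul1mx weyl_change.
transitivity (comp_norm (ginv (metric a) x) (fun r s => \matrix_(j, k) pulled_weyl j k x r s)).
 rewrite /weyl_norm /weyl_comp !comp_normE; congr (- _).
 apply: eq_bigr => j _; apply: eq_bigr => k _; apply: eq_bigr => l _; apply: eq_bigr => m _.
 by rewrite !E -!mulmxA mulKVmx // mxtrace_mulC !mulmxA mulmxK // .
have N' r s : \matrix_(j, k) pulled_weyl j k x r s = J x *m weyl_comp (metric b) r s (tau x) *m S x.
 apply/matrixP => j k.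
 transitivity (\sum_l \sum_m J x j m * J x k l * weyl (metric b) m l (tau x) r s).
  rewrite [LHS]mxE /pulled_weyl summxE exchange_big /=; apply: eq_bigr => m _.
  by rewrite summxE; apply: eq_bigr => l _; rewrite scalemxE.
 rewrite [RHS]mxE; apply: eq_bigr => l _; rewrite [X in _ = X * _]mxE mulr_suml; apply: eq_bigr => m _.
 by rewrite [weyl_comp _ _ _ _ _ _]mxE [S x _ _]mxE; ring.
have hJ : S x *m ginv (metric a) x *m J x = ginv (metric b) (tau x).
 rewrite /ginv (metric_change mM rM Ox) -/J -/(S x) -/tau.
 have uG := g_unit lmB Bx.
 have uU : J x *m metric b (tau x) *m S x \in unitmx by rewrite !unitmx_mul uJ uG.
 apply: (can_inj (mulmxK uG)); rewrite mulVmx //; apply: (can_inj (mulmxK uS)).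
 by rewrite mul1mx -!mulmxA (mulmxA (J x)) mulVmx // mulmx1.
rewrite /weyl_norm /comp_norm; congr (- _); apply: eq_bigr => r _; apply: eq_bigr => s _.
rewrite !N' -hJ !trmx_mul trmxK.
by rewrite -/(S x) !mulmxA [LHS]mxtrace_mulC !mulmxA.
Qed.

End chart_change.

(** * Vanishing of the curvature deviation *)

Section weyl_vanishing.
Context {R : realType} {n : nat} {T : topologicalType}.
Variables (M : riem_data R n T) (v : T -> R).
Hypotheses (n0 : (0 < n)%N) (mM : smooth_manifold M) (rM : riemannian_metric M).
Hypotheses (kM : compact [set: T]) (sv : smooth_fun M v).
Hypotheses (v_hess : forall a x, cimage (charts (r := M) a) x -> trfree (metric a) (in_chart v a) x = 0).
Hypotheses (v_energy : forall a x, cimage (charts (r := M) a) x -> energy (metric a) (in_chart v a) x = 1).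
Hypotheses (v_ge0 : forall p, 0 <= v p) (v_le1 : forall p, v p <= 1).
Hypothesis v_boundary : forall p, mboundary M p <-> v p = 0.
Implicit Types (a b : chart_index M) (p q : T) (x y : 'rV[R]_n).
Local Notation f a := (in_chart v a).
Local Notation o := (ord00 n0).
Let lm a := chart_local_metric mM rM a.

Definition weyl_fun (p : T) : R :=
 get [set r | exists2 a : chart_index M, dom a p & r = weyl_norm (metric a) (a @@ p)].

Lemma weyl_funE a p : dom a p -> weyl_fun p = weyl_norm (metric a) (a @@ p).
move=> Da; rewrite /weyl_fun; set K := (X in get X).
have [b Db E] : K (get K) by apply: getPex; exists (weyl_norm (metric a) (a @@ p)); exists a.
have Ob : overlap b a (b @@ p) by exists p.
by rewrite E (weyl_norm_change mM rM Ob) /transition chart_inv.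
Qed.

Let psi p := weyl_fun p * (1 - v p ^+ 2) ^+ 2.
Let psia a (y : 'rV[R]_n) := weyl_norm (metric a) y * (1 - f a y ^+ 2) ^+ 2.

Let psiE a p : dom a p -> psi p = psia a (a @@ p).
by move=> Da; rewrite /psi /psia (weyl_funE Da) /in_chart /= chart_inv. Qed.

Let sq_smooth a : smooth_on (img a) (fun y => 1 - f a y ^+ 2).
by apply: smooth_onB; [exact: smooth_on_cst|apply: smooth_onM; exact: sv]. Qed.

Let smooth_psia a : smooth_on (img a) (psia a).
apply: smooth_onM; first exact: smooth_weyl_norm.
exact: smooth_onM; exact: sq_smooth.
Qed.

Lemma gradsq_rigid a x : img a x -> gradsq (metric a) (f a) x = 1 - f a x ^+ 2.
by move=> Ax; have := v_energy Ax; rewrite /energy => <-; rewrite addrK. Qed.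

Let dd_v a x : img a x -> dd (gradup (metric a) (f a) x) (f a) x = 1 - f a x ^+ 2.
move=> Ax; rewrite -gradsq_rigid // /gradsq mxE; apply: eq_bigr => i _.
by rewrite [(drow _ _)^T _ _]mxE [drow _ _ _ _]mxE.
Qed.

Let dd_psia a x : img a x -> dd (gradup (metric a) (f a) x) (psia a) x = 0.
move=> Ax; have hA := chart_hopen mM a; set E := gradup _ _ x.
have sW := smooth_weyl_norm (lm a); have sq := @sq_smooth a; have sf := @sv a.
have ddM (F H : 'rV[R]_n -> R) : smooth_on (img a) F -> smooth_on (img a) H ->
  dd E (fun y => F y * H y) x = dd E F x * H x + F x * dd E H x.
 move=> sF sH; rewrite mulr_suml mulr_sumr -big_split /=; apply: eq_bigr => i _.
 by rewrite (pdM hA Ax) //; ring.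
have ddsq : dd E (fun y => 1 - f a y ^+ 2) x = - (2 * f a x * (1 - f a x ^+ 2)).
 rewrite -dd_v // mulr_sumr -sumrN; apply: eq_bigr => i _.
 rewrite (pdB hA Ax); [|exact: smooth_on_cst|exact: smooth_onM].
 by rewrite (pd_cst hA Ax) (pdM hA Ax) //; ring.
rewrite (ddM _ _ sW); last by apply: smooth_onM.
rewrite (ddM _ _ sq sq) ddsq (weyl_norm_transport (lm a) sf (@v_hess a) Ax); ring.
Qed.

(** First-order condition at a maximum that may lie on the boundary: if the derivative were
    positive, a short step along E, which stays in the half-space, would increase F. *)
Lemma local_max_inward a (F : 'rV[R]_n -> R) x (E : 'rV[R]_n) : img a x -> smooth_on (img a) F ->
 (x 0 o = 0 -> 0 <= E 0 o) -> (forall y, img a y -> F y <= F x) -> dd E F x <= 0.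
move=> Ax sF inward mx; rewrite leNgt; apply/negP => dF; have hA := chart_hopen mM a.
have x0 : 0 <= x 0 o.
 by have := chart_halfspace n0 mM (chart_dom_inv mM Ax); rewrite (chart_mapK mM Ax).
have [d d0 Hd] : exists2 d : R, 0 < d & forall y, `|y - x| < d -> 0 <= y 0 o -> img a y.
 have [V oV EV] := hA; have : nbhs x V.
  by apply: open_nbhs_nbhs; split => //; move: Ax; rewrite EV => -[].
 move=> /nbhs_normP[d d0 H]; exists d => // y yd y0; rewrite EV; split; first exact: H.
 exact/(halfspaceE n0).
have sdF : smooth_on (img a) (dd E F) by apply: smooth_dd.
have [e e0 He] := smooth_on_cont sdF Ax dF.
have [d' d'0 H'] := @mvt_near R n n0 (img a) F x hA sF Ax.
pose k := `|E| + 1; have k0 : 0 < k by rewrite ltr_wpDl.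
have [m m0 Hm] : exists2 m : R, 0 < m & forall t, 0 < t -> t < m -> 0 <= (x + t *: E) 0 o.
 have [xo|xo] := eqVneq (x 0 o) 0.
  exists 1 => // t t0 _; rewrite addmxE scalemxE xo add0r.
  by apply: mulr_ge0; [exact: ltW|exact: inward].
 exists (x 0 o / k); first by rewrite divr_gt0 // lt_neqAle eq_sym xo.
 move=> t t0; rewrite ltr_pdivlMr // => tk; rewrite addmxE scalemxE.
 have : `|t * E 0 o| <= t * k.
  rewrite normrM gtr0_norm // ler_pM2l //; apply: le_trans (mx_norm_coord E o) _.
  by rewrite lerDl.
 by rewrite ler_norml => /andP[]; lra.
pose t := Num.min m (Num.min d (Num.min d' e) / k) / 2.
have mm : 0 < Num.min d (Num.min d' e) by rewrite !lt_min d0 d'0.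
have m1 : 0 < Num.min m (Num.min d (Num.min d' e) / k) by rewrite lt_min m0 divr_gt0.
have tp : 0 < t by rewrite divr_gt0.
have : t < Num.min m (Num.min d (Num.min d' e) / k) by rewrite ltr_pdivrMr // ltr_pMr // ltr1n.
rewrite lt_min ltr_pdivlMr // !lt_min => /andP[tm /and3P[td td' te]].
pose y := x + t *: E.
have yx : `|y - x| <= t * k.
 by rewrite /y addrAC subrr add0r normrZ gtr0_norm // ler_pM2l // lerDl.
have Ay : img a y by apply: Hd; [exact: le_lt_trans td|exact: Hm].
have xx : `|x - x| < d' by rewrite subrr normr0.
have [s [sI As sd Es]] := H' x y Ax Ay xx (le_lt_trans yx td').
have := mx _ Ay; rewrite -subr_le0 Es.
have -> : dd (y - x) F (x + s *: (y - x)) = t * dd E F (x + s *: (y - x)).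
 rewrite mulr_sumr; apply: eq_bigr => i _.
 by rewrite addrAC subrr add0r scalemxE mulrA.
rewrite pmulr_rle0 // => K.
have sx : `|x + s *: (y - x) - x| < e.
 rewrite addrAC subrr add0r normrZ; have /andP[s0 s1] := sI; rewrite ger0_norm //.
 by apply: le_lt_trans te; apply: le_trans yx; rewrite ler_piMl.
by have := He _ As sx; rewrite ltr_distl => /andP[+ _]; lra.
Qed.

(** As v >= 0 = v(p), the differential at p is a nonnegative multiple of that of the first
    coordinate, and |Dv| = 1 makes the multiple positive. The last identity says that Dv points
    inward. *)
Lemma boundary_gradient a p (x := a @@ p) : dom a p -> v p = 0 ->
 [/\ forall i, i != o -> pd i (f a) x = 0, 0 < pd o (f a) x & gradup (metric a) (f a) x 0 o * pd o (f a) x = 1].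
move=> Da vp; have Ax : img a x := chart_img Da; have hA := chart_hopen mM a.
have f0 : f a x = 0 by rewrite /in_chart /= chart_inv.
have sfa : smooth_on (img a) (f a) by [].
have ge0 (e : 'rV[R]_n) : 0 <= e 0 o -> 0 <= dd e (f a) x.
 move=> eo; have := local_max_inward Ax (smooth_onN sfa) (fun _ => eo).
 have -> : dd e (fun y => - f a y) x = - dd e (f a) x.
  by rewrite -sumrN; apply: eq_bigr => i _; rewrite (pdN hA Ax) // mulrN.
 by rewrite oppr_le0; apply => y Ay; rewrite f0 oppr0 oppr_le0 /in_chart /=.
have ddb c i : dd (c *: basis i) (f a) x = c * pd i (f a) x.
 rewrite /dd (bigD1 i) //= big1 ?addr0 => [|k ki]; rewrite !mxE ?eqxx ?mulr1 //.
 by rewrite (negbTE ki) mulr0 mul0r.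
have bo c i : i != o -> (c *: basis i : 'rV[R]_n) 0 o = 0.
 by move=> io; rewrite !mxE eq_sym (negbTE io) mulr0.
have tang i : i != o -> pd i (f a) x = 0.
 move=> io; have := ge0 (1 *: basis i); have := ge0 (- 1 *: basis i); rewrite !bo // lexx !ddb => /(_ isT) + /(_ isT).
 lra.
have gE : gradup (metric a) (f a) x 0 o * pd o (f a) x = 1.
 have <- : gradsq (metric a) (f a) x = 1 by rewrite gradsq_rigid // f0 expr0n subr0.
 rewrite [RHS]mxE (bigD1 o) //= [_^T _ _]mxE [drow _ _ _ _]mxE big1 ?addr0 // => i io.
 by rewrite [_^T _ _]mxE [drow _ _ _ _]mxE tang // mulr0.
split => //; rewrite lt_neqAle; apply/andP; split.
 nra.
by have := ge0 (1 *: basis o); rewrite ddb mul1r !mxE mul1r; apply; exact: ler01.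
Qed.

Lemma increasing_direction a (F : 'rV[R]_n -> R) p : dom a p -> smooth_on (img a) F ->
 0 < dd (gradup (metric a) (f a) (a @@ p)) F (a @@ p) ->
 ~ (forall q, dom a q -> F (a @@ q) <= F (a @@ p)).
move=> Da sF dF mx; suff : dd (gradup (metric a) (f a) (a @@ p)) F (a @@ p) <= 0 by nra.
apply: (local_max_inward (chart_img Da) sF) => [xo|y Ay]; last first.
 by have := mx _ (chart_dom_inv mM Ay); rewrite chart_mapK.
have vp : v p = 0 by apply/v_boundary/(mboundaryP n0 mM rM Da).
by have [_ po gE] := boundary_gradient Da vp; rewrite -(pmulr_lge0 _ po) gE.
Qed.

Lemma weyl_vanishes a x : img a x -> v (inv a x) < 1 -> forall j k, weyl (metric a) j k x = 0.
have psi0 p : psi p <= 0.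
 rewrite leNgt; apply/negP => pp.
 (* With the coefficient psi(p)/2, F <= psi(p)/2 < F(p) where v = 1. So the maximum of F lies where
    v < 1, and there F strictly increases along Dv. *)
 pose F q := psi q + psi p / 2 * v q.
 have cF : continuous F.
  move=> q; have [b Db] := chart_exists mM q.
  apply: (chart_continuous (F := fun y => psia b y + psi p / 2 * f b y) mM Db).
   by apply: smooth_onD => //; apply: smooth_onM; [exact: smooth_on_cst|exact: sv].
  by move=> q' Dq'; rewrite /F (psiE Dq') /in_chart /= chart_inv.
 have [q _ H] := @compact_EVT_max T R F setT (ex_intro _ p I) kM (continuous_subspaceT cF).
 have {}H z : F z <= F q by apply: H; rewrite inE.
 have Fp : psi p <= F p by rewrite lerDl mulr_ge0 // divr_ge0 // ltW.
 case: (ltrP (v q) 1) => vq; last first.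
  have v1 : v q = 1 by apply/eqP; rewrite eq_le v_le1.
  have : F q <= psi p / 2 by rewrite /F /psi v1 expr1n subrr expr0n mulr0 add0r mulr1.
  by have := H p; lra.
 have [b Db] := chart_exists mM q; have By := chart_img Db.
 have sF : smooth_on (img b) (fun y => psia b y + psi p / 2 * f b y).
  by apply: smooth_onD => //; apply: smooth_onM; [exact: smooth_on_cst|exact: sv].
 apply: (increasing_direction Db sF).
  have -> : dd (gradup (metric b) (f b) (b @@ q)) (fun y => psia b y + psi p / 2 * f b y) (b @@ q)
    = psi p / 2 * (1 - f b (b @@ q) ^+ 2).
   rewrite -(dd_v By) -[RHS]add0r -(dd_psia By) mulr_sumr -big_split /=; apply: eq_bigr => i _.
   have hB := chart_hopen mM b; have sfb : smooth_on (img b) (f b) by [].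
   rewrite (pdD hB By); [|exact: smooth_psia|by apply: smooth_onM => //; exact: smooth_on_cst].
   by rewrite (pdZ hB By) //; ring.
  have fq : f b (b @@ q) = v q by rewrite /in_chart /= chart_inv.
  by rewrite fq; apply: mulr_gt0; [exact: divr_gt0|rewrite subr_gt0 mulr_ilt1].
 move=> z Dz; have := H z; rewrite /F (psiE Dz) (psiE Db) /in_chart /= !chart_inv //.
move=> Ax vx; have Da := chart_dom_inv mM Ax.
have [W0 Wz] := weyl_norm_ge0 (lm a) Ax; apply: Wz; apply/eqP; rewrite eq_le W0 andbT.
have := psi0 (inv a x); rewrite /psi (weyl_funE Da) chart_mapK // pmulr_lle0 //.
by rewrite exprn_gt0 // subr_gt0 mulr_ilt1.
Qed.

(** Points with v = 1 are limits of points with v < 1: if v were 1 on an open set, then D^2 v = 0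
    there, hence g = 0. *)
Lemma weyl_eq0 a x j k : img a x -> weyl (metric a) j k x = 0.
move=> Ax; apply/matrixP => i l; rewrite [RHS]mxE; apply: contrapT => /eqP W0.
have W1 : 0 < `|weyl (metric a) j k x i l| by rewrite normr_gt0.
have sW : smooth_on (img a) (fun y => weyl (metric a) j k y i l).
 by exact (@smooth_weyl _ _ _ _ (chart_local_metric mM rM a) j k i l).
have [d d0 Hd] := smooth_on_cont sW Ax W1.
have v1 y : img a y -> `|y - x| < d -> in_chart v a y = 1.
 move=> Ay yd; apply/eqP; rewrite eq_le v_le1 leNgt; apply/negP => vy.
 have := Hd _ Ay yd; rewrite (weyl_vanishes Ay vy).
 by rewrite mxE sub0r normrN ltxx.
pose B := img a `&` [set y | `|y - x| < d].
have hB : hopen B by apply: hopen_open; [exact: (chart_hopen mM a)|exact: open_norm_ball].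
have Bx : B x by split => //; rewrite /= subrr normr0.
have sB : smooth_on B (in_chart v a) by apply: smooth_on_sub (@sv a) => y [].
have p0 m y : B y -> pd m (in_chart v a) y = 0.
 move=> By; rewrite (pd_ext hB By m sB (g := fun=> 1)) ?(pd_cst hB By) // => z [Az zd]; exact: v1.
have g0 : metric a x = 0.
 have <- := v_hess Ax; rewrite /trfree v1 //; last by case: Bx.
 rewrite scale1r -[LHS]add0r; congr (_ + _); apply/esym/matrixP => i' l'; rewrite mxE [RHS]mxE /hessian.
 rewrite big1 ?subr0 => [|m _]; last by rewrite p0 // mulr0.
 by rewrite (pd_ext hB Bx i' (smooth_on_pd l' hB sB) (fun y By => p0 l' y By)) (pd_cst hB Bx).
case: rM => _ _ pos _; have b0 : basis (ord00 n0) != 0 :> 'rV[R]_n.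
 by apply/negP => /eqP/(congr1 (fun Z : matrix _ _ _ => Z 0 (ord00 n0))) /eqP; rewrite !mxE !eqxx oner_eq0.
by have := pos a x _ Ax b0; rewrite g0 mulmx0 mul0mx mxE ltxx.
Qed.

End weyl_vanishing.

(** * Linear differential equations on [0, 1] *)

Section linear_ode.
Context {R : realType}.

(** Nearest-point projection onto [0, 1]; it extends continuous functions of time to the whole
    line. *)
Definition clamp (t : R) : R := (`|t| - `|t - 1| + 1) / 2.

Lemma clamp_itv t : 0 <= clamp t <= 1.
have h1 := ler_normB t t; have h2 := ler_normD (t - 1) 1.
rewrite subrK normr1 in h2; rewrite addrC in h1.
have h3 := ler_normB t 1; rewrite normr1 in h3.
rewrite /clamp; apply/andP; split; lra.
Qed.

Lemma clamp_id t : 0 <= t <= 1 -> clamp t = t.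
by move=> /andP[t0 t1]; rewrite /clamp ger0_norm // distrC ger0_norm; lra.
Qed.

Lemma clamp_dist s t : `|clamp s - clamp t| <= `|s - t|.
have h1 := ler_dist_dist s t; have h2 := ler_dist_dist (s - 1) (t - 1).
have e : s - 1 - (t - 1) = s - t by nra.
rewrite e in h2; rewrite !ler_norml in h1 h2 *; move: h1 h2; rewrite /clamp => /andP[a b] /andP[c d].
apply/andP; split; lra.
Qed.

Lemma continuous_clamp : continuous clamp.
move=> t; apply/cvgrPdist_lt => e e0; apply/nbhs_ballP; exists e => //= s.
exact: le_lt_trans (clamp_dist _ _).
Qed.

Lemma primitive_exists (f : R -> R) : continuous f ->
 exists F : R -> R, F 0 = 0 /\ forall t : R, 0 <= t <= 1 -> is_derive t 1 F (f t).
(* Integrating from -1, inside [-1, 2], makes 0 and 1 interior points, so that the derivatives there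
   are two-sided. *)
move=> cf; pose F x := \int[lebesgue_measure]_(t in `[(-1)%R, x]) f t.
have If : lebesgue_measure.-integrable `[(-1)%R, 2%R] (EFin \o f).
 apply: continuous_compact_integrable; first exact: segment_compact.
 exact: continuous_subspaceT.
exists (fun x => F x - F 0); split; first by nra.
move=> t /andP[t0 t1]; have t2 : t < 2 by lra. have tm : -1 < t by lra.
have [dF EF] := continuous_FTC1_closed t2 If tm (cf t).
have DF : is_derive t 1 F (f t) by rewrite -EF derive1E; exact: derivableP.
by apply: der_eq; rewrite subr0.
Qed.

Lemma derivative_bound (F dF phi dphi : R -> R) :
 (forall t : R, 0 <= t <= 1 -> is_derive t 1 F (dF t)) ->
 (forall t : R, 0 <= t <= 1 -> is_derive t 1 phi (dphi t)) ->
 (forall t : R, 0 <= t <= 1 -> dF t <= dphi t) -> F 0 <= phi 0 ->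
 forall t : R, 0 <= t <= 1 -> F t <= phi t.
move=> DF Dp H F0 t /andP[t0 t1].
have D s : Num.min 0 t <= s <= Num.max 0 t -> is_derive s 1 (fun s => phi s - F s) (dphi s - dF s).
 rewrite min_l // max_r // => /andP[s0 st]; have sI : 0 <= s <= 1 by nra.
 by apply: derB; [exact: Dp|exact: DF].
have [s] := MVT_unordered D; rewrite min_l // max_r // => /andP[s0 st] E.
have : 0 <= (dphi s - dF s) * t by rewrite mulr_ge0 // subr_ge0 H // s0 (le_trans st).
nra.
Qed.

Variable m : nat.
Implicit Types (y : R -> 'rV[R]_m) (B : R -> 'M[R]_m).

Definition solves B y (eps : R -> 'rV[R]_m) := forall t : R, 0 <= t <= 1 -> forall j,
 is_derive t 1 (fun s => y s 0 j) ((y t *m B t + eps t) 0 j).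

Lemma mulmx_bound (p q : nat) (v : 'rV[R]_p) (N : 'M[R]_(p, q)) (c K : R) j : 0 <= c ->
 (forall i, `|v 0 i| <= c) -> (forall i k, `|N i k| <= K) -> `|(v *m N) 0 j| <= p%:R * (c * K).
move=> c0 vc NK; rewrite mxE; apply: (le_trans (ler_norm_sum _ _ _)).
apply: (@le_trans _ _ (\sum_(i < p) c * K)); last by rewrite sumr_const card_ord mulr_natl.
by apply: ler_sum => i _; rewrite normrM ler_pM.
Qed.

(** Comes from E' <= (2 m K + 1) E + m e^2 for E = |y|^2, integrated over at most unit time. *)
Definition gronwall_const (K : R) : R := Num.sqrt (m%:R * expR (2 * (m%:R * K) + 1)).

Lemma gronwall B y (eps : R -> 'rV[R]_m) (K e : R) : 0 <= K -> 0 <= e ->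
 (forall t : R, 0 <= t <= 1 -> forall i j, `|B t i j| <= K) ->
 (forall t : R, 0 <= t <= 1 -> forall j, `|eps t 0 j| <= e) ->
 y 0 = 0 -> solves B y eps -> forall t : R, 0 <= t <= 1 -> forall j, `|y t 0 j| <= gronwall_const K * e.
move=> K0 e0 BK epse y0 S t tI j.
pose E t := \sum_i y t 0 i ^+ 2; pose c := 2 * (m%:R * K) + 1.
have c0 : 0 <= c by rewrite addr_ge0 // !mulr_ge0.
pose dE t := \sum_i 2 * y t 0 i * (y t *m B t + eps t) 0 i.
have DE (s : R) : 0 <= s <= 1 -> is_derive s 1 E (dE s).
 move=> sI; rewrite /E.
 have : forall r : seq 'I_m, is_derive s 1 (fun t => \sum_(i <- r) y t 0 i ^+ 2)
   (\sum_(i <- r) 2 * y s 0 i * (y s *m B s + eps s) 0 i).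
  elim=> [|i r IH].
   rewrite big_nil (_ : (fun t => _) = fun=> 0); first exact: derC.
   by apply/funext => z; rewrite big_nil.
  have -> : (fun t => \sum_(k <- i :: r) y t 0 k ^+ 2) = fun t => y t 0 i ^+ 2 + \sum_(k <- r) y t 0 k ^+ 2.
   by apply/funext => z; rewrite big_cons.
  rewrite big_cons; apply: derD; apply: (der_eq (derX 2 (S s sI i))).
  nra.
 exact.
have dEle s : 0 <= s <= 1 -> dE s <= c * E s + m%:R * e ^+ 2.
 move=> sI; have E0 : 0 <= E s by apply: sumr_ge0 => i _; exact: sqr_ge0.
 have : dE s <= \sum_i (\sum_k K * (y s 0 i ^+ 2 + y s 0 k ^+ 2) + (y s 0 i ^+ 2 + e ^+ 2)).
  apply: ler_sum => i _; rewrite addmxE mulrDr; apply: lerD.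
   rewrite mxE mulr_sumr; apply: ler_sum => k _.
   have h1 : `|y s 0 i * y s 0 k| * 2 <= y s 0 i ^+ 2 + y s 0 k ^+ 2.
    have h2 := sqr_ge0 (`|y s 0 i| - `|y s 0 k|).
    rewrite normrM; move: h2; rewrite sqrrB !real_normK ?num_real; lra.
   apply: le_trans (ler_norm _) _.
   have -> : 2 * y s 0 i * (y s 0 k * B s k i) = B s k i * (2 * (y s 0 i * y s 0 k)) by lra.
   rewrite normrM; apply: ler_pM => //; first exact: BK.
   by rewrite normrM ger0_norm // mulrC.
  have h2 := sqr_ge0 (y s 0 i - eps s 0 i).
  have : eps s 0 i ^+ 2 <= e ^+ 2.
   by rewrite -real_normK ?num_real // ler_pXn2r //; exact: epse.
  lra.
 move=> /le_trans; apply; rewrite big_split /= [X in _ + X]big_split /= sumr_const card_ord.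
 rewrite -/(E s).
 have -> : \sum_i \sum_k K * (y s 0 i ^+ 2 + y s 0 k ^+ 2) = 2 * (m%:R * K) * E s.
  transitivity (\sum_i (K * m%:R * y s 0 i ^+ 2 + K * E s)).
   apply: eq_bigr => i _; rewrite -mulr_sumr big_split /= sumr_const card_ord -/(E s); ring.
  by rewrite big_split /= -mulr_sumr -/(E s) sumr_const card_ord; ring.
 by rewrite /c; lra.
have bound := @derivative_bound (fun t => E t * expR (- c * t))
  (fun t => dE t * expR (- c * t) + E t * (expR (- c * t) * (- c * 1))) (fun t => m%:R * e ^+ 2 * t) (fun=> m%:R * e ^+ 2 * 1).
have {}bound := bound (fun s sI => derM (DE s sI) (der_expR (derZ (- c) (derI s)))) (fun s _ => derZ (m%:R * e ^+ 2) (derI s)).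
have me0 : 0 <= m%:R * e ^+ 2 by rewrite mulr_ge0 // sqr_ge0.
have Et : E t * expR (- c * t) <= m%:R * e ^+ 2 * t.
 apply: bound => // [s sI|].
  have h := dEle s sI; have p0 := expR_gt0 (- c * s).
  have p1 : expR (- c * s) <= 1.
   have /andP[s0 _] := sI.
   by rewrite -[X in _ <= X]expR0 ler_expR mulNr oppr_le0 mulr_ge0.
  nra.
 rewrite /E big1 => [|i _]; first by nra.
 by rewrite y0 mxE expr0n.
have /andP[t0 t1] := tI.
have EB : E t <= m%:R * expR c * e ^+ 2.
 have p0 := expR_gt0 (c * t).
 have : E t <= m%:R * e ^+ 2 * t * expR (c * t).
  by rewrite -ler_pdivrMr // -expRN -mulNr.
 move=> /le_trans; apply; apply: (@le_trans _ _ (m%:R * e ^+ 2 * expR (c * t))).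
  by rewrite ler_wpM2r // ler_piMr.
 rewrite [X in _ <= X]mulrAC ler_wpM2l // ler_expR ler_piMr //.
have : y t 0 j ^+ 2 <= (gronwall_const K * e) ^+ 2.
 rewrite exprMn sqr_sqrtr //; apply: le_trans EB.
 by rewrite /E (bigD1 j) //= lerDl; apply: sumr_ge0 => i _; exact: sqr_ge0.
by rewrite -real_normK ?num_real // ler_pXn2r ?nnegrE // mulr_ge0 // sqrtr_ge0.
Qed.

Lemma solves_unique B y z (K : R) : 0 <= K -> (forall t : R, 0 <= t <= 1 -> forall i j, `|B t i j| <= K) ->
 solves B y (fun=> 0) -> solves B z (fun=> 0) -> y 0 = z 0 -> forall t : R, 0 <= t <= 1 -> y t = z t.
move=> K0 BK Sy Sz yz t tI; apply/rowP => j; apply/eqP; rewrite -subr_eq0 -normr_le0.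
have := @gronwall B (fun t => y t - z t) (fun=> 0) K 0 K0 (lexx 0) BK.
rewrite mulr0 => H.
have := H _ _ _ t tI j; rewrite !mxE; apply.
- by move=> s _ i; rewrite mxE normr0.
- by rewrite yz subrr.
- move=> s sI i; have D := derB (Sy s sI i) (Sz s sI i).
 rewrite (_ : (fun s => (y s - z s) 0 i) = fun s => y s 0 i - z s 0 i); last by apply/funext => r; rewrite !mxE.
 by apply: der_eq; rewrite !addr0 mulmxBl addmxE oppmxE.
Qed.

End linear_ode.

Section linear_ode_existence.
Context {R : realType} {m : nat}.
Implicit Types (z : R -> 'rV[R]_m).

Lemma pow_half_squeeze (a c : R) : (forall k : nat, `|a| <= c * 2^-1 ^+ k) -> a = 0.
move=> H; apply/eqP; rewrite -normr_le0; apply/ler_addgt0Pl => e e0; rewrite addr0.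
have c0 : 0 <= c by have := H 0%N; rewrite mulr1; apply: le_trans.
pose N := Num.Def.archi_bound (c / e); have hN : c / e < N%:R.
 by have := @archi_boundP R (c / e); apply; rewrite divr_ge0 // ltW.
apply: le_trans (H N) _; rewrite exprVn ler_pdivrMr //.
rewrite ltr_pdivrMr // in hN; apply: ltW; apply: (lt_le_trans hN).
by rewrite mulrC ler_pM2l // -natrX ler_nat ltnW // ltn_expl.
Qed.

Definition clamp_continuous z := forall j, continuous (fun t : R => z (clamp t) 0 j).

Lemma picard_step (B : R -> 'M[R]_m) z : (forall i j, continuous (fun t : R => B t i j)) -> clamp_continuous z ->
 exists z' : R -> 'rV[R]_m, [/\ z' 0 = 0, clamp_continuous z' &
  forall t : R, 0 <= t <= 1 -> forall j, is_derive t 1 (fun s => z' s 0 j) ((z t *m B t) 0 j)].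
move=> cB cz.
have cf j : continuous (fun t => (z (clamp t) *m B t) 0 j).
 rewrite (_ : (fun t => _) = fun t => \sum_i z (clamp t) 0 i * B t i j); last by apply/funext => t; rewrite mxE.
 by move=> t; apply: continuous_sum => i _; apply: continuousM; [exact: cz|exact: cB].
have [F FP] := choice (fun j => primitive_exists (cf j)).
have DF (t : R) : 0 <= t <= 1 -> forall j, is_derive t 1 (F j) ((z t *m B t) 0 j).
 by move=> tI j; rewrite -[in z _](clamp_id tI); exact: (FP j).2.
exists (fun t => \row_j F j t); split.
- by apply/rowP => j; rewrite !mxE; exact: (FP j).1.
- move=> j; rewrite (_ : (fun t => _) = F j \o clamp); last by apply/funext => t; rewrite mxE.
 move=> t; apply: continuous_comp; first exact: continuous_clamp.
 exact: der_continuous (DF _ (clamp_itv t) j).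
- move=> t tI j; rewrite (_ : (fun s => _) = F j); first exact: DF.
 by apply/funext => s; rewrite mxE.
Qed.

Lemma sup_bound_derivative (F dF : R -> R) (c : R) :
 (forall t : R, 0 <= t <= 1 -> is_derive t 1 F (dF t)) -> F 0 = 0 ->
 (forall t : R, 0 <= t <= 1 -> `|dF t| <= c) -> forall t : R, 0 <= t <= 1 -> `|F t| <= c.
move=> DF F0 dFc t tI; have /andP[t0 t1] := tI.
have c0 : 0 <= c by apply: le_trans (dFc t tI).
have DL (s : R) : 0 <= s <= 1 -> is_derive s 1 (fun t => c * t) (c * 1) by move=> _; exact: derZ.
have h1 := derivative_bound DF DL.
have h2 := derivative_bound (fun s sI => derN (DF s sI)) DL.
have ct : c * t <= c by nra.
rewrite ler_norml lerNl; apply/andP; split.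
 apply: le_trans ct; apply: h2 => // [s sI|]; last by lra.
 by rewrite mulr1; apply: le_trans (dFc s sI); rewrite -normrN ler_norm.
apply: le_trans ct; apply: h1 => // [s sI|]; last by lra.
by rewrite mulr1; apply: le_trans (dFc s sI); rewrite ler_norm.
Qed.

Lemma geometric_cauchy (u : nat -> R) (c : R) : (forall k, `|u k.+1 - u k| <= c * 2^-1 ^+ k) ->
 exists l : R, forall k, `|l - u k| <= 2 * c * 2^-1 ^+ k.
move=> H.
have tail k d : `|u (k + d)%N - u k| <= 2 * c * (2^-1 ^+ k - 2^-1 ^+ (k + d)).
 elim: d => [|d IH]; first by rewrite addn0 !subrr mulr0 normr0.
 rewrite addnS; have := H (k + d)%N; rewrite exprS.
 have := ler_normD (u (k + d).+1 - u (k + d)%N) (u (k + d)%N - u k).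
 rewrite addrA subrK; move: IH; lra.
have c0 : 0 <= c by have := H 0%N; rewrite mulr1; apply: le_trans.
have p0 k : 0 <= (2^-1 : R) ^+ k by [].
have tail' k d : `|u (k + d)%N - u k| <= 2 * c * 2^-1 ^+ k.
 apply: le_trans (tail k d) _; rewrite ler_wpM2l ?mulr_ge0 //.
 by have := p0 (k + d)%N; lra.
have cu : cvgn u.
 apply/cauchy_cvgP/cauchyP => e e0.
 have [k hk] : exists k, 2 * c * 2^-1 ^+ k < e.
  apply: contrapT => /forallNP h; suff : 2 * c = 0 -> False.
   have : e / 2 = 0.
    apply: (@pow_half_squeeze _ (2 * c)) => k.
    have := h k; move/negP; rewrite ger0_norm; last by lra.
    lra.
   lra.
  by move=> c00; apply: (h 0%N); rewrite c00 mul0r.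
 exists (u k); exists k => // i ki; rewrite /ball /= distrC.
 by apply: le_lt_trans hk; rewrite -(subnKC ki); exact: tail'.
exists (limn u) => k; apply/ler_addgt0Pl => e e0.
have /cvgrPdist_lt /(_ e e0) [N _ hN] := cu.
have h1 := hN (k + N)%N (leq_addl _ _); have h2 := tail' k N.
have := ler_normD (limn u - u (k + N)%N) (u (k + N)%N - u k); rewrite addrA subrK.
nra.
Qed.

(** The solution is the sum of the iterated integrals [Z k]. With the weight exp(2 L t), L = m K,
    each integration halves the bound, so the series converges geometrically on all of [0, 1]. *)
Lemma linear_ode_exists (B : R -> 'M[R]_m) (K : R) (y0 : 'rV[R]_m) :
 (forall i j, continuous (fun t : R => B t i j)) ->
 (forall t : R, 0 <= t <= 1 -> forall i j, `|B t i j| <= K) -> 0 <= K ->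
 exists y : R -> 'rV[R]_m, y 0 = y0 /\ solves B y (fun=> 0).
move=> cB BK K0.
have step z : exists z', clamp_continuous z -> [/\ z' 0 = 0, clamp_continuous z' &
  forall t : R, 0 <= t <= 1 -> forall j, is_derive t 1 (fun s => z' s 0 j) ((z t *m B t) 0 j)].
 case: (pselect (clamp_continuous z)) => [cz|ncz]; last by exists z.
 by have [z' h] := picard_step cB cz; exists z'.
have [st stP] := choice step.
pose Z k := iter k st (fun=> y0).
have cZ k : clamp_continuous (Z k).
 elim: k => [|k IH]; first by move=> j t; exact: cvg_cst.
 by have [] := stP _ IH.
pose L : R := m%:R * K; have L0 : 0 <= L by rewrite mulr_ge0.
pose C := `|y0|; have C0 : 0 <= C by exact: normr_ge0.
have bZ k (t : R) : 0 <= t <= 1 -> forall j, `|Z k t 0 j| <= C * 2^-1 ^+ k * expR (2 * L * t).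
 elim: k t => [|k IH] t tI j.
  rewrite expr0 mulr1 /=; apply: (le_trans (mx_norm_coord y0 j)).
  have /andP[t0 _] := tI.
  by rewrite ler_peMr // -expR0 ler_expR !mulr_ge0.
 have [z0 _ DZ] := stP _ (cZ k).
 have Dphi (s : R) : 0 <= s <= 1 -> is_derive s 1 (fun t : R => C * 2^-1 ^+ k.+1 * expR (2 * L * t))
   (C * 2^-1 ^+ k.+1 * (expR (2 * L * s) * (2 * L * 1))).
  by move=> _; apply: derZ; apply: der_expR; exact: derZ (derI s).
 have key (s : R) : 0 <= s <= 1 -> `|(Z k s *m B s) 0 j| <= C * 2^-1 ^+ k.+1 * (expR (2 * L * s) * (2 * L * 1)).
  move=> sI; have := @mulmx_bound _ m m (Z k s) (B s) _ K j _ (IH s sI) (BK s sI).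
  rewrite exprS => /(_ _)/le_trans; apply.
   by rewrite !mulr_ge0 // ?expR_ge0 // exprn_ge0 // invr_ge0.
  by rewrite /L le_eqVlt; apply/orP; left; apply/eqP; field.
 have p0 : 0 <= C * 2^-1 ^+ k.+1 * expR (2 * L * 0).
  by rewrite !mulr_ge0 // ?expR_ge0 // exprn_ge0 // invr_ge0.
 rewrite ler_norml lerNl; apply/andP; split.
  apply: (derivative_bound (fun s sI => derN (DZ s sI j)) Dphi) => // [s sI|].
   by apply: le_trans (key s sI); rewrite -normrN ler_norm.
  by rewrite z0 mxE oppr0.
 apply: (derivative_bound (fun s sI => DZ s sI j) Dphi) => // [s sI|].
  by apply: le_trans (key s sI); rewrite ler_norm.
 by rewrite z0 mxE.
pose c := C * expR (2 * L); have c0 : 0 <= c by rewrite mulr_ge0 // expR_ge0.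
have {}bZ k (t : R) : 0 <= t <= 1 -> forall j, `|Z k t 0 j| <= c * 2^-1 ^+ k.
 move=> tI j; apply: le_trans (bZ k t tI j) _; rewrite /c mulrAC ler_wpM2r ?exprn_ge0 ?invr_ge0 //.
 have /andP[t0 t1] := tI; rewrite ler_wpM2l // ler_expR ler_piMr // mulr_ge0 //.
pose S N (t : R) : 'rV[R]_m := \sum_(k < N) Z k t.
have SS N t : S N.+1 t = S N t + Z N t by rewrite /S big_ord_recr.
have [y yP] : exists y : R -> 'rV[R]_m, forall N (t : R), 0 <= t <= 1 -> forall j,
  `|y t 0 j - S N t 0 j| <= 2 * c * 2^-1 ^+ N.
 have : forall tj : R * 'I_m, exists l : R, 0 <= tj.1 <= 1 -> forall N, `|l - S N tj.1 0 tj.2| <= 2 * c * 2^-1 ^+ N.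
  move=> [t j] /=; case: (pselect (0 <= t <= 1)) => [tI|]; last by exists 0.
  have [|l lP] := @geometric_cauchy (fun N => S N t 0 j) c; last by exists l.
  by move=> k; rewrite SS addmxE addrC addKr; exact: bZ.
 move=> /choice[l lP]; exists (fun t => \row_j l (t, j)) => N t tI j.
 by rewrite mxE; exact: (lP (t, j) tI N).
have cS N : clamp_continuous (S N).
 move=> j; rewrite (_ : (fun t : R => _) = fun t => \sum_(k < N) Z k (clamp t) 0 j).
  by move=> t; apply: continuous_sum => i _; exact: (cZ i j t).
 by apply/funext => t; rewrite summxE.
have cy : clamp_continuous y.
 move=> j t; apply/cvgrPdist_lt => e e0.
 have [N hN] : exists N, 2 * c * 2^-1 ^+ N < e / 4.
  apply: contrapT => /forallNP h.
  have : e / 4 = 0; last by lra.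
  apply: (@pow_half_squeeze _ (2 * c)) => k.
  have := h k; move/negP; rewrite -leNgt; rewrite ger0_norm; lra.
 have e2 : 0 < e / 2 by lra.
 have /cvgrPdist_lt /(_ _ e2) := cS N j t; apply: filterS => s h.
 have h1 := yP N _ (clamp_itv t) j; have h2 := yP N _ (clamp_itv s) j.
 move: h1 h2 h hN; rewrite !ltr_norml !ler_norml => /andP[? ?] /andP[? ?] /andP[? ?] ?.
 apply/andP; split; lra.
have [sy0 _ Dsy] := stP _ cy.
(* The sum satisfies the integral equation: both sides are compared with partial sums, at a distance
   bounded by tails of the series. *)
have eqy (t : R) : 0 <= t <= 1 -> y0 + st y t = y t.
 move=> tI; apply/rowP => j; apply/eqP; rewrite -subr_eq0; apply/eqP.
 apply: (@pow_half_squeeze _ (2 * L * c + c)) => N.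
 have DS (s : R) : 0 <= s <= 1 -> is_derive s 1 (fun s => S N.+1 s 0 j) ((S N s *m B s) 0 j).
  move=> sI; elim: N {tI} => [|N IH].
   rewrite (_ : (fun s => _) = fun=> y0 0 j); last by apply/funext => r; rewrite /S big_ord1.
   by apply: (der_eq (derC (y0 0 j) s)); rewrite /S big_ord0 mul0mx mxE.
  rewrite (_ : (fun s => _) = fun s => S N.+1 s 0 j + Z N.+1 s 0 j); last by apply/funext => r; rewrite SS addmxE.
  have [_ _ DZ] := stP _ (cZ N).
  by apply: (der_eq (derD IH (DZ s sI j))); rewrite SS mulmxDl addmxE.
 have h := @sup_bound_derivative (fun s => (y0 + st y s) 0 j - S N.+1 s 0 j)
   (fun s => (y s *m B s) 0 j - (S N s *m B s) 0 j) (m%:R * ((2 * c * 2^-1 ^+ N) * K)).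
 have {}h : `|(y0 + st y t) 0 j - S N.+1 t 0 j| <= m%:R * ((2 * c * 2^-1 ^+ N) * K).
  apply: h => // [s sI||s sI].
  - apply: derB; last exact: DS.
   rewrite (_ : (fun s => _) = fun s => y0 0 j + st y s 0 j); last by apply/funext => r; rewrite addmxE.
   by apply: (der_eq (derD (derC (y0 0 j) s) (Dsy s sI j))); rewrite add0r.
  - rewrite sy0 addr0 /S big_ord_recl big1 /= => [|k _]; first by rewrite addr0 subrr.
   by have [] := stP _ (cZ k).
  - have -> : (y s *m B s) 0 j - (S N s *m B s) 0 j = ((y s - S N s) *m B s) 0 j by rewrite mulmxBl !mxE.
   apply: mulmx_bound => [|i|i k]; last exact: BK.
    by rewrite !mulr_ge0 // exprn_ge0 // invr_ge0.
   by rewrite addmxE oppmxE; exact: yP.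
 have h2 := yP N.+1 t tI j; rewrite exprS in h2.
 have e1 : (y0 + st y t - y t) 0 j = ((y0 + st y t) 0 j - S N.+1 t 0 j) - (y t 0 j - S N.+1 t 0 j).
  by rewrite addmxE oppmxE; ring.
 rewrite -oppmxE -addmxE e1; apply: le_trans (ler_normB _ _) _; apply: le_trans (lerD h h2) _.
 by rewrite /L le_eqVlt; apply/orP; left; apply/eqP; field.
exists (fun t => y0 + st y t); split; first by rewrite sy0 addr0.
move=> t tI j; rewrite addr0.
rewrite (_ : (fun s => _) = fun s => y0 0 j + st y s 0 j); last by apply/funext => r; rewrite addmxE.
by apply: (der_eq (derD (derC (y0 0 j) t) (Dsy t tI j))); rewrite add0r eqy.
Qed.

End linear_ode_existence.

(** * Smooth dependence on parameters *)

Section ode_parameters.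
Context {R : realType} {n : nat}.
Variables (Om : set 'rV[R]_(1 + n)) (V : set 'rV[R]_n).

(** Time becomes the first coordinate of a point of R^(1 + n), so that joint regularity is expressed
    by [Ck]. *)
Definition timed (t : R) (x : 'rV[R]_n) : 'rV[R]_(1 + n) := row_mx t%:M x.

Lemma timed_dist s t x y (d : R) : 0 < d -> `|s - t| < d -> `|y - x| < d -> `|timed s y - timed t x| < d.
move=> d0 st xy; apply: mx_norm_lt => // i; rewrite addmxE oppmxE.
case: (split_ordP i) => j ->; first by rewrite !row_mxEl !mxE !ord1.
by rewrite !row_mxEr; apply: le_lt_trans xy; have := mx_norm_coord (y - x) j; rewrite addmxE oppmxE.
Qed.

Lemma timed_line t x h (s : R) : timed t (x + s *: h) = timed t x + s *: row_mx 0 h.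
by rewrite scale_row_mx add_row_mx scaler0 addr0. Qed.

Hypotheses (oOm : open Om) (oV : open V).
Hypothesis OmV : forall x, V x -> forall t : R, 0 <= t <= 1 -> Om (timed t x).

Lemma continuous_timed (f : 'rV[R]_(1 + n) -> R) x : Ck 0 Om f -> V x ->
 continuous (fun t : R => f (timed (clamp t) x)).
move=> cf Vx t; apply/cvgrPdist_lt => e e0.
have /cvgrPdist_lt /(_ e e0) /nbhs_normP[d d0 hd] := cf _ (OmV Vx (clamp_itv t)).
apply/nbhs_ballP; exists d => //= s; rewrite /= distrC => st; apply: hd.
by apply: timed_dist => //; [exact: le_lt_trans (clamp_dist _ _) st|rewrite subrr normr0].
Qed.

Lemma clamp_bounded (g : R -> R) : continuous (fun t => g (clamp t)) ->
 exists2 K : R, 0 <= K & forall t : R, 0 <= t <= 1 -> `|g t| <= K.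
move=> cg; have [||c _ H] := @EVT_max R (fun t => `|g (clamp t)|) 0 1 => //.
 apply: continuous_subspaceT => t; apply: continuous_comp; first exact: cg.
 exact: norm_continuous.
exists `|g (clamp c)| => // t tI; rewrite -{1}(clamp_id tI); apply: H; by [].
Qed.

(** Compactness of [0, 1] makes continuity at the points (t, x) uniform in t. *)
Lemma timed_uniform (f : 'rV[R]_(1 + n) -> R) x (e : R) : Ck 0 Om f -> V x -> 0 < e ->
 \forall y \near x, forall t : R, 0 <= t <= 1 -> `|f (timed t y) - f (timed t x)| < e.
move=> cf Vx e0.
have /compact_near_coveringP cK := @segment_compact R 0 1.
have e2 : 0 < e / 2 by lra.
have := cK _ (nbhs x) (fun y t => `|f (timed t y) - f (timed t x)| < e) _.
have H (t : R) : `[0, 1]%classic t -> \forall t' \near t & y \near x, `|f (timed t' y) - f (timed t' x)| < e.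
 rewrite /= => tI.
 have /cvgrPdist_lt /(_ _ e2) /nbhs_normP[d d0 hd] := cf _ (OmV Vx tI).
 exists (ball t d, ball x d); first by split; exact: nbhsx_ballx.
 move=> [s y] /= [st xy].
 have h1 := hd (timed s y); have h2 := hd (timed s x).
 rewrite /ball /= distrC in st; rewrite -ball_normE /= distrC in xy.
 have {}h1 := h1 (timed_dist d0 st xy).
 have {}h2 : `|f (timed t x) - f (timed s x)| < e / 2 by apply: h2; apply: timed_dist; rewrite ?subrr ?normr0.
 move: h1 h2; move: (f _) (f _) (f _) => a b c.
 by rewrite !ltr_norml => /andP[? ?] /andP[? ?]; apply/andP; split; lra.
move=> /(_ _ H); apply: filterS => y hy t tI; apply: hy; by [].
Qed.

Lemma derive_row0 (f : 'rV[R]_(1 + n) -> R) z (h : 'rV[R]_n) : differentiable f z ->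
 'D_(row_mx 0 h) f z = \sum_i h 0 i * 'D_(basis (rshift 1 i)) f z.
move=> df; rewrite derive_sumE // big_split_ord /= big1 ?add0r => [|i _].
 by apply: eq_bigr => i _; rewrite row_mxEr.
by rewrite row_mxEl mxE mul0r.
Qed.

Lemma timed_taylor (f : 'rV[R]_(1 + n) -> R) x (e : R) : Ck 2 Om f -> V x -> 0 < e ->
 \forall h \near (0 : 'rV[R]_n), forall t : R, 0 <= t <= 1 ->
  `|f (timed t (x + h)) - f (timed t x) - \sum_i h 0 i * 'D_(basis (rshift 1 i)) f (timed t x)| <= e * `|h|.
move=> [df cf] Vx e0; pose e' := e / (n%:R + 1).
have n0 : 0 < n%:R + 1 :> R by rewrite ltr_wpDl.
have e'0 : 0 < e' by rewrite divr_gt0.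
have U : \forall y \near x, V y /\ forall i (t : R), 0 <= t <= 1 ->
  `|'D_(basis (rshift 1 i)) f (timed t y) - 'D_(basis (rshift 1 i)) f (timed t x)| < e'.
 apply: filterI; first exact: (open_near oV Vx).
 apply: (@filter_forall _ _ (fun i y => forall t : R, 0 <= t <= 1 ->
  `|'D_(basis (rshift 1 i)) f (timed t y) - 'D_(basis (rshift 1 i)) f (timed t x)| < e') (nbhs x)) => i.
 have cfi : Ck 0 Om ('D_(basis (rshift 1 i)) f) by move=> z Oz; exact: differentiable_continuous ((cf _).1 z Oz).
 exact: (timed_uniform cfi Vx e'0).
have /nbhs_normP[d d0 hd] := U; apply/near0_ball; exists d => // h hh t tI.
have hs (s : R) : 0 <= s <= 1 -> `|x + s *: h - x| < d.
 move=> /andP[s0 s1]; rewrite addrC addKr normrZ ger0_norm //; apply: le_lt_trans hh.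
 by rewrite ler_piMl.
have D (s : R) : Num.min 0 1 <= s <= Num.max 0 1 ->
  is_derive s 1 (fun s : R => f (timed t x + s *: row_mx 0 h)) ('D_(row_mx 0 h) f (timed t x + s *: row_mx 0 h)).
 rewrite min_l // max_r // => sI; apply: is_derive_line; rewrite -timed_line; apply: df; apply: OmV => //.
 by have [] := hd _ (hs s sI).
have [s] := MVT_unordered D; rewrite min_l // max_r // subr0 mulr1 scale1r scale0r addr0 => sI.
have E1 := timed_line t x h 1; rewrite !scale1r in E1; rewrite -E1 => ->.
rewrite -timed_line derive_row0; last by apply: df; apply: OmV => //; have [] := hd _ (hs s sI).
rewrite -sumrB; apply: le_trans (ler_norm_sum _ _ _) _.
apply: (@le_trans _ _ (\sum_i `|h| * e')).
 apply: ler_sum => i _; rewrite -mulrBr normrM ler_pM ?mx_norm_coord //.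
 by apply: ltW; have [_] := hd _ (hs s sI); apply.
rewrite sumr_const card_ord -[X in X <= _]mulr_natl mulrCA mulrC ler_wpM2r //.
by rewrite mulrCA ler_piMr ?(ltW e0) // ler_pdivrMr // mul1r lerDl.
Qed.

Variables (m : nat) (B : 'rV[R]_(1 + n) -> 'M[R]_m).

Definition flow (B : 'rV[R]_(1 + n) -> 'M[R]_m) (y0 : 'rV[R]_m) (Y : R -> 'rV[R]_n -> 'rV[R]_m) :=
 forall x, V x -> Y 0 x = y0 /\ solves (fun t => B (timed t x)) (fun t => Y t x) (fun=> 0).

Lemma timed_bounded x p q (F : 'rV[R]_(1 + n) -> 'M[R]_(p, q)) : (forall i j, Ck 0 Om (fun z => F z i j)) -> V x ->
 exists2 K : R, 0 <= K & forall t : R, 0 <= t <= 1 -> forall i j, `|F (timed t x) i j| <= K.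
move=> cF Vx.
have H ij := @clamp_bounded (fun t => F (timed t x) ij.1 ij.2) (continuous_timed (cF ij.1 ij.2) Vx).
have /choice[K KP] : forall ij : 'I_p * 'I_q, exists K, 0 <= K /\ forall t, 0 <= t <= 1 -> `|F (timed t x) ij.1 ij.2| <= K.
 by move=> ij; have [K] := H ij; exists K.
exists (\sum_ij K ij); first by apply: sumr_ge0 => ij _; exact: (KP ij).1.
move=> t tI i j; apply: (le_trans ((KP (i, j)).2 t tI)).
by rewrite (bigD1 (i, j)) //= lerDl; apply: sumr_ge0 => ij _; exact: (KP ij).1.
Qed.

Lemma flow_exists y0 : (forall i j, Ck 0 Om (fun z => B z i j)) -> exists Y, flow B y0 Y.
move=> cB.
have H x : exists y : R -> 'rV[R]_m, V x -> y 0 = y0 /\ solves (fun t => B (timed t x)) y (fun=> 0).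
 case: (pselect (V x)) => [Vx|]; last by exists (fun=> 0).
 have [K K0 KP] := timed_bounded cB Vx.
 have [i j||//|y [y0E S]] := @linear_ode_exists _ _ (fun t => B (timed (clamp t) x)) K y0; first exact: (continuous_timed (cB i j) Vx).
  by move=> t tI i j; rewrite clamp_id //; exact: KP.
 by exists y => _; split => // t tI j; have := S t tI j; rewrite clamp_id.
have [Y YP] := choice H; exists (fun t x => Y x t) => x Vx; exact: YP.
Qed.

Lemma solves_bounded (C : R -> 'M[R]_m) (y eps : R -> 'rV[R]_m) : solves C y eps ->
 exists2 K : R, 0 <= K & forall t : R, 0 <= t <= 1 -> forall j, `|y t 0 j| <= K.
move=> S.
have /choice[K KP] : forall j : 'I_m, exists K, 0 <= K /\ forall t, 0 <= t <= 1 -> `|y t 0 j| <= K.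
 move=> j; have [|K] := @clamp_bounded (fun t => y t 0 j); last by exists K.
 move=> t; apply: (@continuous_comp _ _ _ clamp (fun t => y t 0 j)); first exact: continuous_clamp.
 exact: der_continuous (S _ (clamp_itv t) j).
exists (\sum_j K j); first by apply: sumr_ge0 => j _; exact: (KP j).1.
move=> t tI j; apply: (le_trans ((KP j).2 t tI)).
by rewrite (bigD1 j) //= lerDl; apply: sumr_ge0 => i _; exact: (KP i).1.
Qed.

End ode_parameters.

Section ode_differentiability.
Context {R : realType} {n : nat}.

Lemma near_shift0 (x : 'rV[R]_n) (P : 'rV[R]_n -> Prop) :
 (\forall y \near x, P y) -> \forall h \near (0 : 'rV[R]_n), P (x + h).
by move=> /nbhs_normP[d d0 H]; apply/near0_ball; exists d => // h hd; apply: H; rewrite addrC addKr.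
Qed.

Lemma der_sum p (f : 'I_p -> R -> R) (df : 'I_p -> R) (t : R) : (forall i, is_derive t 1 (f i) (df i)) ->
 is_derive t 1 (fun s => \sum_i f i s) (\sum_i df i).
move=> H; have := @is_derive_sum _ _ _ _ f t 1 df H.
by rewrite (_ : \sum_i f i = fun s => \sum_i f i s) //; apply/funext => s; rewrite fct_sumE.
Qed.

Variables (Om : set 'rV[R]_(1 + n)) (V : set 'rV[R]_n).
Hypotheses (oOm : open Om) (oV : open V).
Hypothesis OmV : forall x, V x -> forall t : R, 0 <= t <= 1 -> Om (timed t x).

Lemma Ck_le p k l (W : set 'rV[R]_p) f : (l <= k)%N -> Ck k W f -> Ck l W f.
elim: k => [|k IH]; first by rewrite leqn0 => /eqP ->.
by rewrite leq_eqVlt => /orP[/eqP ->//|lk /CkW]; exact: IH.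
Qed.

Definition dparam m (B : 'rV[R]_(1 + n) -> 'M[R]_m) (i : 'I_n) z : 'M[R]_m :=
 \matrix_(a, b) 'D_(basis (rshift 1 i)) (fun z => B z a b) z.

(** Let S be the linear combination of the [sg i] with coefficients h. Then Y(x + h) - Y(x) - S
    starts at 0 and solves the equation at x + h with a source that is small compared with |h|, so
    [gronwall] bounds it. *)
Lemma flow_differentiable m (B : 'rV[R]_(1 + n) -> 'M[R]_m) y0 Y (sg : 'I_n -> R -> 'rV[R]_n -> 'rV[R]_m) x :
 (forall a b, Ck 2 Om (fun z => B z a b)) -> flow V B y0 Y -> V x ->
 (forall i, sg i 0 x = 0 /\
   solves (fun t => B (timed t x)) (fun t => sg i t x) (fun t => Y t x *m dparam B i (timed t x))) ->
 forall j, differentiable (fun x => Y 1 x 0 j) x /\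
  forall i, 'D_(basis i) (fun x => Y 1 x 0 j) x = sg i 1 x 0 j.
move=> sB FY Vx Fs j.
have [Y0 SY] := FY x Vx.
have [Ky Ky0 KyP] := solves_bounded SY.
have [Ks Ks0 KsP] : exists2 K : R, 0 <= K & forall i (t : R), 0 <= t <= 1 -> forall j, `|sg i t x 0 j| <= K.
 have H i : exists K : R, 0 <= K /\ forall t : R, 0 <= t <= 1 -> forall j, `|sg i t x 0 j| <= K.
  by have [K K0 KP] := solves_bounded (Fs i).2; exists K.
 have [K KP] := choice H; exists (\sum_i K i); first by apply: sumr_ge0 => i _; exact: (KP i).1.
 move=> i t tI k; apply: (le_trans ((KP i).2 t tI k)).
 by rewrite (bigD1 i) //= lerDl; apply: sumr_ge0 => l _; exact: (KP l).1.
have sB0 a b : Ck 0 Om (fun z => B z a b) by exact: CkW (CkW (sB a b)).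
have [KB KB0 KBP] := timed_bounded OmV sB0 Vx.
have D : is_diff x (fun x => Y 1 x 0 j) (lin_form (fun i => sg i 1 x 0 j)).
 apply: (@diff_eps _ _ (GRing.Linear.clone _ _ _ _ (lin_form (fun i => sg i 1 x 0 j)) _)) => [|e e0].
  exact: lin_form_continuous.
 pose G := gronwall_const m (KB + 1); have G0 : 0 <= G by exact: sqrtr_ge0.
 pose C := m%:R * Ky + m%:R * (n%:R * Ks); have C0 : 0 <= C by rewrite addr_ge0 ?mulr_ge0.
 have GC : 0 < G * C + 1 by rewrite ltr_wpDl // mulr_ge0.
 (* Makes the final bound G C e1 |h| at most e |h|; the summand 1 covers G C = 0. *)
 pose e1 := e / (G * C + 1); have e10 : 0 < e1 by rewrite divr_gt0.
 pose e2 := Num.min 1 e1; have e20 : 0 < e2 by rewrite lt_min ltr01 e10.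
 have N1 : \forall h \near (0 : 'rV[R]_n), V (x + h).
  by apply: near_shift0; exact: (open_near oV Vx).
 have N2 : \forall h \near (0 : 'rV[R]_n), forall a b (t : R), 0 <= t <= 1 ->
   `|B (timed t (x + h)) a b - B (timed t x) a b| < e2.
  apply: (near_shift0 (P := fun y => forall a b (t : R), 0 <= t <= 1 ->
   `|B (timed t y) a b - B (timed t x) a b| < e2)).
  apply: (@filter_forall _ _ (fun a y => forall b (t : R), 0 <= t <= 1 ->
   `|B (timed t y) a b - B (timed t x) a b| < e2) (nbhs x)) => a.
  apply: (@filter_forall _ _ (fun b y => forall (t : R), 0 <= t <= 1 ->
   `|B (timed t y) a b - B (timed t x) a b| < e2) (nbhs x)) => b.
  by apply: filterS (timed_uniform OmV (sB0 a b) Vx e20) => y.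
 have N3 : \forall h \near (0 : 'rV[R]_n), forall a b (t : R), 0 <= t <= 1 ->
   `|B (timed t (x + h)) a b - B (timed t x) a b -
    \sum_i h 0 i * 'D_(basis (rshift 1 i)) (fun z => B z a b) (timed t x)| <= e1 * `|h|.
  apply: (@filter_forall _ _ (fun a h => forall b (t : R), 0 <= t <= 1 ->
   `|B (timed t (x + h)) a b - B (timed t x) a b -
    \sum_i h 0 i * 'D_(basis (rshift 1 i)) (fun z => B z a b) (timed t x)| <= e1 * `|h|)
    (nbhs (0 : 'rV[R]_n))) => a.
  apply: (@filter_forall _ _ (fun b h => forall (t : R), 0 <= t <= 1 ->
   `|B (timed t (x + h)) a b - B (timed t x) a b -
    \sum_i h 0 i * 'D_(basis (rshift 1 i)) (fun z => B z a b) (timed t x)| <= e1 * `|h|)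
    (nbhs (0 : 'rV[R]_n))) => b.
  by apply: filterS (timed_taylor oV OmV (sB a b) Vx e10) => y.
 move: N1 N2 N3 => /near0_ball[d1 d10 N1] /near0_ball[d2 d20 N2] /near0_ball[d3 d30 N3].
 apply/near0_ball; exists (Num.min d1 (Num.min d2 d3)); first by rewrite !lt_min d10 d20.
 move=> h; rewrite !lt_min => /and3P[/N1 Vh /N2 hU /N3 hT].
 have [Y0' SY'] := FY _ Vh.
 pose S t := \sum_i h 0 i *: sg i t x.
 pose DB t := \sum_i h 0 i *: dparam B i (timed t x).
 pose eps t := Y t x *m (B (timed t (x + h)) - B (timed t x) - DB t) + S t *m (B (timed t (x + h)) - B (timed t x)).
 have SE t k : S t 0 k = \sum_i h 0 i * sg i t x 0 k.
  by rewrite /S summxE; apply: eq_bigr => i _; rewrite scalemxE.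
 have DBE t a b : DB t a b = \sum_i h 0 i * 'D_(basis (rshift 1 i)) (fun z => B z a b) (timed t x).
  by rewrite /DB summxE; apply: eq_bigr => i _; rewrite scalemxE [X in _ * X]mxE.
 have epsb (t : R) : 0 <= t <= 1 -> forall k, `|eps t 0 k| <= C * e1 * `|h|.
  move=> tI k; rewrite /eps addmxE; apply: le_trans (ler_normD _ _) _.
  have -> : C * e1 * `|h| = m%:R * (Ky * (e1 * `|h|)) + m%:R * ((n%:R * (`|h| * Ks)) * e1) by rewrite /C; ring.
  apply: lerD; apply: mulmx_bound => //.
  - exact: KyP.
  - move=> a b; have := hT a b t tI; rewrite addmxE addmxE 2!oppmxE DBE; exact.
  - by rewrite !mulr_ge0.
  - move=> a; rewrite SE; apply: le_trans (ler_norm_sum _ _ _) _.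
   apply: (@le_trans _ _ (\sum_(i < n) `|h| * Ks)).
    by apply: ler_sum => i _; rewrite normrM ler_pM // ?mx_norm_coord // KsP.
   by rewrite sumr_const card_ord mulr_natl.
  - move=> a b; have := hU a b t tI; rewrite addmxE oppmxE => /ltW/le_trans; apply.
   by rewrite /e2 ge_min lexx orbT.
 have KB1 (t : R) : 0 <= t <= 1 -> forall a b, `|B (timed t (x + h)) a b| <= KB + 1.
  move=> tI a b; have h1 := KBP t tI a b; have := hU a b t tI; rewrite /e2 lt_min => /andP[h2 _].
  have := ler_normD (B (timed t x) a b) (B (timed t (x + h)) a b - B (timed t x) a b).
  rewrite addrC subrK; move: h1 h2; lra.
 have KB10 : 0 <= KB + 1 by rewrite addr_ge0.
 have Ce0 : 0 <= C * e1 * `|h| by exact: mulr_ge0 (mulr_ge0 C0 (ltW e10)) (normr_ge0 h).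
 have := @gronwall _ _ (fun t => B (timed t (x + h))) (fun t => Y t (x + h) - Y t x - S t) eps (KB + 1) (C * e1 * `|h|) KB10 Ce0 KB1 epsb.
 have I1 : 0 <= (1 : R) <= 1 by rewrite ler01 lexx.
 move=> /(_ _ _ 1 I1 j) H; have {}H := H _ _.
 have E0 : (Y 1 (x + h) - Y 1 x - S 1) 0 j = Y 1 (h + x) 0 j - Y 1 x 0 j - lin_form (fun i => sg i 1 x 0 j) h.
  by rewrite addmxE addmxE 2!oppmxE SE [h + x]addrC.
 suff : `|(Y 1 (x + h) - Y 1 x - S 1) 0 j| <= e * `|h| by rewrite E0.
 apply: le_trans (H _ _) _.
 - by rewrite Y0 Y0' subrr sub0r /S big1 ?oppr0 // => i _; rewrite (Fs i).1 scaler0.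
 - move=> t tI k.
  rewrite (_ : (fun s => _) = fun s => Y s (x + h) 0 k - Y s x 0 k - \sum_i h 0 i * sg i s x 0 k); last first.
   by apply/funext => s; rewrite addmxE addmxE 2!oppmxE SE.
  have Dsum := der_sum (fun i => derZ (h 0 i) ((Fs i).2 t tI k)).
  apply: (der_eq (derB (derB (SY' t tI k) (SY t tI k)) Dsum)).
  rewrite !addr0.
  have -> : \sum_i h 0 i * (sg i t x *m B (timed t x) + Y t x *m dparam B i (timed t x)) 0 k =
    (S t *m B (timed t x) + Y t x *m DB t) 0 k.
   rewrite addmxE /S mulmx_suml /DB mulmx_sumr 2!summxE -big_split /=; apply: eq_bigr => i _.
   by rewrite addmxE -scalemxAl -scalemxAr 2!scalemxE mulrDr.
  rewrite /eps !mulmxBl !mulmxBr.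
  move: (_ *m _) (Y t x *m _) (Y t x *m _) (S t *m _) (S t *m _) (Y t x *m DB t) => m1 m2 m3 m4 m5 m6.
  by rewrite !(addmxE, oppmxE); ring.
 - rewrite /e1 -/G.
  have -> : G * (C * (e / (G * C + 1)) * `|h|) = (G * C / (G * C + 1)) * (e * `|h|) by ring.
  rewrite ler_piMl ?mulr_ge0 ?(ltW e0) // ler_pdivrMr // mul1r; lra.
split=> [|i]; first by case: D.
rewrite deriveE; last by case: D.
rewrite (@diff_val _ _ _ _ _ _ _ D) /lin_form (bigD1 i) //= mxE !eqxx mul1r big1 ?addr0 // => k ki.
by rewrite mxE (negbTE ki) andbF mul0r.
Qed.

(** The pair formed by Y and its derivative in parameter i solves a linear system with block
    triangular coefficients, so [flow_exists] provides the derivative. *)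
Lemma flow_variation m (B : 'rV[R]_(1 + n) -> 'M[R]_m) y0 Y i : (forall a b, Ck 1 Om (fun z => B z a b)) ->
 flow V B y0 Y ->
 exists Z, flow V (fun z => block_mx (B z) (dparam B i z) 0 (B z)) (row_mx y0 0) Z /\
  forall x, V x -> rsubmx (Z 0 x) = 0 /\
   solves (fun t => B (timed t x)) (fun t => rsubmx (Z t x)) (fun t => Y t x *m dparam B i (timed t x)).
move=> sB FY; pose Bh z : 'M[R]_(m + m) := block_mx (B z) (dparam B i z) 0 (B z).
have sBh a b : Ck 0 Om (fun z => Bh z a b).
 case: (split_ordP a) => a' ->; case: (split_ordP b) => b' ->.
 - rewrite (_ : (fun z => _) = fun z => B z a' b'); first exact: CkW.
  by apply/funext => z; rewrite block_mxEul.
 - rewrite (_ : (fun z => _) = 'D_(basis (rshift 1 i)) (fun z => B z a' b')); first exact: (sB a' b').2.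
  by apply/funext => z; rewrite block_mxEur mxE.
 - rewrite (_ : (fun z => _) = fun=> 0); first exact: Ck_cst.
  by apply/funext => z; rewrite block_mxEdl mxE.
 - rewrite (_ : (fun z => _) = fun z => B z a' b'); first exact: CkW.
  by apply/funext => z; rewrite block_mxEdr.
have [Z FZ] := flow_exists OmV (row_mx y0 0) sBh.
exists Z; split => // x Vx; have [Z0 SZ] := FZ x Vx.
have ZE t : Z t x *m Bh (timed t x) = row_mx (lsubmx (Z t x) *m B (timed t x))
  (lsubmx (Z t x) *m dparam B i (timed t x) + rsubmx (Z t x) *m B (timed t x)).
 by rewrite -{1}[Z t x]hsubmxK mul_row_block mulmx0 addr0.
have sB0 a b : Ck 0 Om (fun z => B z a b) by exact: CkW.
have [K K0 KP] := timed_bounded OmV sB0 Vx; have [Y0 SY] := FY x Vx.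
have ZY : forall t, 0 <= t <= 1 -> lsubmx (Z t x) = Y t x.
 apply: (solves_unique K0 KP _ SY); last by rewrite Z0 row_mxKl.
 move=> t tI j; rewrite (_ : (fun s => _) = fun s => Z s x 0 (lshift m j)); last by apply/funext => s; rewrite mxE.
 by apply: (der_eq (SZ t tI (lshift m j))); rewrite !addr0 ZE row_mxEl.
split; first by rewrite Z0 row_mxKr.
move=> t tI j; rewrite (_ : (fun s => _) = fun s => Z s x 0 (rshift m j)); last by apply/funext => s; rewrite mxE.
by apply: (der_eq (SZ t tI (rshift m j))); rewrite addr0 ZE row_mxEr ZY // addrC.
Qed.

(** Induction on k: the derivatives of the flow are components of the flow of the block system,
    whose coefficients have one derivative less. *)
Lemma flow_Ck k m (B : 'rV[R]_(1 + n) -> 'M[R]_m) y0 Y : (forall a b, Ck k.+2 Om (fun z => B z a b)) ->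
 flow V B y0 Y -> forall j, Ck k V (fun x => Y 1 x 0 j).
have main m' (B' : 'rV[R]_(1 + n) -> 'M[R]_m') y0' Y' : (forall a b, Ck 2 Om (fun z => B' z a b)) -> flow V B' y0' Y' ->
  exists Z, (forall i, flow V (fun z => block_mx (B' z) (dparam B' i z) 0 (B' z)) (row_mx y0' 0) (Z i)) /\
  forall x, V x -> forall j, differentiable (fun x => Y' 1 x 0 j) x /\
   forall i, 'D_(basis i) (fun x => Y' 1 x 0 j) x = Z i 1 x 0 (rshift m' j).
 move=> sB FY; have sB1 a b : Ck 1 Om (fun z => B' z a b) by exact: CkW.
 have [Z ZP] := choice (fun i => flow_variation i sB1 FY).
 exists Z; split => [i|x Vx j]; first exact: (ZP i).1.
 have [D DE] := @flow_differentiable m' B' y0' Y' (fun i t x => rsubmx (Z i t x)) x sB FY Vx (fun i => (ZP i).2 x Vx) j.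
 by split => // i; rewrite DE mxE.
elim: k m B y0 Y => [|k IH] m B y0 Y sB FY j.
 have [Z [_ D]] := main _ _ _ _ sB FY.
 by move=> x Vx; apply: differentiable_continuous; exact: (D x Vx j).1.
have [Z [FZ D]] := main _ _ _ _ (fun a b => Ck_le (isT : 2 <= k.+3)%N (sB a b)) FY.
split => [x Vx|i]; first exact: (D x Vx j).1.
apply: (@Ck_ext _ _ _ _ (fun x => Z i 1 x 0 (rshift m j))) => //.
 by move=> x Vx; rewrite (D x Vx j).2.
apply: (IH _ _ _ _ _ (FZ i)) => a b.
case: (split_ordP a) => a' ->; case: (split_ordP b) => b' ->.
- rewrite (_ : (fun z => _) = fun z => B z a' b'); first exact: CkW.
 by apply/funext => z; rewrite block_mxEul.
- rewrite (_ : (fun z => _) = 'D_(basis (rshift 1 i)) (fun z => B z a' b')); first exact: (sB a' b').2.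
 by apply/funext => z; rewrite block_mxEur mxE.
- rewrite (_ : (fun z => _) = fun=> 0); first exact: Ck_cst.
 by apply/funext => z; rewrite block_mxEdl mxE.
- rewrite (_ : (fun z => _) = fun z => B z a' b'); first exact: CkW.
 by apply/funext => z; rewrite block_mxEdr.
Qed.

End ode_differentiability.

(** * Parallel sections of flat connections *)

Section flat_connections.
Context {R : realType} {n m : nat}.
Variables (q : 'rV[R]_n) (r : R) (A : 'I_n -> 'rV[R]_n -> 'M[R]_m).
Let V : set 'rV[R]_n := [set x | `|x - q| < r].
Hypothesis sA : forall k a b, smooth V (fun x => A k x a b).

Definition dmx i k x : 'M[R]_m := \matrix_(a, b) 'D_(basis i) (fun y => A k y a b) x.

Lemma ray_in_ball x (t : R) : V x -> 0 <= t <= 1 -> V (q + t *: (x - q)).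
rewrite /V /= => h /andP[t0 t1]; rewrite addrC addKr normrZ ger0_norm //.
by apply: le_lt_trans h; rewrite ler_piMl.
Qed.

Definition ray_point (z : 'rV[R]_(1 + n)) : 'rV[R]_n := q + z 0 (lshift n 0) *: (rsubmx z - q).

Lemma ray_point_timed t x : ray_point (timed t x) = q + t *: (x - q).
by rewrite /ray_point /timed row_mxEl row_mxKr mxE eqxx mulr1n. Qed.

(** The connection at q + t (x - q) in the direction x - q, as a function of (t, x): the coefficient
    of parallel transport along the rays from q. *)
Definition radial (z : 'rV[R]_(1 + n)) : 'M[R]_m :=
 \sum_k (rsubmx z - q) 0 k *: A k (ray_point z).

Lemma radial_timed t x : radial (timed t x) = \sum_k (x - q) 0 k *: A k (q + t *: (x - q)).
by rewrite /radial ray_point_timed /timed row_mxKr. Qed.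

Let Om : set 'rV[R]_(1 + n) := ray_point @^-1` V.

Lemma ray_point_Ck k (W : set 'rV[R]_(1 + n)) j : open W -> Ck k W (fun z => ray_point z 0 j).
move=> oW; rewrite (_ : (fun z => _) = fun z : 'rV[R]_(1 + n) => q 0 j + z 0 (lshift n 0) * (z 0 (rshift 1 j) - q 0 j)).
 by apply: CkD => //; [exact: Ck_cst|apply: CkM => //; [exact: Ck_coord|apply: CkB => //; [exact: Ck_coord|exact: Ck_cst]]].
by apply/funext => z; rewrite /ray_point addmxE scalemxE addmxE oppmxE [rsubmx z 0 j]mxE.
Qed.

Lemma open_Om : open Om.
apply: open_comp; last exact: open_norm_ball.
move=> z _; apply: differentiable_continuous; apply: differentiable_row => j.
exact: (@ray_point_Ck 1 setT j openT).1.
Qed.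

Lemma radial_Ck k a b : Ck k Om (fun z => radial z a b).
rewrite (_ : (fun z => _) = fun z : 'rV[R]_(1 + n) => \sum_l (z 0 (rshift 1 l) - q 0 l) * A l (ray_point z) a b).
 apply: Ck_sum => [|l _]; first exact: open_Om.
 apply: CkM; first exact: open_Om.
  by apply: CkB; [exact: open_Om|exact: Ck_coord|exact: Ck_cst].
 apply: (Ck_comp (W := V) open_Om _ _ _ (sA l a b k)) => //; first exact: open_norm_ball.
 by move=> j; apply: ray_point_Ck; exact: open_Om.
apply/funext => z; rewrite /radial summxE; apply: eq_bigr => l _.
by rewrite scalemxE addmxE oppmxE [rsubmx z 0 l]mxE.
Qed.

Lemma OmV x : V x -> forall t : R, 0 <= t <= 1 -> Om (timed t x).
by move=> Vx t tI; rewrite /Om /= ray_point_timed; exact: ray_in_ball. Qed.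

Lemma der_A k a b x (h : 'rV[R]_n) (t : R) : V (x + t *: h) ->
 is_derive t 1 (fun s : R => A k (x + s *: h) a b) (\sum_l h 0 l * dmx l k (x + t *: h) a b).
move=> Vx; have dA : differentiable (fun y => A k y a b) (x + t *: h) by exact: (sA k a b 1).1.
apply: (der_eq (is_derive_line dA)); rewrite derive_sumE //; apply: eq_bigr => l _.
by rewrite [in RHS]mxE.
Qed.

Lemma dparam_radial i (t : R) x : V x -> 0 <= t <= 1 ->
 dparam radial i (timed t x) = A i (q + t *: (x - q)) + t *: \sum_k (x - q) 0 k *: dmx i k (q + t *: (x - q)).
move=> Vx tI; set g := q + t *: (x - q); have Vg : V g by exact: ray_in_ball.
apply/matrixP => a b; rewrite [LHS]mxE.
have D1 := @is_derive_line _ _ (fun z => radial z a b) (timed t x) (basis (rshift 1 i)) 0 _.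
rewrite scale0r addr0 in D1; have {}D1 := D1 ((radial_Ck 1 a b).1 _ (OmV Vx tI)).
have E1 : (fun s : R => radial (timed t x + s *: basis (rshift 1 i)) a b) =
  fun s => \sum_k ((x - q) 0 k + s * (i == k)%:R) * A k (g + s *: (t *: basis i)) a b.
 apply/funext => s; have -> : basis (rshift 1 i) = row_mx 0 (basis i) :> 'rV[R]_(1 + n).
  apply/rowP => j; rewrite mxE eqxx /=; case: (split_ordP j) => l ->.
   by rewrite row_mxEl mxE eq_lrshift.
  by rewrite row_mxEr mxE eqxx eq_rshift.
 rewrite -timed_line radial_timed summxE; apply: eq_bigr => k _; rewrite scalemxE; congr (_ * _).
  by rewrite !addmxE oppmxE scalemxE [basis i 0 k]mxE eqxx [k == i]eq_sym /=; ring.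
 congr (A k _ a b); rewrite /g.
 by apply/rowP => j; rewrite !(addmxE, scalemxE, oppmxE); ring.
rewrite E1 in D1.
have Vg0 : V (g + (0 : R) *: (t *: basis i)) by rewrite scale0r addr0.
have Dk k := derM (derD (derC ((x - q) 0 k) 0) (derM (derI 0) (derC ((i == k)%:R : R) 0))) (@der_A k a b g (t *: basis i) 0 Vg0).
have D2 := der_sum Dk.
rewrite (_ : 'D_(basis (rshift 1 i)) _ _ = 'D_1 (fun s : R => \sum_k ((x - q) 0 k + s * (i == k)%:R) * A k (g + s *: (t *: basis i)) a b) 0); last first.
 by rewrite (@derive_val _ _ _ _ _ _ _ D1).
rewrite (@derive_val _ _ _ _ _ _ _ D2) scale0r addr0.
rewrite addmxE scalemxE summxE mulr_sumr big_split /=; congr (_ + _).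
 rewrite (bigD1 i) //= eqxx big1 ?addr0 => [|k ki]; first by rewrite /=; ring.
 by rewrite eq_sym (negbTE ki) /=; ring.
apply: eq_bigr => k _; rewrite scalemxE mul0r addr0 mulrCA; congr (_ * _).
rewrite (bigD1 i) //= scalemxE [basis i 0 i]mxE !eqxx big1 ?addr0 ?mulr1 // => l li.
by rewrite scalemxE [basis i 0 l]mxE (negbTE li) andbF mulr0 mul0r.
Qed.

(** V is a full ball on which the coefficients are smooth, D a star-shaped part of it on which the
    connection is flat. In the application D is the half-ball, and the coefficients on V are
    extensions from it. *)
Variable D : set 'rV[R]_n.
Hypotheses (DV : D `<=` V) (D_star : forall x (t : R), D x -> 0 <= t <= 1 -> D (q + t *: (x - q))).
Hypothesis flat : forall x j k, D x -> dmx j k x - dmx k j x + A j x *m A k x - A k x *m A j x = 0.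

(* Along each ray from q, the derivative of the solution in direction i and t y A_i solve the same
  linear equation, by flatness. *)
Lemma flat_sections (y0 : 'rV[R]_m) : 0 < r -> exists s : 'rV[R]_n -> 'rV[R]_m, [/\ s q = y0,
 forall j, smooth V (fun x => s x 0 j) &
 forall x k j, D x -> 'D_(basis k) (fun x => s x 0 j) x = (s x *m A k x) 0 j].
move=> r0; have Vq : V q by rewrite /V /= subrr normr0.
have oV : open V := @open_norm_ball _ _ q r.
have [Y FY] := flow_exists OmV y0 (radial_Ck 0).
exists (Y 1); split.
- have [Y0 SY] := FY q Vq; rewrite -Y0.
 have I1 : 0 <= (1 : R) <= 1 by rewrite ler01 lexx.
 have B0 t : radial (timed t q) = 0.
  by rewrite radial_timed big1 // => k _; rewrite subrr mxE scale0r.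
 apply: (@solves_unique _ _ (fun t => radial (timed t q)) (fun t => Y t q) (fun=> Y 0 q) 0) => //.
  by move=> t _ i j; rewrite B0 mxE normr0.
 by move=> t tI j; apply: (der_eq (derC (Y 0 q 0 j) t)); rewrite B0 mulmx0 addr0 mxE.
- by move=> j k; exact (flow_Ck oV OmV (fun a b => radial_Ck k.+2 a b) FY j).
move=> x i j Dx; have Vx := DV Dx; have [Y0 SY] := FY x Vx.
have := @flow_differentiable _ _ Om V oV OmV m radial y0 Y
 (fun i t x => t *: (Y t x *m A i (q + t *: (x - q)))) x (radial_Ck 2) FY Vx.
move=> /(_ _ j)[|_ ->]; last by rewrite !scale1r addrC subrK.
move=> {i j} i; split; first by rewrite scale0r.
move=> t tI j; have Vg := ray_in_ball Vx tI; have Dg := D_star Dx tI.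
rewrite (_ : (fun s => _) = fun s => s * \sum_a Y s x 0 a * A i (q + s *: (x - q)) a j); last first.
 by apply/funext => s; rewrite scalemxE mxE.
have Da a := derM (SY t tI a) (@der_A i a j q (x - q) t Vg).
apply: (der_eq (derM (derI t) (der_sum Da))).
rewrite dparam_radial // radial_timed; move: Vg Dg; set g := q + t *: (x - q) => Vg Dg.
set y := Y t x; set X := (x - q).
(* Flatness contracted with X; it interchanges the products of the radial matrix with A_i at the
   cost of exchanging derivatives. *)
have key : (\sum_k X 0 k *: A k g) *m A i g + \sum_l X 0 l *: dmx l i g =
      A i g *m (\sum_k X 0 k *: A k g) + \sum_l X 0 l *: dmx i l g.
 rewrite mulmx_suml mulmx_sumr -!big_split /=; apply: eq_bigr => k _.
 rewrite -scalemxAl -scalemxAr -!scalerDr; congr (_ *: _).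
 by apply/eqP; rewrite -subr_eq0 -(flat k i Dg); apply/eqP/matrixP => a b; rewrite !(addmxE, oppmxE); ring.
have -> : \sum_a ((y *m (\sum_k X 0 k *: A k g) + 0) 0 a * A i g a j + y 0 a * \sum_l X 0 l * dmx l i g a j) =
  (y *m ((\sum_k X 0 k *: A k g) *m A i g + \sum_l X 0 l *: dmx l i g)) 0 j.
 rewrite addr0 mulmxDr mulmxA addmxE [(_ *m _ *m A i g) 0 j]mxE [(y *m \sum_l _) 0 j]mxE -big_split /=.
 apply: eq_bigr => a _; congr (_ + _ * _); rewrite summxE; apply: eq_bigr => l _; by rewrite scalemxE.
rewrite key.
have -> : \sum_a y 0 a * A i g a j = (y *m A i g) 0 j by rewrite mxE.
rewrite -scalemxAl mulmxDr mulmxDr -scalemxAr mulmxA !(addmxE, scalemxE); ring.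
Qed.

End flat_connections.

(** * Parallel orthonormal frames *)

Section parallel_frames.
Context {R : realType} {n : nat}.
Hypothesis n0 : (0 < n)%N.

(** Householder reflection in the hyperplane orthogonal to u - v. *)
Lemma reflection_exists p (u v : 'rV[R]_p) : (u *m u^T) 0 0 = 1 -> (v *m v^T) 0 0 = 1 ->
 exists H : 'M[R]_p, H *m H^T = 1%:M /\ u *m H = v.
move=> uu vv; pose w := u - v; pose N := (w *m w^T) 0 0; pose P := w^T *m w.
have uv := dot_mxC u v.
have NE : N = 2 - 2 * (u *m v^T) 0 0.
 rewrite /N /w linearB /= mulmxBl !mulmxBr !(addmxE, oppmxE) uu vv -uv; ring.
have PP : P *m P = N *: P.
 by rewrite mulmxA -(mulmxA w^T w w^T) [w *m w^T]mx11_scalar mul_mx_scalar scalemxAl.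
have PT : P^T = P by rewrite trmx_mul trmxK.
exists (1%:M - (2 / N) *: P); case: (eqVneq N 0) => [N0|N0].
 have w0 : u = v.
  apply/eqP; rewrite -subr_eq0; apply/eqP/rowP => j.
  have : \sum_i w 0 i ^+ 2 = 0.
   by rewrite -[RHS]N0 /N mxE; apply: eq_bigr => i _; rewrite [w^T i 0]mxE.
  move/eqP; rewrite psumr_eq0 => [/allP/(_ j (mem_index_enum _))|i _]; last exact: sqr_ge0.
  by rewrite sqrf_eq0 => /eqP ->; rewrite mxE.
 by rewrite N0 invr0 mulr0 scale0r subr0 trmx1 !mulmx1.
split.
 have -> : (1%:M - (2 / N) *: P)^T = 1%:M - (2 / N) *: P.
  apply/matrixP => a b; rewrite [LHS]mxE !(addmxE, oppmxE, scalemxE) -{1}PT [P^T b a]mxE.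
  by rewrite [1%:M b a]mxE [1%:M a b]mxE eq_sym.
 rewrite mulmxBl mul1mx mulmxBr mulmx1 -scalemxAl -scalemxAr PP.
 apply/matrixP => a b; rewrite !(addmxE, oppmxE, scalemxE); field.
 exact: N0.
rewrite mulmxBr mulmx1 -scalemxAr mulmxA [u *m w^T]mx11_scalar mul_scalar_mx scalerA.
have -> : (u *m w^T) 0 0 = N / 2.
 by rewrite NE linearB mulmxBr addmxE oppmxE uu; field.
by rewrite (_ : 2 / N * (N / 2) = 1) ?scale1r ?subKr //; field.
Qed.

Lemma locally_const (A : set 'rV[R]_n) F x : hopen A -> smooth_on A F -> A x ->
 (forall y i, A y -> pd i F y = 0) ->
 exists2 d : R, 0 < d & forall y, A y -> `|y - x| < d -> F y = F x.
move=> hA sF Ax F0; have [d d0 H] := mvt_near n0 hA sF Ax; exists d => // y Ay yd.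
have xd : `|x - x| < d by rewrite subrr normr0.
have [s [_ As _ E]] := H x y Ax Ay xd yd.
apply/eqP; rewrite -subr_eq0 E /dd big1 // => i _; by rewrite F0 // mulr0.
Qed.

Variables (A : set 'rV[R]_n) (g : 'rV[R]_n -> 'M[R]_n).
Hypothesis lm : local_metric A g.
Let hA : hopen A := lm_open lm.
Local Notation P := (sph_metric g).

Lemma sph_metric_unit x : A x -> P x \in unitmx.
move=> Ax; rewrite unitmxE det_ublock det1 mul1r; exact: (g_unit lm Ax).
Qed.

(** The inverse of [sph_metric] is parallel, so it pairs parallel sections to constants. *)
Lemma pd_pairing p p' (S : 'rV[R]_n -> 'M[R]_(p, 1 + n)) (S' : 'rV[R]_n -> 'M[R]_(p', 1 + n)) k x :
 smooth_mx A S -> smooth_mx A S' -> A x -> pdmx k S x = S x *m sph g k x -> pdmx k S' x = S' x *m sph g k x ->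
 pdmx k (fun y => S y *m invmx (P y) *m (S' y)^T) x = 0.
move=> sS sS' Ax DS DS'.
have sP := smooth_sph_metric lm; have sI := smooth_mx_inv sph_metric_unit sP.
have sSI : smooth_mx A (fun y => S y *m invmx (P y)) by exact: smooth_mxM.
have sT : smooth_mx A (fun y => (S' y)^T) by exact: smooth_mx_tr.
rewrite (pdmxM hA Ax) // (pdmxM hA Ax) // (pdmx_tr hA Ax) // (pdmx_inv hA Ax k sph_metric_unit sP).
rewrite (sph_metric_compat lm) // DS DS' trmx_mul; have uP := sph_metric_unit Ax.
move: (sph g k x) (S x) (S' x) (P x) uP => a s s' h uh.
have -> : invmx h *m (a^T *m h + h *m a) *m invmx h = invmx h *m a^T + a *m invmx h.
 by rewrite mulmxDr mulmxDl !mulmxA mulVmx // mul1mx mulmxK.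
rewrite mulmxN mulmxDr opprD !mulmxDl !mulNmx !mulmxA.
by apply/matrixP => i j; rewrite !(addmxE, oppmxE) [RHS]mxE; ring.
Qed.

Lemma pairing_const p p' (S : 'rV[R]_n -> 'M[R]_(p, 1 + n)) (S' : 'rV[R]_n -> 'M[R]_(p', 1 + n)) x :
 smooth_mx A S -> smooth_mx A S' -> A x ->
 (forall y k, A y -> pdmx k S y = S y *m sph g k y) -> (forall y k, A y -> pdmx k S' y = S' y *m sph g k y) ->
 \forall y \near x, A y -> S y *m invmx (P y) *m (S' y)^T = S x *m invmx (P x) *m (S' x)^T.
move=> sS sS' Ax DS DS'; pose F y := S y *m invmx (P y) *m (S' y)^T.
have sF : smooth_mx A F.
 apply: smooth_mxM; last exact: smooth_mx_tr.
 by apply: smooth_mxM => //; exact (smooth_mx_inv sph_metric_unit (smooth_sph_metric lm)).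
have H : \forall y \near x, forall i j, A y -> F y i j = F x i j.
 apply: (@filter_forall _ _ (fun i y => forall j, A y -> F y i j = F x i j) (nbhs x)) => i.
 apply: filter_forall => j.
 have [y k Ay|d d0 dP] := @locally_const A (fun y => F y i j) x hA (sF i j) Ax.
  by rewrite -pdmxE (pd_pairing sS sS' Ay (DS _ _ Ay) (DS' _ _ Ay)) mxE.
 by apply/nbhs_normP; exists d => // y yd Ay; exact: dP.
by apply: filterS H => y H Ay; apply/matrixP => i j; exact: H.
Qed.

End parallel_frames.

Section parallel_frame_existence.
Context {R : realType} {n : nat}.
Hypothesis n0 : (0 < n)%N.
Variables (A : set 'rV[R]_n) (g : 'rV[R]_n -> 'M[R]_n).
Hypothesis lm : local_metric A g.
Let hA : hopen A := lm_open lm.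
Local Notation P := (sph_metric g).
Variable f : 'rV[R]_n -> R.
Hypotheses (sf : smooth_on A f) (f_hess : forall x, A x -> trfree g f x = 0).
Hypothesis f_energy : forall x, A x -> energy g f x = 1.
Hypothesis flat : forall x j k, A x -> weyl g j k x = 0.

Lemma mulmx1_inv p (X Y : 'M[R]_p) : X *m Y = 1%:M -> invmx X = Y.
by move=> XY; have [uX _] := mulmx1_unit XY; rewrite -[RHS]mul1mx -(mulVmx uX) -mulmxA XY mulmx1.
Qed.

Lemma section_unit x : A x -> (sph_section f x *m invmx (P x) *m (sph_section f x)^T) 0 0 = 1.
move=> Ax; have -> : sph_section f x *m invmx (P x) = row_mx (f x)%:M (gradup g f x).
 apply: (can_inj (mulmxK (sph_metric_unit lm Ax))); rewrite mulmxKV ?(sph_metric_unit lm) //.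
 by rewrite mul_row_block !mulmx0 addr0 add0r mulmx1 (gradup_g lm).
rewrite tr_row_mx mul_row_col addmxE tr_scalar_mx -scalar_mxM [_%:M 0 0]mxE.
by have := f_energy Ax; rewrite /energy => <-; rewrite addrC.
Qed.

(** The Cholesky factor at q gives an orthonormal frame, and a reflection brings the unit vector (f,
    df) into its first row. The parallel extension keeps both properties because pairings of
    parallel sections are constant. *)
Lemma parallel_frame q : A q -> exists d : R, exists S : 'rV[R]_n -> 'M[R]_(1 + n), [/\ 0 < d,
 forall x, `|x - q| < d -> halfspace x -> A x,
 forall a b, smooth [set x | `|x - q| < d] (fun x => S x a b),
 forall x k, A x -> `|x - q| < d -> pdmx k S x = S x *m sph g k x &
 forall x, A x -> `|x - q| < d ->
  S x *m invmx (P x) *m (S x)^T = 1%:M /\ usubmx (S x) = sph_section f x].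
move=> Aq; have [V0 oV0 AE] := hA; have Vq : V0 q by move: Aq; rewrite AE => -[].
pose T3 : Type := 'I_n * 'I_(1 + n) * 'I_(1 + n).
have ext (kab : 'I_n * 'I_(1 + n) * 'I_(1 + n)) : exists VF : set 'rV[R]_n * ('rV[R]_n -> R),
  local_ext A (fun x => sph g kab.1.1 x kab.1.2 kab.2) q VF.1 VF.2.
 by have [V [F e]] := (smooth_onP _ _).1 (smooth_sph lm kab.1.1 kab.1.2 kab.2) q Aq; exists (V, F).
have [e eP] := choice ext.
have /nbhs_normP[d d0 dP] : \forall y \near q, V0 y /\ forall kab, (e kab).1 y.
 apply: filterI; first exact: open_nbhs_nbhs.
 apply: (@filter_forall _ _ (fun kab y => (e kab).1 y) (nbhs q)) => kab.
 by have [oV Vq' _ _] := eP kab; exact: open_nbhs_nbhs.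
pose W := [set x | `|x - q| < d]; have oW : open W := @open_norm_ball _ _ q d.
pose D := A `&` W; have hD : hopen D by exact: hopen_open.
have Dq : D q by split => //; rewrite /W /= subrr normr0.
have WA x : W x -> halfspace x -> A x by move=> /dP[Vx _] hx; rewrite AE.
pose B k x : 'M[R]_(1 + n) := \matrix_(a, b) (e (k, a, b)).2 x.
have BF k a b : (fun x => B k x a b) = (e (k, a, b)).2 by apply/funext => x; rewrite mxE.
have sB k a b : smooth W (fun x => B k x a b).
 rewrite BF => l; have [_ _ sF _] := eP (k, a, b).
 by apply: Ck_sub (sF l) => x /dP[_]; apply.
have BE k x : D x -> B k x = sph g k x.
 move=> [Ax Wx]; apply/matrixP => a b; rewrite mxE; have [_ _ _ ->//] := eP (k, a, b).
 by have [_] := dP x Wx; apply.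
have dB j k x : D x -> dmx B j k x = pdmx j (sph g k) x.
 move=> [Ax Wx]; apply/matrixP => a b; rewrite mxE BF; apply/esym.
 rewrite pdmxE; apply: pdE hA Ax _; apply: local_extS (eP (k, a, b)) _.
 by have [_] := dP x Wx; apply.
have flatB x j k : D x -> dmx B j k x - dmx B k j x + B j x *m B k x - B k x *m B j x = 0.
 move=> Dx; rewrite !dB // !BE //; have := curv_sph lm j k Dx.1; rewrite (flat j k Dx.1) block_mx0.
 by [].
have D_star x t : D x -> 0 <= t <= 1 -> D (q + t *: (x - q)).
 move=> [Ax Wx] tI; have Wg : W (q + t *: (x - q)) by exact: ray_in_ball.
 split => //; apply: WA => // i i0; have /andP[t0 t1] := tI.
 have := Ax; have := Aq; rewrite AE => -[_ /(_ i i0) q0] [_ /(_ i i0) x0].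
 rewrite !(addmxE, scalemxE, oppmxE).
 nra.
have DW : D `<=` W by move=> x [].
have [C [uC gE]] := cholesky (lm_sym lm Aq) (lm_pos lm Aq).
pose C1 : 'M[R]_(1 + n) := block_mx 1%:M 0 0 C.
have uC1 : C1 \in unitmx by rewrite unitmxE det_ublock det1 mul1r.
have PE : P q = C1^T *m C1.
 by rewrite tr_block_mx mulmx_block !(trmx0, mulmx0, mul0mx, addr0, add0r) trmx1 mulmx1 -gE.
have PI : invmx (P q) = invmx C1 *m (invmx C1)^T.
 apply: mulmx1_inv; rewrite PE !mulmxA mulmxK // -trmx_mul mulVmx ?trmx1 //.
pose e0 : 'rV[R]_(1 + n) := row_mx 1%:M 0.
have usubE p (X : 'M[R]_(1 + n, p)) : usubmx X = e0 *m X.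
 by rewrite -{2}[X]vsubmxK mul_row_col mul1mx mul0mx addr0.
have e01 : (e0 *m e0^T) 0 0 = 1 by rewrite tr_row_mx mul_row_col trmx1 trmx0 mulmx0 mul1mx addr0 mxE.
have sec1 : (sph_section f q *m invmx C1 *m (sph_section f q *m invmx C1)^T) 0 0 = 1.
 by rewrite trmx_mul mulmxA -(mulmxA _ (invmx C1)) -PI section_unit.
have [H [HH e0H]] := reflection_exists e01 sec1.
pose S0 := H *m C1.
have S0P : S0 *m invmx (P q) *m S0^T = 1%:M.
 by rewrite PI trmx_mul !mulmxA mulmxK // -(mulmxA H (invmx C1)^T) -trmx_mul mulmxV // trmx1 mulmx1.
have S0s : usubmx S0 = sph_section f q by rewrite usubE mulmxA e0H mulmxKV.
have [s sP] := choice (fun i => flat_sections sB DW D_star flatB (row i S0) d0).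
pose S x : 'M[R]_(1 + n) := \matrix_(i, j) s i x 0 j.
have SF a b : (fun x => S x a b) = fun x => s a x 0 b by apply/funext => x; rewrite mxE.
have sS a b : smooth W (fun x => S x a b) by rewrite SF; case: (sP a) => _ h _; exact: h.
have extS a b x : D x -> local_ext D (fun x => S x a b) x W (fun x => S x a b).
 by move=> [Ax Wx]; split.
have sSD : smooth_mx D S.
 by move=> a b; apply/smooth_onP => x Dx; exists W, (fun x => S x a b); exact: extS.
have dS x k : D x -> pdmx k S x = S x *m sph g k x.
 move=> Dx; apply/matrixP => a b; rewrite pdmxE (pdE k hD Dx (extS a b x Dx)) SF.
 have [_ _ ->//] := sP a; rewrite BE // mxE [RHS]mxE; apply: eq_bigr => l _.
 by rewrite [S x a l]mxE.
have Sq : S q = S0.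
 by apply/matrixP => a b; rewrite mxE; have [-> _ _] := sP a; rewrite mxE.
have lmD := local_metric_sub lm hD (fun x Dx => Dx.1).
have sfD : smooth_on D f by apply: smooth_on_sub sf => x [].
have fD x : D x -> trfree g f x = 0 by move=> [Ax _]; exact: f_hess.
have /nbhs_normP[d1 d10 N1] := pairing_const n0 lmD sSD sSD Dq dS dS.
have /nbhs_normP[d2 d20 N2] := pairing_const n0 lmD (smooth_sph_section lmD sfD) sSD Dq
 (fun y k => sph_section_parallel lmD sfD fD k (x := y)) dS.
exists (Num.min d (Num.min d1 d2)), S; split.
- by rewrite !lt_min d0 d10.
- by move=> x; rewrite !lt_min => /and3P[xd _ _]; exact: WA.
- by move=> a b k; apply: Ck_sub (sS a b k) => x /=; rewrite lt_min => /andP[].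
- by move=> x k Ax; rewrite !lt_min => /and3P[xd _ _]; exact: dS.
move=> x Ax; rewrite !lt_min => /and3P[xd x1 x2]; have Dx : D x by [].
have E1 : S x *m invmx (P x) *m (S x)^T = 1%:M by rewrite N1 // Sq.
split=> //; have E2 := N2 x x2 Dx; rewrite Sq -S0s usubE in E2.
have E3 : invmx (P x) *m (S x)^T *m S x = 1%:M by apply: mulmx1C; rewrite mulmxA.
rewrite -[RHS]mulmx1 -E3 !mulmxA E2 -(mulmxA e0) -(mulmxA e0) S0P mulmx1.
exact: usubE.
Qed.

End parallel_frame_existence.

(** * The inverse function theorem *)

Section inverse_function.
Context {R : realType}.

Lemma Ck_det n p k (V : set 'rV[R]_n) (M : 'rV[R]_n -> 'M[R]_p) : open V ->
 (forall i j, Ck k V (fun x => M x i j)) -> Ck k V (fun x => \det (M x)).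
move=> oV sM; apply: Ck_sum => // s _.
by apply: CkM => //; [exact: Ck_cst|apply: Ck_prod => // i _; exact: sM].
Qed.

Lemma Ck_invmx n p k (V : set 'rV[R]_n) (M : 'rV[R]_n -> 'M[R]_p) : open V ->
 (forall x, V x -> M x \in unitmx) -> (forall i j, Ck k V (fun x => M x i j)) ->
 forall i j, Ck k V (fun x => invmx (M x) i j).
move=> oV uM sM i j.
apply: (@Ck_ext _ _ _ _ (fun x => (\det (M x))^-1 * ((-1) ^+ (j + i) * \det (row' j (col' i (M x)))))) => //.
 by move=> x Vx; rewrite /invmx uM // mxE [\adj _ _ _]mxE.
apply: CkM => //.
 by apply: CkV => //; [move=> x Vx; rewrite -unitfE -unitmxE uM|exact: Ck_det].
apply: CkM => //; first exact: Ck_cst.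
apply: Ck_det => // a b; rewrite (_ : (fun x => _) = fun x => M x (lift j a) (lift i b)) //.
by apply/funext => x; rewrite !mxE.
Qed.

Lemma lipschitz_ball n (H : 'rV[R]_n -> 'rV[R]_n) (c : 'rV[R]_n) (d e : R) x y :
 (forall z, `|z - c| < d -> forall j, differentiable (fun x => H x 0 j) z /\
   forall i, `|'D_(basis i) (fun x => H x 0 j) z| <= e) ->
 `|x - c| < d -> `|y - c| < d -> `|H x - H y| <= n%:R * e * `|x - y|.
move=> dH xd yd.
have H0 j : exists2 s : R, 0 <= s <= 1 & H x 0 j - H y 0 j = 'D_(x - y) (fun x => H x 0 j) (y + s *: (x - y)).
 have D (s : R) : Num.min 0 1 <= s <= Num.max 0 1 ->
   is_derive s 1 (fun s => H (y + s *: (x - y)) 0 j) ('D_(x - y) (fun x => H x 0 j) (y + s *: (x - y))).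
  rewrite min_l // max_r // => sI; have [df _] := dH _ (segment_ball yd xd sI) j.
  exact (is_derive_line df).
 have [s] := MVT_unordered D; rewrite min_l // max_r // subr0 mulr1 scale1r scale0r addr0 subrKC => sI ->.
 by exists s.
have B j : `|(H x - H y) 0 j| <= n%:R * e * `|x - y|.
 have [s sI] := H0 j; rewrite addmxE oppmxE => ->; have [df dfe] := dH _ (segment_ball yd xd sI) j.
 rewrite derive_sumE //; apply: le_trans (ler_norm_sum _ _ _) _; apply: (@le_trans _ _ (\sum_i `|x - y| * e)).
  by apply: ler_sum => i _; rewrite normrM ler_pM // mx_norm_coord.
 by rewrite sumr_const card_ord le_eqVlt; apply/orP; left; apply/eqP; ring.
have [n00|nn0] := posnP n; last by apply: mx_norm_le => //; exact: le_trans (B (Ordinal nn0)).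
have nR : n%:R = 0 :> R by rewrite n00.
by apply: mx_norm_le => //; rewrite nR !mul0r.
Qed.

Variables (n : nat) (V : set 'rV[R]_n) (F : 'rV[R]_n -> 'rV[R]_n) (x0 : 'rV[R]_n).
Hypotheses (oV : open V) (Vx0 : V x0) (sF : forall j, smooth V (fun x => F x 0 j)).

Definition frechet_mx (x : 'rV[R]_n) : 'M[R]_n := \matrix_(i, j) 'D_(basis i) (fun x => F x 0 j) x.
Local Notation J := frechet_mx.
Hypothesis uJ : J x0 \in unitmx.

Lemma smooth_frechet i j : smooth V (fun x => J x i j).
move=> k; rewrite (_ : (fun x => _) = 'D_(basis i) (fun x => F x 0 j)); last by apply/funext => x; rewrite mxE.
exact: (sF j k.+1).2.
Qed.

Lemma mulmx_norm p q (N : 'M[R]_(p, q)) : exists2 K : R, 0 < K & forall h : 'rV[R]_p, `|h *m N| <= K * `|h|.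
pose K0 := \sum_ij `|N ij.1 ij.2|; have K00 : 0 <= K0 by apply: sumr_ge0.
exists (p%:R * K0 + 1); first by rewrite ltr_wpDl // mulr_ge0.
move=> h; apply: mx_norm_le => [|j]; first by rewrite mulr_ge0 // addr_ge0 // mulr_ge0.
apply: (@le_trans _ _ (p%:R * (`|h| * K0))).
 apply: mulmx_bound => // [i|i k]; first exact: mx_norm_coord.
 by rewrite /K0 (bigD1 (i, k)) //= lerDl; apply: sumr_ge0.
by rewrite [`|h| * K0]mulrC mulrA mulrDl lerDl.
Qed.

(* Solve x = H x + y C with H x = x - F x C and C = J(x0)^-1, a contraction near x0. *)
Theorem inverse_function : exists (U W : set 'rV[R]_n) (G : 'rV[R]_n -> 'rV[R]_n),
 [/\ [/\ open U, open W, U x0 & W (F x0)], U `<=` V,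
   forall x, U x -> W (F x) /\ G (F x) = x,
   forall y, W y -> U (G y) /\ F (G y) = y &
   forall j, smooth W (fun y => G y 0 j)].
pose C := invmx (J x0).
pose H x := x - F x *m C.
have HE x j : H x 0 j = x 0 j - \sum_l F x 0 l * C l j by rewrite /H addmxE oppmxE mxE.
have sH j : smooth V (fun x => H x 0 j).
 move=> k; rewrite (_ : (fun x => _) = fun x : 'rV[R]_n => x 0 j - \sum_l F x 0 l * C l j); last by apply/funext => x; rewrite HE.
 apply: CkB => //; first exact: Ck_coord.
 by apply: Ck_sum => // l _; apply: CkM => //; [exact: sF|exact: Ck_cst].
have dH0 i j : 'D_(basis i) (fun x => H x 0 j) x0 = 0.
 have Vx : V (x0 + (0 : R) *: basis i) by rewrite scale0r addr0.
 have D1 := is_derive_line ((sH j 1).1 _ Vx); rewrite !scale0r !addr0 in D1.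
 rewrite -(@derive_val _ _ _ _ _ _ _ D1).
 have -> : (fun s : R => H (x0 + s *: basis i) 0 j) =
   fun s : R => x0 0 j + s * basis i 0 j - \sum_l F (x0 + s *: basis i) 0 l * C l j.
  by apply/funext => s; rewrite HE addmxE scalemxE.
 have D2 l := derM (is_derive_line ((sF l 1).1 _ Vx)) (derC (C l j) 0).
 have D3 := derB (derD (derC (x0 0 j) 0) (derM (derI 0) (derC ((basis i : 'rV[R]_n) 0 j) 0))) (der_sum D2).
 rewrite (@derive_val _ _ _ _ _ _ _ D3) !scale0r !addr0 mul0r addr0 add0r mul1r.
 have -> : \sum_l ('D_(basis i) (fun x => F x 0 l) x0 * C l j + F x0 0 l * 0) = (J x0 *m C) i j.
  by rewrite [RHS]mxE; apply: eq_bigr => l _; rewrite mulr0 addr0 [J x0 i l]mxE.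
 by rewrite /C mulmxV // [1%:M i j]mxE mxE eqxx /= eq_sym subrr.
(* So that n e <= 1/2 is the Lipschitz constant given by [lipschitz_ball]; n + 1 avoids a zero
   denominator. *)
pose e : R := (2 * (n%:R + 1))^-1; have e0 : 0 < e by rewrite invr_gt0 mulr_gt0 // ltr_wpDl.
have /nbhs_normP[d d0 dP] : \forall x \near x0, [/\ V x, J x \in unitmx & forall i j, `|'D_(basis i) (fun x => H x 0 j) x| < e].
 have N1 : \forall x \near x0, V x by exact: (open_near oV Vx0).
 have N2 : \forall x \near x0, J x \in unitmx.
  have : {for x0, continuous (fun x => \det (J x))} by exact: (Ck_det oV (fun i j => smooth_frechet i j 0)).
  have uJ' : 0 < `|\det (J x0)| by rewrite normr_gt0 -unitfE -unitmxE.
  move=> /cvgrPdist_lt/(_ _ uJ').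
  apply: filterS => x; rewrite unitmxE unitfE => h; apply: contraTneq h => ->; by rewrite subr0 ltxx.
 have N3 : \forall x \near x0, forall i j, `|'D_(basis i) (fun x => H x 0 j) x| < e.
  apply: (@filter_forall _ _ (fun i x => forall j, `|'D_(basis i) (fun x => H x 0 j) x| < e) (nbhs x0)) => i.
  apply: (@filter_forall _ _ (fun j x => `|'D_(basis i) (fun x => H x 0 j) x| < e) (nbhs x0)) => j.
  have /cvgrPdist_lt/(_ e e0) : {for x0, continuous ('D_(basis i) (fun x => H x 0 j))} by exact: ((sH j 1).2 i).
  by apply: filterS => x; rewrite dH0 sub0r normrN.
 by apply: filterS3 N1 N2 N3.
have contr x y : `|x - x0| < d -> `|y - x0| < d -> `|H x - H y| <= 2^-1 * `|x - y|.
 move=> xd yd; apply: le_trans (lipschitz_ball (e := e) _ xd yd) _ => [z zd j|].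
  have [Vz _ hz] := dP _ zd; split; first exact: (sH j 1).1.
  by move=> i; exact: ltW.
 rewrite ler_wpM2r // /e invfM mulrCA ler_piMr ?invr_ge0 //.
 by rewrite ler_pdivrMr ?ltr_wpDl // mul1r lerDl.
have uC : C \in unitmx by rewrite unitmx_inv.
have expand x y : `|x - x0| < d -> `|y - x0| < d -> `|x - y| <= 2 * `|(F x - F y) *m C|.
 move=> xd yd; have := contr x y xd yd.
 have E : x - y = (H x - H y) + (F x - F y) *m C.
  by rewrite /H mulmxBl; apply/rowP => j; rewrite !(addmxE, oppmxE); ring.
 by have := ler_normD (H x - H y) ((F x - F y) *m C); rewrite -E; lra.
(* The iteration moves away from x0 by at most twice its first step, so the radius d/4 keeps it in
   the ball of radius d/2. *)
pose W := [set y | `|(y - F x0) *m C| < d / 4].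
have d4 : 0 < d / 4 by rewrite divr_gt0.
have solve y : W y -> exists x, `|x - x0| < d / 2 /\ F x = y.
 rewrite /W /= => Wy; pose c := `|(y - F x0) *m C|.
 pose X k := iter k (fun x => H x + y *m C) x0.
 have T x : H x + y *m C - x = (y - F x) *m C.
  by rewrite /H mulmxBl; apply/rowP => j; rewrite !(addmxE, oppmxE); ring.
 have c0 : 0 <= c by exact: normr_ge0.
 have p0 k : 0 < (2^-1 : R) ^+ k by rewrite exprn_gt0 // invr_gt0.
 have near_x0 x k : `|x - x0| <= 2 * c * (1 - 2^-1 ^+ k) -> `|x - x0| < d.
  move=> h; apply: le_lt_trans h _; have := p0 k; have cd : c < d / 4 := Wy; move: c0 cd.
  move: (2^-1 ^+ k) => z; nra.
 have Xb k : `|X k - x0| <= 2 * c * (1 - 2^-1 ^+ k) /\ `|X k.+1 - X k| <= c * 2^-1 ^+ k.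
  elim: k => [|k [IH1 IH2]].
   by split; [rewrite /= subrr normr0 expr0 subrr mulr0|rewrite expr0 mulr1 /= T].
  have h1 : `|X k.+1 - x0| <= 2 * c * (1 - 2^-1 ^+ k.+1).
   by have := ler_normD (X k.+1 - X k) (X k - x0); rewrite addrA subrK exprS; move: IH1 IH2; lra.
  split => //; have -> : X k.+2 - X k.+1 = H (X k.+1) - H (X k).
   by rewrite /X !iterS; apply/rowP => j; rewrite !(addmxE, oppmxE); ring.
  by have := contr _ _ (near_x0 _ _ h1) (near_x0 _ _ IH1); rewrite exprS; move: IH2; lra.
 have lim j : exists l : R, forall k, `|l - X k 0 j| <= 2 * c * 2^-1 ^+ k.
  apply: geometric_cauchy => k; apply: le_trans (Xb k).2.
  by rewrite -oppmxE -addmxE; exact: mx_norm_coord.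
 have [l lP] := choice lim; pose x : 'rV[R]_n := \row_j l j.
 have xX k : `|x - X k| <= 2 * c * 2^-1 ^+ k.
  apply: mx_norm_le => [|j]; last by rewrite addmxE oppmxE mxE; exact: lP.
  by apply: mulr_ge0; [rewrite mulr_ge0|exact: ltW].
 have xd : `|x - x0| < d / 2.
  by have := xX 0%N; rewrite expr0 mulr1 /=; have cd : c < d / 4 := Wy; move: cd; lra.
 exists x; split => //; have xd' : `|x - x0| < d by move: xd d0; lra.
 have fix0 : (y - F x) *m C = 0.
  apply/rowP => j; rewrite [RHS]mxE; apply: (@pow_half_squeeze _ _ (2 * c)) => k.
  apply: le_trans (mx_norm_coord _ j) _; rewrite -T.
  have -> : H x + y *m C - x = (H x - H (X k)) - (x - X k.+1).
   by rewrite /X iterS; apply/rowP => i; rewrite !(addmxE, oppmxE); ring.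
  apply: le_trans (ler_normB _ _) _; have := contr _ _ xd' (near_x0 _ _ (Xb k).1).
  by have := xX k; have := xX k.+1; rewrite exprS; lra.
 by apply/eqP; rewrite eq_sym -subr_eq0; apply/eqP; apply: (can_inj (mulmxK uC)); rewrite mul0mx.
pose G0 y := xget x0 [set x | `|x - x0| < d / 2 /\ F x = y].
have GP y : W y -> `|G0 y - x0| < d / 2 /\ F (G0 y) = y.
 by move=> /solve[x hx]; rewrite /G0; case: xgetP => [z -> //|/(_ x)].
pose U := [set x | `|x - x0| < d / 2] `&` F @^-1` W.
have d2 (x : 'rV[R]_n) : `|x - x0| < d / 2 -> `|x - x0| < d by move: d0; lra.
have oT : open [set: 'rV[R]_n] by exact: openT.
have linC (p : 'rV[R]_n) j : Ck 1 setT (fun x : 'rV[R]_n => ((x - p) *m C) 0 j).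
 rewrite (_ : (fun x => _) = fun x : 'rV[R]_n => \sum_l (x 0 l - p 0 l) * C l j).
  by apply: Ck_sum => // l _; apply: CkM => //; [apply: CkB => //; [exact: Ck_coord|exact: Ck_cst]|exact: Ck_cst].
 by apply/funext => x; rewrite mxE; apply: eq_bigr => l _; rewrite addmxE oppmxE.
have oW : open W.
 have -> : W = (fun y => (y - F x0) *m C) @^-1` [set z | `|z - 0| < d / 4].
  by apply/seteqP; split => y; rewrite /W /= subr0.
 apply: open_comp; last exact: open_norm_ball.
 by move=> y _; apply: differentiable_continuous; apply: differentiable_row => j; exact: (linC (F x0) j).1.
have oU : open U.
 apply: open_preimage_map => //; first exact: open_norm_ball.
 by move=> j; apply: Ck_sub (sF j 0) => x /= /d2/dP[].
have UW x : U x -> `|x - x0| < d /\ W (F x) by move=> [/d2].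
have GF x : U x -> G0 (F x) = x.
 move=> Ux; have [xd WF] := UW _ Ux; have [/d2 gd gF] := GP _ WF.
 apply/eqP; rewrite -subr_eq0 -normr_le0; have := expand _ _ gd xd.
 by rewrite gF subrr mul0mx normr0 mulr0.
have [KC KC0 KCP] := mulmx_norm C.
have lipG y z : W y -> W z -> `|G0 y - G0 z| <= 2 * KC * `|y - z|.
 move=> /GP[/d2 yd yF] /GP[/d2 zd zF]; apply: (le_trans (expand _ _ yd zd)).
 by rewrite yF zF -mulrA ler_pM2l //; exact: KCP.
(* The expansion of F at G(y), multiplied by the inverse Jacobian; the Lipschitz bound on G turns
   its error into one relative to the increment of y. *)
have dG y j : W y -> differentiable (fun y => G0 y 0 j) y /\
  forall i, 'D_(basis i) (fun y => G0 y 0 j) y = invmx (J (G0 y)) i j.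
 move=> Wy; have [/d2 gd gF] := GP _ Wy; have [Vg ug _] := dP _ gd.
 set x := G0 y in gd gF Vg ug *; set I := invmx (J x).
 have [KI KI0 KIP] := mulmx_norm I.
 have D : is_diff y (fun y => G0 y 0 j) (lin_form (fun i => I i j)).
  apply: (@diff_eps _ _ (GRing.Linear.clone _ _ _ _ (lin_form (fun i => I i j)) _)) => [|e1 e10].
   exact: lin_form_continuous.
  pose e2 := e1 / (KI * (2 * KC)); have e20 : 0 < e2 by rewrite divr_gt0 // !mulr_gt0.
  have N1 : \forall k \near (0 : 'rV[R]_n), forall l, `|F (k + x) 0 l - F x 0 l - 'd (fun x => F x 0 l) x k| <= e2 * `|k|.
   apply: (@filter_forall _ _ (fun l k => `|F (k + x) 0 l - F x 0 l - 'd (fun x => F x 0 l) x k| <= e2 * `|k|) (nbhs (0 : 'rV[R]_n))) => l.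
   by apply: diff_epsE => //; exact: (sF l 1).1.
  have N2 : \forall h \near (0 : 'rV[R]_n), W (y + h) by apply: near_shift0; exact: (open_near oW Wy).
  move: N1 N2 => /near0_ball[r1 r10 N1] /near0_ball[r2 r20 N2].
  apply/near0_ball; exists (Num.min r2 (r1 / (2 * KC))); first by rewrite lt_min r20 divr_gt0 // mulr_gt0.
  move=> h; rewrite lt_min => /andP[/N2 Wh hr].
  have [_ gF'] := GP _ Wh; pose k := G0 (y + h) - x.
  have kh : `|k| <= 2 * KC * `|h| by have := lipG _ _ Wh Wy; rewrite [y + h - y]addrC addKr.
  have kr : `|k| < r1.
   by apply: le_lt_trans kh _; rewrite mulrC -ltr_pdivlMr // mulr_gt0.
  have E1 : `|h - k *m J x| <= e2 * `|k|.
   apply: mx_norm_le => [|l]; first by rewrite mulr_ge0 // ltW.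
   have dF : differentiable (fun x => F x 0 l) x by exact: (sF l 1).1.
   have Dk : 'd (fun x => F x 0 l) x k = (k *m J x) 0 l.
    rewrite -(deriveE _ dF) derive_sumE // mxE; apply: eq_bigr => i _; by rewrite [J x i l]mxE.
   have := N1 k kr l; rewrite Dk {1}/k subrK gF' gF [(y + h) 0 l]addmxE addmxE oppmxE.
   by rewrite [y 0 l + _]addrC addrK.
  have E2 : h *m I - k = (h - k *m J x) *m I by rewrite mulmxBl mulmxK.
  have E3 : G0 (h + y) 0 j - G0 y 0 j - lin_form (fun i => I i j) h = - (h *m I - k) 0 j.
   by rewrite addmxE oppmxE /k addmxE oppmxE [h + y]addrC [(h *m I) 0 j]mxE /lin_form -/x; ring.
  suff : `|G0 (h + y) 0 j - G0 y 0 j - lin_form (fun i => I i j) h| <= e1 * `|h| by [].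
  rewrite E3 normrN; apply: le_trans (mx_norm_coord _ j) _; rewrite E2.
  apply: le_trans (KIP _) _; apply: (@le_trans _ _ (KI * (e2 * (2 * KC * `|h|)))).
   by rewrite ler_pM2l //; apply: le_trans E1 _; rewrite ler_pM2l.
  rewrite le_eqVlt; apply/orP; left; apply/eqP; rewrite /e2; field.
  by rewrite !gt_eqF.
 split=> [|i]; first by case: D.
 rewrite deriveE; last by case: D.
 rewrite (@diff_val _ _ _ _ _ _ _ D) /lin_form (bigD1 i) //= mxE !eqxx mul1r big1 ?addr0 // => k ki.
 by rewrite mxE (negbTE ki) andbF mul0r.
exists U, W, G0; split.
- split => //; last by rewrite /W /= subrr mul0mx normr0.
 by split; rewrite /W /= ?subrr ?mul0mx normr0 // divr_gt0.
- by move=> x /UW[/dP[]].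
- by move=> x Ux; split; [have [] := UW _ Ux|exact: GF].
- move=> y Wy; have [h1 h2] := GP _ Wy; split => //; split => //=.
 by rewrite h2.
(* Since the derivative of G is J(G)^-1, regularity of order k of G gives order k + 1. *)
move=> j k; elim: k j => [|k IH] j.
 by move=> y Wy; apply: differentiable_continuous; exact: (dG y j Wy).1.
split=> [y Wy|i]; first exact: (dG y j Wy).1.
apply: (@Ck_ext _ _ _ _ (fun y => invmx (J (G0 y)) i j)) => //; first by move=> y Wy; rewrite (dG y j Wy).2.
apply: Ck_invmx => // [y Wy|a b].
 by have [/d2 gd _] := GP _ Wy; have [] := dP _ gd.
apply: (Ck_comp (W := V) oW oV _ IH (smooth_frechet a b k)) => y Wy.
by have [/d2 gd _] := GP _ Wy; have [] := dP _ gd.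
Qed.

End inverse_function.

(** * Hemisphere coordinates and their rigidity *)

Section hemisphere_frames.
Context {R : realType} {n : nat} {T : topologicalType}.
Variables (M : riem_data R n T).
Hypotheses (n0 : (0 < n)%N) (mM : smooth_manifold M) (rM : riemannian_metric M).
Implicit Types (a b : chart_index M) (p q : T) (x y : 'rV[R]_n) (N : set T).
Local Notation o := (ord00 n0).
Let lm a := chart_local_metric mM rM a.

Definition img_over a N : set 'rV[R]_n := img a `&` inv a @^-1` N.

Lemma img_over_hopen a N : open N -> hopen (img_over a N).
exact: hopen_preimage. Qed.

Lemma img_over_lm a N : open N -> local_metric (img_over a N) (metric a).
by move=> oN; apply: local_metric_sub (lm a) (img_over_hopen a oN) _ => x []. Qed.

Section change.
Variables (a b : chart_index M) (N : set T) (h : T -> R).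
Hypotheses (oN : open N) (sh : smooth_on (img_over b N) (in_chart h b)).
Let D := overlap a b `&` img_over a N.
Let hD : hopen D := hopenI (overlap_hopen mM a b) (img_over_hopen a oN).
Let E := img_over b N.
Let hE : hopen E := img_over_hopen b oN.
Local Notation tau := (transition a b).
Local Notation J := (jac a b).
Let DE y : D y -> E (tau y).
move=> [Oy [Ay Ny]]; split; first exact: transition_img.
by have [_ Db] := (overlapP mM _ _ _).1 Oy; rewrite /= chart_inv.
Qed.
Let sT : smooth_map_on D tau.
by move=> k; apply: smooth_on_sub (transition_smooth mM (b := b) k) => y []. Qed.

Lemma drow_change_over x : D x -> drow (in_chart h a) x = drow (in_chart h b) (tau x) *m (J x)^T.
by move=> Dx; apply: (drow_change_dom mM hD hE _ DE sh Dx) => y []. Qed.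

Lemma smooth_change_over : smooth_on D (in_chart h a).
apply: (smooth_on_ext (f := in_chart h b \o tau)) => [y [Oy _]|]; first by rewrite -in_chart_transition.
exact: smooth_on_comp sT DE sh.
Qed.

(** The Hessian is a tensor: [gam_change] absorbs the derivative of the Jacobian. *)
Lemma trfree_change x : D x ->
 trfree (metric a) (in_chart h a) x = J x *m trfree (metric b) (in_chart h b) (tau x) *m (J x)^T.
move=> Dx; have Ox := Dx.1; have sha := smooth_change_over.
have lmD := local_metric_sub (lm a) hD (fun y Dy => (Dy.2).1).
have lmE := img_over_lm b oN.
have sdE := smooth_drow lmE sh.
have sS : smooth_mx D (fun y => (J y)^T).
 by apply: smooth_mx_tr => i j; apply: smooth_on_sub (smooth_jac mM (a := a) (b := b) i j) => y [].
have sdT : smooth_mx D (fun y => drow (in_chart h b) (tau y)).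
 by move=> i j; exact: smooth_on_comp sT DE (sdE i j).
have dT k : pdmx k (fun y => drow (in_chart h b) (tau y)) x = \sum_l J x k l *: pdmx l (drow (in_chart h b)) (tau x).
 apply/matrixP => i j; rewrite pdmxE summxE; have := pd_comp k hD hE sT DE Dx (sdE i j).
 by rewrite /comp => ->; apply: eq_bigr => l _; rewrite scalemxE pdmxE; congr _; rewrite mxE.
have key k : row k (hessmx (metric a) (in_chart h a) x) = row k (J x *m hessmx (metric b) (in_chart h b) (tau x) *m (J x)^T).
 rewrite (hess_row lmD k sha Dx) (drow_change_over Dx).
 rewrite -(pdmx_ext hD Dx (F := fun y => drow (in_chart h b) (tau y) *m (J y)^T)); first last.
 - by move=> y Dy; rewrite drow_change_over.
 - exact: smooth_mxM.
 have GC := gam_change mM rM k Ox; cbv beta in GC.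
 rewrite (pdmxM hD Dx) // dT GC !row_mul (mulmx_sum_row (row k (J x))).
 have -> : \sum_i (row k (J x)) 0 i *: row i (hessmx (metric b) (in_chart h b) (tau x)) =
   \sum_l J x k l *: pdmx l (drow (in_chart h b)) (tau x) -
   drow (in_chart h b) (tau x) *m \sum_l J x k l *: gam (metric b) l (tau x).
  rewrite mulmx_sumr -sumrB; apply: eq_bigr => l _.
  by rewrite (hess_row lmE l sh (DE Dx)) scalerBr -scalemxAr mxE.
 by rewrite mulmxBl mulmxBr !mulmxA; apply/matrixP => i j; rewrite !(addmxE, oppmxE); ring.
rewrite mulmxDr mulmxDl -scalemxAr -scalemxAl -(metric_change mM rM Ox).
congr (_ + _ *: _); last by rewrite (in_chart_transition mM h Ox).
by apply/row_matrixP => k; rewrite key.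
Qed.

Lemma sph_section_change x : D x -> sph_section (in_chart h a) x =
 sph_section (in_chart h b) (tau x) *m block_mx 1%:M 0 0 (J x)^T.
move=> Dx; rewrite /sph_section mul_row_block mulmx1 !mulmx0 addr0 add0r -drow_change_over //.
by rewrite (in_chart_transition mM h Dx.1).
Qed.

End change.

Lemma parallel_trfree (A : set 'rV[R]_n) g (f : 'rV[R]_n -> R) x : local_metric A g -> smooth_on A f -> A x ->
 (forall k, pdmx k (sph_section f) x = sph_section f x *m sph g k x) -> trfree g f x = 0.
move=> lmA sf Ax H; apply/row_matrixP => k; rewrite row0 linearD /= (hess_row lmA k sf Ax).
have := congr1 rsubmx (H k); rewrite mul_row_block row_mxKr mul_scalar_mx.
have -> : rsubmx (pdmx k (sph_section f) x) = pdmx k (drow f) x.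
 apply/matrixP => i j; rewrite mxE !pdmxE; congr pd; apply/funext => y.
 by rewrite row_mxEr.
have -> : row k (f x *: g x) = f x *: row k (g x) by apply/rowP => j; rewrite !mxE.
by move=> ->; rewrite addrK scalerN addNr.
Qed.

Variable v : T -> R.
Hypothesis sv : smooth_fun M v.
Hypotheses (v_hess : forall a x, img a x -> trfree (metric a) (in_chart v a) x = 0).

Definition pcoord (X : T -> 'rV[R]_n) (i : 'I_n) (p : T) : R := X p 0 i.

(** Its rows are the sections of R + T^*M attached to v and to the components of X. *)
Definition frame a X x : 'M[R]_(1 + n) :=
 col_mx (sph_section (in_chart v a) x) (\matrix_(i, j) sph_section (in_chart (pcoord X i) a) x 0 j).

(* X : N -> R^n such that (v, X) is an isometry of N into the hemisphere; the frame has orthonormal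
  columns for the metric diag(1, g). *)
Record model N (X : T -> 'rV[R]_n) : Prop := Model {
 model_open : open N;
 model_smooth : forall a i, smooth_on (img_over a N) (in_chart (pcoord X i) a);
 model_trfree : forall a i x, img_over a N x -> trfree (metric a) (in_chart (pcoord X i) a) x = 0;
 model_frame : forall a x, img_over a N x -> (frame a X x)^T *m frame a X x = sph_metric (metric a) x }.

Lemma frameEu a X x l j : frame a X x (lshift n l) j = sph_section (in_chart v a) x 0 j.
by rewrite col_mxEu ord1. Qed.

Lemma frameEd a X x i j : frame a X x (rshift 1 i) j = sph_section (in_chart (pcoord X i) a) x 0 j.
by rewrite col_mxEd mxE. Qed.

Lemma row_frame a X x i : row (rshift 1 i) (frame a X x) = sph_section (in_chart (pcoord X i) a) x.
by apply/rowP => j; rewrite mxE frameEd. Qed.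

(** The conditions are tensorial, so one chart covering N suffices to check them. *)
Lemma model_of_chart a N X : open N -> N `<=` dom a ->
 (forall i, smooth_on (img_over a N) (in_chart (pcoord X i) a)) ->
 (forall i x, img_over a N x -> trfree (metric a) (in_chart (pcoord X i) a) x = 0) ->
 (forall x, img_over a N x -> (frame a X x)^T *m frame a X x = sph_metric (metric a) x) -> model N X.
move=> oN Na sX tX fX.
have inD b x : img_over b N x -> (overlap b a `&` img_over b N) x.
 by move=> [Bx Nx]; split => //; apply/(overlapP mM); split => //; exact: Na.
have inA b x : img_over b N x -> img_over a N (transition b a x).
 move=> /inD[Ox [Bx Nx]]; split; first exact: transition_img.
 by have [_ Da] := (overlapP mM _ _ _).1 Ox; rewrite /= chart_inv.
split => //.
- by move=> b i x Bx; have s1 := smooth_change_over (a := b) (sX i); exact (smooth_on_sub (@inD b) s1 Bx).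
- by move=> b i x Bx; rewrite (trfree_change oN (sX i) (inD _ _ Bx)) tX ?mulmx0 ?mul0mx //; exact: inA.
move=> b x Bx; have Dx := inD _ _ Bx; pose Jb := block_mx 1%:M 0 0 (jac b a x)^T : 'M[R]_(1 + n).
have svN : smooth_on (img_over a N) (in_chart v a) by apply: smooth_on_sub (@sv a) => y [].
have -> : frame b X x = frame a X (transition b a x) *m Jb.
 rewrite mul_col_mx -(sph_section_change oN svN Dx); congr col_mx.
 apply/row_matrixP => i; rewrite row_mul; apply/rowP => j.
 rewrite mxE mxE (sph_section_change oN (sX i) Dx); congr ((_ *m _) _ _).
 by apply/rowP => l; rewrite !mxE.
rewrite trmx_mul mulmxA -(mulmxA _ (frame _ _ _)^T) fX; last exact: inA.
rewrite /sph_metric tr_block_mx !mulmx_block !(trmx0, trmx1, mulmx0, mul0mx, addr0, add0r, mulmx1, mul1mx) trmxK.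
by rewrite (metric_change mM rM Dx.1).
Qed.

Section model_theory.
Variables (N : set T) (X : T -> 'rV[R]_n).
Hypothesis mX : model N X.
Let oN := model_open mX.

Lemma smooth_frame a : smooth_mx (img_over a N) (frame a X).
have lmN := img_over_lm a oN.
move=> i j; case: (split_ordP i) => i' ->.
 apply: smooth_on_ext => [y _|]; first by rewrite frameEu.
 by apply: (smooth_sph_section lmN); apply: smooth_on_sub (@sv a) => y [].
apply: smooth_on_ext => [y _|]; first by rewrite frameEd.
by apply: (smooth_sph_section lmN); exact: model_smooth.
Qed.

Lemma frame_parallel a x k : img_over a N x -> pdmx k (frame a X) x = frame a X x *m sph (metric a) k x.
move=> Nx; have lmN := img_over_lm a oN.
have svN : smooth_on (img_over a N) (in_chart v a) by apply: smooth_on_sub (@sv a) => y [].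
have vN y : img_over a N y -> trfree (metric a) (in_chart v a) y = 0 by move=> [Ay _]; exact: v_hess.
apply/matrixP => i j; rewrite pdmxE; case: (split_ordP i) => i' ->.
 have := congr1 (fun Z : matrix _ _ _ => Z 0 j) (sph_section_parallel lmN svN vN k Nx).
 rewrite pdmxE (_ : (fun y => frame a X y (lshift n i') j) = fun y => sph_section (in_chart v a) y 0 j); last first.
  by apply/funext => y; rewrite frameEu.
 by move=> ->; rewrite [LHS]mxE [RHS]mxE; apply: eq_bigr => l _; rewrite frameEu.
have := congr1 (fun Z : matrix _ _ _ => Z 0 j) (sph_section_parallel lmN (@model_smooth _ _ mX a i') (fun y => @model_trfree _ _ mX a i' y) k Nx).
rewrite pdmxE (_ : (fun y => frame a X y (rshift 1 i') j) = fun y => sph_section (in_chart (pcoord X i') a) y 0 j); last first.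
 by apply/funext => y; rewrite frameEd.
by move=> ->; rewrite [LHS]mxE [RHS]mxE; apply: eq_bigr => l _; rewrite frameEd.
Qed.

Lemma frame_orthonormal a x : img_over a N x ->
 frame a X x *m invmx (sph_metric (metric a) x) *m (frame a X x)^T = 1%:M.
move=> Nx; have uP := sph_metric_unit (lm a) Nx.1.
rewrite -mulmxA; apply: mulmx1C; rewrite -mulmxA (model_frame mX Nx); exact: mulVmx.
Qed.

End model_theory.

(** The pairing C of the two frames is locally constant and orthogonal. Both frames have (v, dv) as
    first row, so C is block diagonal with blocks 1 and an orthogonal matrix. *)
Lemma model_rigidity N N' X X' p : model N X -> model N' X' -> N p -> N' p ->
 exists2 O : 'M[R]_n, O *m O^T = 1%:M & \forall p' \near p, X' p' = X p' *m O.
move=> mX mX' Np Np'; have [a Da] := chart_exists mM p.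
have oNN : open (N `&` N') by apply: openI; [exact: model_open mX|exact: model_open mX'].
set q := a @@ p; pose D := img_over a (N `&` N'); have lmD := img_over_lm a oNN.
have Dq : D q by split; [exact: chart_img|rewrite /= chart_inv].
have DN y : D y -> img_over a N y by move=> [? []].
have DN' y : D y -> img_over a N' y by move=> [? []].
have sF : smooth_mx D (frame a X) by move=> i j; apply: smooth_on_sub (smooth_frame mX (a := a) i j); exact: DN.
have sF' : smooth_mx D (frame a X') by move=> i j; apply: smooth_on_sub (smooth_frame mX' (a := a) i j); exact: DN'.
have H := pairing_const n0 lmD sF' sF Dq (fun y k Dy => frame_parallel mX' k (DN' _ Dy)) (fun y k Dy => frame_parallel mX k (DN _ Dy)).
set S := frame a X in sF H; set S' := frame a X' in sF' H.
pose C := S' q *m invmx (sph_metric (metric a) q) *m (S q)^T.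
have SC y : D y -> S' y *m invmx (sph_metric (metric a) y) *m (S y)^T = C -> S' y = C *m S y.
 move=> Dy <-; rewrite -!mulmxA (model_frame mX (DN _ Dy)) mulVmx ?mulmx1 //.
 by have [Ay _] := Dy; have uP := sph_metric_unit (lm a) Ay.
have E0 := SC q Dq erefl.
have CC : C *m C^T = 1%:M.
 have := frame_orthonormal mX' (DN' _ Dq); rewrite -/S' E0 trmx_mul !mulmxA -(mulmxA C) -(mulmxA C).
 by rewrite (frame_orthonormal mX (DN _ Dq)) mulmx1.
have Cu : usubmx C = row_mx 1%:M 0.
 have us y : usubmx (S y) = usubmx (S' y) by rewrite !col_mxKu.
 have h : usubmx C *m S q = row_mx 1%:M 0 *m S q.
  have h0 : usubmx (C *m S q) = usubmx C *m S q by rewrite -{1}[C]vsubmxK mul_col_mx col_mxKu.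
  by rewrite -h0 -E0 -us -{2}[S q]vsubmxK mul_row_col mul1mx mul0mx addr0.
 have := congr1 (fun Z => Z *m (invmx (sph_metric (metric a) q) *m (S q)^T)) h.
 by rewrite -!mulmxA !(mulmxA (S q)) (frame_orthonormal mX (DN _ Dq)) !mulmx1.
pose c := dlsubmx C; pose O := drsubmx C.
have CE : C = block_mx 1%:M 0 c O.
 rewrite -[LHS]submxK; congr block_mx; rewrite /ulsubmx /ursubmx Cu ?row_mxKl ?row_mxKr //.
have OO : c = 0 /\ O *m O^T = 1%:M.
 have h1 := CC; rewrite CE tr_block_mx mulmx_block !(trmx0, trmx1, mulmx0, mul0mx, addr0, add0r, mulmx1, mul1mx) in h1.
 have h2 : block_mx (1%:M : 'M[R]_1) c^T c (c *m c^T + O *m O^T) = block_mx 1%:M 0 0 1%:M.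
  by rewrite h1 scalar_mx_block.
 by have [_ _ c0 h3] := eq_block_mx h2; rewrite c0 mul0mx add0r in h3.
have [c0 OO1] := OO; exists O^T; first by rewrite trmxK; exact: mulmx1C.
have /nbhs_normP[d d0 dP] := H.
have N1 : \forall p' \near p, dom a p' by apply: open_nbhs_nbhs; split => //; exact: chart_open.
have N2 : \forall p' \near p, (N `&` N') p' by apply: open_nbhs_nbhs; split.
have N3 : \forall p' \near p, `|a @@ p' - q| < d.
 by apply: filterS (chart_nbhs mM Da d0) => p' [].
apply: filterS3 N1 N2 N3 => p' Da' NNp' pd; set y := a @@ p'.
have Dy : D y by split; [exact: chart_img|rewrite /= chart_inv].
have := SC y Dy (dP y pd Dy); rewrite CE c0.
move=> /(congr1 (fun Z => dsubmx Z)); rewrite mul_block_col !mul0mx add0r.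
rewrite !col_mxKd => E; apply/rowP => i.
have := congr1 (fun Z : matrix _ _ _ => Z i (lshift n 0)) E.
have secE Z l : sph_section (in_chart (pcoord Z l) a) y 0 (lshift n 0) = Z p' 0 l.
 by rewrite row_mxEl mxE /in_chart /= chart_inv.
rewrite [LHS]mxE secE => ->; rewrite mxE [RHS]mxE; apply: eq_bigr => j _.
have -> : (\matrix_i sph_section (in_chart (pcoord X i) a) y) j (lshift n 0) = X p' 0 j by rewrite mxE.
have OT : (O^T) j i = O i j by rewrite mxE.
nra.
Qed.

End hemisphere_frames.

(** * Local hemisphere coordinates at interior and boundary points *)

Section local_models.
Context {R : realType} {n : nat} {T : topologicalType}.
Variables (M : riem_data R n T) (v : T -> R).
Hypotheses (n0 : (0 < n)%N) (mM : smooth_manifold M) (rM : riemannian_metric M).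
Hypothesis sv : smooth_fun M v.
Implicit Types (a b : chart_index M) (p q : T) (x y z : 'rV[R]_n) (N : set T).
Local Notation o := (ord00 n0).
Local Notation f a := (in_chart v a).
Local Notation i0 := (lshift n (0 : 'I_1)).
Let lm a := chart_local_metric mM rM a.
Hypotheses (v_hess : forall a x, img a x -> trfree (metric a) (f a) x = 0).
Hypotheses (v_energy : forall a x, img a x -> energy (metric a) (f a) x = 1).
Hypotheses (v_ge0 : forall p, 0 <= v p) (v_boundary : forall p, mboundary M p <-> v p = 0).
Hypothesis flat : forall a x j k, img a x -> weyl (metric a) j k x = 0.

Lemma big_ord_1n (F : 'I_(1 + n) -> R) : \sum_i F i = F i0 + \sum_i F (rshift 1 i).
by rewrite big_split_ord big_ord1; congr (F _ + _); apply/val_inj. Qed.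

(** The output of [parallel_frame]. Smoothness is kept on a full ball so that the inverse function
    theorem applies at boundary points too. *)
Record adapted a x0 (d : R) (S : 'rV[R]_n -> 'M[R]_(1 + n)) : Prop := Adapted {
 ad_pos : 0 < d;
 ad_img : forall x, `|x - x0| < d -> halfspace x -> img a x;
 ad_smooth : forall i j, smooth [set x | `|x - x0| < d] (fun x => S x i j);
 ad_parallel : forall x k, img a x -> `|x - x0| < d -> pdmx k S x = S x *m sph (metric a) k x;
 ad_orthonormal : forall x, img a x -> `|x - x0| < d ->
  S x *m invmx (sph_metric (metric a) x) *m (S x)^T = 1%:M;
 ad_first : forall x, img a x -> `|x - x0| < d -> usubmx (S x) = sph_section (f a) x }.

Lemma adapted_exists a x0 : img a x0 -> exists d S, adapted a x0 d S.
move=> Ax; have [d [S [h1 h2 h3 h4 h5]]] := parallel_frame n0 (lm a) (@sv a) (@v_hess a) (@v_energy a) (fun x j k => @flat a x j k) Ax.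
by exists d, S; split => // x Ax' xd; have [] := h5 x Ax' xd.
Qed.

(** The candidate for X: the components along R of all rows but the first. *)
Definition position (S : 'rV[R]_n -> 'M[R]_(1 + n)) x : 'rV[R]_n := \row_i S x (rshift 1 i) i0.

Section adapted_theory.
Variables (a : chart_index M) (x0 : 'rV[R]_n) (d : R) (S : 'rV[R]_n -> 'M[R]_(1 + n)).
Hypothesis aS : adapted a x0 d S.
Let W : set 'rV[R]_n := [set x | `|x - x0| < d].
Let D := img a `&` W.
Let oW : open W := @open_norm_ball _ _ x0 d.
Let hD : hopen D := hopen_open (chart_hopen mM a) oW.

Let extS i j x : D x -> local_ext D (fun y => S y i j) x W (fun y => S y i j).
by move=> [Ax Wx]; split => //; exact: ad_smooth aS i j. Qed.

Lemma ad_smooth_mx : smooth_mx D S.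
by move=> i j; apply/smooth_onP => x Dx; exists W, (fun y => S y i j); exact: extS. Qed.

Lemma ad_gram x : D x -> (S x)^T *m S x = sph_metric (metric a) x.
move=> [Ax Wx]; have uP := sph_metric_unit (lm a) Ax.
have := ad_orthonormal aS Ax Wx; rewrite -mulmxA => /mulmx1C h.
by rewrite -[RHS]mulmx1 -h -mulmxA mulKVmx.
Qed.

Lemma ad_height x : D x -> S x i0 i0 = f a x.
move=> [Ax Wx]; have := congr1 (fun Z : matrix _ _ _ => Z 0 i0) (ad_first aS Ax Wx).
by rewrite [LHS]mxE row_mxEl mxE mulr1n => <-.
Qed.

(** The only nonzero entry of the first column of [sph] is a 1 at index k of the cotangent part, so
    by parallelism the other columns of S are the derivatives of its first column. *)
Lemma ad_pd x i k : D x -> S x i (rshift 1 k) = pd k (fun y => S y i i0) x.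
move=> [Ax Wx]; have := congr1 (fun Z : matrix _ _ _ => Z i i0) (ad_parallel aS k Ax Wx).
rewrite pdmxE => ->; rewrite mxE big_ord_1n block_mxEul [X in _ * X]mxE mulr0 add0r.
rewrite (bigD1 k) //= block_mxEdl mxE !eqxx mulr1 big1 ?addr0 // => l lk.
by rewrite block_mxEdl mxE (negbTE lk) mulr0.
Qed.

Lemma ad_derive x i k : D x -> S x i (rshift 1 k) = 'D_(basis k) (fun y => S y i i0) x.
by move=> Dx; rewrite ad_pd //; exact: (pdE k hD Dx (extS i i0 Dx)). Qed.

Lemma ad_entry x j k : D x -> \sum_i S x i j * S x i k = sph_metric (metric a) x j k.
by move=> Dx; rewrite -ad_gram // mxE; apply: eq_bigr => i _; rewrite [(S x)^T j i]mxE. Qed.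

Lemma ad_sphere x : D x -> f a x ^+ 2 + sqnorm (position S x) = 1.
move=> Dx; have := ad_entry i0 i0 Dx; rewrite block_mxEul mxE mulr1n big_ord_1n.
rewrite ad_height // => <-; congr (_ + _); apply: eq_bigr => i _; by rewrite mxE.
Qed.

Lemma ad_orthogonal x k : D x ->
 f a x * S x i0 (rshift 1 k) + \sum_i position S x 0 i * S x (rshift 1 i) (rshift 1 k) = 0.
move=> Dx; have := ad_entry i0 (rshift 1 k) Dx; rewrite block_mxEur zeromxE big_ord_1n.
rewrite ad_height // => h; rewrite -[RHS]h; congr (_ + _).
by apply: eq_bigr => i _; rewrite [position S x 0 i]mxE.
Qed.

Lemma ad_injective x (c : 'rV[R]_n) : D x -> (forall i, \sum_k c 0 k * S x i (rshift 1 k) = 0) -> c = 0.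
move=> Dx H; have uS : S x \in unitmx.
 by have [] := mulmx1_unit (etrans (mulmxA _ _ _) (ad_orthonormal aS Dx.1 Dx.2)).
have : S x *m (row_mx (0 : 'rV[R]_1) c)^T = 0.
 apply/colP => i; rewrite mxE big_ord_1n [RHS]mxE.
 have -> : (row_mx (0 : 'rV[R]_1) c)^T i0 0 = 0 by rewrite mxE row_mxEl mxE.
 rewrite mulr0 add0r.
 by rewrite -[RHS](H i); apply: eq_bigr => k _; rewrite mxE row_mxEr mulrC.
move=> /(congr1 (mulmx (invmx (S x)))); rewrite mulKmx // mulmx0 => /(congr1 trmx).
by rewrite trmxK => /(congr1 rsubmx); rewrite row_mxKr => ->; apply/rowP => j; rewrite !mxE.
Qed.

Lemma ad_model N (X := fun p => position S (a @@ p)) : open N -> N `<=` dom a ->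
 (forall p, N p -> W (a @@ p)) -> model M v N X.
move=> oN Na NW.
have ND x : img_over a N x -> D x.
 by move=> [Ax /NW]; rewrite (chart_mapK mM Ax); split.
have XE i x : img_over a N x -> S x (rshift 1 i) i0 = in_chart (pcoord X i) a x.
 by move=> [Ax _]; rewrite /in_chart /= /pcoord /X (chart_mapK mM Ax) mxE.
have hN := img_over_hopen mM a oN.
have sX i : smooth_on (img_over a N) (in_chart (pcoord X i) a).
 apply: (smooth_on_ext (@XE i)); apply: smooth_on_sub (ad_smooth_mx (rshift 1 i) i0) => x; exact: ND.
have lmN := img_over_lm mM rM a oN.
have secE i x : img_over a N x -> row (rshift 1 i) (S x) = sph_section (in_chart (pcoord X i) a) x.
 move=> Nx; apply/rowP => j; rewrite mxE; case: (split_ordP j) => j' ->.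
  by rewrite ord1 XE // row_mxEl mxE.
 rewrite row_mxEr [RHS]mxE ad_pd; last exact: ND.
 have sSN : smooth_on (img_over a N) (fun y => S y (rshift 1 i) i0).
  exact: smooth_on_sub (ad_smooth_mx (rshift 1 i) i0) => y; exact: ND.
 exact: (pd_ext hN Nx j' sSN (@XE i)).
have sSN : smooth_mx (img_over a N) S by move=> i j; apply: smooth_on_sub (ad_smooth_mx i j) => y; exact: ND.
apply: (model_of_chart mM rM sv oN Na sX) => [i x Nx|x Nx].
 apply: (parallel_trfree lmN (@sX i) Nx) => k.
 have [Ax Wx] := ND x Nx.
 have sr : smooth_mx (img_over a N) (fun y => row (rshift 1 i) (S y)).
  by move=> i' j; apply: (smooth_on_ext _ (sSN (rshift 1 i) j)) => y _; rewrite mxE.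
 rewrite -(pdmx_ext hN Nx k sr (@secE i)) -(secE i x Nx) -row_mul -(ad_parallel aS k Ax Wx).
 apply/matrixP => i' j; rewrite pdmxE [RHS]mxE pdmxE; congr pd; apply/funext => y; by rewrite mxE.
have -> : frame v a X x = S x; last by apply: ad_gram; exact: ND.
have [Ax Wx] := ND x Nx.
apply/row_matrixP => i; case: (split_ordP i) => i' ->; last by rewrite row_frame secE.
apply/rowP => j; rewrite mxE frameEu -(ad_first aS Ax Wx) ord1 mxE [RHS]mxE.
lra.
Qed.

End adapted_theory.

Lemma adapted_rotate a x0 d S (Q : 'M[R]_n) : adapted a x0 d S -> Q *m Q^T = 1%:M ->
 adapted a x0 d (fun x => block_mx 1%:M 0 0 Q *m S x).
move=> aS QQ; set B := block_mx _ _ _ _.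
have BB : B *m B^T = 1%:M.
 by rewrite tr_block_mx mulmx_block !(trmx0, trmx1, mulmx0, mul0mx, addr0, add0r, mulmx1) QQ -scalar_mx_block.
have hD : hopen (img a `&` [set x | `|x - x0| < d]).
 by apply: hopen_open; [exact: chart_hopen|exact: open_norm_ball].
split.
- exact: ad_pos aS.
- exact: ad_img aS.
- move=> i j k; rewrite (_ : (fun x => _) = fun x => \sum_l B i l * S x l j); last by apply/funext => x; rewrite mxE.
 have oW := @open_norm_ball _ _ x0 d.
 by apply: Ck_sum => // l _; apply: CkM => //; [exact: Ck_cst|exact: (ad_smooth aS)].
- move=> x k Ax Wx; have sS := ad_smooth_mx aS; have Dx : (img a `&` [set x | `|x - x0| < d]) x by [].
 rewrite (pdmxM hD Dx k (smooth_mx_cst B) sS) (pdmx_cst hD Dx) mul0mx add0r (ad_parallel aS k Ax Wx) mulmxA //.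
- move=> x Ax Wx; rewrite trmx_mul !mulmxA -(mulmxA B) -(mulmxA B) (ad_orthonormal aS Ax Wx) mulmx1 //.
- move=> x Ax Wx; rewrite -(ad_first aS Ax Wx) -[S x]vsubmxK mul_block_col col_mxKu col_mxKu.
 by rewrite mul1mx mul0mx addr0.
Qed.

(** Coordinates X near p with an inverse s on the part of the closed ball within r of X(p). At
    boundary points this part is not open in R^n, so the conditions on s are relative to the
    ball. *)
Record local_chart p N (X : T -> 'rV[R]_n) (s : 'rV[R]_n -> T) (r : R) : Prop := LocalChart {
 lc_model : model M v N X;
 lc_pt : N p;
 lc_pos : 0 < r;
 lc_inv : forall p', N p' -> s (X p') = p';
 lc_sec : forall z, unit_ball z -> `|z - X p| < r -> N (s z) /\ X (s z) = z;
 lc_cont : forall z, unit_ball z -> `|z - X p| < r -> forall U, nbhs (s z) U ->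
  \forall z' \near z, unit_ball z' -> U (s z') }.

(** Common to both kinds of points. G inverts a map between Euclidean spaces, and c passes from the
    ball to the target of that map: the identity at interior points, [swap_height] at boundary
    points. *)
Lemma lc_assemble a p d S (U : set 'rV[R]_n) (G c : 'rV[R]_n -> 'rV[R]_n) (r : R) :
 dom a p -> adapted a (a @@ p) d S -> open U -> U (a @@ p) -> 0 < r ->
 (forall x, U x -> `|x - a @@ p| < d) ->
 (forall x, U x -> img a x -> G (c (position S x)) = x) ->
 (forall z, unit_ball z -> `|z - position S (a @@ p)| < r ->
   [/\ U (G (c z)), img a (G (c z)) & position S (G (c z)) = z]) ->
 (forall z, unit_ball z -> `|z - position S (a @@ p)| < r -> forall e : R, 0 < e ->
   \forall z' \near z, unit_ball z' -> `|G (c z') - G (c z)| < e) ->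
 exists N X s r, local_chart p N X s r.
move=> Da aS oU Up r0 UW GcX sec cont.
pose N := dom a `&` [set p' | U (a @@ p')]; pose X p' := position S (a @@ p').
have oN : open N.
 rewrite openE => p' [Da' Up']; apply: filterS (chart_near mM Da' (open_nbhs_nbhs (conj oU Up'))) => p'' [].
 by [].
exists N, X, (fun z => inv a (G (c z))), r; split => //.
- apply: (ad_model aS oN) => [p' []//|p' [_]]; exact: UW.
- by move=> p' [Da' Up']; rewrite GcX //; [exact: chart_inv|exact: chart_img].
- move=> z Kz zr; have [h1 h2 h3] := sec z Kz zr.
 by rewrite /X (chart_mapK mM h2); split => //; split; rewrite /= ?chart_mapK //; exact: chart_dom_inv.
move=> z Kz zr U' nU; have [_ h2 _] := sec z Kz zr.
have [e e0 He] := chart_inv_near mM h2 nU.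
have N1 : \forall z' \near z, `|z' - X p| < r.
 apply/nbhs_normP; exists (r - `|z - X p|); first by lra.
 move=> z' h; have := ler_normD (z' - z) (z - X p); rewrite addrA subrK; move: h; lra.
apply: filterS2 N1 (cont z Kz zr e e0) => z' z'r H Kz'.
by have [_ h2' _] := sec z' Kz' z'r; apply: He => //; exact: H.
Qed.

Lemma inj_unitmx (J : 'M[R]_n) : (forall c : 'rV[R]_n, c *m J = 0 -> c = 0) -> J \in unitmx.
by move=> H; rewrite -row_free_unit; apply: inj_row_free. Qed.

Lemma smooth_cont n' m' (W : set 'rV[R]_n') (G : 'rV[R]_n' -> 'rV[R]_m') (z : 'rV[R]_n') (e : R) :
 (forall j, smooth W (fun w => G w 0 j)) -> W z -> 0 < e -> \forall w \near z, `|G w - G z| < e.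
move=> sG Wz e0; have : {for z, continuous G}.
 by apply: differentiable_continuous; apply: differentiable_row => j; exact: (sG j 1).1.
by move=> /cvgrPdist_lt/(_ e e0); apply: filterS => w; rewrite distrC.
Qed.

Lemma interior_local_chart p : 0 < v p -> exists N X s r, local_chart p N X s r.
move=> vp; have [a Da] := chart_exists mM p; set x0 := a @@ p.
have Ax0 : img a x0 := (chart_img Da).
have [d [S aS]] := adapted_exists Ax0.
have x00 : 0 < x0 0 o.
 apply/(nmboundaryP n0 mM rM Da) => /v_boundary h; by nra.
pose V := [set x | `|x - x0| < d] `&` (fun x => x 0 o) @^-1` [set t | 0 < t].
have oB := @open_norm_ball _ _ x0 d.
have oP : open [set t : R | 0 < t] by [].
have oV : open V := (open_preimage_C0 oB (@Ck_coord R n 0 _ o) oP).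
have Vx0 : V x0 by split => //; rewrite /= subrr normr0; exact: ad_pos aS.
have VA x : V x -> img a x by move=> [Wx xo]; apply: (ad_img aS Wx); apply/halfspaceE; exact: ltW.
have Dx0 : (img a `&` [set x | `|x - x0| < d]) x0 by split => //; case: Vx0.
have posE k : (fun x => position S x 0 k) = fun x => S x (rshift 1 k) i0 by apply/funext => x; rewrite mxE.
have sF j : smooth V (fun x => position S x 0 j).
 by move=> k; rewrite posE; apply: Ck_sub (ad_smooth aS (rshift 1 j) i0 k) => x [].
have uJ : frechet_mx (position S) x0 \in unitmx.
 apply: inj_unitmx => c cJ.
 have cX k : \sum_i c 0 i * S x0 (rshift 1 k) (rshift 1 i) = 0.
  have := congr1 (fun Z : matrix _ _ _ => Z 0 k) cJ; rewrite mxE [RHS]mxE => h; rewrite -[RHS]h.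
  apply: eq_bigr => i _; congr (_ * _); rewrite [RHS]mxE posE; exact: (ad_derive aS).
 (* A vector killed by every dX_i is killed by f df = - sum X_i dX_i, and f > 0. *)
 have cf : \sum_i c 0 i * S x0 i0 (rshift 1 i) = 0.
  have fx : f a x0 != 0 by rewrite /in_chart /= (chart_inv mM Da) gt_eqF.
  apply: (mulfI fx); rewrite mulr0 mulr_sumr.
  rewrite (eq_bigr (fun i => c 0 i * - \sum_k position S x0 0 k * S x0 (rshift 1 k) (rshift 1 i))); last first.
   move=> i _; rewrite mulrCA; congr (_ * _); apply/eqP; rewrite -subr_eq0 opprK; apply/eqP.
   exact: (ad_orthogonal aS).
  rewrite (eq_bigr (fun i => \sum_k - position S x0 0 k * (c 0 i * S x0 (rshift 1 k) (rshift 1 i)))); last first.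
   by move=> i _; rewrite mulrN mulr_sumr -sumrN; apply: eq_bigr => k _; ring.
  by rewrite exchange_big big1 //= => k _; rewrite -mulr_sumr cX mulr0.
 apply: (ad_injective aS Dx0) => i; case: (split_ordP i) => i' -> //.
 by rewrite -[RHS]cf; apply: eq_bigr => k _; congr (_ * S _ _ _); apply/val_inj; rewrite ord1.
have [U [W [G [[oU oW Ux0 Wx0] UV UG WG sG]]]] := inverse_function oV Vx0 sF uJ.
have /nbhs_normP[r r0 Wr] : \forall y \near position S x0, W y by exact: open_nbhs_nbhs.
apply: (@lc_assemble a p d S U G id r) => //.
- by move=> x /UV[].
- by move=> x Ux _; have [] := UG x Ux.
- by move=> z Kz /Wr/WG[h1 h2]; split => //; apply: VA; exact: UV.
by move=> z Kz /Wr Wz e e0; apply: filterS (smooth_cont sG Wz e0).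
Qed.

Lemma mvt_direction (phi : 'rV[R]_n -> R) x h :
 (forall s : R, 0 <= s <= 1 -> differentiable phi (x + s *: h)) ->
 exists2 s : R, 0 <= s <= 1 & phi (x + h) - phi x = 'D_h phi (x + s *: h).
move=> dphi; have D (s : R) : Num.min 0 1 <= s <= Num.max 0 1 ->
  is_derive s 1 (fun s => phi (x + s *: h)) ('D_h phi (x + s *: h)).
 by rewrite min_l // max_r // => sI; apply: is_derive_line; exact: dphi.
have [s] := MVT_unordered D; rewrite min_l // max_r // subr0 mulr1 scale1r scale0r addr0 => sI E.
by exists s.
Qed.

Lemma boundary_slope a p d S : dom a p -> v p = 0 -> adapted a (a @@ p) d S ->
 0 < S (a @@ p) i0 (rshift 1 o).
move=> Da vp aS; set x0 := a @@ p; have Ax0 : img a x0 by exact: chart_img.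
pose D := img a `&` [set x | `|x - x0| < d].
have Dx0 : D x0 by split => //; rewrite /= subrr normr0; exact: ad_pos aS.
have hD : hopen D by apply: hopen_open; [exact: chart_hopen|exact: open_norm_ball].
have sD : smooth_on D (f a) by apply: smooth_on_sub (@sv a) => x [].
rewrite (ad_pd aS _ _ Dx0) -(pd_ext hD Dx0 o sD (fun x Dx => esym (ad_height aS Dx))).
by have [_] := boundary_gradient n0 mM sv v_energy v_ge0 Da vp.
Qed.

Lemma ord0P (j : 'I_n) : (j == 0%N :> nat) = (j == o).
by []. Qed.

Lemma swap_heightE z j : swap_height z 0 j = if j == o then Num.sqrt (1 - sqnorm z) else z 0 j.
by rewrite mxE. Qed.

Lemma swap_height_cont z (e : R) : 0 < e -> \forall w \near z, `|swap_height w - swap_height z| < e.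
move=> e0.
have csq : {for z, continuous (fun w : 'rV[R]_n => Num.sqrt (1 - sqnorm w))}.
 apply: (continuous_comp (f := fun w : 'rV[R]_n => 1 - sqnorm w)); last exact: sqrt_continuous.
 have oT : open [set: 'rV[R]_n] by exact: openT.
 apply: differentiable_continuous; apply: (_ : Ck 1 setT (fun w : 'rV[R]_n => 1 - sqnorm w)).1 => //.
 apply: CkB => //; first exact: Ck_cst.
 by apply: Ck_sum => // i _; rewrite (_ : (fun w => _) = fun w : 'rV[R]_n => w 0 i * w 0 i); [apply: CkM => //; exact: Ck_coord|apply/funext => w; rewrite expr2].
move: csq => /cvgrPdist_lt/(_ e e0) N1.
have N2 : \forall w \near z, `|w - z| < e by apply/nbhs_normP; exists e.
apply: filterS2 N1 N2 => w h1 h2; apply: mx_norm_lt => // j.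
rewrite addmxE oppmxE 2!swap_heightE; case: ifP => _; first by rewrite distrC.
by apply: le_lt_trans h2; have := mx_norm_coord (w - z) j; rewrite addmxE oppmxE.
Qed.

Lemma sqnorm_split z : sqnorm z = z 0 o ^+ 2 + \sum_(j | j != o) z 0 j ^+ 2.
by rewrite /sqnorm (bigD1 o). Qed.

Lemma sqnorm_basis : sqnorm (basis o : 'rV[R]_n) = 1.
rewrite sqnorm_split mxE !eqxx expr1n big1 ?addr0 // => j jo; by rewrite mxE (negbTE jo) andbF expr0n.
Qed.

Lemma sqnorm_mul z : (z *m z^T) 0 0 = sqnorm z.
by rewrite mxE; apply: eq_bigr => j _; rewrite mxE expr2. Qed.

(* On the boundary v and all but one of the X_i are coordinates. *)
Lemma boundary_local_chart p : v p = 0 -> exists N X s r, local_chart p N X s r.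
move=> vp; have [a Da] := chart_exists mM p; set x0 := a @@ p.
have Ax0 : img a x0 by exact: (chart_img Da).
have [d [S1 aS1]] := adapted_exists Ax0.
have d0 := ad_pos aS1.
have Dx0 : (img a `&` [set x | `|x - x0| < d]) x0 by split => //; rewrite /= subrr normr0.
have x00 : x0 0 o = 0 by apply/(mboundaryP n0 mM rM Da)/v_boundary.
have f0 : f a x0 = 0 by rewrite /in_chart /= (chart_inv mM Da).
have u1 : (position S1 x0 *m (position S1 x0)^T) 0 0 = 1.
 by rewrite sqnorm_mul; have := ad_sphere aS1 Dx0; rewrite f0 expr0n add0r.
have w1 : (basis o *m (basis o : 'rV[R]_n)^T) 0 0 = 1 by rewrite sqnorm_mul sqnorm_basis.
(* The frame is rotated so that X(p) is the first basis vector; X_o is then the coordinate traded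
   for v. *)
have [H [HH uH]] := reflection_exists u1 w1.
have QQ : H^T *m (H^T)^T = 1%:M by rewrite trmxK; exact: mulmx1C.
have aS := adapted_rotate aS1 QQ; set S := fun x => _ in aS.
have pos x : position S x = position S1 x *m H.
 apply/rowP => i; rewrite mxE /S -{1}[S1 x]vsubmxK mul_block_col col_mxEd mul0mx add0r mxE [RHS]mxE.
 by apply: eq_bigr => k _; rewrite mxE [position S1 x 0 k]mxE [dsubmx _ _ _]mxE mulrC.
have pos0 : position S x0 = basis o by rewrite pos.
have slp := boundary_slope Da vp aS.
pose phi x := S x i0 i0.
have oB := @open_norm_ball _ _ x0 d.
have posE k : (fun x => position S x 0 k) = fun x => S x (rshift 1 k) i0 by apply/funext => x; rewrite mxE.
have sphi : smooth [set x | `|x - x0| < d] phi by exact: (ad_smooth aS).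
have spos k : smooth [set x | `|x - x0| < d] (fun x => position S x 0 k) by rewrite posE; exact: (ad_smooth aS).
have /nbhs_normP[d' d'0 dP] : \forall x \near x0, [/\ `|x - x0| < d, 0 < 'D_(basis o) phi x & 0 < position S x 0 o].
 have N1 : \forall x \near x0, `|x - x0| < d by apply/nbhs_normP; exists d.
 have N2 : \forall x \near x0, 0 < 'D_(basis o) phi x.
  have c1 : {for x0, continuous ('D_(basis o) phi)} by exact: ((sphi 1).2 o x0 Dx0.2).
  have slp' : 0 < 'D_(basis o) phi x0 by rewrite -(ad_derive aS i0 o Dx0).
  by move: c1 => /cvgrPdist_lt/(_ _ slp'); apply: filterS => x; rewrite ltr_distl => /andP[_]; lra.
 have N3 : \forall x \near x0, 0 < position S x 0 o.
  have c1 : {for x0, continuous (fun x => position S x 0 o)} by exact: (spos o 0 x0 Dx0.2).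
  have p1 : 0 < position S x0 0 o by rewrite pos0 mxE !eqxx.
  by move: c1 => /cvgrPdist_lt/(_ _ p1); apply: filterS => x; rewrite ltr_distl => /andP[_]; lra.
 by apply: filterS3 N1 N2 N3.
pose V := [set x : 'rV[R]_n | `|x - x0| < d'].
have oV : open V := @open_norm_ball _ _ x0 d'.
have VW x : V x -> `|x - x0| < d by move=> /dP[].
have Vx0 : V x0 by rewrite /V /= subrr normr0.
pose F x : 'rV[R]_n := \row_j if j == o then phi x else position S x 0 j.
have FE j : (fun x => F x 0 j) = if j == o then phi else fun x => position S x 0 j.
 by apply/funext => x; rewrite mxE; case: ifP.
have sF j : smooth V (fun x => F x 0 j).
 move=> k; rewrite FE; case: ifP => _; [exact: Ck_sub (sphi k)|exact: Ck_sub (spos j k)].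
have uJ : frechet_mx F x0 \in unitmx.
 apply: inj_unitmx => c cJ.
 have cJj j : \sum_i c 0 i * S x0 (if j == o then i0 else rshift 1 j) (rshift 1 i) = 0.
  have := congr1 (fun Z : matrix _ _ _ => Z 0 j) cJ; rewrite mxE [RHS]mxE => h; rewrite -[RHS]h.
  apply: eq_bigr => i _; congr (_ * _); rewrite [RHS]mxE FE; case: ifP => _; first exact: (ad_derive aS).
  by rewrite posE; exact: (ad_derive aS).
 (* As f = 0 and X is the basis vector o at x0, the orthogonality relation reads dX_o = 0. A vector
    killed by df and by the other dX_i is then killed by the whole frame. *)
 have Xo k : S x0 (rshift 1 o) (rshift 1 k) = 0.
  have h := ad_orthogonal aS k Dx0; rewrite f0 mul0r add0r pos0 (bigD1 o) //= in h.
  rewrite [X in X * _ + _]mxE !eqxx mul1r big1 ?addr0 in h => // i io; by rewrite mxE (negbTE io) andbF mul0r.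
 apply: (ad_injective aS Dx0) => i; case: (split_ordP i) => i' ->.
  by have := cJj o; rewrite eqxx ord1.
 case: (eqVneq i' o) => [->|io]; first by rewrite big1 // => k _; rewrite Xo mulr0.
 by have := cJj i'; rewrite (negbTE io).
have [U [W [G [[oU oW Ux0 Wx0] UV UG WG sG]]]] := inverse_function oV Vx0 sF uJ.
have swapF x : V x -> img a x -> swap_height (position S x) = F x.
 move=> Vx Ax; have Dx : (img a `&` [set x | `|x - x0| < d]) x by split => //; exact: VW.
 apply/rowP => j; rewrite swap_heightE [RHS]mxE; case: ifP => // _.
 have := ad_sphere aS Dx => /(canRL (addrK _)) <-.
 have ph : phi x = f a x := ad_height aS Dx.
 by rewrite sqrtr_sqr ger0_norm ?ph // /in_chart /=.
have [e0 e00 He] : exists2 e : R, 0 < e & forall y, `|y - F x0| < e -> W y.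
 by have /nbhs_normP[e e00 He] := open_nbhs_nbhs (conj oW Wx0); exists e.
have N1 := swap_height_cont (position S x0) e00.
have /nbhs_normP[r1 r10 Hr] := N1.
pose r := Num.min r1 1; have r0 : 0 < r by rewrite lt_min r10 ltr01.
have zW z : `|z - position S x0| < r -> W (swap_height z) /\ 0 < z 0 o.
 rewrite lt_min => /andP[h1 h2]; split; first by apply: He; rewrite -(swapF x0 Vx0 Ax0); exact: Hr.
 have := le_lt_trans (mx_norm_coord _ o) h2; rewrite pos0 addmxE oppmxE [basis o 0 o]mxE !eqxx /=.
 by rewrite ltr_distl => /andP[]; lra.
(* phi vanishes on the boundary and increases in the first coordinate, so it is negative outside the
   half-space. *)
have inhalf x : V x -> 0 <= phi x -> 0 <= x 0 o.
 move=> Vx px; rewrite leNgt; apply/negP => xo.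
 have seg (s : R) : 0 <= s <= 1 -> V (x + s *: (- x 0 o *: basis o)).
  move=> /andP[s0 s1]; apply: mx_norm_lt => // j; rewrite addmxE oppmxE addmxE scalemxE scalemxE.
  have hj := mx_norm_coord (x - x0) j; rewrite addmxE oppmxE in hj.
  rewrite mxE eqxx /=; case: (eqVneq j o) => [jo|_]; last first.
   by rewrite !mulr0 addr0; apply: le_lt_trans Vx.
  have := le_lt_trans hj Vx; rewrite jo x00 mulr1 !subr0 !ltr_norml => /andP[h1 h2].
  by apply/andP; split; nra.
 have dphi (s : R) : 0 <= s <= 1 -> differentiable phi (x + s *: (- x 0 o *: basis o)).
  by move=> sI; exact ((sphi 1).1 _ (VW _ (seg s sI))).
 have [s sI] := mvt_direction dphi.
 have I1 : 0 <= (1 : R) <= 1 by rewrite ler01 lexx.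
 have V1 := seg 1 I1; rewrite scale1r in V1.
 have x10 : (x + - x 0 o *: basis o) 0 o = 0 by rewrite addmxE scalemxE mxE !eqxx mulr1 subrr.
 have A1 : img a (x + - x 0 o *: basis o).
  by apply: (ad_img aS (VW _ V1)); apply/(halfspaceE n0); rewrite x10.
 have D1 : (img a `&` [set x | `|x - x0| < d]) (x + - x 0 o *: basis o) by split => //; exact: VW.
 have -> : phi (x + - x 0 o *: basis o) = 0.
  rewrite /phi (ad_height aS D1) /in_chart /=; apply/v_boundary.
  by apply/(mboundaryP n0 mM rM (chart_dom_inv mM A1)); rewrite (chart_mapK mM A1).
 have dp := dphi s sI; rewrite deriveE // linearZ /= -deriveE // => E; have [_ Dp _] := dP _ (seg s sI).
 have {}E : 0 - phi x = - x 0 o * 'D_(basis o) phi (x + s *: (- x 0 o *: basis o)) by exact: E.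
 have xo' : 0 < - x 0 o by rewrite oppr_gt0.
 by have := mulr_gt0 xo' Dp; rewrite -E; lra.
have LC := @lc_assemble a p d S U G (@swap_height R n) r Da aS oU Ux0 r0.
apply: LC.
- by move=> x /UV/VW.
- by move=> x Ux Ax; rewrite swapF //; [have [] := UG x Ux|exact: UV].
- move=> z Kz /zW[Wz zo]; have [Ux FG] := WG _ Wz; set x := G _ in Ux FG *.
 have Vx := UV _ Ux.
 have phiz : phi x = Num.sqrt (1 - sqnorm z).
  by have := congr1 (fun Z : matrix _ _ _ => Z 0 o) FG; rewrite mxE swap_heightE eqxx.
 have posz j : j != o -> position S x 0 j = z 0 j.
  move=> jo; have := congr1 (fun Z : matrix _ _ _ => Z 0 j) FG; by rewrite mxE swap_heightE (negbTE jo).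
 have Ax : img a x.
  apply: (ad_img aS (VW _ Vx)); apply/(halfspaceE n0); apply: inhalf => //; rewrite phiz; exact: sqrtr_ge0.
 split => //; apply/rowP => j; case: (eqVneq j o) => [->|/posz//].
 have Dx : (img a `&` [set x | `|x - x0| < d]) x by split => //; exact: VW.
 (* The remaining coordinate is determined by the sphere equation and its positive sign. *)
 have [_ _ pp] := dP x Vx.
 have := ad_sphere aS Dx; rewrite -(ad_height aS Dx) -/(phi x) phiz sqr_sqrtr; last by rewrite subr_ge0.
 have e1 : \sum_(j | j != o) position S x 0 j ^+ 2 = \sum_(j | j != o) z 0 j ^+ 2.
  by apply: eq_bigr => i io; rewrite posz.
 rewrite (sqnorm_split z) (sqnorm_split (position S x)) e1 => E.
 apply: sqr_ge0_inj; [exact: ltW|exact: ltW|by move: E; lra].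
move=> z Kz /zW[Wz _] e ee0; have [h1 h1P] : exists2 e1 : R, 0 < e1 & forall y, `|y - swap_height z| < e1 -> `|G y - G (swap_height z)| < e.
 by have /nbhs_normP[e1 e10 H1] := smooth_cont sG Wz ee0; exists e1.
move=> Hy; apply: filterS (swap_height_cont z h1P) => w hw _; exact: Hy.
Qed.

Lemma local_chart_exists p : exists N X s r, local_chart p N X s r.
have := v_ge0 p; rewrite le_eqVlt => /orP[/eqP/esym|]; [exact: boundary_local_chart|exact: interior_local_chart].
Qed.

End local_models.

(** * Orthogonal matrices and the closed unit ball *)

Section orthogonal.
Context {R : realType} {n : nat}.
Implicit Types (z w : 'rV[R]_n) (O : 'M[R]_n).

Definition orth O := O *m O^T = 1%:M.

Lemma sqnorm_orth O z : orth O -> sqnorm (z *m O) = sqnorm z.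
by move=> OO; rewrite -!sqnorm_mul trmx_mul mulmxA -(mulmxA z) OO mulmx1. Qed.

Lemma orth_ball O z : orth O -> unit_ball z -> unit_ball (z *m O).
by move=> OO; rewrite /unit_ball /= sqnorm_orth. Qed.

Lemma orthM O O' : orth O -> orth O' -> orth (O *m O').
by rewrite /orth => h h'; rewrite trmx_mul mulmxA -(mulmxA O) h' mulmx1. Qed.

Lemma orthT O : orth O -> orth O^T.
by rewrite /orth trmxK; exact: mulmx1C. Qed.

Lemma orthK O z : orth O -> z *m O *m O^T = z.
by move=> h; rewrite -mulmxA h mulmx1. Qed.

Lemma orthKT O z : orth O -> z *m O^T *m O = z.
by move=> h; rewrite -mulmxA (mulmx1C h) mulmx1. Qed.

Lemma orth_norm O z : orth O -> `|z *m O| <= n%:R * `|z|.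
move=> OO; apply: mx_norm_le => [|j] //.
rewrite -[`|z|]mulr1; apply: mulmx_bound => // [i|i k]; first exact: mx_norm_coord.
have := congr1 (fun Z : matrix _ _ _ => Z i i) OO; rewrite mxE [RHS]mxE eqxx => h.
have : O i k ^+ 2 <= 1.
 rewrite -[X in _ <= X]h (bigD1 k) //= mxE lerDl; apply: sumr_ge0 => l _; rewrite mxE; exact: sqr_ge0.
by rewrite -real_normK ?num_real // expr_le1.
Qed.

Lemma mul_near O z (U : set 'rV[R]_n) : nbhs (z *m O) U -> \forall w \near z, U (w *m O).
move=> /nbhs_normP[d d0 H]; have [K K0 KP] := mulmx_norm O.
apply/nbhs_normP; exists (d / K); first by rewrite divr_gt0.
move=> w wz; apply: H; rewrite -mulmxBl; apply: le_lt_trans (KP _) _.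
by rewrite mulrC -ltr_pdivlMr.
Qed.

Lemma unit_ball_convex y z (t : R) : unit_ball y -> unit_ball z -> 0 <= t <= 1 -> unit_ball (y + t *: (z - y)).
rewrite /unit_ball /= => Ky Kz /andP[t0 t1].
have : sqnorm (y + t *: (z - y)) <= (1 - t) * sqnorm y + t * sqnorm z.
 rewrite !mulr_sumr -big_split /=; apply: ler_sum => i _; rewrite addmxE scalemxE addmxE oppmxE.
 have : 0 <= t * (1 - t) * (z 0 i - y 0 i) ^+ 2 by rewrite mulr_ge0 ?sqr_ge0 // mulr_ge0 // subr_ge0.
 nra.
nra.
Qed.

Lemma unit_ball_norm z : unit_ball z -> `|z| <= 1.
rewrite /= => Kz; apply: mx_norm_le => // j.
have : z 0 j ^+ 2 <= 1.
 by apply: le_trans Kz; rewrite /sqnorm (bigD1 j) //= lerDl; apply: sumr_ge0 => i _; exact: sqr_ge0.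
by rewrite -real_normK ?num_real // expr_le1.
Qed.

Lemma unit_ball0 : unit_ball (0 : 'rV[R]_n).
by have := @origin_in_unit_ball R n; rewrite inE. Qed.

(** A relative neighbourhood of y contains a short piece of the segment from y to each u of the
    ball, so A and B agree on the ball, which contains the basis vectors. *)
Lemma linear_germ y (A B : 'M[R]_n) : unit_ball y ->
 (\forall w \near y, unit_ball w -> w *m A = w *m B) -> A = B.
move=> Ky H; have yE := nbhs_singleton H Ky.
have uE u : unit_ball u -> u *m A = u *m B.
 move=> Ku; have /nbhs_normP[d d0 dP] := H.
 pose t := Num.min 1 (d / (`|u - y| + 1)) / 2.
 have m0 : 0 < Num.min 1 (d / (`|u - y| + 1)) by rewrite lt_min ltr01 divr_gt0.
 have t0 : 0 < t by rewrite divr_gt0.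
 have tm : t < Num.min 1 (d / (`|u - y| + 1)) by rewrite /t; lra.
 have [t1 td] : t < 1 /\ t < d / (`|u - y| + 1) by move: tm; rewrite lt_min => /andP[].
 have hd : `|y + t *: (u - y) - y| < d.
  have -> : y + t *: (u - y) - y = t *: (u - y) by rewrite addrC addKr.
  rewrite normrZ gtr0_norm //.
  by apply: le_lt_trans (_ : t * (`|u - y| + 1) < d); [rewrite ler_pM2l // lerDl|rewrite -ltr_pdivlMr].
 have E : (y + t *: (u - y)) *m A = (y + t *: (u - y)) *m B.
  by apply: (dP _ hd); apply: unit_ball_convex => //; rewrite !ltW.
 move: E; rewrite !mulmxDl yE => /addrI; rewrite -!scalemxAl => /(scalerI (lt0r_neq0 t0)).
 by rewrite !mulmxDl !mulNmx yE => /addIr.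
apply/row_matrixP => i; rewrite !rowE; apply: uE.
rewrite /unit_ball /= /sqnorm (bigD1 i) //= mxE !eqxx expr1n big1 // => j ji.
by rewrite mxE (negbTE ji) expr0n.
Qed.

Lemma compact_unit_ball : compact [set z : 'rV[R]_n | unit_ball z].
have cl : closed [set z : 'rV[R]_n | unit_ball z].
 have oT : open [set: 'rV[R]_n] by exact: openT.
 apply: (@closed_comp _ _ (@sqnorm R n) [set t : R | t <= 1]) => //.
 move=> z _; apply: differentiable_continuous.
 apply: (_ : Ck 1 setT (@sqnorm R n)).1 => //.
 apply: Ck_sum => // i _; rewrite (_ : (fun z => _) = fun w : 'rV[R]_n => w 0 i * w 0 i).
  by apply: CkM => //; exact: Ck_coord.
 by [].
apply: (subclosed_compact cl (@compact_normball R n 0 1)) => z; rewrite /= subr0; exact: unit_ball_norm.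
Qed.

End orthogonal.

(** * Developing the ball onto M *)

Section developing.
Context {R : realType} {n : nat} {T : topologicalType}.
Variables (M : riem_data R n T) (v : T -> R).
Hypotheses (n0 : (0 < n)%N) (mM : smooth_manifold M) (rM : riemannian_metric M).
Hypothesis sv : smooth_fun M v.
Implicit Types (a b : chart_index M) (p q : T) (w z : 'rV[R]_n) (N : set T) (psi : 'rV[R]_n -> T).
Hypotheses (v_hess : forall a x, cimage (charts a) x -> trfree (metric a) (in_chart v a) x = 0).
Hypothesis lcE : forall p, exists N X s r, local_chart M v p N X s r.
Hypothesis compT : compact [set: T].
Hypothesis clopenT : forall D : set T, open D -> closed D -> D !=set0 -> forall p, D p.
Let hausT : hausdorff_space T. Proof. by case: mM. Qed.
Local Notation LC := (local_chart M v).
Local Notation K := (@unit_ball R n).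

Lemma model_sphere N X p : model M v N X -> N p -> v p ^+ 2 + sqnorm (X p) = 1.
move=> mX Np; have [a Da] := chart_exists mM p; set x := cmap (charts a) p.
have Nx : img_over a N x by split; [exact: chart_img|rewrite /= chart_inv].
have := congr1 (fun Z : matrix _ _ _ => Z (lshift n 0) (lshift n 0)) (model_frame mX Nx).
rewrite block_mxEul mxE big_ord_1n => /eqP; rewrite [X in _ == X]mxE mulr1n => /eqP <-.
have E h : sph_section (in_chart h a) x 0 (lshift n 0) = h p.
 by rewrite row_mxEl mxE /in_chart /= chart_inv.
rewrite [_^T _ _]mxE frameEu E; congr (_ + _); apply: eq_bigr => i _.
by rewrite [_^T _ _]mxE frameEd E.
Qed.

Lemma model_ball N X p : model M v N X -> N p -> K (X p).
by move=> mX Np; rewrite /unit_ball /= -(model_sphere mX Np) lerDr sqr_ge0. Qed.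

Lemma model_continuous N X p : model M v N X -> N p -> forall e : R, 0 < e -> \forall q \near p, `|X q - X p| < e.
move=> mX Np e e0; have [a Da] := chart_exists mM p; set x := cmap (charts a) p.
have Nx : img_over a N x by split; [exact: chart_img|rewrite /= chart_inv].
have H : \forall q \near p, forall i, `|X q 0 i - X p 0 i| < e.
 apply: filter_forall => i.
 have sX : smooth_on (img_over a N) (in_chart (pcoord X i) a) by exact: (@model_smooth _ _ _ _ _ _ _ mX a i).
 have [d d0 dP] := smooth_on_cont sX Nx e0.
 have N1 : \forall q \near p, N q by apply: open_nbhs_nbhs; split => //; exact: model_open mX.
 apply: filterS2 N1 (chart_nbhs mM Da d0) => q Nq [Dq qd].
 have Nq' : img_over a N (cmap (charts a) q) by split; [exact: chart_img|rewrite /= chart_inv].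
 by have := dP _ Nq' qd; rewrite /in_chart /= (chart_inv mM Da) chart_inv.
by apply: filterS H => q H; apply: mx_norm_lt => // i; rewrite addmxE oppmxE; exact: H.
Qed.

Lemma lc_recenter p q N X s r : LC p N X s r -> N q -> `|X q - X p| < r -> LC q N X s (r - `|X q - X p|).
move=> L Nq qr.
have tri z : `|z - X q| < r - `|X q - X p| -> `|z - X p| < r.
 by move=> h; have := ler_normD (z - X q) (X q - X p); rewrite addrA subrK; move: h; lra.
split => //; [exact: lc_model L|by lra|exact: lc_inv L| |].
 by move=> z Kz /tri; exact: lc_sec L z Kz.
by move=> z Kz /tri zr; exact: lc_cont L z Kz zr.
Qed.

Lemma lc_near p N X s r : LC p N X s r -> \forall q \near p, N q.
by move=> L; apply: open_nbhs_nbhs; split; [exact: model_open (lc_model L)|exact: lc_pt L]. Qed.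

(* psi is, near z in the ball, a local inverse of hemisphere coordinates. *)
Definition germ z psi := exists N X s r Q, [/\ LC (psi z) N X s r, orth Q &
 \forall w \near z, K w -> N (psi w) /\ X (psi w) = w *m Q].

Lemma germ_near z psi : germ z psi -> K z -> exists N X s r Q, [/\ LC (psi z) N X s r, orth Q,
 X (psi z) = z *m Q & \forall w \near z, K w -> [/\ N (psi w), X (psi w) = w *m Q & psi w = s (w *m Q)]].
move=> [N [X [s [r [Q [L QQ H]]]]]] Kz; exists N, X, s, r, Q; split => //.
 by have [] := nbhs_singleton H Kz.
by apply: filterS H => w H Kw; have [h1 h2] := H Kw; rewrite -h2 (lc_inv L).
Qed.

Lemma germ_cont z psi U : germ z psi -> K z -> nbhs (psi z) U -> \forall w \near z, K w -> U (psi w).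
move=> g Kz nU; have [N [X [s [r [Q [L QQ zQ H]]]]]] := germ_near g Kz.
have sz : s (z *m Q) = psi z by rewrite -zQ (lc_inv L) //; exact: lc_pt L.
have c0 : `|z *m Q - X (psi z)| < r by rewrite zQ subrr normr0; exact: lc_pos L.
have := lc_cont L (orth_ball QQ Kz) c0; rewrite sz => /(_ U nU)/mul_near.
by apply: filterS2 H => w H1 H2 Kw; have [_ _ ->] := H1 Kw; apply: H2; exact: orth_ball.
Qed.

(** By [model_rigidity] the coordinates of any local chart around psi(z) differ from those of the
    germ by an orthogonal matrix. *)
Lemma germ_any z psi p N X s r : germ z psi -> K z -> LC p N X s r -> N (psi z) ->
 exists2 Q, orth Q & \forall w \near z, K w -> N (psi w) /\ X (psi w) = w *m Q.
move=> g Kz L Np; have [N1 [X1 [s1 [r1 [Q1 [L1 QQ1 _ H]]]]]] := germ_near g Kz.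
have [Q QQ HQ] := model_rigidity n0 mM rM sv v_hess (lc_model L1) (lc_model L) (lc_pt L1) Np.
have oN : nbhs (psi z) N by apply: open_nbhs_nbhs; split => //; exact: model_open (lc_model L).
exists (Q1 *m Q); first exact: orthM.
apply: filterS3 H (germ_cont g Kz HQ) (germ_cont g Kz oN) => w h1 h2 h3 Kw; split; first exact: h3.
by rewrite h2 //; have [_ -> _] := h1 Kw; rewrite mulmxA.
Qed.

(** Compactness of M: the charts around nearby points are recentrings of one chart, so finitely many
    radii have to be considered. *)
Lemma uniform_radius : exists2 rho : R, 0 < rho & forall p, exists p0 N X s r,
 [/\ LC p0 N X s r, N p & forall z, `|z - X p| < rho -> `|z - X p0| < r].
have /compact_near_coveringP cT := compT.
have := cT R (0 : R)^'+ (fun rho p => exists p0 N X s r,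
 [/\ LC p0 N X s r, N p & forall z, `|z - X p| < rho -> `|z - X p0| < r]) _ _.
move=> /(_ _) H; have {H} : \forall rho \near (0 : R)^'+, [set: T] `<=` (fun p => exists p0 N X s r,
 [/\ LC p0 N X s r, N p & forall z, `|z - X p| < rho -> `|z - X p0| < r]).
 apply: H => p _; have [N [X [s [r L]]]] := lcE p.
 have r2 : 0 < r / 2 by rewrite divr_gt0 // (lc_pos L).
 exists ([set q | N q] `&` [set q | `|X q - X p| < r / 2], [set t : R | t < r / 2]).
  split; last by exact: nbhs_right_lt.
  apply: filterI; first exact: lc_near L.
  exact: model_continuous (lc_model L) (lc_pt L) _ r2.
 move=> [q rho] /= [[Nq qr] rr]; exists p, N, X, s, r; split => // z zq.
 by have := ler_normD (z - X q) (X q - X p); rewrite addrA subrK; move: zq qr rr; lra.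
move=> H; have H' : \forall rho \near (0 : R)^'+, [set: T] `<=` (fun p => exists p0 N X s r,
 [/\ LC p0 N X s r, N p & forall z, `|z - X p| < rho -> `|z - X p0| < r]) /\ 0 < rho.
 exact: filterS2 H (nbhs_right_gt (0 : R)).
by have [rho [h1 h2]] := filter_ex H'; exists rho => // p; exact: h1.
Qed.

(** Near z the map is w -> s(w Q) for a local chart of uniform radius, and this formula makes sense
    further out. The factor n + 1 compensates the expansion of the sup norm by orthogonal
    matrices. *)
Lemma germ_extend : exists2 rho : R, 0 < rho & forall z psi, K z -> germ z psi ->
 exists psi', (forall w, K w -> `|w - z| < rho -> germ w psi') /\
  \forall w \near z, K w -> psi' w = psi w.
have [rho0 rho00 H] := uniform_radius.
have n1 : 0 < n%:R + 1 :> R by rewrite ltr_wpDl.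
exists (rho0 / (n%:R + 1)); first by rewrite divr_gt0.
move=> z psi Kz g; have [p0 [N [X [s [r [L Np far]]]]]] := H (psi z).
have [Q QQ HQ] := germ_any g Kz L Np; have [_ zQ] := nbhs_singleton HQ Kz.
exists (fun w => s (w *m Q)); split; last first.
 by apply: filterS HQ => w h Kw; have [Nw <-] := h Kw; rewrite (lc_inv L).
move=> w Kw wz.
have wr : `|w *m Q - X p0| < r.
 apply: far; rewrite zQ -mulmxBl; apply: le_lt_trans (orth_norm _ QQ) _.
 rewrite ltr_pdivlMr // mulrC in wz; apply: le_lt_trans wz; by rewrite ler_wpM2r // lerDl.
have [Nw Xw] := lc_sec L (orth_ball QQ Kw) wr.
have L' : LC (s (w *m Q)) N X s (r - `|X (s (w *m Q)) - X p0|) by apply: lc_recenter => //; rewrite Xw.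
exists N, X, s, (r - `|X (s (w *m Q)) - X p0|), Q; split => //.
have nb : nbhs (w *m Q) [set y : 'rV[R]_n | `|y - X p0| < r].
 by apply: open_nbhs_nbhs; split => //; exact: open_norm_ball.
apply: filterS (mul_near nb) => w' h Kw'; exact: (lc_sec L (orth_ball QQ Kw') h).
Qed.

(** Along a segment in C the set of agreement is open. At a limit point both maps invert the same
    coordinates up to orthogonal matrices, and these coincide by [linear_germ] because the maps
    agree near points close by. *)
Lemma germ_unique (C : set 'rV[R]_n) psi psi' z0 : C `<=` K ->
 (forall y z (t : R), C y -> C z -> 0 <= t <= 1 -> C (y + t *: (z - y))) ->
 (forall z, C z -> germ z psi) -> (forall z, C z -> germ z psi') -> C z0 ->
 (\forall w \near z0, K w -> psi w = psi' w) ->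
 forall z, C z -> \forall w \near z, K w -> psi w = psi' w.
move=> CK cC g g' Cz0 H0 z Cz.
pose gam t := z0 + t *: (z - z0).
have gC t : 0 <= t <= 1 -> C (gam t) by exact: cC.
have gcont (t e : R) : 0 < e -> \forall s \near t, `|gam s - gam t| < e.
 move=> e0; apply/nbhs_ballP; exists (e / (`|z - z0| + 1)) => /=; first by rewrite divr_gt0.
 move=> s; rewrite /ball /= distrC ltr_pdivlMr // => h.
 rewrite opprD addrACA subrr add0r -scalerBl normrZ; apply: le_lt_trans h.
 by rewrite ler_wpM2l // lerDl.
have gnear t P : (\forall w \near gam t, P w) -> \forall s \near t, P (gam s).
 by move=> /nbhs_normP[e e0 He]; apply: filterS (gcont t e e0) => s; exact: He.
pose P t := \forall w \near gam t, K w -> psi w = psi' w.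
suff : P 1 by rewrite /P /gam scale1r subrKC.
have I1 : 0 <= (1 : R) <= 1 by lra.
apply: segment_clopen I1; last by rewrite /P /gam scale0r addr0.
 move=> t tI; move=> /near_join/gnear; apply: filterS => s h _; exact: h.
move=> t tI nP; apply: contrapT => nn; apply: nP.
(* Parameters of agreement accumulate at t, since otherwise disagreement would hold near t. *)
have freq E : (\forall s \near t, E s) -> exists s : R, [/\ 0 <= s <= 1, E s & P s].
 move=> nQ; apply: contrapT => ne; apply: nn; apply: filterS nQ => s Es sI Ps.
 by apply: ne; exists s.
have Ct := gC t tI; have Kt := CK _ Ct.
have eqt : psi (gam t) = psi' (gam t).
 apply: hausT => A B nA nB.
 have [s [sI [h1 h2] Ps]] := freq (fun s => (K (gam s) -> A (psi (gam s))) /\ (K (gam s) -> B (psi' (gam s))))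
  (filterI (gnear t _ (germ_cont (g _ Ct) Kt nA)) (gnear t _ (germ_cont (g' _ Ct) Kt nB))).
 have Ks := CK _ (gC s sI).
 by exists (psi (gam s)); split; [exact: h1|rewrite (nbhs_singleton Ps Ks); exact: h2].
have [N [X [s [r [Q [L QQ _ H]]]]]] := germ_near (g _ Ct) Kt.
have Np' : N (psi' (gam t)) by rewrite -eqt; exact: lc_pt L.
have [Q' QQ' H'] := germ_any (g' _ Ct) Kt L Np'.
have HH' : \forall w \near gam t, (K w -> [/\ N (psi w), X (psi w) = w *m Q & psi w = s (w *m Q)]) /\
 (K w -> N (psi' w) /\ X (psi' w) = w *m Q') by apply: filterS2 H H'.
have [t' [tI' Ht' Pt']] := freq _ (gnear t _ (near_join HH')).
have QE : Q = Q'.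
 apply: (linear_germ (CK _ (gC t' tI'))).
 apply: filterS2 Ht' Pt' => w [h1 h2] h3 Kw; have [_ <- _] := h1 Kw; have [_ <-] := h2 Kw.
 by rewrite h3.
apply: filterS2 H H' => w h1 h2 Kw; have [_ _ ->] := h1 Kw; have [Nw Xw] := h2 Kw.
by rewrite QE -Xw (lc_inv L).
Qed.

Lemma germ_eq z psi psi' : K z -> germ z psi -> (\forall w \near z, K w -> psi w = psi' w) -> germ z psi'.
move=> Kz [N [X [s [r [Q [L QQ H]]]]]] E; exists N, X, s, r, Q; split => //.
 by rewrite -(nbhs_singleton E Kz).
by apply: filterS2 H E => w h1 h2 Kw; rewrite -h2 //; exact: h1.
Qed.

Lemma germ_rotate z psi Q : orth Q -> germ (z *m Q) psi -> germ z (fun w => psi (w *m Q)).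
move=> QQ [N [X [s [r [Q' [L QQ' H]]]]]]; exists N, X, s, r, (Q *m Q'); split => //; first exact: orthM.
by apply: filterS (mul_near H) => w h Kw; rewrite mulmxA; apply: h; exact: orth_ball.
Qed.

Lemma norm_ball_convex (c y z : 'rV[R]_n) (d t : R) : `|y - c| < d -> `|z - c| < d -> 0 <= t <= 1 ->
 `|y + t *: (z - y) - c| < d.
move=> yd zd /andP[t0 t1].
have -> : y + t *: (z - y) - c = (1 - t) *: (y - c) + t *: (z - c).
 by apply/rowP => j; rewrite !mxE; ring.
apply: le_lt_trans (ler_normD _ _) _; rewrite !normrZ !ger0_norm ?subr_ge0 //.
have [->|t_gt0] := eqVneq t 0; first by lra.
nra.
Qed.

(** At w the new map is the extension centred at the contracted point lam w, where psi is already a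
    germ. Extensions with near centres agree by [germ_unique], as the intersections of the ball with
    sup-norm balls are convex. *)
Lemma germ_enlarge : exists2 rho : R, 0 < rho & forall (r0 : R) psi, 0 < r0 ->
 (forall z, K z -> `|z| < r0 -> germ z psi) ->
 exists psi', forall z, K z -> `|z| < r0 + rho / 2 -> germ z psi'.
have [rho rho0 ext] := germ_extend; exists rho => // r0 psi r00 g.
have /boolp.choice[e eP] z : exists psi', K z -> `|z| < r0 ->
  (forall w, K w -> `|w - z| < rho -> germ w psi') /\ \forall w \near z, K w -> psi' w = psi w.
 have [[Kz zr]|h] := pselect (K z /\ `|z| < r0); last by exists psi => Kz zr; case: h.
 by have [psi' ?] := ext z psi Kz (g z Kz zr); exists psi'.
have rho2 : 0 < rho / 2 by nra.
(* The homothety of ratio lam takes radius r0 + rho/2 to r0 and moves the points concerned by less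
   than rho. *)
pose lam := r0 / (r0 + rho / 2).
have lamE : lam * (r0 + rho / 2) = r0 by rewrite divfK // gt_eqF // addr_gt0.
have lam0 : 0 < lam by nra.
have lam1 : lam < 1 by nra.
have Kc w : K w -> K (lam *: w).
 move=> Kw; have := unit_ball_convex unit_ball0 Kw (t := lam); rewrite add0r subr0; apply.
 nra.
have cr w : `|w| < r0 + rho / 2 -> `|lam *: w| < r0.
 by move=> h; rewrite normrZ gtr0_norm // -[X in _ < X]lamE ltr_pM2l.
have wc w : `|w| < r0 + rho / 2 -> `|w - lam *: w| < rho.
 move=> h; rewrite -[X in X - _]scale1r -scalerBl normrZ gtr0_norm ?subr_gt0 //.
 nra.
have compat z1 z2 w : K z1 -> K z2 -> `|z1| < r0 -> `|z2| < r0 -> `|z2 - z1| < rho -> K w ->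
  `|w - z1| < rho -> `|w - z2| < rho -> e z1 w = e z2 w.
 move=> K1 K2 z1r z2r z12 Kw w1 w2; have [g1 e1] := eP z1 K1 z1r; have [g2 e2] := eP z2 K2 z2r.
 have self z : `|z - z| < rho by rewrite subrr normr0.
 (* Agreement with psi near z1 is carried to z2 inside the convex set of points within rho of z1 and
    of norm below r0. *)
 have H1 : \forall y \near z2, K y -> e z1 y = psi y.
  apply: (@germ_unique [set z | [/\ K z, `|z - z1| < rho & `|z - 0| < r0]] (e z1) psi z1) => //=.
  - by move=> z [].
  - move=> y z t [Ky y1 yr] [Kz zz1 zr] tI; split; [exact: unit_ball_convex|exact: norm_ball_convex|exact: norm_ball_convex].
  - by move=> z [Kz zz1 _]; exact: g1.
  - by move=> z [Kz _]; rewrite subr0; exact: g.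
  - by rewrite subr0.
  - by rewrite subr0.
 have : \forall y \near w, K y -> e z1 y = e z2 y.
  apply: (@germ_unique [set z | [/\ K z, `|z - z1| < rho & `|z - z2| < rho]] _ _ z2) => //=.
  - by move=> z [].
  - move=> y z t [Ky y1 yr] [Kz zz1 zr] tI; split; [exact: unit_ball_convex|exact: norm_ball_convex|exact: norm_ball_convex].
  - by move=> z [Kz zz1 _]; exact: g1.
  - by move=> z [Kz _]; exact: g2.
  - by apply: filterS2 H1 e2 => y h1 h2 Ky; rewrite h1 // h2.
 by move=> /nbhs_singleton; exact.
exists (fun w => e (lam *: w) w) => w Kw wr.
have [g1 _] := eP _ (Kc w Kw) (cr w wr).
apply: (germ_eq Kw (g1 w Kw (wc w wr))).
have N1 : \forall y \near w, `|y - 0| < r0 + rho / 2.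
 by apply: open_nbhs_nbhs; split; [exact: open_norm_ball|rewrite subr0].
have N2 : \forall y \near w, `|y - lam *: w| < rho.
 by apply: open_nbhs_nbhs; split; [exact: open_norm_ball|exact: wc].
have N3 : \forall y \near w, `|y - w| < rho.
 by apply: open_nbhs_nbhs; split; [exact: open_norm_ball|rewrite subrr normr0].
apply: filterS3 N1 N2 N3 => y; rewrite subr0 => h1 h2 h3 Ky.
apply: compat => //; [exact: Kc|exact: Kc|exact: cr|exact: cr| |exact: wc].
rewrite -scalerBr normrZ gtr0_norm //; apply: le_lt_trans h3; by rewrite ler_piMl // ltW.
Qed.

Lemma model_near N X p U : model M v N X -> N p -> nbhs (X p) U -> \forall q \near p, U (X q).
by move=> mX Np /nbhs_normP[e e0 He]; apply: filterS (model_continuous mX Np e0) => q; exact: He.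
Qed.

Hypothesis max_v : exists p, v p = 1.

(** At a maximum of v the sphere equation gives X = 0, so the inverse of a local chart there is a
    germ around the centre of the ball. Finitely many enlargements by rho/2 reach the whole ball. *)
Lemma developing_map_germ : exists psi, forall z, K z -> germ z psi.
have [rho rho0 big] := germ_enlarge.
have [psi0 [r0 r00 g0]] : exists psi, exists2 r : R, 0 < r & forall z, K z -> `|z| < r -> germ z psi.
 have [p vp] := max_v; have [N [X [s [r L]]]] := lcE p.
 have Xp : X p = 0.
  have := model_sphere (lc_model L) (lc_pt L); rewrite vp => h.
  have {}h : sqnorm (X p) = 0 by nra.
  apply/rowP => j; rewrite mxE; apply/eqP; rewrite -sqrf_eq0; apply/eqP.
  exact: (psumr_eq0P (fun i _ => sqr_ge0 (X p 0 i)) h).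
 exists s, r; first exact: lc_pos L.
 move=> z Kz zr; have zr' : `|z - X p| < r by rewrite Xp subr0.
 have [Nz Xz] := lc_sec L Kz zr'.
 exists N, X, s, (r - `|X (s z) - X p|), 1%:M; split; first by apply: lc_recenter => //; rewrite Xz.
  by rewrite /orth trmx1 mulmx1.
 have nb : nbhs z [set y : 'rV[R]_n | `|y - X p| < r].
  by apply: open_nbhs_nbhs; split => //; exact: open_norm_ball.
 by apply: filterS nb => w h Kw; rewrite mulmx1; exact: (lc_sec L Kw h).
have steps k : exists psi, forall z, K z -> `|z| < r0 + rho / 2 * k%:R -> germ z psi.
 elim: k => [|k [psi IH]]; first by exists psi0; rewrite mulr0 addr0.
 have rk : 0 < r0 + rho / 2 * k%:R by rewrite ltr_wpDr // mulr_ge0 // divr_ge0 // ltW.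
 have [psi' h] := big _ psi rk IH; exists psi' => z Kz.
 have -> : r0 + rho / 2 * k.+1%:R = r0 + rho / 2 * k%:R + rho / 2 by nra.
 exact: h.
have rho2 : 0 < rho / 2 by nra.
have [psi h] := steps (Num.truncn (rho / 2)^-1).+1; exists psi => z Kz; apply: h => //.
apply: le_lt_trans (unit_ball_norm Kz) _.
have : (rho / 2)^-1 < (Num.truncn (rho / 2)^-1).+1%:R by exact: truncnS_gt.
by rewrite -(ltr_pM2l rho2) divff; move: r00; lra.
Qed.

(** The image is open because psi is locally inverted by coordinates, and closed because the ball is
    compact. *)
Lemma germ_surjective psi : (forall z, K z -> germ z psi) -> forall p, exists2 z, K z & psi z = p.
move=> g; apply: clopenT.
- rewrite openE => p [z Kz <-]; have [N [X [s [r [Q [L QQ zQ H]]]]]] := germ_near (g z Kz) Kz.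
 have zE : X (psi z) *m Q^T = z by rewrite zQ orthK.
 have H' : nbhs (X (psi z) *m Q^T) [set w | K w -> psi w = s (w *m Q)].
  by rewrite zE; apply: filterS H => w h /h[].
 apply: filterS2 (lc_near L) (model_near (lc_model L) (lc_pt L) (mul_near H')) => q Nq h.
 have Kq : K (X q *m Q^T) by apply: orth_ball; [exact: orthT|exact: model_ball (lc_model L) Nq].
 by exists (X q *m Q^T) => //; rewrite h // orthKT // (lc_inv L).
- apply: (compact_closed hausT); apply: continuous_compact; last exact: compact_unit_ball.
 by apply/subspace_continuousP => z Kz U nU; exact: germ_cont (g z Kz) Kz nU.
by exists (psi 0); exists 0 => //; exact: unit_ball0.
Qed.

(** If psi(y) = psi(z), there is an orthogonal A with y A = z and psi(w A) = psi(w) for w near y,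
    hence for w near 0 by uniqueness. But A fixes 0 and psi is injective near 0, so A = 1. *)
Lemma germ_injective psi : (forall z, K z -> germ z psi) -> forall y z, K y -> K z -> psi y = psi z -> y = z.
move=> g y z Ky Kz E; have [N [X [s [r [Q1 [L QQ1 yQ H1]]]]]] := germ_near (g y Ky) Ky.
have Nz : N (psi z) by rewrite -E; exact: lc_pt L.
have [Q2 QQ2 H2] := germ_any (g z Kz) Kz L Nz.
have [_ zQ] := nbhs_singleton H2 Kz.
pose A := Q1 *m Q2^T.
have oA : orth A by apply: orthM => //; exact: orthT.
have yA : y *m A = z by rewrite mulmxA -yQ E zQ orthK.
have H3 : \forall w \near y, K w -> psi (w *m A) = psi w.
 rewrite -yA in H2; apply: filterS2 H1 (mul_near H2) => w h1 h2 Kw.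
 have [_ X1 ->] := h1 Kw; have [N2 X2] := h2 (orth_ball oA Kw).
 by rewrite -[LHS](lc_inv L N2) X2 mulmxA orthKT.
have U : \forall w \near (0 : 'rV[R]_n), K w -> psi (w *m A) = psi w.
 apply: (@germ_unique [set z | K z] (fun w => psi (w *m A)) psi y) => //=; last exact: unit_ball0.
  by move=> *; exact: unit_ball_convex.
 by move=> w Kw; apply: germ_rotate => //; apply: g; exact: orth_ball.
have [N' [X' [s' [r' [B [L' BB _ H']]]]]] := germ_near (g 0 unit_ball0) unit_ball0.
have HA : \forall w \near (0 : 'rV[R]_n), K (w *m A) -> X' (psi (w *m A)) = w *m A *m B.
 have HA : nbhs ((0 : 'rV[R]_n) *m A) [set w | K w -> X' (psi w) = w *m B].
  by rewrite mul0mx; apply: filterS H' => w h /h[].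
 exact: mul_near HA.
have AB : A *m B = B.
 apply: (linear_germ unit_ball0); apply: filterS3 U HA H' => w h1 h2 h3 Kw.
 by rewrite mulmxA -h2 ?h1 //; [have [_ -> _] := h3 Kw|exact: orth_ball].
have A1 : A = 1%:M by rewrite -[A]mulmx1 -BB mulmxA AB.
by rewrite -yA A1 mulmx1.
Qed.

Lemma model_sub N N' X : N' `<=` N -> open N' -> model M v N X -> model M v N' X.
move=> N'N oN' [oN sX tX fX].
have sub a : img_over a N' `<=` img_over a N by move=> x [Ax /N'N].
split => //; [move=> a i; apply: smooth_on_sub (sX a i); exact: sub|move=> a i x /sub|move=> a x /sub]; [exact: tX|exact: fX].
Qed.

Lemma germ_inverse psi : (forall z, K z -> germ z psi) -> exists phi : T -> 'rV[R]_n,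
 [/\ forall p, K (phi p) /\ psi (phi p) = p, forall z, K z -> phi (psi z) = z &
   forall p, exists N X Q, [/\ model M v N X, N p, orth Q & forall q, N q -> phi q = X q *m Q]].
move=> g; have /boolp.choice[phi phiP] p : exists z, K z /\ psi z = p.
 by have [z Kz zp] := germ_surjective g p; exists z.
have phiK z : K z -> phi (psi z) = z.
 by move=> Kz; have [Kp E] := phiP (psi z); exact: (germ_injective g Kp Kz E).
exists phi; split => // p; have [Kp pE] := phiP p.
have [N [X [s [r [Q [L QQ zQ H]]]]]] := germ_near (g _ Kp) Kp; rewrite pE in L zQ.
have H' : nbhs (X p *m Q^T) [set w | K w -> psi w = s (w *m Q)].
 by rewrite zQ orthK //; apply: filterS H => w h /h[].
pose S := [set q | N q /\ phi q = X q *m Q^T].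
have near_p : nbhs p S.
 apply: filterS2 (lc_near L) (model_near (lc_model L) (lc_pt L) (mul_near H')) => q Nq h; split => //.
 have Kq : K (X q *m Q^T) by apply: orth_ball; [exact: orthT|exact: model_ball (lc_model L) Nq].
 by rewrite -[RHS]phiK // h // orthKT // (lc_inv L).
exists S°, X, Q^T; split => //; [|exact: orthT|by move=> q /interior_subset[]].
by apply: model_sub (lc_model L); [move=> q /interior_subset[]|exact: open_interior].
Qed.

(** * The inverse of the developing map as global coordinates *)

Section coordinates.
Variable phi : T -> 'rV[R]_n.
Hypothesis phi_model : forall p, exists N X Q, [/\ model M v N X, N p, orth Q & forall q, N q -> phi q = X q *m Q].
Local Notation "phi_[ a ] i" := (in_chart (pcoord phi i) a) (at level 10, i at level 9).

Lemma coord_sphere p : v p ^+ 2 + sqnorm (phi p) = 1.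
by have [N [X [Q [mX Np QQ E]]]] := phi_model p; rewrite E // sqnorm_orth // (model_sphere mX Np).
Qed.

Lemma coord_local a x : cimage (charts a) x -> exists N X Q, [/\ model M v N X, img_over a N x, orth Q &
 forall i y, img_over a N y -> \sum_k in_chart (pcoord X k) a y * Q k i = phi_[a] i y].
move=> Ax; have [N [X [Q [mX Np QQ E]]]] := phi_model (cinv (charts a) x).
exists N, X, Q; split => // i y [_ Ny]; by rewrite /in_chart /= /pcoord E // mxE.
Qed.

Let sXQ N X (Q : 'M[R]_n) a i : model M v N X -> smooth_on (img_over a N) (fun y => \sum_k in_chart (pcoord X k) a y * Q k i).
move=> mX; apply: smooth_on_sum => k _; apply: smooth_onM; [exact (@model_smooth _ _ _ _ _ _ _ mX a k)|exact: smooth_on_cst].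
Qed.

Lemma coord_smooth a i : smooth_on (cimage (charts a)) (phi_[a] i).
move=> x Ax; have [N [X [Q [mX Nx QQ E]]]] := coord_local Ax.
have [W oW WE] := img_over_hopen mM a (model_open mX).
have [V [F [oV Vx sF FE]]] := smooth_on_ext (E i) (sXQ Q i mX) Nx.
exists (V `&` W), F; split; [exact: openI| |by move=> l y [Vy _]; exact: sF|].
 by split => //; have := Nx; rewrite WE => -[].
move=> y Ay [Vy Wy]; apply: FE => //; rewrite WE; split => //.
by have [V' _ VE] := chart_hopen mM a; move: Ay; rewrite VE => -[].
Qed.

(** This is the lower right block of [model_frame]; the sum over i is unaffected by the local
    orthogonal matrix Q. *)
Lemma coord_metric a x j k : cimage (charts a) x ->
 metric a x j k = pd j (in_chart v a) x * pd k (in_chart v a) x + \sum_i pd j (phi_[a] i) x * pd k (phi_[a] i) x.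
move=> Ax; have [N [X [Q [mX Nx QQ E]]]] := coord_local Ax.
have hN := img_over_hopen mM a (model_open mX).
pose A l : 'rV[R]_n := \row_i pd l (in_chart (pcoord X i) a) x.
have pE l i : pd l (phi_[a] i) x = (A l *m Q) 0 i.
 rewrite -(pd_ext hN Nx l (sXQ Q i mX) (E i)) (pd_sum hN Nx) => [|m].
  rewrite [RHS]mxE; apply: eq_bigr => m _; rewrite mxE.
  by rewrite (pdM hN Nx) ?(pd_cst hN Nx) ?mulr0 ?addr0 //; [exact (@model_smooth _ _ _ _ _ _ _ mX a m)|exact: smooth_on_cst].
 by apply: smooth_onM; [exact (@model_smooth _ _ _ _ _ _ _ mX a m)|exact: smooth_on_cst].
have -> : \sum_i pd j (phi_[a] i) x * pd k (phi_[a] i) x = (A j *m (A k)^T) 0 0.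
 have <- : (A j *m Q) *m (A k *m Q)^T = A j *m (A k)^T by rewrite trmx_mul mulmxA orthK.
 by rewrite [RHS]mxE; apply: eq_bigr => i _; rewrite !pE [_^T _ _]mxE.
have := congr1 (fun Z : matrix _ _ _ => Z (rshift 1 j) (rshift 1 k)) (model_frame mX Nx).
rewrite block_mxEdr => <-; rewrite mxE big_ord_1n [_^T _ _]mxE !frameEu !row_mxEr.
congr (_ + _); first by rewrite ![drow _ _ _ _]mxE.
rewrite mxE; apply: eq_bigr => i _; by rewrite [_^T _ _]mxE !frameEd !row_mxEr !mxE.
Qed.

Lemma coord_tangent a x k : cimage (charts a) x ->
 in_chart v a x * pd k (in_chart v a) x + \sum_i phi_[a] i x * pd k (phi_[a] i) x = 0.
move=> Ax; have hA := chart_hopen mM a; have svA : smooth_on (cimage (charts a)) (in_chart v a) by [].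
have sA i : smooth_on (cimage (charts a)) (phi_[a] i) by exact: coord_smooth.
have sum1 y : in_chart v a y * in_chart v a y + \sum_i phi_[a] i y * phi_[a] i y = 1.
 rewrite -[RHS](coord_sphere (cinv (charts a) y)); congr _.
have s1 : smooth_on (cimage (charts a)) (fun y => in_chart v a y * in_chart v a y) by apply: smooth_onM.
have s2 i : smooth_on (cimage (charts a)) (fun y => phi_[a] i y * phi_[a] i y) by apply: smooth_onM.
have s3 : smooth_on (cimage (charts a)) (fun y => \sum_i phi_[a] i y * phi_[a] i y) by apply: smooth_on_sum.
have := pdD hA Ax k s1 s3; rewrite (funext sum1) (pd_cst hA Ax) (pdM hA Ax k svA svA) (pd_sum hA Ax _ _ k s2).
rewrite (eq_bigr (fun i => 2 * (phi_[a] i x * pd k (phi_[a] i) x))) => [|i _]; last by rewrite (pdM hA Ax) //; ring.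
by rewrite -mulr_sumr => h; lra.
Qed.

End coordinates.

End developing.

(** * The isometry with the hemisphere *)

Section hemisphere_isometry.
Context {R : realType} {n : nat} {T : topologicalType}.
Variables (M : riem_data R n T) (v : T -> R) (psi : 'rV[R]_n -> T) (phi : T -> 'rV[R]_n).
Hypotheses (n0 : (0 < n)%N) (mM : smooth_manifold M) (rM : riemannian_metric M).
Hypotheses (sv : smooth_fun M v) (v_ge0 : forall p, 0 <= v p).
Implicit Types (a : chart_index M) (b : chart_index (@de_Sitter R n)) (p q : T) (w x y z : 'rV[R]_n).
Local Notation K := (@unit_ball R n).
Local Notation o := (ord00 n0).
Local Notation f a := (in_chart v a).
Local Notation "phi_[ a ] i" := (in_chart (pcoord phi i) a) (at level 10, i at level 9).
Hypotheses (phi_ball : forall p, K (phi p)) (phiK : forall p, psi (phi p) = p) (psiK : forall z, K z -> phi (psi z) = z).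
Hypothesis psi_cont : forall z U, K z -> nbhs (psi z) U -> \forall w \near z, K w -> U (psi w).
Hypothesis phi_smooth : forall a i, smooth_on (img a) (phi_[a] i).
Hypothesis phi_sphere : forall p, v p ^+ 2 + sqnorm (phi p) = 1.
Hypothesis phi_metric : forall a x j k, img a x ->
 metric a x j k = pd j (f a) x * pd k (f a) x + \sum_i pd j (phi_[a] i) x * pd k (phi_[a] i) x.
Hypothesis phi_tangent : forall a x k, img a x ->
 f a x * pd k (f a) x + \sum_i phi_[a] i x * pd k (phi_[a] i) x = 0.

Definition Phi p : M0 n := exist _ (phi p) (mem_set (phi_ball p)).
Definition Psi (m : M0 n) : T := psi (val m).

Lemma Phi_continuous : continuous Phi.
have cphi p : {for p, continuous phi}.
 apply/cvgrPdist_lt => e e0.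
 have : \forall q \near p, forall i, `|pcoord phi i q - pcoord phi i p| < e.
  apply: filter_forall => i.
  have : {for p, continuous (pcoord phi i)} by apply: (smooth_fun_continuous mM) => a; exact: phi_smooth.
  by move=> /cvgrPdist_lt/(_ e e0); apply: filterS => q; rewrite distrC.
 apply: filterS => q H; rewrite distrC; apply: mx_norm_lt => // i; rewrite addmxE oppmxE; exact: H.
exact: continuous_comp_initial => p; exact: cphi.
Qed.

Lemma val_M0_continuous : continuous (fun m : M0 (R := R) n => val m).
exact: initial_continuous. Qed.

Lemma Psi_continuous : continuous Psi.
move=> m U nU; have Km : K (val m) := set_valP m.
have : \forall m' \near m, K (val m') -> U (psi (val m')) := val_M0_continuous (psi_cont Km nU).
by apply: filterS => m'; apply; exact: set_valP.
Qed.

Lemma PhiK : cancel Phi Psi. Proof. exact: phiK. Qed.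

Lemma PsiK : cancel Psi Phi.
by move=> m; apply/val_inj; rewrite /= psiK //; exact: set_valP. Qed.

Lemma v_sqrt p : Num.sqrt (1 - sqnorm (phi p)) = v p.
by rewrite -(phi_sphere p) addrK sqrtr_sqr ger0_norm. Qed.

Lemma v_u0 p : v p = u0 (Phi p). Proof. by rewrite /u0 v_sqrt. Qed.

(** In a boundary chart the swapped coordinate sqrt(1 - |phi|^2) is v itself, hence smooth up to the
    boundary. *)
Definition Phi_coord a b : 'rV[R]_n -> 'I_n -> R := fun x j =>
 match b with
 | Some Q => if j == o then f a x else \sum_k phi_[a] k x * val Q k j
 | None => phi_[a] j x + 1
 end.

Lemma orth_val (Q : {Q : 'M[R]_n | Q *m Q^T == 1%:M}) : orth (val Q).
by apply/eqP; exact: (valP Q). Qed.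

Lemma Phi_coordE a b j : (fun x => map_in_charts (M' := de_Sitter) Phi a b x 0 j) = fun x => Phi_coord a b x j.
apply/funext => x; case: b => [Q|] /=; last by rewrite addmxE mxE.
rewrite swap_heightE sqnorm_orth; last exact: orth_val.
by case: ifP => _; [rewrite v_sqrt|rewrite mxE].
Qed.

Lemma Phi_coord_smooth a b : smooth_map_on (img a) (map_in_charts (M' := de_Sitter) Phi a b).
move=> j; rewrite Phi_coordE /Phi_coord; case: b => [Q|]; last first.
 by apply: smooth_onD; [exact: phi_smooth|exact: smooth_on_cst].
case: (j == o) => //.
by apply: smooth_on_sum => k _; apply: smooth_onM; [exact: phi_smooth|exact: smooth_on_cst].
Qed.

(* Any n of n + 1 coordinates on the hemisphere, with remaining one of value q and differential D. *)
Lemma round_pullback (J : 'M[R]_n) y (q : R) (D : 'cV[R]_n) : 1 - sqnorm y = q ^+ 2 -> q != 0 ->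
 J *m y^T = - q *: D -> J *m round_metric y *m J^T = J *m J^T + D *m D^T.
move=> yq q0 H; rewrite /round_metric yq mulmxDr mulmx1 mulmxDl -scalemxAr -scalemxAl; congr _.
have -> : J *m (y^T *m y) *m J^T = (J *m y^T) *m (J *m y^T)^T by rewrite trmx_mul trmxK !mulmxA.
rewrite H linearZ -scalemxAl -scalemxAr !scalerA.
have -> : (q ^+ 2)^-1 * - q * - q = 1 by field.
by rewrite scale1r.
Qed.

Let P a x : 'M[R]_n := \matrix_(k, i) pd k (phi_[a] i) x.
Let D a x : 'cV[R]_n := \col_k pd k (f a) x.

Lemma metric_split a x : img a x -> metric a x = P a x *m (P a x)^T + D a x *m (D a x)^T.
move=> Ax; apply/matrixP => j k; rewrite phi_metric // addmxE addrC; congr (_ + _).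
 by rewrite mxE; apply: eq_bigr => i _; rewrite !mxE.
by rewrite mxE big_ord1 !mxE.
Qed.

Lemma tangent_split a x : img a x -> P a x *m (phi (inv a x))^T = - f a x *: D a x.
move=> Ax; apply/colP => k; rewrite scalemxE [D _ _ _ _]mxE mulNr; apply/eqP; rewrite -addr_eq0; apply/eqP.
rewrite -[RHS](phi_tangent k Ax) addrC; congr (_ + _); rewrite mxE; apply: eq_bigr => i _.
by rewrite !mxE mulrC.
Qed.

(** The metric is the sum of the squares of the differentials of v and of the components of phi. A
    chart of the hemisphere uses all of these functions, after a rotation of phi, but one: v in the
    interior chart, component o otherwise. [round_pullback] accounts for the missing one. *)
Lemma Phi_metric a b p : dom a p -> cdom (charts b) (Phi p) ->
 let x := a @@ p in let J := pd_mx (map_in_charts (M' := de_Sitter) Phi a b) x in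
 metric a x = J *m metric b (cmap (charts b) (Phi p)) *m J^T.
move=> Da Db /=; set x := a @@ p; set J := pd_mx _ x.
have Ax : img a x := (chart_img Da).
have xp : inv a x = p by rewrite chart_inv.
have JE k j : J k j = pd k (fun y => Phi_coord a b y j) x by rewrite mxE Phi_coordE.
have hA := chart_hopen mM a.
have cS c : smooth_on (img a) (fun=> c) by exact: smooth_on_cst.
have fx : f a x = v p by rewrite /in_chart /= xp.
have tan := tangent_split Ax; rewrite xp fx in tan.
rewrite (metric_split Ax).
clearbody J; case: b Db JE => [Q|] Db JE; move: Db; rewrite /=.
 set B := val Q; have oB : orth B := orth_val Q; set y := swap_height _ => Db.
 have ro : 0 < (phi p *m B) 0 o by exact: Db.
 have yE j : y 0 j = if j == o then v p else (phi p *m B) 0 j.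
  by rewrite swap_heightE sqnorm_orth // v_sqrt.
 have JE' k j : J k j = if j == o then D a x k 0 else (P a x *m B) k j.
  rewrite JE /Phi_coord; case: (j == o); first by rewrite mxE.
  have sk l : smooth_on (img a) (fun z => phi_[a] l z * val Q l j).
   exact: smooth_onM => //.
  rewrite (pd_sum hA Ax _ _ k sk) mxE; apply: eq_bigr => l _; rewrite mxE.
  have sl : smooth_on (img a) (phi_[a] l) by [].
  by rewrite (pdM hA Ax k sl (cS _)) (pd_cst hA Ax) mulr0 addr0.
 have tanB k : \sum_j (phi p *m B) 0 j * (P a x *m B) k j = - v p * D a x k 0.
  have := congr1 (fun Z : matrix _ _ _ => Z k 0) tan; rewrite scalemxE => <-.
  have <- : (P a x *m B) *m (phi p *m B)^T = P a x *m (phi p)^T by rewrite trmx_mul mulmxA -(mulmxA (P a x)) oB mulmx1.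
  by rewrite [RHS]mxE; apply: eq_bigr => j _; rewrite [_^T _ _]mxE mulrC.
 have sq : v p ^+ 2 + sqnorm (phi p *m B) = 1 by rewrite sqnorm_orth.
 rewrite (@round_pullback J y ((phi p *m B) 0 o) (col o (P a x *m B))).
 - have -> : P a x *m (P a x)^T = (P a x *m B) *m (P a x *m B)^T.
   by rewrite trmx_mul mulmxA -(mulmxA (P a x)) oB mulmx1.
  apply/matrixP => j k; rewrite !addmxE.
  rewrite [(P a x *m B *m _) j k]mxE [(D a x *m _) j k]mxE [(J *m _) j k]mxE [(col _ _ *m _) j k]mxE !big_ord1.
  rewrite (bigD1 o) // [X in _ = X + _](bigD1 o) //=.
  rewrite [J^T _ _]mxE !JE'.
  rewrite [(P a x *m B)^T o k]mxE [(D a x)^T 0 k]mxE [(col o _)^T 0 k]mxE ![col o _ _ 0]mxE.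
  have -> : \sum_(i | i != o) J j i * J^T i k = \sum_(i | i != o) (P a x *m B) j i * (P a x *m B)^T i k.
   by apply: eq_bigr => i io; rewrite [_^T i k]mxE [_^T i k]mxE !JE' (negbTE io).
  have swap3 (r1 r2 r3 : R) : r1 + r2 + r3 = r3 + r2 + r1 by nra.
  exact: swap3.
 - rewrite -sq sqnorm_split sqnorm_split yE eqxx.
  have -> : \sum_(j | j != o) y 0 j ^+ 2 = \sum_(j | j != o) (phi p *m B) 0 j ^+ 2.
   by apply: eq_bigr => j jo; rewrite yE (negbTE jo).
  lra.
 - by rewrite gt_eqF.
 apply/colP => k; rewrite mxE (bigD1 o) //= [_^T _ _]mxE yE JE' scalemxE [col _ _ _ _]mxE.
 have := tanB k; rewrite (bigD1 o) //= => h.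
 rewrite (eq_bigr (fun j => (phi p *m B) 0 j * (P a x *m B) k j)) => [|j jo].
  lra.
 by rewrite [_^T _ _]mxE yE JE' (negbTE jo) mulrC.
move=> Db; rewrite addrK.
have -> : J = P a x.
 apply/matrixP => k j; rewrite JE mxE.
 have sj : smooth_on (img a) (phi_[a] j) by [].
 by rewrite (pdD hA Ax k sj (cS _)) (pd_cst hA Ax) addr0.
have vp : 0 < v p ^+ 2 by have := phi_sphere p; move: Db; lra.
rewrite (@round_pullback _ _ (v p) (D a x)) //; first by rewrite -(phi_sphere p) addrK.
by rewrite -sqrf_eq0 gt_eqF.
Qed.

Lemma Phi_jac_unit a b p : dom a p -> cdom (charts b) (Phi p) ->
 pd_mx (map_in_charts (M' := de_Sitter) Phi a b) (a @@ p) \in unitmx.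
move=> Da Db; apply: inj_unitmx => c cJ; have := Phi_metric Da Db => E.
case: rM => _ _ pos _; apply/eqP/negPn/negP => c0.
have := pos a _ c (chart_img Da) c0; rewrite E !mulmxA cJ !mul0mx mxE ltxx //.
Qed.

(** The vector underlying [cinv], without the membership test in the ball; this makes it continuous
    on all of R^n. *)
Definition chart_inverse b y : 'rV[R]_n :=
 if b is Some Q then swap_height y *m (val Q)^T else y - const_mx 1.

Lemma chart_inverseK b m : cdom (charts b) m -> chart_inverse b (cmap (charts b) m) = val m.
case: b => [Q|] /= Db; last by rewrite addrK.
have oQ := orth_val Q; set z := val m *m val Q.
suff -> : swap_height (swap_height z) = z by rewrite orthK.
have z0 : 0 < z 0 o by exact: Db.
have Kz : sqnorm z <= 1 by rewrite sqnorm_orth //; exact: (set_valP m).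
apply/rowP => j; rewrite swap_heightE; case: eqVneq => [->|jo]; last by rewrite swap_heightE (negbTE jo).
rewrite sqnorm_split swap_heightE sqr_sqrtr ?subr_ge0 // sqnorm_split.
have -> : \sum_(k | k != o) swap_height z 0 k ^+ 2 = \sum_(k | k != o) z 0 k ^+ 2.
 by apply: eq_bigr => k ko; rewrite swap_heightE (negbTE ko).
by rewrite opprD opprB addrA addrCA subrr addr0 addrAC subrK sqrtr_sqr gtr0_norm.
Qed.

Lemma cinv_de_Sitter b m : cdom (charts b) m -> cinv (charts b) (cmap (charts b) m) = m.
move=> Db; rewrite -[RHS](valKd (@origin R n)) -(chart_inverseK Db); by case: b Db.
Qed.

Lemma chart_inverse_near b y (e : R) : 0 < e -> \forall w \near y, `|chart_inverse b w - chart_inverse b y| < e.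
move=> e0; case: b => [Q|]; last first.
 by apply/nbhs_normP; exists e => // w; rewrite opprB addrA subrK.
have [C C0 CP] := mulmx_norm (val Q)^T.
have eC : 0 < e / C by rewrite divr_gt0.
apply: filterS (swap_height_cont n0 y eC) => w h; rewrite -mulmxBl; apply: le_lt_trans (CP _) _.
by rewrite mulrC -ltr_pdivlMr.
Qed.

(** The inverse function theorem is applied to an extension of the chart expression of Phi, whose
    Jacobian is invertible because Phi preserves the metrics; the local inverse extends the
    expression of Psi smoothly. *)
Lemma Psi_smooth b a :
 smooth_map_on (cmap (charts b) @` (cdom (charts b) `&` Psi @^-1` dom a)) (map_in_charts (M := de_Sitter) Psi b a).
move=> j; apply/smooth_onP => y [m [Dm Da] my].
set p := Psi m in Da; set x := a @@ p; have Ax : img a x by exact: chart_img.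
have Fm q : dom a q -> map_in_charts (M' := de_Sitter) Phi a b (a @@ q) = cmap (charts b) (Phi q).
 by move=> Dq; rewrite /map_in_charts /= chart_inv.
have [V [F [oV Vx sF FE]]] := local_ext_map (@Phi_coord_smooth a b) Ax.
have Fx : F x = y by rewrite FE // Fm // PsiK.
have uJ : frechet_mx F x \in unitmx.
 have Db : cdom (charts b) (Phi p) by rewrite PsiK.
 rewrite (_ : frechet_mx F x = pd_mx (map_in_charts (M' := de_Sitter) Phi a b) x); first exact: Phi_jac_unit.
 apply/matrixP => k l; rewrite mxE [RHS]mxE; apply/esym; apply: (pdE k (chart_hopen mM a) Ax (V := V)).
 by split => // w Aw Vw; rewrite FE.
have [U [W [G [[oU oW Ux Wx] UV UG WG sG]]]] := inverse_function oV Vx sF uJ.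
have near_p : nbhs p [set q | dom a q /\ U (a @@ q)].
 by apply: (chart_near mM Da); exact: open_nbhs_nbhs.
have /nbhs_normP[e e0 eP] := psi_cont (set_valP m) near_p.
pose S := [set w | W w] `&` [set w | `|chart_inverse b w - chart_inverse b y| < e].
have nS : nbhs y S.
 by apply: filterI; [rewrite -Fx; exact: open_nbhs_nbhs|exact: chart_inverse_near].
exists S°, (fun w => G w 0 j); split; [exact: open_interior|exact: nS| |].
 by move=> k; apply: Ck_sub (sG j k) => w /interior_subset[].
move=> w [m' [Dm' Da'] mw] /interior_subset[_ /= wS]; congr (_ 0 j).
rewrite /map_in_charts /= -mw cinv_de_Sitter //; set p' := Psi m'.
have [_ Up] : dom a p' /\ U (a @@ p').
 have Km' : K (val m') := set_valP m'.
 by apply: eP; move: wS; rewrite -mw -my !chart_inverseK.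
have [_ <-] := UG _ Up; congr G.
by rewrite FE ?Fm ?PsiK //; [exact: chart_img|exact: UV].
Qed.

Lemma hemisphere_isometry : isometry M de_Sitter Phi.
split; last by move=> a b p; exact: Phi_metric.
 split; first exact: Phi_continuous.
 by move=> a b j; apply: smooth_on_sub (@Phi_coord_smooth a b j) => x [p [Da _] <-]; exact: chart_img.
exists Psi; split; [exact: PhiK|exact: PsiK|split; [exact: Psi_continuous|exact: Psi_smooth]].
Qed.

End hemisphere_isometry.

(** * Normalisation of u and conclusion *)

Section normalization.
Context {R : realType} {n : nat}.
Variables (A : set 'rV[R]_n) (g : 'rV[R]_n -> 'M[R]_n) (f : 'rV[R]_n -> R) (c : R).
Hypotheses (hA : hopen A) (sf : smooth_on A f).
Local Notation h := (fun y => c * f y).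

Lemma drow_scale x : A x -> drow h x = c *: drow f x.
by move=> Ax; apply/rowP => i; rewrite !mxE (pdZ hA Ax c i sf). Qed.

Lemma energy_scale x : A x -> energy g h x = c ^+ 2 * energy g f x.
move=> Ax; rewrite /energy /gradsq /gradup drow_scale // linearZ -!scalemxAl -scalemxAr !scalemxE.
lra.
Qed.

Lemma trfree_scale x : A x -> trfree g h x = c *: trfree g f x.
move=> Ax; rewrite scalerDr scalerA; congr (_ + _).
have sh : smooth_on A h by apply: smooth_onM => //; exact: smooth_on_cst.
apply/matrixP => i j; rewrite !mxE /hessian.
rewrite (pd_ext hA Ax i (smooth_on_pd j hA sh) (fun y Ay => pdZ hA Ay c j sf)).
rewrite (pdZ hA Ax c i (smooth_on_pd j hA sf)) mulrBr; congr (_ - _).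
by rewrite mulr_sumr; apply: eq_bigr => k _; rewrite (pdZ hA Ax c k sf); ring.
Qed.

End normalization.

Section rigidity.
Context {R : realType} {n : nat} {T : topologicalType}.
Variables (M : riem_data R n T) (u : T -> R).
Hypotheses (n0 : (0 < n)%N) (hM : static_triple M u).
Local Notation c := (u_max u).

Lemma static_rigidity : (forall p, wfun M u p = c ^+ 2) -> de_Sitter_up_to_normalization M u.
move=> wE; have c0 := u_max_gt0 n0 hM.
have mM := st_manifold hM; have rM := st_metric hM; have kM := st_compact hM; have su := st_smooth hM.
pose v p := c^-1 * u p.
have hA (a : chart_index M) := chart_hopen mM a.
have sv : smooth_fun M v.
 by move=> a; apply: smooth_onM; [exact: smooth_on_cst|exact: su].
have v_hess (a : chart_index M) x : img a x -> trfree (metric a) (in_chart v a) x = 0.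
 by move=> Ax; rewrite (trfree_scale _ _ (hA a) (@su a) Ax) (trfree_eq0 n0 hM wE Ax) scaler0.
have v_energy (a : chart_index M) x : img a x -> energy (metric a) (in_chart v a) x = 1.
 move=> Ax; rewrite (energy_scale _ _ (hA a) (@su a) Ax).
 have Dx := chart_dom_inv mM Ax; have := wfunE hM Dx; rewrite (chart_mapK mM Ax) wE => <-.
 by rewrite exprVn mulVf // expf_neq0 // gt_eqF.
have [[pm pmE] u_le] := u_max_spec hM.
have v_boundary p : mboundary M p <-> v p = 0.
 rewrite (boundary_u0 hM) /v; split => [->|/eqP]; first by lra.
 by rewrite mulf_eq0 invr_eq0 gt_eqF //= => /eqP.
have v_ge0 p : 0 <= v p.
 rewrite mulr_ge0 ?invr_ge0 ?(ltW c0) //; have [B|B] := pselect (mboundary M p).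
  by rewrite (st_boundary0 hM B).
 exact/ltW/(st_interior hM B).
have v_le1 p : v p <= 1 by rewrite /v mulrC ler_pdivrMr // mul1r.
have flat a x j k (Ax : img a x) :=
 weyl_eq0 n0 mM rM kM sv v_hess v_energy v_ge0 v_le1 v_boundary j k Ax.
have lcE := local_chart_exists n0 mM rM sv v_hess v_energy v_ge0 v_boundary flat.
have max_v : exists p, v p = 1 by exists pm; rewrite /v pmE mulVf // gt_eqF.
have [psi g] := developing_map_germ n0 mM rM sv v_hess lcE kM max_v.
have [phi [phiB psiK phi_model]] := germ_inverse n0 mM rM sv v_hess (connected_clopen hM) g.
have phi_ball p : unit_ball (phi p) by case: (phiB p).
have phiK p : psi (phi p) = p by case: (phiB p).
have sphere := coord_sphere mM phi_model.
exists c, (Phi phi_ball); split => //; last first.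
 by move=> p; rewrite -(v_u0 v_ge0 phi_ball sphere) mulrA divff ?mul1r // gt_eqF.
apply: (hemisphere_isometry (v := v) (psi := psi) n0 mM rM sv v_ge0 phi_ball phiK psiK) => //.
- by move=> z U Kz; exact: germ_cont (g z Kz) Kz.
- by move=> a i; exact: coord_smooth.
- by move=> a x j k; exact: coord_metric.
by move=> a x k; exact: coord_tangent.
Qed.

End rigidity.

Theorem theorem2p3 (R : realType) (n : nat) (hn : (3 <= n)%N)
  (T : topologicalType) (M : riem_data R n T) (u : T -> R)
  (hM : static_triple M u) :
 (forall N, regions u N ->
   virtual_mass_well_defined M u N /\ 0 <= virtual_mass M u N) /\
 (forall N, regions u N -> virtual_mass M u N = 0 ->
   de_Sitter_up_to_normalization M u).
Proof.
have n1 : (1 < n)%N by exact: ltnW.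
have n0 : (0 < n)%N by exact: ltnW.
split=> N rN; have [k1 kE w1] := max_grad_norm_ge1 n0 hM n1 rN;
 rewrite /virtual_mass /virtual_mass_well_defined /outer_region kE; case: ifP => outer.
- by have [/andP[]] := k_plus_inv_spec hn k1 outer; rewrite k1.
- have ge : Num.sqrt n%:R <= max_grad_norm M u N by nra.
 by have [/andP[/ltW]] := k_minus_inv_spec hn ge.
(* For an outer region, zero mass means maximal surface gravity 1, the equality case of
   [max_grad_norm_ge1]. *)
- by move=> /(k_plus_inv_eq0 hn k1 outer)/w1; exact: static_rigidity.
(* Inner and cylindrical regions have positive mass, since [k_minus] is inverted with values in (0,
   m_max]. *)
have ge : Num.sqrt n%:R <= max_grad_norm M u N by lra.
by have [/andP[+ _] _] := k_minus_inv_spec hn ge => + E; rewrite E ltxx.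
Qed.
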